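(* Let $m\ge3$, let $K\subset\mathbb{R}^m$ be a nonempty compact set satisfying Condition A of the context, let $\Omega\subset\mathbb{R}^m$ be an open ball containing $K$, and let $\mathcal L=-\sum_{j,k}\partial_j a_{j,k}(X)\partial_k$ be a second order elliptic operator in $\Omega$ satisfying the coefficient conditions of the context. Let $\omega$ be a continuity modulus as in the context and let $f\in C^\omega(K)$. Then there are constants $c_2,c_3>0$ such that for every $\delta>0$ with $K_\delta\subset\Omega$ there exists a function $v_\delta\in H^1(\Omega)$ which is a weak solution of the equation $\mathcal L v_\delta=0$ in the $\delta$-neighborhood $K_\delta$ of $K$, satisfies $$|\nabla v_\delta|\le c_2\,\frac{\omega(\delta)}{\delta}\quad\text{in }K_\delta,$$ and approximates $f$ on $K$: $$|f(X)-v_\delta(X)|\le c_3\,\omega(\delta),\qquad X\in K.$$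
   Context: Notation: $B_r(X)$ is the open ball of radius $r$ centered at $X$; $K_\delta=\bigcup_{X\in K}B_\delta(X)$. Functions are real- or complex-valued; $\langle\cdot,\cdot\rangle$ is the scalar product in $\mathbb{C}^m$. Continuity modulus: a continuous nondecreasing function $\omega:[0,\infty)\to[0,\infty)$ with $\omega(0)=0$ and $\omega(t)>0$ for $t>0$; here it is assumed to be concave, with $\omega(t)/t$ nonincreasing, and to satisfy, for some constants $C',C''$ and all $t>0$, $\int_0^t\frac{\omega(\tau)}{\tau}\,d\tau\le C'\omega(t)$ and $\int_t^\infty\frac{\omega(\tau)}{\tau^2}\,d\tau\le C''\frac{\omega(t)}{t}$. $C^\omega(K)$ is the space of functions $f$ on $K$ with $|f(X_1)-f(X_2)|\le C\omega(|X_1-X_2|)$ for all $X_1,X_2\in K$ and some constant $C$. Condition A for $K$: there are constants $c_0,c_1$ such that for every $\delta>0$ there is a finite set $\mathcal Z(\delta)\subset K$ with: (i) any two distinct points of $\mathcal Z(\delta)$ are at distance at least $\delta$; (ii) $K_\delta\subset\bigcup_{Z\in\mathcal Z(\delta)}\overline{B_{c_0\delta}(Z)}$; (iii) for every $R\ge\delta$ and every point $X\in\mathbb{R}^m$, the closed ball $\overline{B_R(X)}$ contains at most $c_1(R/\delta)^{m-2}$ points of $\mathcal Z(\delta)$ (in particular, $\#\mathcal Z(\delta)\le c_1(\operatorname{diam}K/\delta)^{m-2}$ for $0<\delta\le\operatorname{diam}K$). Coefficient conditions on $\mathcal L$: the matrix $\mathfrak a(X)=(a_{j,k}(X))$ is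 real, symmetric, uniformly elliptic ($\mathfrak a(X)\ge\kappa>0$ in $\Omega$), and Dini continuous: $|a_{j,k}(X)-a_{j,k}(Y)|\le\omega_0(|X-Y|)$ for $X,Y\in\Omega$, where $\omega_0$ is a continuity modulus (continuous, nondecreasing, zero at zero; the further assumptions on $\omega$ are not required of it) with $\omega_0(2t)\le A\omega_0(t)$ and $\int_0\frac{\omega_0(t)}{t}dt<\infty$ (convergence at $0$). Weak solution: a function $u$ with locally integrable gradient is a weak solution of $\mathcal Lu=0$ in an open set $U\subset\Omega$ if $\int_U\langle\mathfrak a(X)\nabla u(X),\nabla\psi(X)\rangle dX=0$ for all $\psi\in C_0^\infty(U)$. *)

(* Defs.v *)
From HB Require Import structures.
From mathcomp Require Import all_boot all_order all_algebra.
From mathcomp Require Import all_classical all_reals all_analysis.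
From mathcomp Require Import finmap complex.
Import Order.TTheory GRing.Theory Num.Theory.
Import numFieldNormedType.Exports.

Set Implicit Arguments.
Unset Strict Implicit.
Unset Printing Implicit Defensive.

Local Open Scope classical_set_scope.
Local Open Scope ring_scope.
Local Open Scope complex_scope.

(* Points of R^n are row vectors, with the product (Borel) sigma-algebra
   generated by the coordinate projections. *)

Definition row_display : measure_display. Proof. by constructor. Qed.

Section measurable_row.
Variables (R : realType) (n : nat).

Definition row_coord (i : 'I_n) (x : 'rV[R]_n) : R := x ord0 i.

Let row_set0 : g_sigma_preimage row_coord set0.
Proof. exact: sigma_algebra0. Qed.

Let row_setC A : g_sigma_preimage row_coord A ->
  g_sigma_preimage row_coord (~` A).
Proof. exact: sigma_algebraC. Qed.

Let row_bigcup (F : _^nat) : (forall i, g_sigma_preimage row_coord (F i)) ->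
  g_sigma_preimage row_coord (\bigcup_i (F i)).
Proof. exact: sigma_algebra_bigcup. Qed.

HB.instance Definition _ := @isMeasurable.Build row_display
  'rV[R]_n (g_sigma_preimage row_coord) row_set0 row_setC row_bigcup.

Lemma measurable_row_coord (i : 'I_n) : measurable_fun setT (row_coord i).
Proof.
move=> _ B mB; apply: sub_sigma_algebra.
rewrite -bigcup_seq/=; exists i => /=; first by rewrite mem_index_enum.
by exists B.
Qed.

Lemma measurable_fun_rowP d (T : measurableType d) (f : T -> 'rV[R]_n) :
  (forall i, measurable_fun setT (fun x => f x ord0 i)) -> measurable_fun setT f.
Proof.
move=> mf _ A mA; rewrite setTI.
have : measurable `<=` [set B : set 'rV[R]_n | measurable (f @^-1` B)].
  apply: smallest_sub.
    split; rewrite /=.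
    - by rewrite preimage_set0.
    - by move=> B /= mB; rewrite setTD preimage_setC; exact: measurableC.
    - by move=> F /= mF; rewrite preimage_bigcup; exact: bigcup_measurable.
  rewrite -bigcup_seq/=; apply: bigcup_sub => i _ _ [B mB <-] /=.
  by have := mf i measurableT B mB; rewrite !setTI.
exact.
Qed.

End measurable_row.

Lemma sigma_finite_prod d1 d2 (T1 : measurableType d1)
    (T2 : measurableType d2) (R : realType)
    (m1 : {sigma_finite_measure set T1 -> \bar R})
    (m2 : {sigma_finite_measure set T2 -> \bar R}) :
  sigma_finite setT (m1 \x m2)%E.
Proof.
have /sigma_finiteP[F [TF ndF Foo]] := sigma_finiteT m1.
have /sigma_finiteP[G [TG ndG Goo]] := sigma_finiteT m2.
exists (fun n => F n `*` G n).
  rewrite -setXTT TF TG predeqE => -[x y]; split.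
    move=> [/= [n _ Fnx] [k _ Gky]]; exists (maxn n k) => //; split.
    - by move: x Fnx; exact/subsetPset/ndF/leq_maxl.
    - by move: y Gky; exact/subsetPset/ndG/leq_maxr.
  by move=> [n _ []/= ? ?]; split; exists n.
move=> k; have [mF Fk] := Foo k; have [mG Gk] := Goo k.
split; first exact: measurableX.
by rewrite product_measure1E// lte_mul_pinfty// ge0_fin_numE.
Qed.

Section lebesgue_row.
Variable R : realType.

Definition row_cons n (p : measurableTypeR R * 'rV[R]_n) : 'rV[R]_n.+1 :=
  \row_(i < n.+1) oapp (fun j => p.2 ord0 j) p.1 (unlift ord0 i).

Definition row_uncons n (x : 'rV[R]_n.+1) : measurableTypeR R * 'rV[R]_n :=
  (x ord0 ord0, \row_(j < n) x ord0 (lift ord0 j)).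

Lemma row_consK n : cancel (@row_cons n) (@row_uncons n).
Proof.
move=> [a y]; congr pair; first by rewrite mxE unlift_none.
by apply/rowP => j; rewrite !mxE liftK.
Qed.

Lemma measurable_row_cons n : measurable_fun setT (@row_cons n).
Proof.
apply: measurable_fun_rowP => i.
under eq_fun do rewrite mxE.
case: unliftP => [j _|_] /=; last exact: measurable_fst.
exact: (measurableT_comp (@measurable_row_coord R n j) measurable_snd).
Qed.

Lemma measurable_row_uncons n : measurable_fun setT (@row_uncons n).
Proof.
apply/measurable_fun_pairP; split; first exact: measurable_row_coord.
apply: measurable_fun_rowP => j; rewrite (_ : (fun _ => _) = @row_coord R n.+1 (lift ord0 j)).
  exact: measurable_row_coord.
by apply/funext => x; rewrite /= mxE.
Qed.

Section lebesgue_row_step.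
Variables (n : nat) (mu : {sigma_finite_measure set 'rV[R]_n -> \bar R}).

Let prod_mu : {measure set (measurableTypeR R * 'rV[R]_n)%type -> \bar R} :=
  (@lebesgue_measure R \x mu)%E.

Definition lebesgue_row_step : set 'rV[R]_n.+1 -> \bar R :=
  pushforward (@lebesgue_measure R \x mu)%E (@row_cons n).

HB.instance Definition _ := Measure.copy lebesgue_row_step
  (measure_function_pushforward__canonical__measure_function_Measure
     prod_mu (@measurable_row_cons n)).

Let sigma_finite_step : sigma_finite setT lebesgue_row_step.
Proof.
have [F TF Foo] := sigma_finite_prod (@lebesgue_measure R) mu.
exists (fun k => @row_uncons n @^-1` F k).
  by rewrite -preimage_bigcup -TF preimage_setT.
move=> k; have [mF Fk] := Foo k; split.
  by rewrite -[X in measurable X]setTI; exact: measurable_row_uncons.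
rewrite /lebesgue_row_step /pushforward -comp_preimage.
by rewrite (_ : _ \o _ = id)//; apply/funext/row_consK.
Qed.

HB.instance Definition _ :=
  Measure_isSigmaFinite.Build _ _ _ lebesgue_row_step sigma_finite_step.

End lebesgue_row_step.

(* Lebesgue measure of R^0 is the unit mass, and that of R^(n+1) = R x R^n is
   the product measure. *)
Fixpoint lebesgue_row n : {sigma_finite_measure set 'rV[R]_n -> \bar R} :=
  if n is n'.+1 then @lebesgue_row_step n' (lebesgue_row n')
  else \d_(0 : 'rV[R]_0).

End lebesgue_row.

Lemma lebesgue_row_box (R : realType) n (A : 'I_n -> set R) :
  (forall i, measurable (A i)) ->
  lebesgue_row R n [set x | forall i, A i (x ord0 i)] =
  (\prod_(i < n) lebesgue_measure (A i))%E.
Proof.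
elim: n A => [|n IH] A mA.
  rewrite big_ord0 /= diracE mem_set//= => -[].
  by [].
rewrite big_ord_recl -IH; last by move=> i; exact: mA.
have mB : measurable
    [set x : 'rV[R]_n | forall i, A (lift ord0 i) (x ord0 i)].
  rewrite [X in measurable X](_ : _ = \bigcap_(i in [set: 'I_n])
      (@row_coord R n i @^-1` A (lift ord0 i))).
    apply: fin_bigcap_measurable => // i _; rewrite -[X in measurable X]setTI.
    exact: measurable_row_coord.
  by apply/seteqP; split => x /= h i; [move=> _; exact: h|exact: h].
rewrite -product_measure1E//; last exact: mA.
rewrite /= /lebesgue_row_step /pushforward; congr (_ _).
apply/seteqP; split => -[x y] /=.
  move=> h; split; first by have := h ord0; rewrite mxE unlift_none.
  by move=> i; have := h (lift ord0 i); rewrite mxE liftK.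
by move=> [h0 h] i; rewrite mxE; case: unliftP => [j ->|->] //=; exact: h.
Qed.

(* The library norm on row vectors is the sup norm, hence an explicit Euclidean
   norm; both induce the same topology. *)

Section geometry.
Variables (R : realType) (m : nat).
Implicit Types (K : set 'rV[R]_m) (X Y Z : 'rV[R]_m).

Definition enorm X : R := Num.sqrt (\sum_(i < m) X ord0 i ^+ 2).

Definition eball X (r : R) : set 'rV[R]_m := [set Y | enorm (Y - X) < r].

Definition eclosed_ball X (r : R) : set 'rV[R]_m :=
  [set Y | enorm (Y - X) <= r].

Definition thickening K (delta : R) : set 'rV[R]_m :=
  \bigcup_(X in K) eball X delta.

Definition condition_A K : Prop :=
  exists c0 c1 : R, forall delta : R, 0 < delta ->
  exists S : set 'rV[R]_m,
  [/\ finite_set S, S `<=` K,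
      forall Z1 Z2, S Z1 -> S Z2 -> Z1 <> Z2 -> delta <= enorm (Z1 - Z2),
      thickening K delta `<=` \bigcup_(Z in S) eclosed_ball Z (c0 * delta) &
      forall (r : R) X, delta <= r ->
        #|` fset_set (S `&` eclosed_ball X r)|%:R
          <= c1 * (r / delta) ^+ (m - 2)].

End geometry.

Section moduli.
Variable R : realType.
Implicit Type omega : R -> R.
Local Notation mu := (@lebesgue_measure R).

(* Only the values on [0, +oo[ matter. *)
Definition continuity_modulus omega : Prop :=
  [/\ {within `[0, +oo[, continuous omega},
      {in `[0, +oo[ &, {homo omega : s t / s <= t}},
      omega 0 = 0 &
      forall t, 0 < t -> 0 < omega t].

(* Integrals of nonnegative functions are extended-real valued, so the two
   bounds include convergence. *)
Definition regular_modulus omega : Prop :=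
  [/\ continuity_modulus omega,
      convex_function (`[0, +oo[%classic : set R) (fun t => - omega t),
      (forall s t, 0 < s -> s <= t -> omega t / t <= omega s / s) &
      exists C' C'' : R, forall t : R, 0 < t ->
        (\int[mu]_(tau in `]0%R, t]) (omega tau / tau)%:E
           <= (C' * omega t)%:E)%E /\
        (\int[mu]_(tau in `]t, +oo[) (omega tau / tau ^+ 2)%:E
           <= (C'' * (omega t / t))%:E)%E].

Definition dini_modulus omega : Prop :=
  [/\ continuity_modulus omega,
      exists A : R, forall t, 0 <= t -> omega (2 * t) <= A * omega t &
      (\int[mu]_(t in `]0%R, 1%R]) (omega t / t)%:E < +oo)%E].

End moduli.

Section weak_solutions.
Variables (R : realType) (m : nat).
Implicit Types (U : set 'rV[R]_m) (u psi : 'rV[R]_m -> R[i])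
  (g : 'rV[R]_m -> 'rV[R[i]]_m) (a : 'rV[R]_m -> 'M[R]_m).
Local Notation mu := (lebesgue_row R m).
Local Notation normc := (@ComplexField.Normc.normc R).

Definition in_Comega (K : set 'rV[R]_m) (omega : R -> R)
    (f : 'rV[R]_m -> R[i]) : Prop :=
  exists C : R, forall X1 X2, K X1 -> K X2 ->
    normc (f X1 - f X2) <= C * omega (enorm (X1 - X2)).

Definition elliptic_coefficients U a : Prop :=
  [/\ forall X, U X -> (a X)^T = a X,
      exists2 kappa : R, 0 < kappa & forall X (xi : 'rV[R]_m), U X ->
        kappa * enorm xi ^+ 2 <= (xi *m a X *m xi^T) ord0 ord0 &
      exists2 omega0 : R -> R, dini_modulus omega0 &
        forall X Y j k, U X -> U Y ->
          `|a X j k - a Y j k| <= omega0 (enorm (X - Y))].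

Definition partial (i : 'I_m) (phi : 'rV[R]_m -> R) : 'rV[R]_m -> R :=
  fun X => 'D_(delta_mx ord0 i) phi X.

Fixpoint Ck (k : nat) (phi : 'rV[R]_m -> R) : Prop :=
  continuous phi /\
  if k is k'.+1 then
    forall i : 'I_m, (forall X, derivable phi X (delta_mx ord0 i)) /\
                     Ck k' (partial i phi)
  else True.

Definition smooth (phi : 'rV[R]_m -> R) : Prop := forall k, Ck k phi.

Definition test_function U psi : Prop :=
  [/\ smooth (fun X => complex.Re (psi X)),
      smooth (fun X => complex.Im (psi X)) &
      exists C : set 'rV[R]_m, [/\ compact C, C `<=` U &
        forall X, ~ C X -> psi X = 0]].

Definition cpartial (i : 'I_m) psi : 'rV[R]_m -> R[i] := fun X =>
  partial i (fun Y => complex.Re (psi Y)) X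
    +i* partial i (fun Y => complex.Im (psi Y)) X.

Definition cintegral U u : R[i] :=
  Rintegral mu U (fun X => complex.Re (u X))
    +i* Rintegral mu U (fun X => complex.Im (u X)).

Definition L1loc U u : Prop :=
  forall C : set 'rV[R]_m, compact C -> C `<=` U ->
    mu.-integrable C (fun X => (complex.Re (u X))%:E) /\
    mu.-integrable C (fun X => (complex.Im (u X))%:E).

Definition L2 U u : Prop :=
  [/\ measurable_fun U (fun X => complex.Re (u X)),
      measurable_fun U (fun X => complex.Im (u X)) &
      (\int[mu]_(X in U) (normc (u X) ^+ 2)%:E < +oo)%E].

(* [g] is one representative of the gradient of [u], determined by [u] up to a
   Lebesgue-null subset of [U]. *)
Definition weak_gradient U u g : Prop :=
  [/\ L1loc U u,
      forall j, L1loc U (fun X => g X ord0 j) &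
      forall psi, test_function U psi -> forall j,
        cintegral U (fun X => u X * cpartial j psi X) =
        - cintegral U (fun X => g X ord0 j * psi X)].

Definition in_H1 U u g : Prop :=
  [/\ L2 U u, forall j, L2 U (fun X => g X ord0 j) & weak_gradient U u g].

(* [u], with weak gradient [g], is a weak solution in [U] of
   - sum_(j, k) d_j (a_jk d_k u) = 0. *)
Definition weak_solution a U u g : Prop :=
  weak_gradient U u g /\
  forall psi, test_function U psi ->
    cintegral U (fun X => \sum_(j < m)
      (\sum_(k < m) (a X j k)%:C * g X ord0 k) * (cpartial j psi X)^*) = 0.

Definition cvnorm (z : 'rV[R[i]]_m) : R :=
  Num.sqrt (\sum_(j < m) normc (z ord0 j) ^+ 2).

(* Selects the continuous representative of a Sobolev function, without which
   its values on a Lebesgue-null set would be meaningless. *)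
Definition ccontinuous_on U u : Prop :=
  forall X, U X ->
    {for X, continuous (fun Y => complex.Re (u Y))} /\
    {for X, continuous (fun Y => complex.Im (u Y))}.

End weak_solutions.

(* Main.v *)
(* A first approximation v0 blends the values of f at a net of K of spacing
   rho = R delta by a partition of unity made of functions whose gradients and
   images under L are bounded by 1 / rho and 1 / rho^2.  Hence |L v0| is at most
   a constant times omega(delta) / delta^2 near K, and it remains to solve
   L w = L v0 on K_delta with |w| of order omega(delta) and |grad w| of order
   omega(delta) / delta.

   The solver works on balls of radius rho.  With coefficients frozen at a net
   point Q and coordinates given by a Cholesky factor of a(Q), L becomes minus
   the Laplacian, with heat semigroup P_t, and the time integral of P_t s over
   [0, T] solves the equation with right-hand side s - P_T s, where T = rho^2.
   By Condition A a neighborhood of K of width delta occupies only a fraction of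
   order R^-2 of a ball of radius rho, so P_T s is small when s lives near K and
   R is large.  The variation of the coefficients is removed by a perturbation
   series over the dyadic times t_k = T 4^-k: multiplication by a - a(Q) costs
   at time t_k the oscillation of a at scale sqrt t_k, and the sum of these costs
   is small by the Dini condition.  Cutting off and summing the local solutions
   solves the equation on K_delta up to a factor 1/2 of the data, and iterating
   makes it exact.  For delta bounded below v is constant. *)

Require Import Defs.
From HB Require Import structures.
From mathcomp Require Import all_boot all_order all_algebra.
From mathcomp Require Import finmap complex.
From mathcomp Require Import all_classical all_reals all_analysis.
From mathcomp Require Import measurable_realfun gauss_integral.
From mathcomp Require Import ring lra.
Import Order.TTheory GRing.Theory Num.Theory.
Import numFieldNormedType.Exports.

Set Implicit Arguments.
Unset Strict Implicit.
Unset Printing Implicit Defensive.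

Local Open Scope classical_set_scope.
Local Open Scope ring_scope.

(** * Measure and differentiation on row vectors *)

(** The obstacle is the sup norm. Passing from [F] to the gradient of the solution of
    [- Delta u = div F] is a combination of second order Riesz transforms, unbounded on bounded
    functions, so a series in powers of [a - a(Q)] need not converge there. The norm used instead
    adds to the sup of [F] the sum over [k] of [t_k |D^2 P_{t_k} F|], a Besov norm of type
    B^0_{infty,1}. The solution step is bounded in it, and multiplication by a small function with
    summable dyadic oscillations is small in it; this is where the Dini condition enters. With Dini
    coefficients a smooth cutoff [chi] need not have a bounded [L chi]. Cutoffs are therefore made
    out of solutions, truncated by functions of class C^2, and the Leibniz and chain rules for [L]
    are proved in weak form. The fraction R^-2 is a balance of exponents: about [(rho/delta)^(n-2)]
    balls of volume [delta^n] inside a ball of volume [rho^n]. Constants are fixed in the order: the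
    dyadic index beyond which times are estimated crudely, then R, then the tolerated oscillation of
    the coefficients, which restricts [delta]. *)

Section row_measure.
Variable R : realType.
Local Notation lam := (@lebesgue_measure R).

Lemma ler_row_norm n (x : 'rV[R]_n) i : `|x ord0 i| <= `|x|.
Proof.
rewrite [leRHS]/Num.Def.normr /= mx_normrE.
by apply: (le_trans _ (le_bigmax _ _ (ord0, i))).
Qed.

Lemma row_norm_lt n (x : 'rV[R]_n) (r : R) : 0 < r ->
  (forall i, `|x ord0 i| < r) -> `|x| < r.
Proof.
move=> r0 h; rewrite [ltLHS]/Num.Def.normr /= mx_normrE.
by apply/bigmax_ltP; split => // -[i j] _ /=; rewrite ord1.
Qed.

Lemma row_norm_le n (x : 'rV[R]_n) (r : R) : 0 <= r ->
  (forall i, `|x ord0 i| <= r) -> `|x| <= r.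
Proof.
move=> r0 h; rewrite [leLHS]/Num.Def.normr /= mx_normrE.
by apply/bigmax_leP; split => // -[i j] _ /=; rewrite ord1.
Qed.

Lemma measurable_row_box n (x : 'rV[R]_n) (r : R) :
  measurable [set y : 'rV[R]_n | forall i, `|y ord0 i - x ord0 i| < r].
Proof.
rewrite [X in measurable X](_ : _ = \bigcap_(i in [set: 'I_n])
    (@row_coord R n i @^-1` [set z | `|z - x ord0 i| < r])).
  apply: fin_bigcap_measurable => // i _; rewrite -[X in measurable X]setTI.
  apply: measurable_row_coord => //.
  rewrite (_ : [set _ | _] = ball (x ord0 i) r); first exact: measurable_ball.
  by apply/seteqP; split => z /=; rewrite /ball /= distrC.
by apply/seteqP; split => y /= h i; [move=> _; exact: h|exact: h].
Qed.

(** Sup-norm boxes with rational centre and radius [1 / (k + 1)] form a countable base, so the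
    sigma-algebra generated by the coordinates contains every open set. *)
Lemma measurable_row_open n (U : set 'rV[R]_n) : open U -> measurable U.
Proof.
move=> oU; pose r (k : nat) : R := k.+1%:R^-1.
pose c (q : 'rV[rat]_n) : 'rV[R]_n := map_mx ratr q.
pose bx (p : 'rV[rat]_n * nat) :=
  [set y : 'rV[R]_n | forall i, `|y ord0 i - c p.1 ord0 i| < r p.2].
rewrite (_ : U = \bigcup_p (if `[< bx p `<=` U >] then bx p else set0)).
  apply: countable_bigcupT_measurable => [|p]; first exact: countableP.
  by case: ifP => _; [exact: measurable_row_box|].
apply/seteqP; split => [x Ux|x [p _]]; last by case: asboolP => // h /h.
have [e /= e0 he] : nbhs_ball x U by apply/nbhs_ballP; exact: oU.
have [k _ hk] : \forall k \near \oo, (r k < e / 2).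
  have e20 : 0 < e / 2 by rewrite divr_gt0.
  exact: (near_infty_natSinv_lt (PosNum e20)).
have {hk} hk : r k < e / 2 by apply: hk => /=.
have rk0 : 0 < r k by rewrite invr_gt0.
have h (i : 'I_n) : exists q : rat, `|x ord0 i - ratr q| < r k.
  have [|q] := @rat_in_itvoo R (x ord0 i - r k) (x ord0 i + r k).
    by rewrite ltrBlDr -addrA ltrDl addr_gt0.
  rewrite in_itv /= => /andP[h1 h2]; exists q.
  by rewrite distrC ltr_norml ltrBrDl h1 ltrBlDl h2.
have [q hq] := choice h.
have cqx (i : 'I_n) : `|x ord0 i - c (\row_i q i) ord0 i| < r k.
  by rewrite !mxE; exact: hq.
exists (\row_i q i, k) => //; case: asboolP => // -[] y yb; apply: he.
rewrite mx_norm_ball /ball_/=; apply: row_norm_lt => // i.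
have := yb i; have := cqx i; move: (c _ ord0 i) => z /= h1 h2.
rewrite !mxE; apply: le_lt_trans (ler_distD z _ _) _.
rewrite (@lt_trans _ _ (r k + r k))// ?ltrD// 1?distrC//.
by rewrite (splitr e) ltrD.
Qed.

Lemma continuous_measurable_row n (F : 'rV[R]_n -> R) :
  continuous F -> measurable_fun setT F.
Proof.
move=> /continuousP cF; apply: (measurability _ (RGenOpens.measurableE R)).
move=> _ [_ [x [y ->]] <-]; rewrite setTI; apply: measurable_row_open.
exact/cF/interval_open.
Qed.

Lemma measurable_fun_row_add d (T : measurableType d) n (f g : T -> 'rV[R]_n) :
  measurable_fun setT f -> measurable_fun setT g ->
  measurable_fun setT (fun x => f x + g x).
Proof.
move=> mf mg; apply: measurable_fun_rowP => i; under eq_fun do rewrite mxE.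
by apply: measurable_funD; exact: (measurableT_comp (measurable_row_coord i)).
Qed.

Lemma measurable_fun_row_mulmx d (T : measurableType d) n p (f : T -> 'rV[R]_n)
    (B : 'M[R]_(n, p)) :
  measurable_fun setT f -> measurable_fun setT (fun x => f x *m B).
Proof.
move=> mf; apply: measurable_fun_rowP => i; under eq_fun do rewrite mxE.
apply: measurable_sum => j; apply: measurable_funM => //.
exact: (measurableT_comp (measurable_row_coord j)).
Qed.

Lemma lebesgue_measure_translate (a : R) (A : set R) :
  measurable A -> lam ((fun x => x + a) @^-1` A) = lam A.
Proof.
move=> mA.
have mf : measurable_fun setT (fun x : measurableTypeR R => (x + a : measurableTypeR R)).
  exact: measurable_funD.
pose nu : {measure set (measurableTypeR R) -> \bar R} :=
  measure_function_pushforward__canonical__measure_function_Measure lam mf.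
apply/esym.
apply: (@lebesgue_measure_unique R nu) => // X /ocitvP[->|[[x y] /= xy ->]].
  by rewrite /nu /= /pushforward preimage_set0 !measure0.
rewrite /nu /= /pushforward.
rewrite (_ : _ @^-1` _ = `]x - a, y - a]%classic); last first.
  by apply/seteqP; split => z /=; rewrite !in_itv/= ltrBlDr lerBrDr.
rewrite !lebesgue_measure_itv/= !lte_fin ltrD2r; case: ifP => // _.
by rewrite -!EFinB opprB addrA subrK.
Qed.

Lemma ge0_integral_translate (f : R -> \bar R) (a : R) :
  measurable_fun setT f -> (forall x, 0 <= f x)%E ->
  (\int[lam]_x f (x + a)%R = \int[lam]_x f x)%E.
Proof.
move=> mf f0.
have ma : measurable_fun setT (fun x : measurableTypeR R => (x + a : measurableTypeR R)).
  exact: measurable_funD.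
have := @ge0_integral_pushforward _ _ _ _ R _ ma lam setT f measurableT mf (fun x _ => f0 x).
rewrite preimage_setT => <-.
apply: eq_measure_integral => A mA _; exact: lebesgue_measure_translate.
Qed.

Lemma integral_lebesgue_row_cons n (f : 'rV[R]_n.+1 -> \bar R) :
  measurable_fun setT f -> (forall x, 0 <= f x)%E ->
  (\int[lebesgue_row R n.+1]_x f x =
   \int[lam]_x \int[lebesgue_row R n]_y f (row_cons (x, y)))%E.
Proof.
move=> mf f0.
have := ge0_integral_pushforward (@measurable_row_cons R n)
  (lam \x lebesgue_row R n)%E measurableT mf (fun x _ => f0 x).
rewrite preimage_setT fubini_tonelli1; last 2 first.
- exact: (measurableT_comp mf (@measurable_row_cons R n)).
- by move=> x; exact: f0.
move=> h; etransitivity; [|exact: h]; apply: eq_measure_integral => //.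
exact: measurable_row_cons.
Qed.

Lemma row_consD n (a : R) (x : R) (v y : 'rV[R]_n) :
  row_cons (x + a, y + v) = row_cons (x, y) + row_cons (a, v).
Proof.
by apply/rowP => i; rewrite !mxE; case: unliftP => [j _|_] /=; rewrite ?mxE.
Qed.

Lemma row_unconsK n (x : 'rV[R]_n.+1) : row_cons (row_uncons x) = x.
Proof.
apply/rowP => i; rewrite !mxE; case: unliftP => [j ->|->] /=; by rewrite ?mxE.
Qed.

(** Induction on the dimension through Tonelli: the first coordinate uses translation invariance on
    the line, the others the induction hypothesis. *)
Lemma ge0_integral_row_translate n (f : 'rV[R]_n -> \bar R) (v : 'rV[R]_n) :
  measurable_fun setT f -> (forall x, 0 <= f x)%E ->
  (\int[lebesgue_row R n]_x f (x + v)%R = \int[lebesgue_row R n]_x f x)%E.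
Proof.
elim: n f v => [|n IH] f v mf f0.
  by apply: eq_integral => x _; congr f; apply/rowP => -[].
have mfv : measurable_fun setT (fun x : 'rV[R]_n.+1 => f (x + v)).
  by apply: measurableT_comp => //; exact: measurable_fun_row_add.
rewrite !integral_lebesgue_row_cons//.
have [a [w ->]] : exists a w, v = row_cons (a, w).
  by exists (row_uncons v).1, (row_uncons v).2; rewrite -surjective_pairing row_unconsK.
have mfc : measurable_fun setT (f \o @row_cons R n).
  exact: measurableT_comp (@measurable_row_cons R n).
transitivity (\int[lam]_x (\int[lebesgue_row R n]_y f (row_cons (x + a, y)%R)))%E.
  apply: eq_integral => x _; under eq_integral do rewrite -row_consD.
  rewrite (IH (fun y => f (row_cons (x + a, y)))) //.
  exact: (measurableT_comp mfc (pair1_measurable _)).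
rewrite (ge0_integral_translate (f := fun x => \int[lebesgue_row R n]_y f (row_cons (x, y)))%E)//.
  by apply: (measurable_fun_fubini_tonelli_F (f \o @row_cons R n)) => // x; exact: f0.
by move=> x; exact: integral_ge0.
Qed.

(** Reduces the total mass of the Gaussian kernel to that of the one-dimensional normal density. *)
Lemma ge0_integral_row_prod n (f : 'I_n -> R -> R) :
  (forall i, measurable_fun setT (f i)) -> (forall i x, 0 <= f i x) ->
  (\int[lebesgue_row R n]_x (\prod_(i < n) f i (x ord0 i))%:E =
   \prod_(i < n) \int[lam]_x (f i x)%:E)%E.
Proof.
elim: n f => [|n IH] f mf f0.
  rewrite big_ord0; under eq_integral do rewrite big_ord0.
  by rewrite /= integral_dirac//= diracT mule1.
rewrite integral_lebesgue_row_cons//; last 2 first.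
- apply/measurable_EFinP; apply: measurable_prod => i _.
  exact: measurableT_comp (measurable_row_coord i).
- by move=> x; rewrite lee_fin prodr_ge0.
rewrite big_ord_recl -IH//.
have mp : measurable_fun setT (fun y : 'rV[R]_n => (\prod_(i < n) f (lift ord0 i) (y ord0 i))%:E).
  apply/measurable_EFinP; apply: measurable_prod => i _.
  exact: measurableT_comp (measurable_row_coord i).
have p0 (y : 'rV[R]_n) : (0 <= (\prod_(i < n) f (lift ord0 i) (y ord0 i))%:E)%E.
  by rewrite lee_fin prodr_ge0.
rewrite -ge0_integralZr//; last 3 first.
- by apply/measurable_EFinP; exact: mf.
- by move=> x _; rewrite lee_fin.
- by apply: integral_ge0 => y _.
apply: eq_integral => x _; rewrite -ge0_integralZl//; last by rewrite lee_fin.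
apply: eq_integral => y _; rewrite big_ord_recl EFinM mxE unlift_none /=.
by congr (_ * (_)%:E)%E; apply: eq_bigr => i _; rewrite mxE liftK.
Qed.

End row_measure.

(** * Continuity and limits of real functions *)

Section continuity.
Variables (R : realType) (T : topologicalType).
Implicit Types f g : T -> R.

Lemma cts_add f g : continuous f -> continuous g -> continuous (fun x => f x + g x).
Proof. by move=> cf cg x; exact: (cvgD (cf x) (cg x)). Qed.

Lemma cts_opp f : continuous f -> continuous (fun x => - f x).
Proof. by move=> cf x; exact: (cvgN (cf x)). Qed.

Lemma cts_sub f g : continuous f -> continuous g -> continuous (fun x => f x - g x).
Proof. by move=> cf cg; apply: cts_add => //; exact: cts_opp. Qed.

Lemma cts_mul f g : continuous f -> continuous g -> continuous (fun x => f x * g x).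
Proof. by move=> cf cg x; exact: (cvgM (cf x) (cg x)). Qed.

Lemma cts_cst (c : R) : continuous (fun _ : T => c).
Proof. exact: cst_continuous. Qed.

Lemma cts_inv f : (forall x, f x != 0) -> continuous f -> continuous (fun x => (f x)^-1).
Proof. by move=> f0 cf x; exact: (cvgV (f0 x) (cf x)). Qed.

Lemma cts_norm f : continuous f -> continuous (fun x => `|f x|).
Proof. by move=> cf x; exact: (cvg_norm (cf x)). Qed.

Lemma cts_max f g : continuous f -> continuous g -> continuous (fun x => Num.max (f x) (g x)).
Proof. by move=> cf cg x; exact: (continuous_max (cf x) (cg x)). Qed.

Lemma cts_min f g : continuous f -> continuous g -> continuous (fun x => Num.min (f x) (g x)).
Proof. by move=> cf cg x; exact: (continuous_min (cf x) (cg x)). Qed.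

Lemma cts_comp (phi : R -> R) f : continuous phi -> continuous f -> continuous (fun x => phi (f x)).
Proof. by move=> cp cf x; apply: (continuous_comp (cf x) (cp (f x))). Qed.

Lemma cts_sum (I : Type) (s : seq I) (P : pred I) (f : I -> T -> R) :
  (forall i, P i -> continuous (f i)) -> continuous (fun x => \sum_(i <- s | P i) f i x).
Proof.
move=> cf; elim: s => [|i s IH].
  by under eq_fun do rewrite big_nil; exact: cts_cst.
under eq_fun do rewrite big_cons.
by have [Pi|//] := boolP (P i); apply: cts_add => //; exact: cf.
Qed.

End continuity.

Lemma seq_cvgP (R : realType) (u : nat -> R) (l : R) :
  u k @[k --> \oo] --> l <->
  (forall e : R, 0 < e -> exists N, forall k, (N <= k)%N -> `|u k - l| < e).
Proof.
split=> [h e e0|h].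
  have /cvgrPdist_lt/(_ e e0)[N _ hN] := h.
  by exists N => k Nk; rewrite distrC; apply: hN.
apply/cvgrPdist_lt => e e0; have [N hN] := h e e0.
by exists N => // k /= Nk; rewrite distrC; exact: hN.
Qed.

Lemma seq_cvg_le (R : realType) (u : nat -> R) (l M : R) :
  u k @[k --> \oo] --> l -> (exists N, forall k, (N <= k)%N -> u k <= M) -> l <= M.
Proof.
move=> /seq_cvgP h [N hN]; apply/ler_addgt0Pr => e /h[N' hN'].
have := hN _ (leq_maxl N N'); have := hN' _ (leq_maxr N N').
rewrite ltr_norml => /andP[+ _]; lra.
Qed.

(** * Directional derivatives along a fixed vector *)

Section directional.
Variables (R : realType) (n : nat).
Implicit Types (X Y v w : 'rV[R]_n) (u : 'rV[R]_n -> R).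

Lemma continuous_epsP u X :
  {for X, continuous u} <->
  (forall e : R, 0 < e -> exists2 d : R, 0 < d &
     forall Y, `|Y - X| < d -> `|u Y - u X| < e).
Proof.
split=> [cu e e0|h].
  have /cvgrPdist_lt/(_ e e0)/nbhs_normP[d /= d0 hd] := cu.
  by exists d => // Y hY; rewrite distrC; apply: hd => /=; rewrite /ball_/= distrC.
have fX : ProperFilter (nbhs X) by exact: nbhs_pfilter.
apply: (proj2 (@cvgrPdist_lt R R 'rV[R]_n (nbhs X) _ u (u X))) => e e0.
have [d d0 hd] := h e e0.
rewrite near_simpl; apply/nbhs_normP; exists d => //= Y; rewrite /ball_/= distrC => hY.
by rewrite distrC hd.
Qed.

Lemma is_derive_epsP (phi : R -> R) (d : R) :
  is_derive (0 : R) 1 phi d <->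
  (forall e : R, 0 < e -> exists2 r : R, 0 < r &
     forall h : R, h != 0 -> `|h| < r -> `|h^-1 * (phi h - phi 0) - d| < e).
Proof.
have qE : (fun h : R => h^-1 *: ((phi \o shift 0) (h *: (1 : R)) - phi 0)) =
          (fun h => h^-1 * (phi h - phi 0)).
  by apply/funext => h /=; rewrite /shift/= addr0 /GRing.scale/= mulr1.
split=> [[dphi vphi] e e0|h].
  have : h^-1 * (phi h - phi 0) @[h --> 0^'] --> d.
    by rewrite -vphi /derive -qE; exact: dphi.
  move=> /cvgrPdist_lt/(_ e e0)/nbhs_normP[r /= r0 hr]; exists r => // k k0 kr.
  by rewrite distrC; apply: hr => //=; rewrite /ball_/= sub0r normrN.
have cq : h^-1 * (phi h - phi 0) @[h --> 0^'] --> d.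
  apply/cvgrPdist_lt => e e0; have [r r0 hr] := h e e0.
  apply/nbhs_normP; exists r => //= k; rewrite /ball_/= sub0r normrN => kr k0.
  by rewrite distrC hr.
split; first by rewrite /derivable qE; apply/cvg_ex; exists d.
by rewrite /derive qE; exact: cvg_lim.
Qed.

(** Stated on the line through [X] in direction [v], so that the mean value theorem and
    differentiation under the integral apply as in one variable. *)
Definition dird u X v (d : R) := is_derive (0 : R) 1 (fun r : R => u (X + r *: v)) d.

Lemma dirdP u X v d : dird u X v d <->
  (forall e : R, 0 < e -> exists2 r : R, 0 < r &
     forall h : R, h != 0 -> `|h| < r -> `|h^-1 * (u (X + h *: v) - u X) - d| < e).
Proof.
rewrite /dird is_derive_epsP scale0r addr0; by [].
Qed.

Lemma dird_is_derive u X v d : dird u X v d <-> is_derive X v u d.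
Proof.
have qE : (fun h : R => h^-1 *: (((fun r : R => u (X + r *: v)) \o shift 0) (h *: (1 : R))
     - u (X + (0 : R) *: v))) =
     (fun h => h^-1 *: ((u \o shift X) (h *: v) - u X)).
  apply/funext => h /=; rewrite /shift/= addr0 scale0r addr0 (addrC X).
  have -> : h *: (1 : R) = h by exact: mulr1.
  by [].
split=> -[h1 h2]; split.
- by rewrite /derivable -qE; exact: h1.
- by rewrite /derive -qE; exact: h2.
- by rewrite /derivable qE; exact: h1.
- by rewrite /derive qE; exact: h2.
Qed.

Lemma dird_unique u X v d e : dird u X v d -> dird u X v e -> d = e.
Proof. by move=> [_ <-] [_ <-]. Qed.

Lemma dird_ext u1 u2 X v d : u1 =1 u2 -> dird u1 X v d -> dird u2 X v d.
Proof. by move=> /funext ->. Qed.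

Lemma dird_line u u' v : (forall X, dird u X v (u' X)) ->
  forall X (r : R), is_derive r 1 (fun s : R => u (X + s *: v)) (u' (X + r *: v)).
Proof.
move=> hu X r.
have h1 := hu (X + r *: v).
have h2 : is_derive (r : R) 1 (fun s : R => s - r) 1.
  exact: (@is_derive_shift R r 1 (- r)).
rewrite /dird in h1.
have h3 : is_derive ((fun s : R => s - r) r) 1 (fun s : R => u (X + r *: v + s *: v))
   (u' (X + r *: v)) by rewrite subrr.
have := @is_derive1_comp R _ _ r _ _ h3 h2; rewrite mulr1.
congr (is_derive _ _ _ _); apply/funext => s /=.
by rewrite -addrA -scalerDl subrKC.
Qed.

Lemma dird_mvt u u' v : (forall X, dird u X v (u' X)) ->
  forall X (r : R), exists2 t : R, `|t| <= `|r| & u (X + r *: v) - u X = r * u' (X + t *: v).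
Proof.
move=> hu X r.
have hl := dird_line hu X.
have cl a b : {within `[a, b], continuous (fun s : R => u (X + s *: v))}.
  apply: continuous_subspaceT => s; apply: differentiable_continuous.
  by apply/derivable1_diffP; have [] := hl s.
have [r0|r0] := leP 0 r.
  have [t] := @MVT_segment R _ _ 0 r r0 (fun x _ => hl x) (cl _ _).
  rewrite in_itv/= => /andP[t0 tr]; rewrite scale0r addr0 subr0 mulrC => ->.
  by exists t => //; rewrite !ger0_norm.
have [t] := @MVT_segment R _ _ r 0 (ltW r0) (fun x _ => hl x) (cl _ _).
rewrite in_itv/= => /andP[t0 tr]; rewrite scale0r addr0 sub0r => E.
exists t; last by rewrite -[LHS]opprB E mulrN opprK mulrC.
by rewrite !ler0_norm ?lerN2// ltW.
Qed.

Lemma dird_lip u u' v (M : R) : (forall X, dird u X v (u' X)) ->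
  (forall X, `|u' X| <= M) ->
  forall X (r : R), `|u (X + r *: v) - u X| <= M * `|r|.
Proof.
move=> hu hM X r; have [t _ ->] := dird_mvt hu X r.
by rewrite normrM mulrC ler_wpM2r.
Qed.

(** Directional derivatives alone need not be additive in the direction; continuity of one of the
    two restores additivity. The increment is split at [X + h v], and the mean value theorem along
    [w] turns its second half into a value of [uw] near [X]. *)
Lemma dird_dirD u v w (uv uw : 'rV[R]_n -> R) : continuous uw ->
  (forall X, dird u X v (uv X)) -> (forall X, dird u X w (uw X)) ->
  forall X, dird u X (v + w) (uv X + uw X).
Proof.
move=> cw hv hw X; apply/dirdP => e e0.
have e20 : 0 < e / 2 by rewrite divr_gt0.
have /dirdP/(_ _ e20)[r1 r10 h1] := hv X.
have /continuous_epsP/(_ _ e20)[r2 r20 h2] := cw X.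
pose c := `|v| + `|w| + 1.
have c0 : 0 < c by rewrite ltr_wpDl// addr_ge0.
exists (Num.min r1 (r2 / c)); first by rewrite lt_min r10 divr_gt0.
move=> h h0; rewrite lt_min => /andP[hr1 hr2].
have [t tr Ew] := dird_mvt hw (X + h *: v) h.
rewrite scalerDr addrA -(subrK (u (X + h *: v)) (u _)) Ew -addrA mulrDr.
rewrite mulKf// (addrC (uv X)) opprD addrACA (splitr e).
apply: le_lt_trans (ler_normD _ _) _; apply: ltrD; last exact: h1.
apply: h2; rewrite (_ : _ - X = h *: v + t *: w); last first.
  by rewrite -(addrA X) (addrC X) addrK.
apply: le_lt_trans (ler_normD _ _) _; rewrite !normrZ.
rewrite ltr_pdivlMr// in hr2; apply: le_lt_trans hr2.
rewrite /c mulrDr mulr1 mulrDr -[leLHS]addr0 lerD//.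
by rewrite lerD// ler_wpM2r.
Qed.

Lemma dird_dirZ u X v d (c : R) : dird u X v d -> dird u X (c *: v) (c * d).
Proof.
move=> /dirdP hv; have [->|c0] := eqVneq c 0.
  apply/dirdP => e e0; exists 1 => // h _ _.
  by rewrite scale0r scaler0 addr0 subrr mulr0 mul0r subrr normr0.
apply/dirdP => e e0.
have c0' : 0 < `|c| by rewrite normr_gt0.
have [|r r0 hr] := hv (e / `|c|); first by rewrite divr_gt0.
exists (r / `|c|); first by rewrite divr_gt0.
move=> h h0; rewrite ltr_pdivlMr// -normrM => hc.
have := hr (h * c) (mulf_neq0 h0 c0) hc; rewrite scalerA ltr_pdivlMr// -normrM.
by congr (`|_| < _); field; rewrite h0 c0.
Qed.

Lemma dird_dir_sum u (I : Type) (s : seq I) (v : I -> 'rV[R]_n)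
    (d : I -> 'rV[R]_n -> R) (c : I -> R) :
  (forall i, continuous (d i)) -> (forall i X, dird u X (v i) (d i X)) ->
  forall X, dird u X (\sum_(i <- s) c i *: v i) (\sum_(i <- s) c i * d i X).
Proof.
move=> cd hd; elim: s => [|i s IH] X.
  rewrite !big_nil; apply/dirdP => e e0; exists 1 => // h _ _.
  by rewrite scaler0 addr0 subrr mulr0 subrr normr0.
rewrite !big_cons addrC [X in dird _ _ _ X]addrC.
apply: (@dird_dirD u _ _ (fun X => \sum_(j <- s) c j * d j X) (fun X => c i * d i X)) => //.
  by apply: cts_mul => //; exact: cts_cst.
by move=> Y; exact: dird_dirZ.
Qed.

Lemma dirdD u1 u2 X v d1 d2 : dird u1 X v d1 -> dird u2 X v d2 ->
  dird (fun Y => u1 Y + u2 Y) X v (d1 + d2).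
Proof. exact: is_deriveD. Qed.

Lemma dirdZ (c : R) u X v d : dird u X v d -> dird (fun Y => c * u Y) X v (c * d).
Proof. exact: is_deriveZ. Qed.

Lemma dirdM u1 u2 X v d1 d2 : dird u1 X v d1 -> dird u2 X v d2 ->
  dird (fun Y => u1 Y * u2 Y) X v (u1 X * d2 + u2 X * d1).
Proof.
move=> h1 h2; have := is_deriveM h1 h2.
by rewrite /= scale0r addr0.
Qed.

Lemma dird_cst (c : R) X v : dird (fun=> c) X v 0.
Proof. exact: is_derive_cst. Qed.

Lemma dird_sum (I : Type) (s : seq I) (u : I -> 'rV[R]_n -> R) (d : I -> R) X v :
  (forall i, dird (u i) X v (d i)) ->
  dird (fun Y => \sum_(i <- s) u i Y) X v (\sum_(i <- s) d i).
Proof.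
move=> h; elim: s => [|i s IH].
  by rewrite big_nil; under [X in dird X]eq_fun do rewrite big_nil; exact: dird_cst.
rewrite big_cons; under [X in dird X]eq_fun do rewrite big_cons.
exact: dirdD.
Qed.

Lemma dird_comp (phi : R -> R) (d' : R) u X v d :
  is_derive (u X) 1 phi d' -> dird u X v d -> dird (fun Y => phi (u Y)) X v (d' * d).
Proof.
move=> h1 h2; apply: (@is_derive1_comp R phi (fun r => u (X + r *: v)) 0 d' d) => //.
by rewrite scale0r addr0.
Qed.

(** By the mean value theorem the difference quotients of [u_ k - u_ N] are bounded uniformly in the
    step, so the quotient of [u_ N] at one fixed [N] controls that of the limit. *)
Lemma dird_lim (u_ : nat -> 'rV[R]_n -> R) u (g_ : nat -> 'rV[R]_n -> R) g v :
  (forall k X, dird (u_ k) X v (g_ k X)) ->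
  (forall X, u_ k X @[k --> \oo] --> u X) ->
  (forall e : R, 0 < e -> exists N, forall k, (N <= k)%N -> forall X, `|g_ k X - g X| <= e) ->
  forall X, dird u X v (g X).
Proof.
move=> hd hu hg X; apply/dirdP => e e0.
(* Four of the five parts are spent: two on the difference of the quotients, one on the derivative
   of [u_ N], one on [g_ N - g]. *)
have e50 : 0 < e / 5 by rewrite divr_gt0.
have [N hN] := hg _ e50.
have /dirdP/(_ _ e50)[r r0 hr] := hd N X.
exists r => // h h0 /(hr _ h0) hq.
have hlip k : (N <= k)%N -> `|(u_ k (X + h *: v) - u_ k X) - (u_ N (X + h *: v) - u_ N X)|
    <= e / 5 *+ 2 * `|h|.
  move=> Nk; have hdd Y : dird (fun Z => u_ k Z - u_ N Z) Y v (g_ k Y - g_ N Y).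
    by have := dirdD (hd k Y) (dirdZ (-1) (hd N Y)); under eq_fun do rewrite mulN1r; rewrite mulN1r.
  have := @dird_lip _ _ v (e / 5 *+ 2) hdd _ X h.
  rewrite opprB -opprB !opprD !opprK addrACA => -> // Y.
  rewrite -(subrK (g Y) (g_ k Y)) -addrA mulr2n.
  apply: le_trans (ler_normD _ _) _; rewrite lerD ?hN// distrC; exact: hN.
have {}hlip : `|(u (X + h *: v) - u X) - (u_ N (X + h *: v) - u_ N X)| <= e / 5 *+ 2 * `|h|.
  have : `|(u_ k (X + h *: v) - u_ k X) - (u_ N (X + h *: v) - u_ N X)| @[k --> \oo] -->
    `|(u (X + h *: v) - u X) - (u_ N (X + h *: v) - u_ N X)|.
    by apply: cvg_norm; apply: cvgB; [apply: cvgB; exact: hu|exact: cvg_cst].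
  by move=> /seq_cvg_le; apply; exists N.
have h0' : 0 < `|h| by rewrite normr_gt0.
have : `|h^-1 * (u (X + h *: v) - u X) - h^-1 * (u_ N (X + h *: v) - u_ N X)| <= e / 5 *+ 2.
  by rewrite -mulrBr normrM normfV ler_pdivrMl// mulrC.
set a := h^-1 * (u _ - _) in hq *; set b := h^-1 * _ in hq *.
have := hN N (leqnn N) X; move: a b hq => a b + +; rewrite mulr2n.
rewrite !ltr_norml !ler_norml => /andP[? ?] /andP[? ?] /andP[? ?].
apply/andP; split; lra.
Qed.

End directional.

(** * Real-valued integrals: domination, differentiation under the integral, Fubini *)

Section real_integrals.
Context d (S : measurableType d) (R : realType) (nu : {measure set S -> \bar R}).
Implicit Types f g : S -> R.
Local Notation integ f := (nu.-integrable setT (EFin \o f)).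

Lemma integ_le f g : measurable_fun setT f -> integ g ->
  (forall s, `|f s| <= g s) -> integ f.
Proof.
move=> mf ig fg; apply: (le_integrable measurableT _ _ ig).
  exact/measurable_EFinP.
by move=> s _ /=; rewrite lee_fin (le_trans (fg s))// ler_norm.
Qed.

Lemma integ_measurable f : integ f -> measurable_fun setT f.
Proof. by move=> /measurable_int/measurable_EFinP. Qed.

Lemma integ_norm f : integ f -> integ (fun s => `|f s|).
Proof. by move=> /integrable_norm. Qed.

Lemma Rintegral_norm_le f g : measurable_fun setT f -> integ g ->
  (forall s, `|f s| <= g s) -> `|Rintegral nu setT f| <= Rintegral nu setT g.
Proof.
move=> mf ig fg; have If := integ_le mf ig fg.
apply: (le_trans (le_normr_Rintegral measurableT If)).
by apply: le_Rintegral => //; exact: integ_norm.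
Qed.

Lemma EFin_Rintegral f : integ f ->
  (Rintegral nu setT f)%:E = (\int[nu]_s (f s)%:E)%E.
Proof. by move=> If; rewrite /Rintegral fineK//; exact: integrable_fin_num. Qed.

Lemma Rdominated_cvg (f_ : nat -> S -> R) f g :
  (forall j, measurable_fun setT (f_ j)) ->
  (forall s, f_ j s @[j --> \oo] --> f s) -> integ g ->
  (forall j s, `|f_ j s| <= g s) ->
  Rintegral nu setT (f_ j) @[j --> \oo] --> Rintegral nu setT f.
Proof.
move=> mf_ f_f ig fg.
have mf : measurable_fun setT f.
  by apply: (measurable_fun_cvg mf_) => s _; exact: f_f.
have fle s : `|f s| <= g s.
  apply: (@seq_cvg_le R (fun j => `|f_ j s|)); last by exists 0%N => j _.
  exact: (cvg_norm (f_f s)).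
apply: fine_cvg; rewrite -/(Rintegral nu setT f) EFin_Rintegral; last exact: (integ_le mf ig).
apply: (@dominated_cvg _ _ _ nu setT measurableT (fun j s => (f_ j s)%:E) (EFin \o f) (EFin \o g)) => //.
- by move=> j; exact/measurable_EFinP.
- by move=> s _; apply: cvg_EFin; [exact: nearW|exact: f_f].
- by move=> j s _; rewrite lee_fin.
Qed.

Lemma Rdiff_under_integral (f f' : R -> S -> R) (G : S -> R) (a u v : R) :
  u < a < v ->
  (forall r, u < r < v -> integ (f r)) ->
  (forall r s, u < r < v -> is_derive r 1 (f^~ s) (f' r s)) ->
  (forall r s, u < r < v -> `|f' r s| <= G s) -> integ G ->
  is_derive a 1 (fun r => Rintegral nu setT (f r)) (Rintegral nu setT (f' a)).
Proof.
move=> auv If df f'G IG.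
have Ia : `]u, v[%classic a by rewrite /= in_itv.
have G0 s : 0 <= G s by exact: le_trans (normr_ge0 _) (f'G a s auv).
have If' r : `]u, v[%classic r -> nu.-integrable setT (EFin \o f r).
  by rewrite /= in_itv/=; exact: If.
have df' r s : `]u, v[%classic r -> setT s -> derivable (f^~ s) r 1.
  by rewrite /= in_itv/= => /(df r s)[].
have pE r s : u < r < v -> partial1of2 f r s = f' r s.
  by move=> /(df r s)[_ <-]; rewrite partial1of2E.
have Gub r s : `]u, v[%classic r -> setT s -> `|partial1of2 f r s| <= G s.
  by rewrite /= in_itv/= => h _; rewrite pE// f'G.
split; first exact: (derivable_under_integral measurableT Ia If' df' G0 IG Gub).
rewrite -derive1E.
rewrite (differentiation_under_integral measurableT Ia If' df' G0 IG Gub).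
by apply: eq_Rintegral => s _; rewrite pE.
Qed.

End real_integrals.

(** A majorant in product form [g1 s * g2 t] settles every integrability condition at once. *)
Lemma Rfubini d1 d2 (S1 : measurableType d1) (S2 : measurableType d2) (R : realType)
    (m1 : {sigma_finite_measure set S1 -> \bar R})
    (m2 : {sigma_finite_measure set S2 -> \bar R}) (f : S1 * S2 -> R)
    (g1 : S1 -> R) (g2 : S2 -> R) :
  measurable_fun setT f -> m1.-integrable setT (EFin \o g1) ->
  m2.-integrable setT (EFin \o g2) ->
  (forall s t, `|f (s, t)| <= g1 s * g2 t) ->
  (forall s, 0 <= g1 s) -> (forall t, 0 <= g2 t) ->
  [/\ (m1 \x m2)%E.-integrable setT (EFin \o f),
   Rintegral m1 setT (fun s => Rintegral m2 setT (fun t => f (s, t))) =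
   Rintegral (m1 \x m2)%E setT f &
   Rintegral m1 setT (fun s => Rintegral m2 setT (fun t => f (s, t))) =
   Rintegral m2 setT (fun t => Rintegral m1 setT (fun s => f (s, t)))].
Proof.
move=> mf I1 I2 fg g10 g20.
have mf1 s : measurable_fun setT (fun t => f (s, t)).
  exact: (measurableT_comp mf (pair1_measurable s)).
have mf2 t : measurable_fun setT (fun s => f (s, t)).
  exact: (measurableT_comp mf (pair2_measurable t)).
have mg1 := integ_measurable I1; have mg2 := integ_measurable I2.
have Ig2 s : m2.-integrable setT (EFin \o (fun t => g1 s * g2 t)).
  exact: (integrableZl measurableT (g1 s) I2).
have Ig1 t : m1.-integrable setT (EFin \o (fun s => g1 s * g2 t)).
  by under [X in EFin \o X]eq_fun do rewrite mulrC; exact: (integrableZl measurableT (g2 t) I1).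
have If1 s := integ_le (mf1 s) (Ig2 s) (fg s).
have If2 t : m1.-integrable setT (EFin \o (fun s => f (s, t))).
  exact: (integ_le (mf2 t) (Ig1 t)).
have If : (m1 \x m2)%E.-integrable setT (EFin \o f).
  apply/integrable12ltyP; first exact/measurable_EFinP.
  apply: (@le_lt_trans _ _ (\int[m1]_s ((g1 s)%:E * \int[m2]_t (g2 t)%:E))%E).
    apply: ge0_le_integral => //.
    - by move=> s _; exact: integral_ge0.
    - apply: (measurable_fun_fubini_tonelli_F (fun p => `|(f p)%:E|%E)) => //.
      by apply: measurableT_comp => //; exact/measurable_EFinP.
    - by apply: emeasurable_funM => //; exact/measurable_EFinP.
    - move=> s _; rewrite -ge0_integralZl ?lee_fin//; last 2 first.
      + exact/measurable_EFinP.
      + by move=> t _; rewrite lee_fin.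
      apply: ge0_le_integral => //.
      + by apply: measurableT_comp => //; apply/measurable_EFinP; exact: mf1.
      + by apply: emeasurable_funM => //; exact/measurable_EFinP.
      + by move=> t _; rewrite -EFinM lee_fin.
  rewrite -EFin_Rintegral//; under eq_integral do rewrite -EFinM.
  under eq_integral do rewrite mulrC.
  rewrite -(EFin_Rintegral (f := fun s => Rintegral m2 setT g2 * g1 s)) ?ltry//.
  exact: (integrableZl measurableT _ I1).
have E1 : Rintegral m1 setT (fun s => Rintegral m2 setT (fun t => f (s, t))) =
   Rintegral (m1 \x m2)%E setT f.
  rewrite {1 3}/Rintegral -(integral12_prod_meas1 If); congr fine.
  by apply: eq_integral => s _; rewrite EFin_Rintegral.
split => //; rewrite E1 {1 2}/Rintegral -(integral21_prod_meas1 If); congr fine.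
by apply: eq_integral => t _; rewrite EFin_Rintegral.
Qed.

(** * Averages of translates against an integrable kernel *)

Section average.
Context d (S : measurableType d) (R : realType) (nu : {measure set S -> \bar R}).
Variables (n : nat) (k : S -> R) (phi : S -> 'rV[R]_n).
Hypotheses (Ik : nu.-integrable setT (EFin \o k)) (mphi : measurable_fun setT phi).
Implicit Types (F : 'rV[R]_n -> R) (X : 'rV[R]_n).

(** Common form of [heat], its derivatives [dheat] and [ddheat], and the time averages [tavg]: only
    the kernel [k], the displacement [phi] and the measure change. With [k] integrable the operator
    acts on bounded continuous functions and commutes with derivatives and with other averages. *)
Definition avg F X := Rintegral nu setT (fun s => k s * F (X + phi s)).

Lemma avg_measurable F X : continuous F -> measurable_fun setT (fun s => k s * F (X + phi s)).
Proof.
move=> cF; apply: measurable_funM; first exact: integ_measurable Ik.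
apply: (measurableT_comp (continuous_measurable_row cF)).
exact: measurable_fun_row_add.
Qed.

Lemma integ_Zabs (M : R) : nu.-integrable setT (EFin \o (fun s => M * `|k s|)).
Proof. exact: (integrableZl measurableT M (integ_norm Ik)). Qed.

Lemma avg_integrable F X M : continuous F -> (forall Y, `|F Y| <= M) ->
  nu.-integrable setT (EFin \o (fun s => k s * F (X + phi s))).
Proof.
move=> cF FM; apply: (integ_le (avg_measurable X cF) (integ_Zabs M)) => s.
by rewrite normrM mulrC ler_wpM2r.
Qed.

Lemma avg_le F X G : continuous F -> nu.-integrable setT (EFin \o G) ->
  (forall s, `|k s| * `|F (X + phi s)| <= G s) -> `|avg F X| <= Rintegral nu setT G.
Proof.
move=> cF IG FG; apply: Rintegral_norm_le => // [|s]; first exact: avg_measurable.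
by rewrite normrM.
Qed.

Lemma avg_bound F X M : continuous F -> (forall Y, `|F Y| <= M) ->
  `|avg F X| <= M * Rintegral nu setT (fun s => `|k s|).
Proof.
move=> cF FM; rewrite -RintegralZl//; last exact: integ_norm.
apply: avg_le => //; first exact: integ_Zabs.
by move=> s; rewrite mulrC ler_wpM2r.
Qed.

Lemma avg_continuous F M : continuous F -> (forall Y, `|F Y| <= M) -> continuous (avg F).
Proof.
(* A discontinuity would yield a sequence [Y j] tending to [X], which brings the claim under
   dominated convergence for sequences. *)
move=> cF FM X; apply/continuous_epsP => e e0; apply/not_exists2P => hX.
have {}hX (j : nat) : exists Y, `|Y - X| < j.+1%:R^-1 /\ e <= `|avg F Y - avg F X|.
  have [|] := hX (j.+1%:R^-1); first by rewrite invr_gt0 ltr0n.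
  move=> /existsNP[Y /not_implyP[h1 /negP]]; rewrite -leNgt => h2.
  by exists Y.
have [Y hY] := choice hX.
have YX s : F (Y j + phi s) @[j --> \oo] --> F (X + phi s).
  apply/seq_cvgP => e1 e10.
  have /continuous_epsP/(_ _ e10)[r r0 hr] := cF (X + phi s).
  have [N _ hN] := near_infty_natSinv_lt (PosNum r0).
  exists N => j Nj; apply: hr; rewrite opprD addrACA subrr addr0.
  by apply: lt_trans (hY j).1 _; exact: hN.
have := @Rdominated_cvg _ _ _ nu (fun j s => k s * F (Y j + phi s))
  (fun s => k s * F (X + phi s)) (fun s => M * `|k s|) (fun j => avg_measurable _ cF).
move=> /(_ (fun s => cvgM (cvg_cst _) (YX s)) (integ_Zabs M)).
have hb j s : `|k s * F (Y j + phi s)| <= M * `|k s|.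
  by rewrite normrM mulrC ler_wpM2r.
move=> /(_ hb)/seq_cvgP/(_ e e0)[N /(_ N (leqnn N))].
by rewrite ltNge (hY N).2.
Qed.

Lemma avgD F1 F2 M1 M2 X : continuous F1 -> (forall Y, `|F1 Y| <= M1) ->
  continuous F2 -> (forall Y, `|F2 Y| <= M2) ->
  avg (fun Y => F1 Y + F2 Y) X = avg F1 X + avg F2 X.
Proof.
move=> c1 h1 c2 h2; rewrite /avg -RintegralD//.
- by apply: eq_Rintegral => s _; rewrite mulrDr.
- exact: (avg_integrable X c1 h1).
- exact: (avg_integrable X c2 h2).
Qed.

Lemma avgZ F M c X : continuous F -> (forall Y, `|F Y| <= M) ->
  avg (fun Y => c * F Y) X = c * avg F X.
Proof.
move=> c1 h1; rewrite /avg -RintegralZl//; last exact: (avg_integrable X c1 h1).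
by apply: eq_Rintegral => s _; rewrite mulrCA.
Qed.

Lemma avg_cst c X : avg (fun=> c) X = c * Rintegral nu setT k.
Proof. by rewrite /avg -RintegralZl//; apply: eq_Rintegral => s _; rewrite mulrC. Qed.

Lemma avg_dird F F' M M' v : continuous F -> (forall Y, `|F Y| <= M) ->
  continuous F' -> (forall Y, `|F' Y| <= M') ->
  (forall X, dird F X v (F' X)) -> forall X, dird (avg F) X v (avg F' X).
Proof.
move=> cF FM cF' FM' dF X; rewrite /dird.
have := @Rdiff_under_integral _ _ _ nu (fun r s => k s * F (X + r *: v + phi s))
  (fun r s => k s * F' (X + r *: v + phi s)) (fun s => M' * `|k s|) 0 (-1) 1.
rewrite ltrN10 ltr01 => /(_ isT).
rewrite scale0r addr0; apply.
- by move=> r _; exact: (avg_integrable _ cF FM).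
- move=> r s _; have := dird_line dF (X + phi s) r.
  rewrite addrAC => /(is_deriveZ (k s)); congr (is_derive _ _ _ _).
  by apply/funext => t /=; rewrite addrAC.
- by move=> r s _; rewrite normrM mulrC ler_wpM2r.
- exact: integ_Zabs.
Qed.

End average.

Section average_commute.
Context d1 d2 (S1 : measurableType d1) (S2 : measurableType d2) (R : realType).
Variables (m1 : {sigma_finite_measure set S1 -> \bar R})
  (m2 : {sigma_finite_measure set S2 -> \bar R}).
Variables (n : nat) (k1 : S1 -> R) (phi1 : S1 -> 'rV[R]_n)
  (k2 : S2 -> R) (phi2 : S2 -> 'rV[R]_n).
Hypotheses (I1 : m1.-integrable setT (EFin \o k1)) (mphi1 : measurable_fun setT phi1).
Hypotheses (I2 : m2.-integrable setT (EFin \o k2)) (mphi2 : measurable_fun setT phi2).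

(** Both iterated averages are one average over the product space with displacement [phi1 + phi2],
    which is symmetric in the two factors. *)
Lemma avg_comp (F : 'rV[R]_n -> R) M X : continuous F -> (forall Y, `|F Y| <= M) ->
  avg m1 k1 phi1 (avg m2 k2 phi2 F) X =
  avg (m1 \x m2)%E (fun p => k1 p.1 * k2 p.2) (fun p => phi1 p.1 + phi2 p.2) F X /\
  avg m1 k1 phi1 (avg m2 k2 phi2 F) X = avg m2 k2 phi2 (avg m1 k1 phi1 F) X.
Proof.
move=> cF FM.
pose f (p : S1 * S2) := k1 p.1 * k2 p.2 * F (X + (phi1 p.1 + phi2 p.2)).
have mk1 := integ_measurable I1; have mk2 := integ_measurable I2.
have mf : measurable_fun setT f.
  apply: measurable_funM.
    by apply: measurable_funM; [exact: (measurableT_comp mk1)|exact: (measurableT_comp mk2)].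
  apply: (measurableT_comp (continuous_measurable_row cF)).
  apply: measurable_fun_row_add => //; apply: measurable_fun_row_add.
    exact: (measurableT_comp mphi1).
  exact: (measurableT_comp mphi2).
have hf s t : `|f (s, t)| <= (M * `|k1 s|) * `|k2 t|.
  rewrite /f/= !normrM (_ : M * _ * _ = `|k1 s| * `|k2 t| * M); last by ring.
  by rewrite ler_wpM2l// mulr_ge0.
have M0 : 0 <= M by exact: le_trans (FM X).
have [_ E12 E] := @Rfubini _ _ _ _ _ m1 m2 f _ _ mf (integ_Zabs I1 M) (integ_norm I2) hf
  (fun s => mulr_ge0 M0 (normr_ge0 _)) (fun t => normr_ge0 _).
have L : avg m1 k1 phi1 (avg m2 k2 phi2 F) X =
    Rintegral m1 setT (fun s => Rintegral m2 setT (fun t => f (s, t))).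
  apply: eq_Rintegral => s _; rewrite -RintegralZl//.
    by apply: eq_Rintegral => t _; rewrite /f/= mulrA addrA.
  exact: (avg_integrable I2 mphi2 _ cF FM).
split; first by rewrite L E12.
rewrite L E; apply: eq_Rintegral => t _; rewrite -RintegralZl//.
  by apply: eq_Rintegral => s _; rewrite /f/= mulrA (mulrC (k2 t)) -addrA (addrC (phi2 t)).
exact: (avg_integrable I1 mphi1 _ cF FM).
Qed.

End average_commute.

(** * Gaussian kernels and the heat semigroup *)

Section gaussian.
Variables (R : realType) (n : nat).
Implicit Types (x y z : 'rV[R]_n) (s t r c : R) (i : 'I_n).
Local Notation mu := (lebesgue_row R n).
Local Notation e_ i := (delta_mx ord0 i : 'rV[R]_n).

Definition sqnorm y : R := \sum_i y ord0 i ^+ 2.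

(** Heat kernel of the Laplacian; [dgk] is minus its derivative in [y_i], and [ddgk] its second
    derivative. Since [F] is evaluated at [X] plus a displacement in [y], a derivative in [X] passes
    to the kernel with the opposite sign. *)
Definition gk t y : R := (Num.sqrt (4 * pi * t))^-1 ^+ n * expR (- (sqnorm y / (4 * t))).
Definition dgk i t y : R := y ord0 i / (2 * t) * gk t y.
Definition ddgk i t y : R := (y ord0 i ^+ 2 / (4 * t ^+ 2) - (2 * t)^-1) * gk t y.

Lemma sqnorm_ge0 y : 0 <= sqnorm y.
Proof. by apply: sumr_ge0 => i _; exact: sqr_ge0. Qed.

Lemma sqr_coord_le y i : y ord0 i ^+ 2 <= sqnorm y.
Proof.
by rewrite /sqnorm (bigD1 i)//= lerDl sumr_ge0// => j _; exact: sqr_ge0.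
Qed.

Lemma sqr_norm_le y : `|y| ^+ 2 <= sqnorm y.
Proof.
rewrite -(@sqr_sqrtr _ (sqnorm y)) ?sqnorm_ge0// ler_sqr ?nnegrE ?sqrtr_ge0//.
apply: row_norm_le => [|i]; first exact: sqrtr_ge0.
by rewrite -sqrtr_sqr ler_wsqrtr// sqr_coord_le.
Qed.

Lemma peak_gt0 t : 0 < t -> 0 < (Num.sqrt (4 * pi * t))^-1.
Proof. by move=> t0; rewrite invr_gt0 sqrtr_gt0 !mulr_gt0 ?pi_gt0. Qed.

Lemma gk_ge0 t y : 0 <= gk t y.
Proof. by rewrite mulr_ge0 ?expR_ge0// exprn_ge0// invr_ge0. Qed.

Lemma gk_sup t y : 0 < t -> gk t y <= (Num.sqrt (4 * pi * t))^-1 ^+ n.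
Proof.
move=> t0; apply: ler_piMr; first by rewrite exprn_ge0// ltW// peak_gt0.
by rewrite -expR0 ler_expR oppr_le0 divr_ge0 ?sqnorm_ge0// mulr_ge0// ltW.
Qed.

Lemma coord_continuous i : continuous (fun y : 'rV[R]_n => y ord0 i).
Proof. exact: coord_continuous. Qed.

Lemma sqnorm_continuous : continuous sqnorm.
Proof.
apply: (@cts_sum _ _ _ _ xpredT (fun i (y : 'rV[R]_n) => y ord0 i ^+ 2)) => i _.
by under eq_fun do rewrite expr2; apply: cts_mul; exact: coord_continuous.
Qed.

Lemma gk_continuous t : continuous (gk t).
Proof.
apply: cts_mul; first exact: cts_cst.
apply: cts_comp; first exact: continuous_expR.
by apply: cts_opp; apply: cts_mul; [exact: sqnorm_continuous|exact: cts_cst].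
Qed.

Lemma dgk_continuous i t : continuous (dgk i t).
Proof.
apply: cts_mul; last exact: gk_continuous.
by apply: cts_mul; [exact: coord_continuous|exact: cts_cst].
Qed.

Lemma ddgk_continuous i t : continuous (ddgk i t).
Proof.
apply: cts_mul; last exact: gk_continuous.
apply: cts_sub; last exact: cts_cst.
apply: cts_mul; last exact: cts_cst.
by under eq_fun do rewrite expr2; apply: cts_mul; exact: coord_continuous.
Qed.

Lemma gk_prod t y : 0 < t -> gk t y = \prod_(i < n) normal_pdf 0 (Num.sqrt (2 * t)) (y ord0 i).
Proof.
move=> t0; have s0 : Num.sqrt (2 * t) != 0 by rewrite gt_eqF// sqrtr_gt0 mulr_gt0.
under eq_bigr do rewrite normal_pdfE// /normal_fun subr0.
rewrite big_split/= prodr_const card_ord -expR_sum; congr (_ ^+ _ * expR _).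
  rewrite /normal_peak sqr_sqrtr; last by rewrite mulr_ge0// ltW.
  by congr (Num.sqrt _)^-1; ring.
rewrite sqr_sqrtr; last by rewrite mulr_ge0// ltW.
rewrite /sqnorm mulr_suml -sumrN; apply: eq_bigr => i _.
by rewrite -mulNr; congr (_ * _^-1); ring.
Qed.

Lemma gk_integral t : 0 < t ->
  mu.-integrable setT (EFin \o gk t) /\ Rintegral mu setT (gk t) = 1.
Proof.
move=> t0; have mg : measurable_fun setT (gk t) by exact: continuous_measurable_row (@gk_continuous t).
have E : (\int[mu]_y (gk t y)%:E = 1)%E.
  under eq_integral do rewrite gk_prod//.
  rewrite (@ge0_integral_row_prod R n (fun _ => normal_pdf 0 (Num.sqrt (2 * t))))//.
  - by rewrite big1// => i _; rewrite integral_normal_pdf.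
  - by move=> _; exact: measurable_normal_pdf.
  - by move=> _ x; exact: normal_pdf_ge0.
split; last by rewrite /Rintegral E.
apply/integrableP; split; first exact/measurable_EFinP.
under eq_integral do rewrite /= ger0_norm ?gk_ge0//.
by rewrite E ltry.
Qed.

(** Peaks and exponents are compared separately: [b <= a ^+ 2 * t] bounds the ratio of the peaks by
    [a ^+ n], and [k] is the loss allowed in the exponent. *)
Lemma gk_compare (k a b t : R) y z : 0 < t -> 0 < b -> 0 <= k ->
  sqnorm z / (4 * b) <= sqnorm y / (4 * t) + k -> b <= a ^+ 2 * t -> 0 <= a ->
  gk t y <= a ^+ n * expR k * gk b z.
Proof.
move=> t0 b0 k0 h1 h2 a0; rewrite /gk mulrACA -exprMn; apply: ler_pM;
  rewrite ?expR_ge0 ?exprn_ge0 ?invr_ge0 ?sqrtr_ge0//.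
- apply: lerXn2r; rewrite ?nnegrE ?mulr_ge0 ?invr_ge0 ?sqrtr_ge0//.
  have p4 : 0 < 4 * pi :> R by rewrite mulr_gt0// pi_gt0.
  have h : Num.sqrt (4 * pi * b) <= a * Num.sqrt (4 * pi * t).
    have -> : a * Num.sqrt (4 * pi * t) = Num.sqrt (a ^+ 2 * (4 * pi * t)).
      by rewrite [RHS]sqrtrM ?sqr_ge0// sqrtr_sqr ger0_norm.
    by rewrite ler_wsqrtr// mulrCA ler_wpM2l// ltW.
  by rewrite ler_pdivlMr ?sqrtr_gt0 ?mulr_gt0 ?pi_gt0// mulrC ler_pdivrMr ?sqrtr_gt0 ?mulr_gt0 ?pi_gt0.
- by rewrite -expRD ler_expR; lra.
Qed.

(** Doubling the time frees half of the Gaussian exponent, and [c x <= x^2 / 8 + 2 c^2] with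
    [x = |y| / sqrt t] makes it absorb the exponential weight. *)
Lemma gk_weight c t y : 0 < t -> 0 <= c ->
  gk t y * expR (c * `|y| / Num.sqrt t) <= Num.sqrt 2 ^+ n * expR (2 * c ^+ 2) * gk (2 * t) y.
Proof.
move=> t0 c0; have st0 : 0 < Num.sqrt t by rewrite sqrtr_gt0.
rewrite /gk mulrACA -exprMn -expRD.
rewrite (_ : _ ^+ n * _ * _ = (Num.sqrt (4 * pi * t))^-1 ^+ n *
  expR (- (sqnorm y / (4 * t)) + c * `|y| / Num.sqrt t)); last by rewrite expRD mulrA.
have -> : Num.sqrt 2 * (Num.sqrt (4 * pi * (2 * t)))^-1 = (Num.sqrt (4 * pi * t))^-1 :> R.
  rewrite (_ : 4 * pi * (2 * t) = 2 * (4 * pi * t)); last by ring.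
  by rewrite sqrtrM// invfM mulrA divff ?mul1r// gt_eqF// sqrtr_gt0.
rewrite ler_wpM2l ?exprn_ge0 ?(ltW (peak_gt0 _))// ler_expR.
set x := `|y| / Num.sqrt t.
have xq : x ^+ 2 <= sqnorm y / t.
  by rewrite expr_div_n (sqr_sqrtr (ltW t0)) ler_wpM2r ?sqr_norm_le// invr_ge0 ltW.
have -> : sqnorm y / (4 * t) = sqnorm y / t / 4 by field; rewrite gt_eqF.
have -> : sqnorm y / (4 * (2 * t)) = sqnorm y / t / 8 by field; rewrite gt_eqF.
rewrite -(mulrA c) -/x; have := sqr_ge0 (x - 4 * c); nra.
Qed.

(** The inequality [|y|^2 <= 2 |y - r e_i|^2 + 2 r^2] bounds all small translates by one fixed
    kernel, the majorant needed to differentiate in [r]. *)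
Lemma gk_shift t r y i : 0 < t -> `|r| <= Num.sqrt t ->
  gk t (y - r *: e_ i) <= Num.sqrt 2 ^+ n * expR 1 * gk (2 * t) y.
Proof.
move=> t0 rt; apply: gk_compare => //; rewrite ?mulr_gt0 ?sqrtr_ge0//; last first.
  by rewrite sqr_sqrtr.
have r2 : r ^+ 2 <= t.
  by rewrite -(sqr_sqrtr (ltW t0)) -[leLHS]real_normK ?num_real// ler_sqr ?nnegrE ?sqrtr_ge0.
have h : sqnorm y <= 2 * sqnorm (y - r *: e_ i) + 2 * r ^+ 2.
  rewrite /sqnorm (bigD1 i)//= [X in 2 * X + _](bigD1 i)//= !mxE !eqxx mulr1.
  have -> : \sum_(j < n | j != i) (y - r *: e_ i) ord0 j ^+ 2 = \sum_(j < n | j != i) y ord0 j ^+ 2.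
    by apply: eq_bigr => j ji; rewrite !mxE eqxx (negbTE ji) mulr0 subr0.
  have : 0 <= \sum_(j < n | j != i) y ord0 j ^+ 2 by rewrite sumr_ge0// => j _; rewrite sqr_ge0.
  move: (\sum_(j < n | j != i) _) => S S0; have := sqr_ge0 (y ord0 i - 2 * r); nra.
rewrite ler_pdivrMr ?mulr_gt0// mulrDl mul1r.
have -> : sqnorm (y - r *: e_ i) / (4 * t) * (4 * (2 * t)) = 2 * sqnorm (y - r *: e_ i).
  by field; rewrite gt_eqF.
lra.
Qed.

Lemma gk_mono a t b y : 0 < a -> a <= t -> t <= b ->
  gk t y <= Num.sqrt (b / a) ^+ n * gk b y.
Proof.
move=> a0 at_ tb; have t0 := lt_le_trans a0 at_; have b0 := lt_le_trans t0 tb.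
rewrite -[X in _ ^+ n * X]mul1r mulrA -[X in _ ^+ n * X]expR0.
apply: gk_compare; rewrite ?sqrtr_ge0// ?addr0.
  by rewrite ler_wpM2l ?sqnorm_ge0// lef_pV2 ?posrE ?mulr_gt0// ler_wpM2l.
have h : b <= b / a * t by rewrite mulrAC ler_pdivlMr// ler_wpM2l// ltW.
by rewrite sqr_sqrtr// divr_ge0// ltW.
Qed.

(** The prefactor [|y_i| / (2 t)] is at most [x / sqrt t] with [x = |y| / sqrt t], and [x <= exp x]
    raises the weight from [c] to [c + 1]. *)
Lemma dgk_weight i c t y : 0 < t -> 0 <= c ->
  `|dgk i t y| * expR (c * `|y| / Num.sqrt t) <=
  (Num.sqrt t)^-1 * (Num.sqrt 2 ^+ n * expR (2 * (c + 1) ^+ 2) * gk (2 * t) y).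
Proof.
move=> t0 c0; have st0 : 0 < Num.sqrt t by rewrite sqrtr_gt0.
have c10 : 0 <= c + 1 by rewrite addr_ge0.
apply: le_trans (ler_wpM2l _ (gk_weight y t0 c10)); last by rewrite invr_ge0 ltW.
rewrite /dgk normrM (ger0_norm (gk_ge0 _ _)).
have -> : (c + 1) * `|y| / Num.sqrt t = c * `|y| / Num.sqrt t + `|y| / Num.sqrt t by ring.
rewrite expRD -!(mulrA c).
set x := `|y| / Num.sqrt t; set E := expR (c * x); set g := gk t y.
set d := `|y ord0 i / (2 * t)|; set S := Num.sqrt t.
rewrite (_ : d * g * E = (g * E) * d); last by ring.
rewrite (_ : S^-1 * (g * (E * expR x)) = (g * E) * (expR x / S)); last by ring.
rewrite ler_wpM2l ?mulr_ge0 ?gk_ge0 ?expR_ge0//.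
have x0 : 0 <= x by rewrite divr_ge0// ltW.
apply: (@le_trans _ _ (x / Num.sqrt t)); last first.
  rewrite ler_wpM2r ?invr_ge0 ?ltW//; have := expR_ge1Dx x; lra.
rewrite /x /S /d -mulrA -invfM -expr2 (sqr_sqrtr (ltW t0)) normrM ler_pM ?normr_ge0 ?ler_row_norm//.
have t20 : 0 < 2 * t by rewrite mulr_gt0.
rewrite ger0_norm ?invr_ge0 ?(ltW t20)// lef_pV2 ?posrE//; lra.
Qed.

Lemma dgk_le i t y : 0 < t ->
  `|dgk i t y| <= (Num.sqrt t)^-1 * (Num.sqrt 2 ^+ n * expR 2 * gk (2 * t) y).
Proof.
move=> t0; have := @dgk_weight i 0 t y t0 (lexx _).
by rewrite !mul0r expR0 mulr1 add0r expr1n mulr1.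
Qed.

Lemma ddgk_le i t y : 0 < t ->
  `|ddgk i t y| <= t^-1 * (Num.sqrt 2 ^+ n * expR 2 * gk (2 * t) y).
Proof.
move=> t0; have st0 : 0 < Num.sqrt t by rewrite sqrtr_gt0.
have := gk_weight y t0 ler01; rewrite expr1n mulr1 mul1r => hw.
apply: le_trans (ler_wpM2l _ hw); last by rewrite invr_ge0 ltW.
rewrite /ddgk normrM (ger0_norm (gk_ge0 _ _)) -/(gk t y).
set x := `|y| / Num.sqrt t; set g := gk t y.
rewrite [leLHS]mulrC [leRHS]mulrCA ler_wpM2l ?gk_ge0//.
have x0 : 0 <= x by rewrite divr_ge0// ltW.
have xq : y ord0 i ^+ 2 / t <= x ^+ 2.
  rewrite expr_div_n sqr_sqrtr; last exact: ltW.
  rewrite ler_wpM2r ?invr_ge0 ?(ltW t0)//.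
  by rewrite -[leLHS]real_normK ?num_real// ler_sqr ?nnegrE// ler_row_norm.
have q0 : 0 <= y ord0 i ^+ 2 / t by rewrite divr_ge0 ?sqr_ge0// ltW.
have ex : 1 + x ^+ 2 / 2 <= expR x by exact: (expR_ge1Dxn 1 x0).
have -> : y ord0 i ^+ 2 / (4 * t ^+ 2) - (2 * t)^-1 = t^-1 * (y ord0 i ^+ 2 / t / 4 - 2^-1).
  by field; rewrite gt_eqF.
rewrite normrM (@ger0_norm _ t^-1) ?invr_ge0 ?(ltW t0)// ler_wpM2l ?invr_ge0 ?(ltW t0)//.
by rewrite ler_norml; apply/andP; split; lra.
Qed.

End gaussian.

Section one_dim_derivatives.
Variable R : realType.
Implicit Types (f g : R -> R) (x a b c : R).

Lemma isdD f g x a b : is_derive x 1 f a -> is_derive x 1 g b ->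
  is_derive x 1 (fun s => f s + g s) (a + b).
Proof. exact: is_deriveD. Qed.

Lemma isdM f g x a b : is_derive x 1 f a -> is_derive x 1 g b ->
  is_derive x 1 (fun s => f s * g s) (f x * b + g x * a).
Proof. exact: is_deriveM. Qed.

Lemma isdZ c f x a : is_derive x 1 f a -> is_derive x 1 (fun s => c * f s) (c * a).
Proof. exact: is_deriveZ. Qed.

Lemma isd_id x : is_derive x 1 (fun s : R => s) 1.
Proof. exact: is_derive_id. Qed.

Lemma isd_cst c x : is_derive x 1 (fun _ : R => c) 0.
Proof. exact: is_derive_cst. Qed.

Lemma isd_eq f g x a b : f =1 g -> a = b -> is_derive x 1 f a -> is_derive x 1 g b.
Proof. by move=> /funext -> ->. Qed.

Lemma isd_comp f g x a b : is_derive (g x) 1 f a -> is_derive x 1 g b ->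
  is_derive x 1 (fun s => f (g s)) (a * b).
Proof. exact: is_derive1_comp. Qed.

Lemma isd_quad (c0 c1 c2 x : R) :
  is_derive x 1 (fun s => c0 + c1 * s + c2 * s ^+ 2) (c1 + c2 * (2 * x)).
Proof.
have h1 : is_derive x 1 (fun s : R => c0 + c1 * s) (0 + c1 * 1).
  exact: isdD (isd_cst c0 x) (isdZ c1 (isd_id x)).
have h2 : is_derive x 1 (fun s : R => c2 * (s * s)) (c2 * (x * 1 + x * 1)).
  exact: isdZ (isdM (isd_id x) (isd_id x)).
by apply: isd_eq (isdD h1 h2) => [s|]; [rewrite expr2|ring].
Qed.
End one_dim_derivatives.

Section row_translation.
Variables (R : realType) (n : nat).
Local Notation mu := (lebesgue_row R n).

Lemma Rintegral_row_translate (f : 'rV[R]_n -> R) (v : 'rV[R]_n) :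
  measurable_fun setT f ->
  Rintegral mu setT (fun y => f (y + v)) = Rintegral mu setT f.
Proof.
move=> mf; rewrite /Rintegral; congr fine; rewrite integralE [in RHS]integralE.
have me : measurable_fun setT (EFin \o f) by exact/measurable_EFinP.
have mp : measurable_fun setT (EFin \o f)^\+%E by exact: measurable_funepos.
have mn : measurable_fun setT (EFin \o f)^\-%E by exact: measurable_funeneg.
congr (_ - _)%E.
- rewrite -(ge0_integral_row_translate v mp)//; apply: eq_integral => x _.
  by rewrite !funeposE.
- rewrite -(ge0_integral_row_translate v mn)//; apply: eq_integral => x _.
  by rewrite !funenegE.
Qed.

Lemma integ_row_translate (f : 'rV[R]_n -> R) (v : 'rV[R]_n) :
  mu.-integrable setT (EFin \o f) -> mu.-integrable setT (EFin \o (fun y => f (y + v))).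
Proof.
move=> If; have mf := integ_measurable If; have /integrableP[_ fi] := If.
apply/integrableP; split.
  apply/measurable_EFinP; apply: (measurableT_comp mf).
  exact: measurable_fun_row_add.
rewrite (ge0_integral_row_translate (f := fun y => `|(EFin \o f) y|%E))//.
by apply: measurableT_comp => //; exact/measurable_EFinP.
Qed.
End row_translation.

Section gaussian_calculus.
Variables (R : realType) (n : nat).
Implicit Types (x y z : 'rV[R]_n) (s t r c : R) (i : 'I_n).
Local Notation mu := (lebesgue_row R n).
Local Notation e_ i := (delta_mx ord0 i : 'rV[R]_n).

Lemma sqnorm_shift y i r :
  sqnorm (y - r *: e_ i) = sqnorm y + (- 2 * y ord0 i) * r + 1 * r ^+ 2.
Proof.
rewrite /sqnorm (bigD1 i)//= [in RHS](bigD1 i)//= !mxE !eqxx mulr1.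
have -> : \sum_(j < n | j != i) (y - r *: e_ i) ord0 j ^+ 2 = \sum_(j < n | j != i) y ord0 j ^+ 2.
  by apply: eq_bigr => j ji; rewrite !mxE eqxx (negbTE ji) mulr0 subr0.
ring.
Qed.

Lemma gk_shift_derive i t y r : 0 < t ->
  is_derive r 1 (fun s => gk t (y - s *: e_ i)) (dgk i t (y - r *: e_ i)).
Proof.
move=> t0; have h := isd_quad (sqnorm y) (- 2 * y ord0 i) 1 r.
have h1 := isdZ (- (4 * t)^-1) h.
have h2 := isdZ ((Num.sqrt (4 * pi * t))^-1 ^+ n) (isd_comp (is_derive_expR _) h1).
apply: isd_eq h2 => [s|].
  by rewrite /gk sqnorm_shift; congr (_ * expR _); rewrite mulrC mulrN.
have H A : - (4 * t)^-1 * A = - (A / (4 * t)) by ring.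
rewrite /dgk /gk sqnorm_shift !mxE !eqxx mulr1 !H.
by move: (expR _) (_ ^+ n) => E P; field; rewrite gt_eqF.
Qed.

Lemma dgk_shift_derive i t y r : 0 < t ->
  is_derive r 1 (fun s => dgk i t (y - s *: e_ i)) (ddgk i t (y - r *: e_ i)).
Proof.
move=> t0; have h := isdM (isd_quad (y ord0 i / (2 * t)) (- (2 * t)^-1) 0 r)
  (gk_shift_derive i y r t0).
apply: isd_eq h => [s|].
  by rewrite /dgk !mxE !eqxx mulr1 mul0r addr0; congr (_ * _); ring.
rewrite /dgk /ddgk !mxE !eqxx mulr1.
by move: (gk t _) => G; field; rewrite gt_eqF.
Qed.

(** The heat equation. Near [t] the kernel is the exponential of
    [- n/2 ln (4 pi s) - |y|^2 / (4 s)], whose derivative is elementary. *)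
Lemma gk_time_derive t y : 0 < t ->
  is_derive t 1 (fun s => gk s y) (\sum_(i < n) ddgk i t y).
Proof.
move=> t0; have p4 : 0 < 4 * pi :> R by rewrite mulr_gt0// pi_gt0.
pose g (s : R) := expR (- (n%:R / 2) * ln (4 * pi * s) + - (sqnorm y / 4) * s^-1).
have gE (s : R) : 0 < s -> gk s y = g s.
  move=> s0; have ps0 : 0 < 4 * pi * s by rewrite mulr_gt0.
  rewrite /gk /g expRD; congr (_ * expR _); last by field; rewrite gt_eqF.
  have sq : 0 < Num.sqrt (4 * pi * s) by rewrite sqrtr_gt0.
  rewrite -[X in X ^+ n]lnK ?posrE ?invr_gt0// -expRM_natl; congr expR.
  rewrite lnV ?posrE// -[in RHS](@sqr_sqrtr _ (4 * pi * s)) ?ltW// lnXn//.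
  by rewrite -mulr_natr; field.
have : is_derive t 1 g (\sum_(i < n) ddgk i t y).
  have h1 := isd_comp (is_derive1_ln (mulr_gt0 p4 t0)) (isdZ (4 * pi) (isd_id t)).
  have t0' : (fun s : R => s) t != 0 by rewrite gt_eqF.
  have h2 := is_deriveV t0' (isd_id t).
  have h3 := isd_comp (is_derive_expR _) (isdD (isdZ (- (n%:R / 2)) h1) (isdZ (- (sqnorm y / 4)) h2)).
  apply: isd_eq h3 => //.
  rewrite /ddgk -mulr_suml -/(g t) -gE// mulrC; congr (_ * _).
  rewrite big_split/= sumr_const card_ord -mulr_suml -/(sqnorm y) -mulr_natl.
  rewrite /GRing.scale/=; move: (pi_gt0 R); move: (@pi R) => P P0.
  by field; rewrite !gt_eqF.
apply: near_eq_is_derive; near=> s; rewrite gE//; near: s.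
exact: lt_nbhsr.
Unshelve. all: by end_near. Qed.

(** Completing the square in [y]: as a function of [y] the product is a Gaussian centred at
    [s / (s + t) z]. *)
Lemma gk_conv_id s t y z : 0 < s -> 0 < t ->
  gk s y * gk t (z - y) = gk (s + t) z * gk (s * t / (s + t)) (y - (s / (s + t)) *: z).
Proof.
move=> s0 t0; have st0 : 0 < s + t by rewrite addr_gt0.
have p4 : 0 < 4 * pi :> R by rewrite mulr_gt0// pi_gt0.
have r0 : 0 < s * t / (s + t) by rewrite divr_gt0// mulr_gt0.
rewrite /gk mulrACA [RHS]mulrACA -!exprMn -!invfM -!sqrtrM ?(mulr_ge0 (ltW p4)) ?(ltW s0) ?(ltW t0) ?(ltW st0)//.
rewrite -!expRD; congr (_ ^+ n * expR _).
  by congr (Num.sqrt _)^-1; field; rewrite gt_eqF.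
rewrite -!opprD; congr (- _).
rewrite /sqnorm !mulr_suml -!big_split/=; apply: eq_bigr => i _; rewrite !mxE.
by field; rewrite !gt_eqF.
Qed.

Lemma gk_conv s t z : 0 < s -> 0 < t ->
  Rintegral mu setT (fun y => gk s y * gk t (z - y)) = gk (s + t) z.
Proof.
move=> s0 t0; have st0 : 0 < s + t by rewrite addr_gt0.
have r0 : 0 < s * t / (s + t) by rewrite divr_gt0// mulr_gt0.
under eq_Rintegral do rewrite gk_conv_id//.
have [I1 E1] := @gk_integral R n _ r0.
rewrite RintegralZl//; last exact: integ_row_translate.
rewrite (Rintegral_row_translate (f := gk (s * t / (s + t))) (- ((s / (s + t)) *: z)))//.
  by rewrite E1 mulr1.
exact: integ_measurable I1.
Qed.

(** Supplies the product majorant for Fubini: [|y|^2 + |z|^2 <= 3 (|y|^2 + |z - y|^2)] trades the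
    coupled exponents for separate ones at time [3 max (s, t)]. *)
Lemma gk_conv_dom s t : 0 < s -> 0 < t -> exists C a, [/\ 0 <= C, 0 < a &
  forall y z, gk s y * gk t (z - y) <= (C * gk a y) * gk a z].
Proof.
move=> s0 t0; pose m := Num.max s t.
have m0 : 0 < m by rewrite lt_max s0.
pose K (u : R) := Num.sqrt (3 * m / u).
exists (K s ^+ n * K t ^+ n), (3 * m); split.
- by rewrite mulr_ge0// exprn_ge0// sqrtr_ge0.
- by rewrite mulr_gt0.
move=> y z; have m30 : 0 < 3 * m by rewrite mulr_gt0.
have p4 : 0 < 4 * pi :> R by rewrite mulr_gt0// pi_gt0.
have KE u : 0 < u -> K u ^+ n * (Num.sqrt (4 * pi * (3 * m)))^-1 ^+ n = (Num.sqrt (4 * pi * u))^-1 ^+ n.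
  move=> u0; rewrite -exprMn /K; congr (_ ^+ n).
  have -> : 4 * pi * (3 * m) = (3 * m / u) * (4 * pi * u) by field; rewrite gt_eqF.
  rewrite (@sqrtrM _ (3 * m / u) (4 * pi * u)) ?divr_ge0 ?(ltW m30) ?(ltW u0)// invfM mulrA divff ?mul1r//.
  by rewrite gt_eqF// sqrtr_gt0 divr_gt0.
rewrite /gk; set P := (Num.sqrt (4 * pi * (3 * m)))^-1 ^+ n; set E1 := expR _; set E2 := expR _.
rewrite (_ : K s ^+ n * K t ^+ n * (P * expR (- (sqnorm y / (4 * (3 * m))))) * (P * expR (- (sqnorm z / (4 * (3 * m))))) =
  (K s ^+ n * P) * (K t ^+ n * P) * (expR (- (sqnorm y / (4 * (3 * m)))) * expR (- (sqnorm z / (4 * (3 * m)))))); last by ring.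
rewrite !KE// mulrACA ler_wpM2l ?mulr_ge0 ?exprn_ge0 ?invr_ge0//.
rewrite -!expRD ler_expR -!opprD lerN2.
apply: (@le_trans _ _ (sqnorm y / (4 * m) + sqnorm (z - y) / (4 * m))); last first.
  by apply: lerD; rewrite ler_wpM2l ?sqnorm_ge0// lef_pV2 ?posrE ?mulr_gt0// ler_wpM2l// le_max lexx ?orbT.
rewrite -!mulrDl ler_pdivrMr ?mulr_gt0//.
have -> : (sqnorm y + sqnorm (z - y)) / (4 * m) * (4 * (3 * m)) = 3 * (sqnorm y + sqnorm (z - y)).
  by field; rewrite gt_eqF.
rewrite /sqnorm -!big_split/= mulr_sumr; apply: ler_sum => i _; rewrite !mxE.
move: (y _ _) (z _ _) => a b; have := sqr_ge0 (2 * a - b); have := sqr_ge0 (a - b); nra.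
Qed.

End gaussian_calculus.

(* The heat semigroup in linear coordinates *)
Local Opaque gk dgk ddgk.
Section heat.
Variables (R : realType) (n : nat) (B : 'M[R]_n).
Implicit Types (X Y v : 'rV[R]_n) (F G : 'rV[R]_n -> R) (s t r M : R) (i j : 'I_n).
Local Notation mu := (lebesgue_row R n).
Local Notation e_ i := (delta_mx ord0 i : 'rV[R]_n).
Local Notation ll i := (row i B).

Definition phiB (y : 'rV[R]_n) := y *m B.

Lemma measurable_phiB : measurable_fun setT phiB.
Proof. exact: measurable_fun_row_mulmx. Qed.

Definition heat t F := avg mu (gk t) phiB F.
Definition dheat i t F := avg mu (dgk i t) phiB F.
Definition ddheat i t F := avg mu (ddgk i t) phiB F.

Lemma gk_integrable t : 0 < t -> mu.-integrable setT (EFin \o @gk R n t).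
Proof. by move=> t0; have [] := @gk_integral R n t t0. Qed.

Lemma gkZ_integrable t c : 0 < t -> mu.-integrable setT (EFin \o (fun y => c * @gk R n t y)).
Proof. by move=> t0; exact: (integrableZl measurableT c (gk_integrable t0)). Qed.

Lemma gkZ_integral t c : 0 < t -> Rintegral mu setT (fun y => c * @gk R n t y) = c.
Proof.
by move=> t0; have [I1 E1] := @gk_integral R n t t0; rewrite RintegralZl// E1 mulr1.
Qed.

Definition Cg : R := Num.sqrt 2 ^+ n * expR 2.

Lemma Cg_ge0 : 0 <= Cg.
Proof. by rewrite mulr_ge0 ?expR_ge0// exprn_ge0// sqrtr_ge0. Qed.

Lemma dgk_integrable i t : 0 < t -> mu.-integrable setT (EFin \o @dgk R n i t).
Proof.
move=> t0; have t20 : 0 < 2 * t by rewrite mulr_gt0.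
apply: (integ_le _ (gkZ_integrable ((Num.sqrt t)^-1 * Cg) t20)) => [|y].
  exact: continuous_measurable_row (@dgk_continuous R n i t).
by rewrite -mulrA; exact: dgk_le.
Qed.

Lemma ddgk_integrable i t : 0 < t -> mu.-integrable setT (EFin \o @ddgk R n i t).
Proof.
move=> t0; have t20 : 0 < 2 * t by rewrite mulr_gt0.
apply: (integ_le _ (gkZ_integrable (t^-1 * Cg) t20)) => [|y].
  exact: continuous_measurable_row (@ddgk_continuous R n i t).
by rewrite -mulrA; exact: ddgk_le.
Qed.

Lemma heat_continuous t F M : 0 < t -> continuous F -> (forall Y, `|F Y| <= M) ->
  continuous (heat t F).
Proof. move=> t0 cF FM; exact: (avg_continuous (gk_integrable t0) measurable_phiB cF FM). Qed.

Lemma dheat_continuous i t F M : 0 < t -> continuous F -> (forall Y, `|F Y| <= M) ->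
  continuous (dheat i t F).
Proof. move=> t0 cF FM; exact: (avg_continuous (dgk_integrable i t0) measurable_phiB cF FM). Qed.

Lemma heat_bound t F M X : 0 < t -> continuous F -> (forall Y, `|F Y| <= M) ->
  `|heat t F X| <= M.
Proof.
move=> t0 cF FM; have := avg_bound (gk_integrable t0) measurable_phiB X cF FM.
under eq_Rintegral do rewrite ger0_norm ?gk_ge0//.
by have [_ ->] := @gk_integral R n t t0; rewrite mulr1.
Qed.

Lemma dheat_bound i t F M X : 0 < t -> continuous F -> (forall Y, `|F Y| <= M) ->
  `|dheat i t F X| <= Cg / Num.sqrt t * M.
Proof.
move=> t0 cF FM; have M0 : 0 <= M by exact: le_trans (FM X).
have t20 : 0 < 2 * t by rewrite mulr_gt0.
rewrite -(gkZ_integral (Cg / Num.sqrt t * M) t20).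
apply: (avg_le (dgk_integrable i t0) measurable_phiB cF); first exact: gkZ_integrable.
move=> y; rewrite mulrAC.
by apply: ler_pM => //; rewrite -mulrA mulrCA; exact: dgk_le.
Qed.

Lemma heat_cst t c X : 0 < t -> heat t (fun=> c) X = c.
Proof.
by move=> t0; rewrite /heat avg_cst ?gk_integrable//; have [_ ->] := @gk_integral R n t t0; rewrite mulr1.
Qed.

Lemma heatD t F G M1 M2 X : 0 < t -> continuous F -> (forall Y, `|F Y| <= M1) ->
  continuous G -> (forall Y, `|G Y| <= M2) ->
  heat t (fun Y => F Y + G Y) X = heat t F X + heat t G X.
Proof. move=> t0 cF FM cG GM; exact: (avgD (gk_integrable t0) measurable_phiB X cF FM cG GM). Qed.

Lemma dheatD i t F G M1 M2 X : 0 < t -> continuous F -> (forall Y, `|F Y| <= M1) ->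
  continuous G -> (forall Y, `|G Y| <= M2) ->
  dheat i t (fun Y => F Y + G Y) X = dheat i t F X + dheat i t G X.
Proof. move=> t0 cF FM cG GM; exact: (avgD (dgk_integrable i t0) measurable_phiB X cF FM cG GM). Qed.

Lemma dheatZ i t F M c X : 0 < t -> continuous F -> (forall Y, `|F Y| <= M) ->
  dheat i t (fun Y => c * F Y) X = c * dheat i t F X.
Proof. move=> t0 cF FM; exact: (avgZ (dgk_integrable i t0) measurable_phiB c X cF FM). Qed.

(** Moving [X] along row [i] of [B] amounts to translating the kernel along the [i]-th unit vector,
    so the derivative falls on the kernel and [F] need only be bounded and continuous. *)
Lemma kernel_dird i (k k' : 'rV[R]_n -> R) (D : 'rV[R]_n -> R) (r0 : R) F M :
  0 < r0 -> mu.-integrable setT (EFin \o k) -> continuous F -> (forall Y, `|F Y| <= M) ->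
  (forall y r, `|r| < r0 -> is_derive r 1 (fun s => k (y - s *: e_ i)) (k' (y - r *: e_ i))) ->
  mu.-integrable setT (EFin \o D) ->
  (forall y r, `|r| < r0 -> `|k' (y - r *: e_ i)| <= D y) ->
  forall X, dird (avg mu k phiB F) X (ll i) (avg mu k' phiB F X).
Proof.
move=> r00 Ik cF FM dk ID kD X; have M0 : 0 <= M by exact: le_trans (FM X).
have mF Z : measurable_fun setT (fun y => F (Z + phiB y)).
  apply: (measurableT_comp (continuous_measurable_row cF)).
  by apply: measurable_fun_row_add => //; exact: measurable_phiB.
have shiftE (r : R) : avg mu k phiB F (X + r *: ll i) =
    Rintegral mu setT (fun y => k (y - r *: e_ i) * F (X + phiB y)).
  rewrite -(Rintegral_row_translate (r *: e_ i)); last first.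
    apply: measurable_funM => //.
    exact: integ_measurable (integ_row_translate (- (r *: e_ i)) Ik).
  apply: eq_Rintegral => y _; rewrite addrK; congr (_ * F _).
  by rewrite /phiB mulmxDl -scalemxAl -rowE -addrA (addrC (r *: _)).
rewrite /dird; under eq_fun do rewrite shiftE.
have -> : avg mu k' phiB F X = Rintegral mu setT (fun y => k' (y - (0 : R) *: e_ i) * F (X + phiB y)).
  by apply: eq_Rintegral => y _; rewrite scale0r subr0.
apply: (@Rdiff_under_integral _ _ _ mu (fun r y => k (y - r *: e_ i) * F (X + phiB y))
  (fun r y => k' (y - r *: e_ i) * F (X + phiB y)) (fun y => M * D y) 0 (- r0) r0).
- by rewrite oppr_lt0 r00.
- move=> r _; apply: (integ_le _ (integrableZl measurableT M (integ_norm (integ_row_translate (- (r *: e_ i)) Ik)))).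
    apply: measurable_funM => //.
    exact: integ_measurable (integ_row_translate (- (r *: e_ i)) Ik).
  by move=> y /=; rewrite normrM mulrC ler_wpM2r.
- move=> r y hr; have := dk y r; rewrite ltr_norml hr => /(_ isT) h.
  have := isdM h (isd_cst (F (X + phiB y)) r); rewrite mulr0 add0r mulrC; exact.
- move=> r y hr; rewrite normrM mulrC; apply: ler_pM => //.
  by apply: kD; rewrite ltr_norml.
- exact: (integrableZl measurableT M ID).
Qed.

Lemma heat_dird i t F M : 0 < t -> continuous F -> (forall Y, `|F Y| <= M) ->
  forall X, dird (heat t F) X (ll i) (dheat i t F X).
Proof.
move=> t0 cF FM; have t20 : 0 < 2 * t by rewrite mulr_gt0.
have t40 : 0 < 2 * (2 * t) by rewrite mulr_gt0.
have st0 : 0 < Num.sqrt t by rewrite sqrtr_gt0.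
apply: (kernel_dird st0 (gk_integrable t0) cF FM _ (gkZ_integrable ((Num.sqrt t)^-1 * Cg * (Num.sqrt 2 ^+ n * expR 1)) t40)).
  by move=> y r _; exact: gk_shift_derive.
move=> y r rt; apply: le_trans (dgk_le _ _ t0) _; rewrite -/Cg.
have h : gk (2 * t) (y - r *: e_ i) <= Num.sqrt 2 ^+ n * expR 1 * gk (2 * (2 * t)) y.
  by apply: gk_shift => //; apply: le_trans (ltW rt) _; rewrite ler_wsqrtr//; lra.
rewrite -[leRHS]mulrA -[leRHS]mulrA ler_wpM2l ?invr_ge0 ?(ltW st0)//.
by rewrite ler_wpM2l ?Cg_ge0.
Qed.

Lemma dheat_dird i t F M : 0 < t -> continuous F -> (forall Y, `|F Y| <= M) ->
  forall X, dird (dheat i t F) X (ll i) (ddheat i t F X).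
Proof.
move=> t0 cF FM; have t20 : 0 < 2 * t by rewrite mulr_gt0.
have t40 : 0 < 2 * (2 * t) by rewrite mulr_gt0.
have st0 : 0 < Num.sqrt t by rewrite sqrtr_gt0.
apply: (kernel_dird st0 (dgk_integrable i t0) cF FM _ (gkZ_integrable (t^-1 * Cg * (Num.sqrt 2 ^+ n * expR 1)) t40)).
  by move=> y r _; exact: dgk_shift_derive.
move=> y r rt; apply: le_trans (ddgk_le _ _ t0) _; rewrite -/Cg.
have h : gk (2 * t) (y - r *: e_ i) <= Num.sqrt 2 ^+ n * expR 1 * gk (2 * (2 * t)) y.
  by apply: gk_shift => //; apply: le_trans (ltW rt) _; rewrite ler_wsqrtr//; lra.
rewrite -[leRHS]mulrA -[leRHS]mulrA ler_wpM2l ?invr_ge0 ?(ltW t0)//.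
by rewrite ler_wpM2l ?Cg_ge0.
Qed.

(** The substitution of [z - y] for the inner variable makes the iterated average an integral
    against the convolved kernels, which [gk_conv] evaluates. *)
Lemma heat_heat s t F M X : 0 < s -> 0 < t -> continuous F -> (forall Y, `|F Y| <= M) ->
  heat s (heat t F) X = heat (s + t) F X.
Proof.
move=> s0 t0 cF FM; have M0 : 0 <= M by exact: le_trans (FM X).
have mF Z : measurable_fun setT (fun y => F (Z + phiB y)).
  apply: (measurableT_comp (continuous_measurable_row cF)).
  by apply: measurable_fun_row_add => //; exact: measurable_phiB.
have mg u : measurable_fun setT (@gk R n u) by exact: continuous_measurable_row (@gk_continuous R n u).
have [C [a [C0 a0 hC]]] := @gk_conv_dom R n s t s0 t0.
pose f (p : 'rV[R]_n * 'rV[R]_n) := gk s p.1 * gk t (p.2 - p.1) * F (X + phiB p.2).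
have mf : measurable_fun setT f.
  apply: measurable_funM; last exact: (measurableT_comp (mF X) measurable_snd).
  apply: measurable_funM; first exact: (measurableT_comp (mg s) measurable_fst).
  apply: (measurableT_comp (mg t)); apply: measurable_fun_row_add; first exact: measurable_snd.
  apply: measurable_fun_rowP => i; under eq_fun do rewrite mxE.
  apply: measurableT_comp => //; exact: (measurableT_comp (measurable_row_coord i) measurable_fst).
have hf y z : `|f (y, z)| <= (M * C * gk a y) * gk a z.
  rewrite /f /= normrM (ger0_norm (mulr_ge0 (gk_ge0 _ _) (gk_ge0 _ _))).
  have -> : M * C * gk a y * gk a z = C * gk a y * gk a z * M by ring.
  by apply: ler_pM; rewrite ?mulr_ge0 ?gk_ge0.
have [_ _ E] := @Rfubini _ _ _ _ R mu mu f _ _ mf (gkZ_integrable (M * C) a0) (gk_integrable a0) hf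
  (fun y => mulr_ge0 (mulr_ge0 M0 C0) (gk_ge0 _ _)) (@gk_ge0 R n a).
transitivity (Rintegral mu setT (fun y => Rintegral mu setT (fun z => f (y, z)))).
  apply: eq_Rintegral => y _.
  have IF := avg_integrable (gk_integrable t0) measurable_phiB (X + phiB y) cF FM.
  rewrite -(RintegralZl (gk s y) measurableT IF).
  rewrite -(Rintegral_row_translate (f := fun z => f (y, z)) y); last first.
    exact: (measurableT_comp mf (pair1_measurable y)).
  apply: eq_Rintegral => z _; rewrite /f/= addrK mulrA; congr (_ * F _).
  by rewrite /phiB mulmxDl -addrA (addrC (z *m B)).
rewrite E; apply: eq_Rintegral => z _.
have Ic : mu.-integrable setT (EFin \o (fun y => gk s y * gk t (z - y))).
  apply: (integ_le _ (gkZ_integrable (C * gk a z) a0)).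
    apply: (measurable_funM (mg s)); apply: (measurableT_comp (mg t)).
    apply: measurable_fun_row_add; first exact: measurable_cst.
    apply: measurable_fun_rowP => i.
    by under eq_fun do rewrite mxE; apply: measurableT_comp; [|exact: measurable_row_coord].
  move=> y; rewrite (ger0_norm (mulr_ge0 (gk_ge0 _ _) (gk_ge0 _ _))) (mulrAC C); exact: hC.
rewrite -(gk_conv z s0 t0) mulrC -(RintegralZl (F (X + phiB z)) measurableT Ic).
by apply: eq_Rintegral => y _; rewrite /f/= mulrC.
Qed.

Lemma heat_dheat_comm i s t F M X : 0 < s -> 0 < t -> continuous F -> (forall Y, `|F Y| <= M) ->
  heat s (dheat i t F) X = dheat i t (heat s F) X.
Proof.
move=> s0 t0 cF FM.
by have [_] := avg_comp (gk_integrable s0) measurable_phiB (dgk_integrable i t0) measurable_phiB X cF FM.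
Qed.

Lemma heat_derive_comm i t F F' M M' X : 0 < t -> continuous F -> (forall Y, `|F Y| <= M) ->
  continuous F' -> (forall Y, `|F' Y| <= M') -> (forall Y, dird F Y (ll i) (F' Y)) ->
  dheat i t F X = heat t F' X.
Proof.
move=> t0 cF FM cF' FM' dF; apply: (dird_unique (heat_dird i t0 cF FM X)).
exact: (avg_dird (gk_integrable t0) measurable_phiB cF FM cF' FM' dF).
Qed.

(** Both sides are the derivative along row [i] of [heat (s + t) F], so uniqueness of the derivative
    replaces a convolution of kernels. *)
Lemma heat_dheat i s t F M X : 0 < s -> 0 < t -> continuous F -> (forall Y, `|F Y| <= M) ->
  heat s (dheat i t F) X = dheat i (s + t) F X.
Proof.
move=> s0 t0 cF FM; have st0 : 0 < s + t by rewrite addr_gt0.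
have := heat_dird i st0 cF FM X; apply: dird_unique.
apply: (dird_ext (u1 := heat s (heat t F))) => [Y|]; first exact: heat_heat.
exact: (avg_dird (gk_integrable s0) measurable_phiB (heat_continuous t0 cF FM)
  (fun Y => heat_bound Y t0 cF FM) (@dheat_continuous i t F M t0 cF FM)
  (fun Y => dheat_bound i Y t0 cF FM) (heat_dird i t0 cF FM)).
Qed.

Lemma dheat_heat i s t F M X : 0 < s -> 0 < t -> continuous F -> (forall Y, `|F Y| <= M) ->
  dheat i s (heat t F) X = dheat i (s + t) F X.
Proof.
move=> s0 t0 cF FM; rewrite -(heat_dheat_comm i X t0 s0 cF FM) addrC.
exact: heat_dheat.
Qed.

(** Only the total time matters: each side is rewritten with the same outer time [r], smaller than
    [s] and [s'], the excess being moved inside by the semigroup law. *)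
Lemma dheat_dheatE i j s t s' t' F M X : 0 < s -> 0 < t -> 0 < s' -> 0 < t' ->
  s + t = s' + t' -> continuous F -> (forall Y, `|F Y| <= M) ->
  dheat i s (dheat j t F) X = dheat i s' (dheat j t' F) X.
Proof.
move=> s0 t0 s0' t0' E cF FM; pose r := Num.min s s' / 2.
have r0 : 0 < r by rewrite divr_gt0// lt_min s0.
have H a b : 0 < a -> 0 < b -> r < a ->
    dheat i a (dheat j b F) X = dheat i r (dheat j (a + b - r) F) X.
  move=> a0 b0 ra; have ar0 : 0 < a - r by rewrite subr_gt0.
  have := dheat_heat i X r0 ar0 (@dheat_continuous j b F M b0 cF FM) (fun Y => dheat_bound j Y b0 cF FM).
  rewrite subrKC => <-; congr (dheat i r _ X).
  by apply/funext => Y; rewrite (heat_dheat j Y ar0 b0 cF FM) addrAC.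
have rm : r < Num.min s s' by rewrite /r ltr_pdivrMr// ltr_pMr ?ltr1n// lt_min s0.
have rs : r < s by rewrite (lt_le_trans rm)// ge_min lexx.
have rs' : r < s' by rewrite (lt_le_trans rm)// ge_min lexx orbT.
have := H s' t' s0' t0' rs'; rewrite -E => ->; exact: (H s t s0 t0 rs).
Qed.

Variables (KB : R).
Hypotheses (KB0 : 0 <= KB) (hKB : forall y : 'rV[R]_n, `|y *m B| <= KB * `|y|).

(** The exponent is that of [dgk_weight] with [c = KB]; it also dominates that of [gk_weight]. *)
Definition Cw : R := Num.sqrt 2 ^+ n * expR (2 * (KB + 1) ^+ 2).

Lemma Cw_ge1 : 1 <= Cw.
Proof.
rewrite -[leLHS]mulr1 ler_pM//.
  by rewrite exprn_ege1// -[leLHS]sqrtr1 ler_wsqrtr// ler1n.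
by rewrite -expR0 ler_expR mulr_ge0// sqr_ge0.
Qed.

Lemma weight_le (y : 'rV[R]_n) t r : 0 < t -> Num.sqrt t <= r ->
  expR (`|phiB y| / r) <= expR (KB * `|y| / Num.sqrt t).
Proof.
move=> t0 tr; have st0 : 0 < Num.sqrt t by rewrite sqrtr_gt0.
have r0 := lt_le_trans st0 tr.
rewrite ler_expR; apply: ler_pM; rewrite ?invr_ge0 ?normr_ge0 ?(ltW r0)//.
  exact: hKB.
by rewrite lef_pV2.
Qed.

(** Control of [F] that degrades exponentially away from [X] still bounds the value at [X], as long
    as the growth length is at least [sqrt t]. This is how estimates are localized at one point. *)
Lemma heat_weight t r F M X : 0 < t -> Num.sqrt t <= r -> continuous F -> 0 <= M ->
  (forall Y, `|F Y| <= M * expR (`|Y - X| / r)) -> `|heat t F X| <= Cw * M.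
Proof.
move=> t0 tr cF M0 FM; have t20 : 0 < 2 * t by rewrite mulr_gt0.
rewrite mulrC -(gkZ_integral (M * Cw) t20).
apply: (avg_le (gk_integrable t0) measurable_phiB cF); first exact: gkZ_integrable.
move=> y; rewrite ger0_norm ?gk_ge0//.
apply: (@le_trans _ _ (gk t y * (M * expR (KB * `|y| / Num.sqrt t)))).
  rewrite ler_wpM2l ?gk_ge0//; apply: le_trans (FM _) _.
  by rewrite ler_wpM2l// addrC addKr; exact: weight_le.
rewrite mulrCA -[leRHS]mulrA ler_wpM2l//; apply: le_trans (gk_weight y t0 KB0) _.
rewrite ler_wpM2r ?gk_ge0// ler_wpM2l ?exprn_ge0 ?sqrtr_ge0// ler_expR.
by rewrite ler_wpM2l// ler_sqr ?nnegrE ?addr_ge0// lerDl.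
Qed.

Lemma dheat_weight i t r F M X : 0 < t -> Num.sqrt t <= r -> continuous F -> 0 <= M ->
  (forall Y, `|F Y| <= M * expR (`|Y - X| / r)) -> `|dheat i t F X| <= Cw / Num.sqrt t * M.
Proof.
move=> t0 tr cF M0 FM; have t20 : 0 < 2 * t by rewrite mulr_gt0.
rewrite -(gkZ_integral (Cw / Num.sqrt t * M) t20).
apply: (avg_le (dgk_integrable i t0) measurable_phiB cF); first exact: gkZ_integrable.
move=> y.
apply: (@le_trans _ _ (`|dgk i t y| * (M * expR (KB * `|y| / Num.sqrt t)))).
  rewrite ler_wpM2l//; apply: le_trans (FM _) _.
  by rewrite ler_wpM2l// addrC addKr; exact: weight_le.
rewrite mulrCA (mulrC _ M) -[leRHS]mulrA ler_wpM2l//.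
rewrite (mulrC Cw) -[leRHS]mulrA /Cw; exact: (dgk_weight i y t0 KB0).
Qed.

Lemma heat_cvg (t_ : nat -> R) F M X : (forall k, 0 < t_ k) -> t_ k @[k --> \oo] --> 0 ->
  continuous F -> (forall Y, `|F Y| <= M) -> heat (t_ k) F X @[k --> \oo] --> F X.
Proof.
move=> t0 tc cF FM; have M0 : 0 <= M by exact: le_trans (FM X).
have Cw0 : 0 < Cw by exact: lt_le_trans Cw_ge1.
apply/seq_cvgP => e e0; pose e1 := e / (4 * Cw).
have e10 : 0 < e1 by rewrite divr_gt0// mulr_gt0.
have /continuous_epsP/(_ _ e10)[d d0 hd] := cF X.
(* With this [r], beyond distance [d] the exponential exceeds [d / r], which is large enough to
   outweigh the bound [2 M] on the oscillation of [F]. *)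
pose r := e1 * d / (2 * M + 1).
have M1 : 0 < 2 * M + 1 by rewrite ltr_wpDl// mulr_ge0.
have r0 : 0 < r by rewrite divr_gt0// mulr_gt0.
have [N hN] := (seq_cvgP _ _).1 tc (r ^+ 2) (exprn_gt0 2 r0).
exists N => k /hN; rewrite subr0 gtr0_norm// => tr.
have str : Num.sqrt (t_ k) <= r by rewrite -(gtr0_norm r0) -sqrtr_sqr ler_wsqrtr// ltW.
have cG : continuous (fun Y => F Y - F X) by apply: cts_sub => //; exact: cts_cst.
have GM Y : `|F Y - F X| <= M + M by apply: le_trans (ler_normB _ _) _; exact: lerD.
have -> : heat (t_ k) F X - F X = heat (t_ k) (fun Y => F Y - F X) X.
  rewrite (heatD X (t0 k) cF FM (@cts_cst _ _ (- F X)) (M2 := M)); last by move=> _; rewrite normrN.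
  by rewrite heat_cst.
apply: (@le_lt_trans _ _ (Cw * (2 * e1))); last first.
  by rewrite /e1 mulrA (_ : _ * _ = e / 2); [rewrite ltr_pdivrMr// ltr_pMr ?ltr1n|field; rewrite gt_eqF].
apply: (heat_weight (t0 k) str cG); first by rewrite mulr_ge0// ltW.
move=> Y; have [Yd|Yd] := ltP `|Y - X| d.
  apply: le_trans (ltW (hd Y Yd)) _; rewrite -[leLHS]mulr1 ler_pM ?(ltW e10)//.
    by rewrite ler_pMl// ler1n.
  by rewrite -expR0 ler_expR divr_ge0// ltW.
apply: le_trans (GM Y) _.
have h1 : `|Y - X| / r <= expR (`|Y - X| / r).
  by apply: le_trans (expR_ge1Dx _); rewrite lerDr.
apply: (@le_trans _ _ (2 * e1 * (d / r))); last first.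
  apply: ler_wpM2l; first by rewrite mulr_ge0// ltW.
  apply: (le_trans _ h1).
  by rewrite ler_wpM2r// invr_ge0 ltW.
have -> : 2 * e1 * (d / r) = 2 * (2 * M + 1) by rewrite /r; field; rewrite !gt_eqF.
lra.
Qed.

End heat.

(** * Compactly supported functions and vanishing integrals of derivatives *)

Section compact_support.
Variables (R : realType) (n : nat).
Implicit Types (X Y v : 'rV[R]_n) (f : 'rV[R]_n -> R) (r rho M : R).
Local Notation mu := (lebesgue_row R n).

Definition cbox rho : set 'rV[R]_n := [set X | forall i, X ord0 i \in `[- rho, rho]].

Lemma cboxP rho X : 0 <= rho -> cbox rho X <-> `|X| <= rho.
Proof.
move=> r0; split=> h; first by apply: row_norm_le => // i; rewrite ler_norml; have := h i; rewrite in_itv.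
by move=> i; rewrite in_itv/= -ler_norml (le_trans _ h)// ler_row_norm.
Qed.

Lemma measurable_cbox rho : measurable (cbox rho).
Proof.
rewrite [X in measurable X](_ : _ = \bigcap_(i in [set: 'I_n])
    (@row_coord R n i @^-1` `[- rho, rho])).
  apply: fin_bigcap_measurable => // i _; rewrite -[X in measurable X]setTI.
  exact: measurable_row_coord.
by apply/seteqP; split => y /= h i; [move=> _; exact: h|exact: h].
Qed.

Lemma cbox_fin rho : (mu (cbox rho) < +oo)%E.
Proof.
rewrite (@lebesgue_row_box R n (fun=> `[- rho, rho]%classic))//.
have c1 : (lebesgue_measure (`[(- rho)%R, rho]%classic : set R) < +oo)%E.
  by rewrite lebesgue_measure_itv/=; case: ifP => _; rewrite ?ltry// -EFinB ltry.
have cf : lebesgue_measure (`[- rho, rho]%classic : set R) \is a fin_num.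
  by rewrite ge0_fin_numE.
have c0 : (0 <= lebesgue_measure (`[(- rho)%R, rho]%classic : set R))%E by exact: measure_ge0.
move: c1 cf c0.
move: (lebesgue_measure _) => c _ cf c0.
elim/big_rec: _ => [|i x _ hx]; [exact: ltry|exact: (lte_mul_pinfty c0 cf hx)].
Qed.

Definition bump rho : 'rV[R]_n -> R := \1_(cbox rho).

Lemma bumpE rho X : bump rho X = (X \in cbox rho)%:R.
Proof. by rewrite /bump indicE. Qed.

Lemma bump_integrable rho : mu.-integrable setT (EFin \o bump rho).
Proof.
apply/integrableP; split.
  by apply/measurable_EFinP; apply: measurable_indic; exact: measurable_cbox.
rewrite (_ : (fun _ => _) = (fun x => (\1_(cbox rho) x)%:E)); last first.
  by apply/funext => x /=; rewrite ger0_norm// /bump indicE ler0n.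
rewrite integral_indic//; last exact: measurable_cbox.
by rewrite setIT; exact: cbox_fin.
Qed.

Lemma bump_ge0 rho X : 0 <= bump rho X.
Proof. by rewrite bumpE ler0n. Qed.

Definition boxvol rho : R := Rintegral mu setT (bump rho).

Lemma boxvol_ge0 rho : 0 <= boxvol rho.
Proof. by apply: Rintegral_ge0 => X _; exact: bump_ge0. Qed.

Lemma supp_bound f rho M : 0 <= rho -> 0 <= M ->
  (forall X, rho < `|X| -> f X = 0) -> (forall X, `|X| <= rho -> `|f X| <= M) ->
  forall X, `|f X| <= M * bump rho X.
Proof.
move=> r0 M0 f0 fM X; rewrite bumpE; case: (leP `|X| rho) => h.
  by rewrite mem_set ?mulr1 ?fM//; exact/cboxP.
rewrite f0// normr0 mulr_ge0// ler0n.
Qed.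

Lemma supp_integrable f rho M : 0 <= rho -> 0 <= M -> measurable_fun setT f ->
  (forall X, rho < `|X| -> f X = 0) -> (forall X, `|X| <= rho -> `|f X| <= M) ->
  mu.-integrable setT (EFin \o f).
Proof.
move=> r0 M0 mf f0 fM.
apply: (integ_le mf (integrableZl measurableT M (bump_integrable rho))).
exact: supp_bound.
Qed.

Lemma supp_Rintegral_le f rho M : 0 <= rho -> 0 <= M -> measurable_fun setT f ->
  (forall X, rho < `|X| -> f X = 0) -> (forall X, `|X| <= rho -> `|f X| <= M) ->
  `|Rintegral mu setT f| <= M * boxvol rho.
Proof.
move=> r0 M0 mf f0 fM; rewrite -RintegralZl//; last exact: bump_integrable.
apply: Rintegral_norm_le => //; last exact: supp_bound.
exact: (integrableZl measurableT M (bump_integrable rho)).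
Qed.

Lemma cts_bounded_ball f rho : continuous f ->
  exists2 M, 0 <= M & forall X, `|X| <= rho -> `|f X| <= M.
Proof.
move=> cf; have [r0|r0] := ltP rho 0.
  by exists 0 => // X /le_lt_trans/(_ r0); rewrite ltNge normr_ge0.
have cK : compact [set X : 'rV[R]_n | `|X| <= rho].
  apply: bounded_closed_compact.
    exists rho; split; first exact: num_real.
    by move=> M rM X /= /le_trans; apply; exact: ltW.
  have cn : continuous (fun X : 'rV[R]_n => `|X|) by move=> X; exact: norm_continuous.
  exact: (closed_comp (f := fun X : 'rV[R]_n => `|X|) (fun X _ => cn X) (@closed_le R rho)).
have ne : [set X : 'rV[R]_n | `|X| <= rho] !=set0 by exists 0; rewrite /= normr0.
have cnf : {within [set X : 'rV[R]_n | `|X| <= rho], continuous (fun X => `|f X|)}.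
  by apply: continuous_subspaceT; exact: cts_norm.
have [c cA hc] := @compact_EVT_max _ R _ _ ne cK cnf.
by exists `|f c| => // X hX; apply: hc; rewrite inE.
Qed.

Lemma cts_supp_integrable f rho : continuous f -> 0 <= rho ->
  (forall X, rho < `|X| -> f X = 0) -> mu.-integrable setT (EFin \o f).
Proof.
move=> cf r0 f0; have [M M0 hM] := cts_bounded_ball rho cf.
exact: (supp_integrable r0 M0 (continuous_measurable_row cf) f0 hM).
Qed.

Lemma cts_supp_bounded f rho : continuous f ->
  (forall X, rho < `|X| -> f X = 0) -> exists2 M, 0 <= M & forall X, `|f X| <= M.
Proof.
move=> cf f0; have [M M0 hM] := cts_bounded_ball rho cf; exists M => // X.
by have [/hM//|/f0 ->] := leP `|X| rho; rewrite normr0.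
Qed.

(** The integral of [phi (X + r v)] does not depend on [r]; differentiating under the integral at
    [r = 0] gives the integral of [phi']. *)
Lemma Rintegral_dird0 (phi phi' : 'rV[R]_n -> R) v rho : 0 <= rho ->
  continuous phi -> continuous phi' -> (forall X, dird phi X v (phi' X)) ->
  (forall X, rho < `|X| -> phi X = 0) -> (forall X, rho < `|X| -> phi' X = 0) ->
  Rintegral mu setT phi' = 0.
Proof.
move=> r0 c c' dphi s s'; have [M M0 hM] := cts_supp_bounded c' s'.
have I := cts_supp_integrable c r0 s.
have far X (r : R) : `|r| < 1 -> rho + `|v| < `|X| -> rho < `|X + r *: v|.
  move=> r1 hX; have : `|X| <= `|X + r *: v| + `|r *: v|.
    by rewrite -{1}(addrK (r *: v) X); exact: ler_normB.
  rewrite normrZ => h; have : `|r| * `|v| <= `|v| by rewrite ler_piMl// ltW.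
  lra.
have := @Rdiff_under_integral _ _ _ mu (fun r X => phi (X + r *: v)) (fun r X => phi' (X + r *: v))
  (fun X => M * bump (rho + `|v|) X) 0 (-1) 1.
rewrite ltrN10 ltr01 => /(_ isT) h.
have {}h : is_derive (0 : R) 1 (fun r => Rintegral mu setT (fun X => phi (X + r *: v)))
   (Rintegral mu setT (fun X => phi' (X + (0 : R) *: v))).
  apply: h.
  - by move=> r _; exact: integ_row_translate.
  - by move=> r X _; exact: dird_line.
  - move=> r X hr; apply: (@supp_bound (fun X => phi' (X + r *: v)) (rho + `|v|) M) => //.
      by rewrite addr_ge0.
    by move=> Y hY; apply: s'; apply: far => //; rewrite ltr_norml.
  - exact: (integrableZl measurableT M (bump_integrable _)).
have E : (fun r : R => Rintegral mu setT (fun X => phi (X + r *: v))) = (fun=> Rintegral mu setT phi).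
  apply/funext => r; rewrite Rintegral_row_translate//; exact: continuous_measurable_row.
rewrite E in h; have [_ d1] := h; have [_ d2] := isd_cst (Rintegral mu setT phi) (0 : R).
transitivity (Rintegral mu setT (fun X => phi' (X + (0 : R) *: v))).
  by apply: eq_Rintegral => X _; rewrite scale0r addr0.
by rewrite -d1 d2.
Qed.

End compact_support.

(** * Averages of the heat semigroup over a time interval *)

Section time_average.
Variables (R : realType) (n : nat).
Local Notation mu := (lebesgue_row R n).
Local Notation lam := (@lebesgue_measure R).

(** The product measure gets its own name so that sigma-finiteness can be attached to it. *)
Definition time_space : set (measurableTypeR R * 'rV[R]_n) -> \bar R := (lam \x mu)%E.

HB.instance Definition _ := Measure.copy time_space (lam \x mu)%E.

Let time_space_sigma_finite : sigma_finite setT time_space.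
Proof. exact: (sigma_finite_prod lam mu). Qed.

HB.instance Definition _ :=
  Measure_isSigmaFinite.Build _ _ _ time_space time_space_sigma_finite.

(** Keeps the time of the kernel in [[a, b]], hence positive, also where the indicator in [tker]
    vanishes; the kernel is then jointly measurable on the whole product. *)
Definition clamp (a b s : R) := Num.max a (Num.min b s).

Definition tker (a b : R) (p : measurableTypeR R * 'rV[R]_n) : R :=
  \1_(`[a, b]%classic : set R) p.1 * gk (clamp a b p.1) p.2.

Lemma clamp_in a b s : a <= b -> a <= clamp a b s <= b.
Proof.
move=> ab; rewrite /clamp le_max lexx/= ge_max ab ge_min lexx.
by [].
Qed.

Lemma clamp_id a b s : a <= s <= b -> clamp a b s = s.
Proof. by move=> /andP[h1 h2]; rewrite /clamp (min_idPr h2) (max_idPr h1). Qed.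

Lemma clamp_continuous a b : continuous (clamp a b).
Proof.
apply: cts_max; first exact: cts_cst.
by apply: cts_min; [exact: cts_cst|move=> x; exact: cvg_id].
Qed.

Lemma measurable_tker a b : 0 < a -> a <= b -> measurable_fun setT (tker a b).
Proof.
move=> a0 ab.
have cl0 s : 0 < clamp a b s by apply: lt_le_trans a0 _; have /andP[] := clamp_in s ab.
have mc (f : R -> R) : continuous f ->
    measurable_fun setT (fun p : measurableTypeR R * 'rV[R]_n => f p.1).
  move=> cf; apply: (@measurableT_comp _ _ _ _ _ _ f) => //.
  exact: continuous_measurable_fun.
have mq : measurable_fun setT (fun p : measurableTypeR R * 'rV[R]_n => sqnorm p.2).
  apply: (measurableT_comp (continuous_measurable_row (@sqnorm_continuous R n))).
  exact: measurable_snd.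
apply: measurable_funM.
  by apply: measurableT_comp; [exact: measurable_indic|exact: measurable_fst].
apply: measurable_funM.
  apply: (mc (fun s => (Num.sqrt (4 * pi * clamp a b s))^-1 ^+ n)).
  apply: (@cts_comp _ _ (fun x => x ^+ n)); first exact: exprn_continuous.
  apply: cts_inv; first by move=> x; rewrite gt_eqF// sqrtr_gt0 !mulr_gt0 ?pi_gt0.
  apply: (@cts_comp _ _ Num.sqrt); first exact: sqrt_continuous.
  by apply: cts_mul; [exact: cts_cst|exact: clamp_continuous].
apply: measurableT_comp => //; apply: measurableT_comp => //.
apply: measurable_funM => //.
apply: (mc (fun s => (4 * clamp a b s)^-1)); apply: cts_inv.
  by move=> x; rewrite gt_eqF// mulr_gt0.
by apply: cts_mul; [exact: cts_cst|exact: clamp_continuous].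
Qed.

Lemma tker_ge0 a b p : 0 <= tker a b p.
Proof. by rewrite mulr_ge0 ?gk_ge0// indicE ler0n. Qed.

Lemma tker_integral a b : 0 < a -> a <= b ->
  time_space.-integrable setT (EFin \o tker a b) /\
  Rintegral time_space setT (tker a b) = b - a.
Proof.
move=> a0 ab.
have cl0 s : 0 < clamp a b s by apply: lt_le_trans a0 _; have /andP[] := clamp_in s ab.
have mt := measurable_tker a0 ab.
have E : (\int[time_space]_p (tker a b p)%:E = (b - a)%:E)%E.
  rewrite (_ : (\int[_]_p _)%E = (\int[lam]_s \int[mu]_y (tker a b (s, y))%:E)%E); last first.
    rewrite -(fubini_tonelli1 (EFin \o tker a b)); last 2 first.
    - exact/measurable_EFinP.
    - by move=> p; rewrite lee_fin tker_ge0.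
    by [].
  transitivity (\int[lam]_s (\1_(`[a, b]%classic : set R) s)%:E)%E.
    apply: eq_integral => s _; have [I1 E1] := @gk_integral R n _ (cl0 s).
    rewrite -EFin_Rintegral; last exact: (integrableZl measurableT (\1_(`[a, b]%classic : set R) s) I1).
    by rewrite /tker/= RintegralZl// E1 mulr1.
  transitivity (lam (`[a, b]%classic : set R)); first by rewrite integral_indic// setIT.
  rewrite lebesgue_measure_itv/= lte_fin.
  by move: ab; rewrite le_eqVlt => /orP[/eqP->|->//]; rewrite ltxx subrr.
split; last by rewrite /Rintegral E.
apply/integrableP; split; first exact/measurable_EFinP.
under eq_integral do rewrite /= ger0_norm ?tker_ge0//.
by rewrite E ltry.
Qed.

Variable B : 'M[R]_n.
Implicit Types (F G : 'rV[R]_n -> R) (X : 'rV[R]_n).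
Local Notation phiB := (phiB B).
Local Notation heat := (heat B).
Local Notation dheat := (dheat B).

Definition tphi (p : measurableTypeR R * 'rV[R]_n) := phiB p.2.

Lemma measurable_tphi : measurable_fun setT tphi.
Proof. by apply: measurable_fun_row_mulmx; exact: measurable_snd. Qed.

(** The integral of [heat s F] over [s] in [[a, b]], put in the form of [avg] so that continuity,
    differentiation and commutation carry over; [tavgE] recovers the one-variable integral for the
    fundamental theorem of calculus. *)
Definition tavg a b F := avg time_space (tker a b) tphi F.

Lemma tavg_continuous a b F M : 0 < a -> a <= b -> continuous F -> (forall Y, `|F Y| <= M) ->
  continuous (tavg a b F).
Proof.
move=> a0 ab cF FM.
exact: (avg_continuous (tker_integral a0 ab).1 measurable_tphi cF FM).
Qed.

Lemma tavgE a b F M X : 0 < a -> a <= b -> continuous F -> (forall Y, `|F Y| <= M) ->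
  tavg a b F X = Rintegral lam `[a, b]%classic (fun s => heat s F X) /\
  lam.-integrable `[a, b]%classic (EFin \o (fun s => heat s F X)).
Proof.
move=> a0 ab cF FM.
have cl0 s : 0 < clamp a b s by apply: lt_le_trans a0 _; have /andP[] := clamp_in s ab.
have I := avg_integrable (tker_integral a0 ab).1 measurable_tphi X cF FM.
have Ht s : Rintegral mu setT (fun y => tker a b (s, y) * F (X + phiB y)) =
    \1_(`[a, b]%classic : set R) s * heat (clamp a b s) F X.
  rewrite -RintegralZl//; last exact: (avg_integrable (gk_integrable n (cl0 s)) (measurable_phiB B) X cF FM).
  by apply: eq_Rintegral => y _; rewrite /tker mulrA.
have Is s : mu.-integrable setT (EFin \o (fun y => tker a b (s, y) * F (X + phiB y))).
  have := integrableZl measurableT (\1_(`[a, b]%classic : set R) s)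
    (avg_integrable (gk_integrable n (cl0 s)) (measurable_phiB B) X cF FM).
  by congr (_.-integrable _ _); apply/funext => y /=; rewrite /tker -EFinM mulrA.
have cE : {in `[a, b]%classic, (fun s => \1_(`[a, b]%classic : set R) s * heat (clamp a b s) F X) =1
    (fun s => heat s F X)}.
  move=> s sab; rewrite indicE sab mul1r; congr (heat _ F X).
  by apply: clamp_id; move: sab; rewrite inE/= in_itv.
have fE : fubini_F mu (fun p => (tker a b p * F (X + tphi p))%:E) =
    (fun s => (\1_(`[a, b]%classic : set R) s * heat (clamp a b s) F X)%:E).
  by apply/funext => s; rewrite /fubini_F -Ht EFin_Rintegral.
have I2 := @integrable_fubini_F _ _ _ _ _ lam mu _ I.
rewrite fE in I2.
have fE2 : (fun s => (\1_(`[a, b]%classic : set R) s * heat (clamp a b s) F X)%:E) =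
    (EFin \o (fun s => heat s F X)) \_ `[a, b]%classic.
  apply/funext => s; rewrite patchE; case: ifPn => [|/negbTE] h; first by have /= -> := cE s h.
  by rewrite indicE h mul0r.
split.
- rewrite /tavg /avg /Rintegral.
  rewrite -[X in fine X](@integral12_prod_meas1 _ _ _ _ _ lam mu _ I) fE.
  by rewrite [in RHS]integral_mkcond fE2.
- by apply/integrable_mkcond => //; rewrite -fE2.
Qed.

End time_average.

Local Opaque gk dgk ddgk.

Lemma cts_at_sum (R : realType) (T : topologicalType) (x : T) (I : Type) (s : seq I)
    (f : I -> T -> R) : (forall i, f i y @[y --> x] --> f i x) ->
  \sum_(i <- s) f i y @[y --> x] --> \sum_(i <- s) f i x.
Proof.
move=> cf; elim: s => [|i s IH].
  by under eq_fun do rewrite big_nil; rewrite big_nil; exact: cvg_cst.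
under eq_fun do rewrite big_cons; rewrite big_cons.
exact: (cvgD (cf i) IH).
Qed.

Section time_average_calculus.
Variables (R : realType) (n : nat) (B : 'M[R]_n).
Implicit Types (F G : 'rV[R]_n -> R) (X Y : 'rV[R]_n) (a b s t M : R) (i j : 'I_n).
Local Notation mu := (lebesgue_row R n).
Local Notation lam := (@lebesgue_measure R).
Local Notation heat := (heat B).
Local Notation dheat := (dheat B).
Local Notation tavg := (tavg B).
Local Notation ll i := (row i B).

Lemma tavg_bound a b F M X : 0 < a -> a <= b -> continuous F -> (forall Y, `|F Y| <= M) ->
  `|tavg a b F X| <= (b - a) * M.
Proof.
move=> a0 ab cF FM; have [I1 E1] := @tker_integral R n a b a0 ab.
have := avg_bound I1 (measurable_tphi B) X cF FM.
under eq_Rintegral do rewrite (ger0_norm (tker_ge0 _ _ _)).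
by rewrite E1 mulrC.
Qed.

(** Uses the heat values at [X] only, so that estimates valid at one point survive the time
    average. *)
Lemma tavg_bound_loc a b F M MF X : 0 < a -> a <= b -> continuous F -> (forall Y, `|F Y| <= MF) ->
  (forall s, a <= s <= b -> `|heat s F X| <= M) -> `|tavg a b F X| <= (b - a) * M.
Proof.
move=> a0 ab cF FMF FM; have [-> I] := tavgE B X a0 ab cF FMF.
have mab : measurable (`[a, b]%classic : set R) by exact: measurable_itv.
apply: le_trans (le_normr_Rintegral _ I) _; first exact: measurable_itv.
have Ic : lam.-integrable `[a, b]%classic (EFin \o (fun=> M)).
  apply/integrableP; split; first exact: measurable_cst.
  rewrite integral_cst//= lebesgue_measure_itv/=; case: ifP => _.
    by rewrite -EFinB -EFinM ltry.
  by rewrite mule0 ltry.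
apply: (@le_trans _ _ (Rintegral lam `[a, b]%classic (fun=> M))).
  apply: le_Rintegral; [exact: measurable_itv|exact: integrable_norm I|exact: Ic|].
  by move=> s /=; rewrite in_itv/= => /FM.
have L : lam (`[a, b]%classic : set R) = (b - a)%:E.
  rewrite lebesgue_measure_itv/= lte_fin.
  by move: ab; rewrite le_eqVlt => /orP[/eqP->|->//]; rewrite ltxx subrr.
have -> : Rintegral lam `[a, b]%classic (fun=> M) = M * fine (lam (`[a, b]%classic : set R)).
  by rewrite Rintegral_cst//; exact: measurable_itv.
by rewrite L mulrC.
Qed.

Lemma tavg_cst a b c X : 0 < a -> a <= b -> tavg a b (fun=> c) X = (b - a) * c.
Proof.
move=> a0 ab; have [I1 E1] := @tker_integral R n a b a0 ab.
by rewrite /tavg avg_cst ?I1// E1 mulrC.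
Qed.

Lemma tavgD a b F G M1 M2 X : 0 < a -> a <= b -> continuous F -> (forall Y, `|F Y| <= M1) ->
  continuous G -> (forall Y, `|G Y| <= M2) ->
  tavg a b (fun Y => F Y + G Y) X = tavg a b F X + tavg a b G X.
Proof.
move=> a0 ab cF FM cG GM; have [I1 _] := @tker_integral R n a b a0 ab.
exact: (avgD I1 (measurable_tphi B) X cF FM cG GM).
Qed.

Lemma tavg_dird a b F F' M M' v : 0 < a -> a <= b -> continuous F -> (forall Y, `|F Y| <= M) ->
  continuous F' -> (forall Y, `|F' Y| <= M') ->
  (forall X, dird F X v (F' X)) -> forall X, dird (tavg a b F) X v (tavg a b F' X).
Proof.
move=> a0 ab cF FM cF' FM' dF; have [I1 _] := @tker_integral R n a b a0 ab.
exact: (avg_dird I1 (measurable_tphi B) cF FM cF' FM' dF).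
Qed.

Lemma dheat_tavg_comm i s a b F M X : 0 < s -> 0 < a -> a <= b -> continuous F ->
  (forall Y, `|F Y| <= M) -> dheat i s (tavg a b F) X = tavg a b (dheat i s F) X.
Proof.
move=> s0 a0 ab cF FM; have [I1 _] := @tker_integral R n a b a0 ab.
by have [_] := avg_comp (dgk_integrable i s0) (measurable_phiB B) I1 (measurable_tphi B) X cF FM.
Qed.

Lemma heat_time_derive F M X t : 0 < t -> continuous F -> (forall Y, `|F Y| <= M) ->
  is_derive t 1 (fun s => heat s F X) (\sum_(i < n) ddheat B i t F X).
Proof.
move=> t0 cF FM; have M0 : 0 <= M by exact: le_trans (FM X).
have t20 : 0 < 2 * t by rewrite mulr_gt0.
have h20 : 0 < t / 2 by rewrite divr_gt0.
have t40 : 0 < 2 * (2 * t) by rewrite mulr_gt0.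
have mF : measurable_fun setT (fun y => F (X + phiB B y)).
  apply: (measurableT_comp (continuous_measurable_row cF)).
  by apply: measurable_fun_row_add; [exact: measurable_cst|exact: measurable_phiB].
(* Majorant for [s] between [t / 2] and [2 t]: [s^-1 <= 2 / t], and passing from time [2 s] to [4 t]
   costs the last factor. *)
pose C : R := M * (n%:R * (2 / t * (Cg R n * Num.sqrt (2 * (2 * t) / t) ^+ n))).
have -> : \sum_(i < n) ddheat B i t F X =
    Rintegral mu setT (fun y => (\sum_(i < n) ddgk i t y) * F (X + phiB B y)).
  transitivity (\sum_(i <- index_enum 'I_n) ddheat B i t F X) => //.
  have key (s : seq 'I_n) : mu.-integrable setT (EFin \o (fun y => (\sum_(i <- s) ddgk i t y) * F (X + phiB B y))) /\
      \sum_(i <- s) ddheat B i t F X = Rintegral mu setT (fun y => (\sum_(i <- s) ddgk i t y) * F (X + phiB B y)).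
    elim: s => [|i s [I E]].
      have E0 : (fun y : 'rV[R]_n => (\sum_(i <- [::]) ddgk i t y) * F (X + phiB B y)) = (fun=> 0).
        by apply/funext => y; rewrite big_nil mul0r.
      rewrite E0 big_nil; split; first exact: integrable0.
      by rewrite Rintegral_cst// mul0r.
    have Ii := avg_integrable (ddgk_integrable i t0) (measurable_phiB B) X cF FM.
    have E0 : (fun y : 'rV[R]_n => (\sum_(j <- i :: s) ddgk j t y) * F (X + phiB B y)) =
        (fun y => ddgk i t y * F (X + phiB B y) + (\sum_(j <- s) ddgk j t y) * F (X + phiB B y)).
      by apply/funext => y; rewrite big_cons mulrDl.
    rewrite E0 big_cons; split; first exact: (integrableD measurableT Ii I).
    by rewrite (RintegralD measurableT Ii I) E.
  exact: (key _).2.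
apply: (@Rdiff_under_integral _ _ _ mu (fun s y => gk s y * F (X + phiB B y))
  (fun s y => (\sum_(i < n) ddgk i s y) * F (X + phiB B y))
  (fun y => C * gk (2 * (2 * t)) y) t (t / 2) (2 * t)).
- by rewrite ltr_pdivrMr// !ltr_pMr// ?ltr1n ltr_pMl ?ltr1n.
- move=> s /andP[hs _]; have s0 := lt_trans h20 hs.
  exact: (avg_integrable (gk_integrable n s0) (measurable_phiB B) X cF FM).
- move=> s y /andP[hs _]; have s0 := lt_trans h20 hs.
  have := isdM (gk_time_derive y s0) (isd_cst (F (X + phiB B y)) s).
  by rewrite mulr0 add0r mulrC.
- move=> s y /andP[hs1 hs2]; have s0 := lt_trans h20 hs1.
  rewrite normrM mulrC /C -!mulrA ler_pM//.
  apply: le_trans (ler_norm_sum _ _ _) _.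
  set c := (X in _ <= _ * X).
  apply: (@le_trans _ _ (\sum_(i < n) c)); last by rewrite sumr_const card_ord mulr_natl.
  apply: ler_sum => i _; rewrite {}/c.
  apply: le_trans (ddgk_le i y s0) _; rewrite -/(Cg R n).
  have h1 : s^-1 <= 2 / t.
    rewrite (_ : 2 / t = (t / 2)^-1); last by field; rewrite gt_eqF.
    by rewrite lef_pV2 ?posrE// ltW.
  have t2s : t <= 2 * s by rewrite ltr_pdivrMr// in hs1; rewrite mulrC ltW.
  have h2 : gk (2 * s) y <= Num.sqrt (2 * (2 * t) / t) ^+ n * gk (2 * (2 * t)) y.
    by apply: gk_mono => //; rewrite ler_pM2l// ltW.
  apply: (@le_trans _ _ (2 / t * (Cg R n * (Num.sqrt (2 * (2 * t) / t) ^+ n * gk (2 * (2 * t)) y)))).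
    apply: ler_pM => //; first by rewrite invr_ge0 ltW.
      by rewrite mulr_ge0 ?Cg_ge0 ?gk_ge0.
    by rewrite ler_wpM2l ?Cg_ge0.
  by rewrite -!mulrA.
- exact: gkZ_integrable.
Qed.

(** The heat equation integrated in time, with both space derivatives moved from the kernel onto
    [G]. *)
Lemma heat_FTC a b G (Gi Gii : 'I_n -> 'rV[R]_n -> R) M X : 0 < a -> a < b ->
  continuous G -> (forall i, continuous (Gi i)) -> (forall i, continuous (Gii i)) ->
  (forall Y, `|G Y| <= M) -> (forall i Y, `|Gi i Y| <= M) -> (forall i Y, `|Gii i Y| <= M) ->
  (forall i Y, dird G Y (ll i) (Gi i Y)) -> (forall i Y, dird (Gi i) Y (ll i) (Gii i Y)) ->
  heat b G X - heat a G X = \sum_(i < n) tavg a b (Gii i) X.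
Proof.
move=> a0 ab cG cGi cGii GM GiM GiiM dG dGi.
have pos s : a <= s -> 0 < s by exact: lt_le_trans.
have ddE i s : 0 < s -> ddheat B i s G X = heat s (Gii i) X.
  move=> s0; apply: (dird_unique (dheat_dird B i s0 cG GM X)).
  apply: (dird_ext (u1 := heat s (Gi i))).
    by move=> Y; rewrite (heat_derive_comm Y s0 cG GM (cGi i) (GiM i) (dG i)).
  exact: (avg_dird (gk_integrable n s0) (measurable_phiB B) (cGi i) (GiM i) (cGii i) (GiiM i) (dGi i)).
pose f s := \sum_(i < n) heat s (Gii i) X.
have dF s : a <= s -> is_derive s 1 (fun r => heat r G X) (f s).
  move=> /pos s0; rewrite /f; under eq_bigr do rewrite -ddE//.
  exact: (heat_time_derive X s0 cG GM).
have cts (H : 'rV[R]_n -> R) s : continuous H -> (forall Y, `|H Y| <= M) -> a <= s ->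
    {for s, continuous (fun r => heat r H X)}.
  move=> cH HM /pos s0; apply: differentiable_continuous.
  by apply/derivable1_diffP; have [] := heat_time_derive X s0 cH HM.
have ab' := ltW ab.
have cf : {within `[a, b], continuous f}.
  apply: continuous_in_subspaceT => s; rewrite inE/= in_itv/= => /andP[as_ _].
  by apply: cts_at_sum => i; exact: (cts _ s (cGii i) (GiiM i) as_).
have dd : derivable_oo_LRcontinuous (fun r => heat r G X) a b.
  split.
  - by move=> s; rewrite in_itv/= => /andP[as_ _]; have [] := dF s (ltW as_).
  - by apply: cvg_at_right_filter; exact: (cts G a cG GM (lexx a)).
  - by apply: cvg_at_left_filter; exact: (cts G b cG GM ab').
have dE : {in `]a, b[, (fun r => heat r G X)^`()%classic =1 f}.
  move=> s; rewrite in_itv/= => /andP[as_ _]; rewrite derive1E.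
  by have [_ ->] := dF s (ltW as_).
have E := continuous_FTC2 ab cf dd dE.
have -> : heat b G X - heat a G X = Rintegral lam `[a, b]%classic f.
  by rewrite /Rintegral E.
rewrite /f; transitivity (\sum_(i <- index_enum 'I_n) tavg a b (Gii i) X) => //.
rewrite (_ : (fun s => _) = (fun s => \sum_(i <- index_enum 'I_n) heat s (Gii i) X))//.
have key (s : seq 'I_n) :
    lam.-integrable `[a, b]%classic (EFin \o (fun r => \sum_(i <- s) heat r (Gii i) X)) /\
    Rintegral lam `[a, b]%classic (fun r => \sum_(i <- s) heat r (Gii i) X) =
    \sum_(i <- s) tavg a b (Gii i) X.
  elim: s => [|i s [I E']].
    have E0 : (fun r : R => \sum_(i <- [::]) heat r (Gii i) X) = (fun=> 0).
      by apply/funext => r; rewrite big_nil.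
    rewrite E0 big_nil; split; first exact: integrable0.
    by rewrite Rintegral_cst ?mul0r//; exact: measurable_itv.
  have [T Ii] := tavgE B X a0 ab' (cGii i) (GiiM i).
  have E0 : (fun r : R => \sum_(j <- i :: s) heat r (Gii j) X) =
      (fun r => heat r (Gii i) X + \sum_(j <- s) heat r (Gii j) X).
    by apply/funext => r; rewrite big_cons.
  have mi : measurable (`[a, b]%classic : set R) by exact: measurable_itv.
  rewrite E0 big_cons; split; first exact: (@integrableD _ _ R lam _ mi _ _ Ii I).
  by rewrite (@RintegralD _ _ R lam _ _ _ mi Ii I) E' T.
exact: (key _).2.
Qed.

(** A compactly supported test function of class C^1 with its derivatives along the rows of [B]
    carried as data. A change of coordinates is then a linear combination of these derivatives, and
    products with C^1 functions remain admissible. *)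
Definition test_dirs (rho : R) (psi : 'rV[R]_n -> R) (dpsi : 'I_n -> 'rV[R]_n -> R) :=
  [/\ 0 <= rho, continuous psi, (forall i, continuous (dpsi i)),
      (forall i X, dird psi X (ll i) (dpsi i X)) &
      (forall X, rho < `|X| -> psi X = 0 /\ forall i, dpsi i X = 0)].

Lemma supp_cts_integrable rho psi (f : 'rV[R]_n -> R) : 0 <= rho ->
  continuous psi -> (forall X, rho < `|X| -> psi X = 0) -> continuous f ->
  mu.-integrable setT (EFin \o (fun X => f X * psi X)).
Proof.
move=> r0 cp p0 cf; apply: (cts_supp_integrable (cts_mul cf cp) r0) => X /p0 ->.
by rewrite mulr0.
Qed.

Lemma Rintegral_sum (I : Type) (s : seq I) (f : I -> 'rV[R]_n -> R) :
  (forall k : I, mu.-integrable setT (EFin \o f k)) ->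
  mu.-integrable setT (EFin \o (fun X => \sum_(k <- s) f k X)) /\
  Rintegral mu setT (fun X => \sum_(k <- s) f k X) = \sum_(k <- s) Rintegral mu setT (f k).
Proof.
move=> If; elim: s => [|k s [IH E]].
  have E0 : (fun X => \sum_(j <- [::]) f j X) = (fun=> 0).
    by apply/funext => X; rewrite big_nil.
  by rewrite E0 big_nil; split; [exact: integrable0|rewrite Rintegral_cst ?mul0r].
have E0 : (fun X => \sum_(j <- k :: s) f j X) = (fun X => f k X + \sum_(j <- s) f j X).
  by apply/funext => X; rewrite big_cons.
rewrite E0 big_cons; split; first exact: (integrableD measurableT (If k) IH).
by rewrite (RintegralD measurableT (If k) IH) E.
Qed.

Lemma int_by_parts rho psi dpsi i (g g' : 'rV[R]_n -> R) : test_dirs rho psi dpsi ->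
  continuous g -> continuous g' -> (forall X, dird g X (ll i) (g' X)) ->
  Rintegral mu setT (fun X => g X * dpsi i X) = - Rintegral mu setT (fun X => g' X * psi X).
Proof.
move=> [r0 cp cd dp sp] cg cg' dg.
have I1 := supp_cts_integrable r0 (cd i) (fun X h => (sp X h).2 i) cg.
have I2 := supp_cts_integrable r0 cp (fun X h => (sp X h).1) cg'.
apply/eqP; rewrite -subr_eq0 opprK -(RintegralD measurableT I1 I2).
apply/eqP; apply: (@Rintegral_dird0 R n (fun X => g X * psi X) _ (ll i) rho) => //.
- exact: cts_mul.
- by apply: cts_add; apply: cts_mul.
- by move=> X; have := dirdM (dg X) (dp i X); rewrite (mulrC (psi X)).
- by move=> X /sp[-> _]; rewrite mulr0.
- by move=> X /sp[-> ->]; rewrite !mulr0 addr0.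
Qed.

(** Weak form of the Laplacian of the integral of [P_s P_t F] over [[a, b]]: it telescopes to the
    heat at the two ends. The time [t] is split in halves to carry the two derivatives, as [F] is
    only continuous. *)
Lemma tavg_weak rho psi dpsi a b t F M : test_dirs rho psi dpsi ->
  0 < a -> a < b -> 0 < t -> continuous F -> (forall Y, `|F Y| <= M) ->
  \sum_(i < n) Rintegral mu setT (fun X => tavg a b (dheat i t F) X * dpsi i X) =
  Rintegral mu setT (fun X => (heat (a + t) F X - heat (b + t) F X) * psi X).
Proof.
move=> tst a0 ab t0 cF FM; have [r0 cp cd dp sp] := tst; have ab' := ltW ab.
have b0 := lt_trans a0 ab.
have h0 : 0 < t / 2 by rewrite divr_gt0.
have tE : t = t / 2 + t / 2 by rewrite -splitr.
have cD i s : 0 < s -> continuous (dheat i s F) by move=> s0; exact: dheat_continuous cF FM.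
have DM i s (s0 : 0 < s) Y := dheat_bound B i Y s0 cF FM.
pose g2 i := dheat i (t / 2) (dheat i (t / 2) F).
have cg2 i : continuous (g2 i) by exact: (dheat_continuous h0 (cD i _ h0) (DM i _ h0)).
have g2M i Y := dheat_bound B i Y h0 (cD i _ h0) (DM i _ h0).
have dg i X : dird (dheat i t F) X (ll i) (g2 i X).
  apply: (dird_ext (u1 := heat (t / 2) (dheat i (t / 2) F))).
    by move=> Y; rewrite (heat_dheat B i Y h0 h0 cF FM) -tE.
  exact: (heat_dird B i h0 (cD i _ h0) (DM i _ h0)).
(* [heat_FTC] takes one bound for the function and for both orders of derivatives. *)
pose K := Num.max M (Num.max (Cg R n / Num.sqrt t * M) (Cg R n / Num.sqrt (t / 2) * (Cg R n / Num.sqrt (t / 2) * M))).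
have K1 Y : `|heat t F Y| <= K by apply: le_trans (heat_bound B Y t0 cF FM) _; rewrite le_max lexx.
have K2 i Y : `|dheat i t F Y| <= K by apply: le_trans (DM i t t0 Y) _; rewrite !le_max lexx !orbT.
have K3 i Y : `|g2 i Y| <= K by apply: le_trans (g2M i Y) _; rewrite !le_max lexx !orbT.
have E X := heat_FTC X a0 ab (heat_continuous t0 cF FM) (fun i => cD i t t0) cg2 K1 K2 K3
  (fun i => heat_dird B i t0 cF FM) dg.
transitivity (- Rintegral mu setT (fun X => (\sum_(i < n) tavg a b (g2 i) X) * psi X)).
  have ct i : continuous (tavg a b (g2 i)) by exact: tavg_continuous (K3 i).
  have Ii i := supp_cts_integrable r0 cp (fun X h => (sp X h).1) (ct i).
  have [_ S] := Rintegral_sum (index_enum 'I_n) Ii.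
  under [in RHS]eq_Rintegral do rewrite mulr_suml.
  rewrite [X in - X]S -sumrN; apply: eq_bigr => i _.
  apply: (@int_by_parts rho psi dpsi i (tavg a b (dheat i t F)) (tavg a b (g2 i)) tst _ (ct i)).
    exact: tavg_continuous (cD i t t0) (K2 i).
  exact: (tavg_dird a0 ab' (cD i t t0) (K2 i) (cg2 i) (K3 i) (dg i)).
have cH s : 0 < s -> continuous (heat s F) by move=> s0; exact: heat_continuous cF FM.
have at0 : 0 < a + t by rewrite addr_gt0.
have bt0 : 0 < b + t by rewrite addr_gt0.
have I := supp_cts_integrable r0 cp (fun X h => (sp X h).1) (cts_sub (cH _ bt0) (cH _ at0)).
rewrite -mulN1r -RintegralZl//; last first.
  move: I; congr (_.-integrable _ _); apply/funext => X /=; rewrite -E.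
  by rewrite !(heat_heat B _ _ _ cF FM).
apply: eq_Rintegral => X _; rewrite -E !(heat_heat B _ _ _ cF FM)//.
by rewrite mulN1r -mulNr opprB.
Qed.

End time_average_calculus.

(** * Series of potentials and the Dini perturbation *)

Local Opaque gk dgk ddgk Cg Cw.

Section uniform_series.
Variables (R : realType) (n : nat).
Implicit Types (f : nat -> 'rV[R]_n -> R) (c : nat -> R).

Lemma sum_ord_cat c (N1 N2 : nat) : (N1 <= N2)%N ->
  \sum_(k < N2) c k = \sum_(k < N1) c k + \sum_(N1 <= k < N2) c k.
Proof.
move=> h; rewrite -!(big_mkord xpredT c).
by rewrite (@big_cat_nat _ _ _ N1 0 N2).
Qed.

Lemma psum_cvg c (S : R) : (forall k, 0 <= c k) -> (forall N, \sum_(k < N) c k <= S) ->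
  \sum_(k < N) c k @[N --> \oo] --> sup (range (fun N => \sum_(k < N) c k)).
Proof.
move=> c0 cS; apply: nondecreasing_cvgn; last by exists S => _ [N _ <-]; exact: cS.
by move=> a b ab; rewrite (sum_ord_cat _ ab) lerDl sumr_ge0.
Qed.

Lemma psum_cauchy c (S : R) : (forall k, 0 <= c k) -> (forall N, \sum_(k < N) c k <= S) ->
  forall e : R, 0 < e -> exists N0, forall N1 N2, (N0 <= N1)%N -> (N1 <= N2)%N ->
    \sum_(N1 <= k < N2) c k <= e.
Proof.
move=> c0 cS e e0; have e20 : 0 < e / 2 by rewrite divr_gt0.
have [N0 hN0] := (seq_cvgP _ _).1 (psum_cvg c0 cS) _ e20.
exists N0 => N1 N2 h1 h2; have := hN0 N1 h1; have := hN0 N2 (leq_trans h1 h2).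
rewrite (sum_ord_cat _ h2) !ltr_norml => /andP[_ +] /andP[+ _]; lra.
Qed.

(** The Weierstrass M-test. Adding [c k] to each term makes the partial sums monotone, so the limit
    can be defined through a supremum. *)
Lemma uniform_series f c (S : R) : (forall k, continuous (f k)) -> (forall k, 0 <= c k) ->
  (forall k X, `|f k X| <= c k) -> (forall N, \sum_(k < N) c k <= S) ->
  exists g : 'rV[R]_n -> R, [/\ continuous g, (forall X, `|g X| <= S),
    (forall X, \sum_(k < N) f k X @[N --> \oo] --> g X) &
    (forall e : R, 0 < e -> exists N0, forall N, (N0 <= N)%N ->
       forall X, `|\sum_(k < N) f k X - g X| <= e)].
Proof.
move=> cf c0 fc cS.
have hfc k X : 0 <= f k X + c k by have := fc k X; rewrite ler_norml => /andP[]; lra.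
have S2 X N : \sum_(k < N) (f k X + c k) <= 2 * S.
  apply: (@le_trans _ _ (\sum_(k < N) (2 * c k))); last by rewrite -mulr_sumr ler_wpM2l.
  by apply: ler_sum => k _; have := fc k X; rewrite ler_norml => /andP[]; lra.
pose g X := sup (range (fun N => \sum_(k < N) (f k X + c k))) -
            sup (range (fun N => \sum_(k < N) c k)).
have cv X : \sum_(k < N) f k X @[N --> \oo] --> g X.
  have E : (fun N => \sum_(k < N) f k X) = (fun N => \sum_(k < N) (f k X + c k)) - (fun N => \sum_(k < N) c k).
    by apply/funext => N /=; rewrite [RHS]/= -[RHS]/(_ - _) -sumrB; apply: eq_bigr => k _; rewrite addrK.
  by rewrite E; apply: cvgB; [exact: (psum_cvg (hfc ^~ X) (S2 X))|exact: (psum_cvg c0 cS)].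
have uc (e : R) : 0 < e -> exists N0, forall N, (N0 <= N)%N ->
    forall X, `|\sum_(k < N) f k X - g X| <= e.
  move=> /(psum_cauchy c0 cS)[N0 hN0]; exists N0 => N N0N X.
  have cv' : `|\sum_(k < N) f k X - \sum_(k < N') f k X| @[N' --> \oo] -->
      `|\sum_(k < N) f k X - g X|.
    by apply: cvg_norm; apply: cvgB; [exact: cvg_cst|exact: cv].
  apply: (seq_cvg_le cv'); exists N => N' NN'.
  rewrite (sum_ord_cat (f ^~ X) NN') opprD addrA subrr sub0r normrN.
  apply: le_trans (ler_norm_sum _ _ _) _; apply: le_trans (hN0 _ _ N0N NN').
  exact: ler_sum.
exists g; split => //.
- move=> X; apply/continuous_epsP => e e0.
  have e30 : 0 < e / 4 by rewrite divr_gt0.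
  have [N /(_ N (leqnn N)) hN] := uc _ e30.
  have cN : continuous (fun Y => \sum_(k < N) f k Y).
    by apply: (@cts_sum _ _ _ _ xpredT (fun (k : 'I_N) Y => f k Y)) => k _.
  have /continuous_epsP/(_ _ e30)[d d0 hd] := cN X.
  exists d => // Y /hd; have := hN X; have := hN Y.
  rewrite !ltr_norml !ler_norml => /andP[? ?] /andP[? ?] /andP[? ?].
  apply/andP; split; lra.
- move=> X; apply: (seq_cvg_le (cvg_norm (cv X))); exists 0%N => N _.
  apply: le_trans (ler_norm_sum _ _ _) _; apply: le_trans (cS N).
  exact: ler_sum.
Qed.

Lemma gradient_series (B : 'M[R]_n) (v : nat -> 'rV[R]_n -> R)
    (e : nat -> 'I_n -> 'rV[R]_n -> R) (c1 c2 : nat -> R) (S1 S2 : R) :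
  (forall k, continuous (v k)) -> (forall k i, continuous (e k i)) ->
  (forall k, 0 <= c1 k) -> (forall k, 0 <= c2 k) ->
  (forall k X, `|v k X| <= c1 k) -> (forall k i X, `|e k i X| <= c2 k) ->
  (forall N, \sum_(k < N) c1 k <= S1) -> (forall N, \sum_(k < N) c2 k <= S2) ->
  (forall k i X, dird (v k) X (row i B) (e k i X)) ->
  exists u (d : 'I_n -> 'rV[R]_n -> R),
  [/\ continuous u /\ (forall i, continuous (d i)),
      (forall X, `|u X| <= S1) /\ (forall i X, `|d i X| <= S2),
      (forall i X, dird u X (row i B) (d i X)),
      (forall r : R, 0 < r -> exists N0, forall N, (N0 <= N)%N ->
         forall i X, `|\sum_(k < N) e k i X - d i X| <= r) &
      (forall X, \sum_(k < N) v k X @[N --> \oo] --> u X) /\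
      (forall i X, \sum_(k < N) e k i X @[N --> \oo] --> d i X)].
Proof.
move=> cv ce c10 c20 vc ec h1 h2 dv.
have [u [cu uS uc uu]] := uniform_series cv c10 vc h1.
have hd i := uniform_series (fun k => ce k i) c20 (fun k X => ec k i X) h2.
have [d hdd] := choice hd.
have du (r : R) : 0 < r -> exists N0, forall N, (N0 <= N)%N ->
         forall i X, `|\sum_(k < N) e k i X - d i X| <= r.
  move=> r0; have hN i : exists N0, forall N, (N0 <= N)%N -> forall X, `|\sum_(k < N) e k i X - d i X| <= r.
    by have [_ _ _ /(_ r r0)] := hdd i.
  have [N0 hN0] := choice hN.
  exists (\max_(i < n) N0 i) => N hmax i X; apply: hN0.
  by apply: leq_trans hmax; exact: leq_bigmax.
exists u, d; split => //.
- by split=> // i; have [] := hdd i.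
- by split=> // i; have [] := hdd i.
- move=> i; apply: (@dird_lim R n (fun N X => \sum_(k < N) v k X) u (fun N X => \sum_(k < N) e k i X) (d i)).
  + by move=> N X; apply: dird_sum => k; exact: dv.
  + exact: uc.
  + by move=> r /du[N0 hN0]; exists N0 => N NN0 X; exact: hN0.
- by split=> // i; have [] := hdd i.
Qed.

Lemma weak_series (rho : R) (psi : 'rV[R]_n -> R) (B : 'M[R]_n) (dpsi : 'I_n -> 'rV[R]_n -> R)
    (e : nat -> 'I_n -> 'rV[R]_n -> R) (d : 'I_n -> 'rV[R]_n -> R) :
  test_dirs B rho psi dpsi -> (forall k i, continuous (e k i)) -> (forall i, continuous (d i)) ->
  (forall r : R, 0 < r -> exists N0, forall N, (N0 <= N)%N ->
         forall i X, `|\sum_(k < N) e k i X - d i X| <= r) ->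
  \sum_(k < N) \sum_(i < n) Rintegral (lebesgue_row R n) setT (fun X => e k i X * dpsi i X) @[N --> \oo]
   --> \sum_(i < n) Rintegral (lebesgue_row R n) setT (fun X => d i X * dpsi i X).
Proof.
move=> [r0 cp cd dp sp] ce cdd du.
have s0 i X : rho < `|X| -> dpsi i X = 0 by move=> /sp[_].
have Ie k i := supp_cts_integrable r0 (cd i) (s0 i) (ce k i).
have hM i : exists M, 0 <= M /\ forall X, `|dpsi i X| <= M.
  by have [M M0 hM] := cts_supp_bounded (cd i) (s0 i); exists M.
have [M hMM] := choice hM.
pose C := \sum_(i < n) M i * boxvol n rho.
have C0 : 0 <= C by apply: sumr_ge0 => i _; rewrite mulr_ge0 ?boxvol_ge0//; exact: (hMM i).1.
apply/seq_cvgP => r rp; have rC : 0 < r / (C + 1) by rewrite divr_gt0// ltr_wpDl.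
have [N0 hN0] := du _ rC; exists N0 => N NN0.
rewrite exchange_big/= -sumrB.
apply: (@le_lt_trans _ _ (\sum_(i < n) (r / (C + 1)) * (M i * boxvol n rho))).
  apply: le_trans (ler_norm_sum _ _ _) _; apply: ler_sum => i _.
  have [IS ES] := Rintegral_sum (index_enum 'I_N) (fun k : 'I_N => Ie k i).
  have Id := supp_cts_integrable r0 (cd i) (s0 i) (cdd i).
  rewrite -ES -(RintegralB measurableT IS Id).
  rewrite mulrA; have [Mi0 hMi] := hMM i.
  apply: supp_Rintegral_le => //.
  - by rewrite mulr_ge0// ltW.
  - apply: measurable_funB; [exact: (integ_measurable IS)|exact: (integ_measurable Id)].
  - by move=> X h; rewrite big1 => [|k _]; rewrite (s0 i X h) mulr0 ?subr0.
  - move=> X _; rewrite -mulr_suml -mulrBl normrM ler_pM//; exact: hN0.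
rewrite -mulr_sumr -/C mulrAC ltr_pdivrMr ?ltr_wpDl// mulrDr mulr1 ltrDl//.
Qed.

End uniform_series.

(** * Second derivatives of the heat semigroup *)

Section second_order.
Variables (R : realType) (n : nat) (B : 'M[R]_n).
Implicit Types (F G : 'rV[R]_n -> R) (X Y : 'rV[R]_n) (a b s t M : R) (i j p q : 'I_n).
Local Notation Cg := (Cg R n).
Local Notation heat := (heat B).
Local Notation dheat := (dheat B).
Local Notation tavg := (tavg B).

(** The second derivative of the heat at time [t], half of the time serving each derivative; by
    [dheat_dheatE] the split is immaterial. *)
Definition D2 i j t F := dheat i (t / 2) (dheat j (t / 2) F).

Lemma half_gt0 t : 0 < t -> 0 < t / 2.
Proof. by move=> t0; rewrite divr_gt0. Qed.

Section bounded.
Variables (F : 'rV[R]_n -> R) (M : R).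
Hypotheses (cF : continuous F) (FM : forall Y, `|F Y| <= M).

Lemma bound_ge0 : 0 <= M.
Proof. exact: le_trans (FM 0). Qed.

Lemma dheat_cb j t : 0 < t ->
  continuous (dheat j t F) /\ forall Y, `|dheat j t F Y| <= Cg / Num.sqrt t * M.
Proof.
by move=> t0; split=> [|Y]; [exact: dheat_continuous cF FM|exact: (dheat_bound B j Y t0 cF FM)].
Qed.

Lemma heat_cb t : 0 < t -> continuous (heat t F) /\ forall Y, `|heat t F Y| <= M.
Proof.
by move=> t0; split=> [|Y]; [exact: heat_continuous cF FM|exact: (heat_bound B Y t0 cF FM)].
Qed.

Lemma D2_cb i j t : 0 < t ->
  continuous (D2 i j t F) /\ forall Y, `|D2 i j t F Y| <= 2 * Cg ^+ 2 / t * M.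
Proof.
move=> t0; have h0 := half_gt0 t0; have [c1 b1] := dheat_cb j h0.
split=> [|Y]; first exact: dheat_continuous c1 b1.
apply: le_trans (dheat_bound B i Y h0 c1 b1) _.
rewrite (_ : Cg / _ * _ = Cg ^+ 2 / (Num.sqrt (t / 2) ^+ 2) * M); last first.
  by field; rewrite sqrtr_eq0 -ltNge.
by rewrite sqr_sqrtr ?(ltW h0)// invf_div mulrA (mulrC (Cg ^+ 2)).
Qed.

Lemma dheat_D2 i j t X : 0 < t -> dird (dheat j t F) X (row i B) (D2 i j t F X).
Proof.
move=> t0; have h0 := half_gt0 t0; have [c1 b1] := dheat_cb j h0.
apply: (@dird_ext _ _ (heat (t / 2) (dheat j (t / 2) F))).
  by move=> Y; rewrite (heat_dheat B j Y h0 h0 cF FM) -splitr.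
exact: (heat_dird B i h0 c1 b1).
Qed.

Lemma heat_D2 i j s t X : 0 < s -> 0 < t -> heat s (D2 i j t F) X = D2 i j (s + t) F X.
Proof.
move=> s0 t0; have h0 := half_gt0 t0; have [c1 b1] := dheat_cb j h0.
have st0 : 0 < s + t by rewrite addr_gt0.
rewrite /D2 (heat_dheat B i X s0 h0 c1 b1).
apply: (dheat_dheatE B i j X _ _ _ _ _ cF FM) => //; rewrite ?half_gt0 ?addr_gt0//; lra.
Qed.

Lemma D2_heat i j s t X : 0 < s -> 0 < t -> D2 i j s (heat t F) X = D2 i j (s + t) F X.
Proof.
move=> s0 t0; have h0 := half_gt0 s0; have [c1 b1] := heat_cb t0.
have st0 : 0 < s + t by rewrite addr_gt0.
have -> : D2 i j s (heat t F) = dheat i (s / 2) (dheat j (s / 2 + t) F).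
  by congr dheat; apply/funext => Y; rewrite (dheat_heat B j Y h0 t0 cF FM).
apply: (dheat_dheatE B i j X _ _ _ _ _ cF FM) => //; rewrite ?half_gt0 ?addr_gt0//; lra.
Qed.

End bounded.

(** Heat time can be moved from the inner second derivative to the outer one, so the scale at which
    [F] is measured is free within the total time. *)
Lemma D2D2E p q i j s t s' t' F M X : 0 < s -> 0 < t -> 0 < s' -> 0 < t' -> t' < t ->
  s + t = s' + t' -> continuous F -> (forall Y, `|F Y| <= M) ->
  D2 p q s (D2 i j t F) X = D2 p q s' (D2 i j t' F) X.
Proof.
move=> s0 t0 s'0 t'0 tt' e cF FM.
have r0 : 0 < t - t' by rewrite subr_gt0.
have [c1 b1] := D2_cb cF FM i j t'0.
have -> : D2 i j t F = heat (t - t') (D2 i j t' F).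
  by apply/funext => Y; rewrite (heat_D2 cF FM i j Y r0 t'0) subrK.
rewrite (D2_heat c1 b1 p q X s0 r0) (_ : s + (t - t') = s') //; lra.
Qed.

Lemma D2_dheat p q i s t F M X : 0 < s -> 0 < t -> continuous F -> (forall Y, `|F Y| <= M) ->
  D2 p q s (dheat i t F) X = D2 p q (s + t / 2) (dheat i (t / 2) F) X.
Proof.
move=> s0 t0 cF FM; have h0 := half_gt0 t0.
have [c1 b1] := dheat_cb cF FM i h0.
rewrite -(D2_heat c1 b1 p q X s0 h0) (_ : heat _ _ = dheat i t F)//.
by apply/funext => Y; rewrite (heat_dheat B i Y h0 h0 cF FM) -splitr.
Qed.

Lemma D2D i j t F G M1 M2 X : 0 < t -> continuous F -> (forall Y, `|F Y| <= M1) ->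
  continuous G -> (forall Y, `|G Y| <= M2) ->
  D2 i j t (fun Y => F Y + G Y) X = D2 i j t F X + D2 i j t G X.
Proof.
move=> t0 cF FM cG GM; have h0 := half_gt0 t0.
have [c1 b1] := dheat_cb cF FM j h0; have [c2 b2] := dheat_cb cG GM j h0.
rewrite -(dheatD B i X h0 c1 b1 c2 b2); congr dheat; apply/funext => Y.
exact: (dheatD B j Y h0 cF FM cG GM).
Qed.

Lemma D2Z i j t c F M X : 0 < t -> continuous F -> (forall Y, `|F Y| <= M) ->
  D2 i j t (fun Y => c * F Y) X = c * D2 i j t F X.
Proof.
move=> t0 cF FM; have h0 := half_gt0 t0; have [c1 b1] := dheat_cb cF FM j h0.
rewrite -(dheatZ B i c X h0 c1 b1); congr dheat; apply/funext => Y.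
exact: (dheatZ B j c Y h0 cF FM).
Qed.

Lemma D2_0 i j t X : 0 < t -> D2 i j t (fun=> 0) X = 0.
Proof.
move=> t0; have := @D2Z i j t 0 (fun=> 0) 0 X t0 (@cts_cst _ _ _).
have b0 : forall Y : 'rV[R]_n, `|(0 : R)| <= 0 by move=> _; rewrite normr0.
by move=> /(_ b0); rewrite !mul0r.
Qed.

Lemma D2_sum_bound (I : Type) (r : seq I) i j t (f : I -> 'rV[R]_n -> R) (M m : I -> R) X : 0 < t ->
  (forall k, continuous (f k)) -> (forall k Y, `|f k Y| <= M k) ->
  (forall k, `|D2 i j t (f k) X| <= m k) ->
  `|D2 i j t (fun Y => \sum_(k <- r) f k Y) X| <= \sum_(k <- r) m k.
Proof.
move=> t0 cf fM fm; elim: r => [|k r IH].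
  rewrite (_ : (fun Y => _) = fun=> 0); last by apply/funext => Y; rewrite big_nil.
  by rewrite D2_0// normr0 big_nil.
rewrite (_ : (fun Y => _) = fun Y => f k Y + \sum_(l <- r) f l Y); last first.
  by apply/funext => Y; rewrite big_cons.
rewrite (@D2D _ _ _ _ _ (M k) (\sum_(l <- r) M l)) ?big_cons//.
- by apply: le_trans (ler_normD _ _) _; exact: lerD.
- by apply: (@cts_sum _ _ _ _ xpredT) => l _; exact: cf.
- by move=> Y; apply: le_trans (ler_norm_sum _ _ _) _; apply: ler_sum => l _; exact: fM.
Qed.

(** At a fixed time [D2] is continuous for the sup norm, so a pointwise bound passes to uniform
    limits. *)
Lemma D2_limit i j t (f : nat -> 'rV[R]_n -> R) g (m M M' : R) X : 0 < t ->
  (forall k, continuous (f k)) -> (forall k Y, `|f k Y| <= M) -> continuous g ->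
  (forall Y, `|g Y| <= M') ->
  (forall e, 0 < e -> exists k, forall Y, `|f k Y - g Y| <= e) ->
  (forall k, `|D2 i j t (f k) X| <= m) -> `|D2 i j t g X| <= m.
Proof.
move=> t0 cf fM cg gM fg fm; apply/ler_addgt0Pr => e e0.
pose C := 2 * Cg ^+ 2 / t.
have C0 : 0 <= C by rewrite /C mulr_ge0 ?invr_ge0 ?(ltW t0)// mulr_ge0// sqr_ge0.
have eC : 0 < e / (C + 1) by rewrite divr_gt0// ltr_wpDl.
have [k hk] := fg _ eC.
have hk' Y : `|g Y - f k Y| <= e / (C + 1) by rewrite distrC.
have cgf : continuous (fun Y => g Y - f k Y) by exact: cts_sub.
rewrite (_ : g = fun Y => f k Y + (g Y - f k Y)); last by apply/funext => Y; rewrite addrC subrK.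
rewrite (D2D i j X t0 (cf k) (fM k) cgf hk').
apply: le_trans (ler_normD _ _) _; apply: lerD; first exact: fm.
apply: le_trans ((D2_cb cgf hk' i j t0).2 X) _; rewrite -/C.
rewrite mulrCA ler_piMr ?(ltW e0)// ler_pdivrMr ?ltr_wpDl// mul1r lerDl//.
Qed.

Section weighted.
Variables (KB : R).
Hypotheses (KB0 : 0 <= KB) (hKB : forall y : 'rV[R]_n, `|y *m B| <= KB * `|y|).
Local Notation Cw := (Cw n KB).

(* Freezing the multiplier at the center of the exponential weight. *)
Lemma D2_mul_bound i j t (bf g : 'rV[R]_n -> R) (eps beta M m : R) X : 0 < t ->
  continuous bf -> continuous g -> (forall Y, `|g Y| <= M) -> (forall Y, `|bf Y| <= eps) ->
  0 <= beta -> (forall Y Z, `|bf Y - bf Z| <= beta * expR (`|Y - Z| / Num.sqrt t)) ->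
  `|D2 i j t g X| <= m ->
  `|D2 i j t (fun Y => bf Y * g Y) X| <= 2 * Cw ^+ 2 / t * (beta * M) + eps * m.
Proof.
move=> t0 cb cg gM be b0 bb hm; have h0 := half_gt0 t0.
have M0 := bound_ge0 gM.
have rt : Num.sqrt (t / 2) <= Num.sqrt t by rewrite ler_sqrt ?(ltW t0)//; lra.
have cf : continuous (fun Y => (bf Y - bf X) * g Y).
  by apply: cts_mul => //; apply: cts_sub => //; exact: cts_cst.
have fM Y : `|(bf Y - bf X) * g Y| <= 2 * eps * M.
  rewrite normrM ler_pM//; apply: le_trans (ler_normB _ _) _.
  by have := be X; have := be Y; lra.
have c2 : continuous (fun Y => bf X * g Y) by apply: cts_mul => //; exact: cts_cst.
have M2 Y : `|bf X * g Y| <= eps * M by rewrite normrM ler_pM.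
rewrite (_ : (fun Y => bf Y * g Y) = fun Y => (bf Y - bf X) * g Y + bf X * g Y); last first.
  by apply/funext => Y; rewrite mulrBl subrK.
rewrite (D2D i j X t0 cf fM c2 M2) (D2Z i j (bf X) X t0 cg gM).
apply: le_trans (ler_normD _ _) _; apply: lerD; last by rewrite normrM ler_pM.
pose W := Cw / Num.sqrt (t / 2) * (beta * M).
have bM0 : 0 <= beta * M by rewrite mulr_ge0.
have W0 : 0 <= W.
  by rewrite /W mulr_ge0// divr_ge0 ?sqrtr_ge0// (le_trans ler01)// Cw_ge1.
have [c1 b1] := dheat_cb cf fM j h0.
have st0 : 0 < Num.sqrt t by rewrite sqrtr_gt0.
have b1' Y : `|dheat j (t / 2) (fun Y => (bf Y - bf X) * g Y) Y| <= W * expR (`|Y - X| / Num.sqrt t).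
  rewrite /W -(mulrA (Cw / _)); apply: (dheat_weight KB0 hKB j h0 rt cf).
    by rewrite mulr_ge0 ?expR_ge0.
  move=> Z; rewrite normrM -[X in _ <= X]mulrA -expRD mulrAC.
  apply: ler_pM => //.
  apply: le_trans (bb Z X) _; rewrite ler_wpM2l// ler_expR -mulrDl ler_pM2r ?invr_gt0//.
  by have := ler_distD Y Z X; lra.
apply: le_trans (dheat_weight KB0 hKB i h0 rt c1 W0 b1') _.
rewrite /W (_ : Cw / _ * _ = Cw ^+ 2 / (Num.sqrt (t / 2) ^+ 2) * (beta * M)); last first.
  by field; rewrite sqrtr_eq0 -ltNge.
by rewrite sqr_sqrtr ?(ltW h0)// invf_div (mulrA (Cw ^+ 2)) (mulrC (Cw ^+ 2)).
Qed.

End weighted.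
End second_order.

Lemma cvg_telescope (R : realType) (a b : nat -> R) (la lb : R) : (forall k, a k = b k.+1 - b k) ->
  \sum_(k < N) a k @[N --> \oo] --> la -> b k @[k --> \oo] --> lb -> la = lb - b 0%N.
Proof.
move=> ab ca cb; have E : (fun N => \sum_(k < N) a k) = (fun N => b N - b 0%N).
  apply/funext; elim=> [|N IH]; first by rewrite big_ord0 subrr.
  by rewrite big_ord_recr/= IH ab; lra.
rewrite E in ca; apply: (cvg_unique _ ca); first exact: norm_hausdorff.
by apply: cvgB => //; exact: cvg_cst.
Qed.

Lemma seq_cvg_sum (R : realType) (I : Type) (r : seq I) (f : I -> nat -> R) (l : I -> R) :
  (forall i, f i k @[k --> \oo] --> l i) ->
  \sum_(i <- r) f i k @[k --> \oo] --> \sum_(i <- r) l i.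
Proof.
move=> h; elim: r => [|i r IH].
  by rewrite big_nil; under eq_fun do rewrite big_nil; exact: cvg_cst.
by rewrite big_cons; under eq_fun do rewrite big_cons; apply: cvgD.
Qed.

(** * Interaction of dyadic scales *)

Section dyadic_weights.
Variables (R : realType).
Implicit Types (mu : nat -> R) (S : R).
Local Notation q := (4^-1 : R).

Lemma q_ge0 k : 0 <= q ^+ k.
Proof. by rewrite exprn_ge0// invr_ge0. Qed.

Lemma sum_geom (r : R) N : 0 <= r -> r < 1 -> \sum_(k < N) r ^+ k <= (1 - r)^-1.
Proof.
move=> r0 r1; have r1' : 0 < 1 - r by rewrite subr_gt0.
have -> : \sum_(k < N) r ^+ k = (1 - r ^+ N) / (1 - r).
  elim: N => [|N IH]; first by rewrite big_ord0 expr0 subrr mul0r.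
  by rewrite big_ord_recr/= IH exprS; field; rewrite gt_eqF.
by rewrite ler_piMl ?invr_ge0 ?(ltW r1')// gerBl exprn_ge0.
Qed.

Lemma psum_mono mu N1 N2 : (forall k, 0 <= mu k) -> (N1 <= N2)%N ->
  \sum_(k < N1) mu k <= \sum_(k < N2) mu k.
Proof. by move=> m0 h; rewrite (sum_ord_cat _ h) lerDl sumr_ge0. Qed.

Lemma psum_shift mu S l : (forall k, 0 <= mu k) -> (forall N, \sum_(k < N) mu k <= S) ->
  forall N, \sum_(k < N) mu (k + l)%N <= S.
Proof.
move=> m0 mS N; apply: le_trans (mS (l + N)%N); rewrite big_split_ord/=.
rewrite (eq_bigr (fun k : 'I_N => mu (l + k)%N)) => [|k _]; last by rewrite addnC.
by rewrite lerDr sumr_ge0.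
Qed.

(** Weight with which the dyadic block [k] acts at scale [m]. It decays like [4^-|k - m|]; the data
    enter at index [m + 1] or [k + 3], one dyadic step below the times [t_m] and [t_(k+2)]
    respectively. *)
Definition interaction mu (k m : nat) : R :=
  if (m <= k)%N then q ^+ (k - m) * mu m.+1 else q ^+ (m - k) * mu (k + 3)%N.

Definition interaction_sum mu (m : nat) : R :=
  \sum_(k < m) q ^+ (m - k) * mu (k + 3)%N + 4 / 3 * mu m.+1.

Lemma interaction_ge0 mu k m : (forall k, 0 <= mu k) -> 0 <= interaction mu k m.
Proof. by move=> m0; rewrite /interaction; case: ifP => _; rewrite mulr_ge0// q_ge0. Qed.

Lemma interaction_sum_ge0 mu m : (forall k, 0 <= mu k) -> 0 <= interaction_sum mu m.
Proof.
move=> m0; rewrite addr_ge0 ?mulr_ge0//.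
by apply: sumr_ge0 => k _; rewrite mulr_ge0// q_ge0.
Qed.

Lemma sum_interaction mu m N : (forall k, 0 <= mu k) ->
  \sum_(k < N) interaction mu k m <= interaction_sum mu m.
Proof.
move=> m0; apply: (@le_trans _ _ (\sum_(k < m + N) interaction mu k m)).
  by apply: (@psum_mono (interaction mu ^~ m)); [move=> k; exact: interaction_ge0|exact: leq_addl].
rewrite big_split_ord/=; apply: lerD.
  by apply: ler_sum => k _; rewrite /interaction leqNgt ltn_ord.
rewrite (eq_bigr (fun k : 'I_N => q ^+ k * mu m.+1)) => [|k _]; last first.
  by rewrite /interaction leq_addr addKn.
rewrite -mulr_suml ler_wpM2r//; apply: le_trans (@sum_geom q N _ _) _; try lra.
by rewrite (_ : (1 - q)^-1 = 4 / 3)//; field.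
Qed.

(** The sums [c m] satisfy [c (m + 1) = (c m + mu (m + 3)) / 4], whence their total is at most
    [S / 3]; with [4 / 3 S] from the remaining terms this stays below [2 S]. *)
Lemma sum_interaction_sum mu S N : (forall k, 0 <= mu k) ->
  (forall N, \sum_(k < N) mu k <= S) -> \sum_(m < N) interaction_sum mu m <= 2 * S.
Proof.
move=> m0 mS; rewrite big_split/= -mulr_sumr.
pose c m := \sum_(k < m) q ^+ (m - k) * mu (k + 3)%N.
have c0 m : 0 <= c m by apply: sumr_ge0 => k _; rewrite mulr_ge0// q_ge0.
have cS m : c m.+1 = q * c m + q * mu (m + 3)%N.
  rewrite /c big_ord_recr/= subSnn expr1; congr (_ + _); rewrite mulr_sumr.
  by apply: eq_bigr => k _; rewrite subSn 1?ltnW// exprS mulrA.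
have h1 : \sum_(m < N) c m <= S / 3.
  elim: N => [|N IH].
    by rewrite big_ord0 divr_ge0// (le_trans _ (mS 0%N))// big_ord0.
  rewrite big_ord_recl {1}/c big_ord0 add0r.
  rewrite (eq_bigr (fun m : 'I_N => q * c m + q * mu (m + 3)%N)) => [|m _]; last exact: cS.
  rewrite big_split/= -!mulr_sumr.
  have := psum_shift 3 m0 mS N; lra.
have h2 : \sum_(m < N) mu m.+1 <= S.
  have := psum_shift 1 m0 mS N; rewrite (eq_bigr (fun m : 'I_N => mu m.+1)) // => m _.
  by rewrite addn1.
have : 0 <= \sum_(m < N) mu m.+1 by exact: sumr_ge0.
rewrite -/(\sum_(m < N) c m); lra.
Qed.

End dyadic_weights.

(** * The Poisson equation with divergence data *)

Section step_solver.
Variables (R : realType) (n : nat) (B : 'M[R]_n) (T : R).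
Hypothesis T0 : 0 < T.
Implicit Types (F G : 'rV[R]_n -> R) (X Y : 'rV[R]_n) (i j p q : 'I_n).
Local Notation Cg := (Cg R n).
Local Notation heat := (heat B).
Local Notation dheat := (dheat B).
Local Notation tavg := (tavg B).
Local Notation D2 := (D2 B).
Local Notation mu_ := (lebesgue_row R n).

Definition tk (k : nat) : R := T * (4^-1) ^+ k.

Lemma tk_gt0 k : 0 < tk k.
Proof. by rewrite mulr_gt0// exprn_gt0// invr_gt0. Qed.

Lemma tkD k l : tk (k + l) = tk k * (4^-1) ^+ l.
Proof. by rewrite /tk exprD mulrA. Qed.

Lemma tkS k : tk k = 4 * tk k.+1.
Proof. by have := tkD k 1; rewrite addn1 expr1; lra. Qed.

Lemma tk_le k : tk k <= T.
Proof. rewrite ler_piMr ?(ltW T0)// exprn_ile1 ?invr_ge0//; lra. Qed.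

Lemma sqrt_tk k : Num.sqrt (tk k) = Num.sqrt T * (2^-1) ^+ k.
Proof.
have -> : tk k = (Num.sqrt T * (2^-1) ^+ k) ^+ 2.
  rewrite exprMn sqr_sqrtr ?(ltW T0)// -exprM mulnC exprM /tk; congr (_ * _ ^+ _).
  by rewrite expr2; lra.
by rewrite sqrtr_sqr ger0_norm// mulr_ge0 ?sqrtr_ge0// exprn_ge0// invr_ge0.
Qed.

(** With [mu] summable this is the Besov condition on which the perturbation argument rests. A
    bounded function only has [mu] bounded. *)
Definition mb F (mu : nat -> R) := forall k i j X, tk k * `|D2 i j (tk k) F X| <= mu k.

(** The derivatives already use heat time [tk k.+2]. Added to [ta k] and [tb k] it gives
    [4 tk k.+2 = tk k.+1] and [16 tk k.+2 = tk k], so consecutive blocks tile the times up to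
    [T]. *)
Definition ta k : R := 3 * tk k.+2.
Definition tb k : R := 15 * tk k.+2.

Lemma ta_gt0 k : 0 < ta k.
Proof. by rewrite mulr_gt0// tk_gt0. Qed.

Lemma ta_ltb k : ta k < tb k.
Proof. by rewrite ltr_pM2r ?tk_gt0//; lra. Qed.

Lemma tavgk_bound k G (M : R) X : continuous G -> (forall Y, `|G Y| <= M) ->
  `|tavg (ta k) (tb k) G X| <= 12 * tk k.+2 * M.
Proof.
move=> cG GM; have := tavg_bound B X (ta_gt0 k) (ltW (ta_ltb k)) cG GM.
by rewrite /ta /tb -mulrBl (_ : 15 - 3 = 12)//; lra.
Qed.

Lemma tavgk_cts k G (M : R) : continuous G -> (forall Y, `|G Y| <= M) ->
  continuous (tavg (ta k) (tb k) G).
Proof. by move=> cG GM; exact: tavg_continuous (ta_gt0 k) (ltW (ta_ltb k)) cG GM. Qed.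

Lemma tavgk_D2 k p q s G (M : R) : 0 < s -> continuous G -> (forall Y, `|G Y| <= M) ->
  D2 p q s (tavg (ta k) (tb k) G) = tavg (ta k) (tb k) (D2 p q s G).
Proof.
move=> s0 cG GM; have h0 := half_gt0 s0; have [c1 b1] := dheat_cb B cG GM q h0.
have E : dheat q (s / 2) (tavg (ta k) (tb k) G) = tavg (ta k) (tb k) (dheat q (s / 2) G).
  by apply/funext => Y; exact: (dheat_tavg_comm B q Y h0 (ta_gt0 k) (ltW (ta_ltb k)) cG GM).
apply/funext => X; rewrite /D2 E.
exact: (dheat_tavg_comm B p X h0 (ta_gt0 k) (ltW (ta_ltb k)) c1 b1).
Qed.

(** The two second derivatives share the time [tk m + tk k.+2]. Measuring [F] at a scale [r] with
    [4 tk r] at most that total leaves at least [3 tk r] for the outer derivatives, and the bound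
    decays with the separation of the scales. *)
Lemma interaction_bound p q i j k m F (M : R) mu X : continuous F -> (forall Y, `|F Y| <= M) ->
  mb F mu -> (forall k, 0 <= mu k) ->
  tk m * (12 * tk k.+2 * `|D2 p q (tk m) (D2 i j (tk k.+2) F) X|) <=
  2048 * Cg ^+ 2 * interaction mu k m.
Proof.
move=> cF FM hF mu0.
have main r : tk r != tk k.+2 -> 4 * tk r <= tk m + tk k.+2 ->
    tk m * (12 * tk k.+2 * `|D2 p q (tk m) (D2 i j (tk k.+2) F) X|) <=
    8 * Cg ^+ 2 * (tk m * tk k.+2 / tk r ^+ 2) * mu r.
  move=> ne h; have tr := tk_gt0 r; have tm := tk_gt0 m; have t2 := tk_gt0 k.+2.
  have s'0 : 0 < tk m + tk k.+2 - tk r by lra.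
  have e : tk m + tk k.+2 = tk m + tk k.+2 - tk r + tk r by lra.
  have -> : D2 p q (tk m) (D2 i j (tk k.+2) F) X = D2 p q (tk m + tk k.+2 - tk r) (D2 i j (tk r) F) X.
    move: ne; rewrite neq_lt => /orP[lt1|lt1]; first exact: (D2D2E B p q i j X tm t2 s'0 tr lt1 e cF FM).
    exact: (esym (D2D2E B p q i j X s'0 tr tm t2 lt1 (esym e) cF FM)).
  have [c1 _] := D2_cb B cF FM i j tr.
  have b1 Y : `|D2 i j (tk r) F Y| <= mu r / tk r by rewrite ler_pdivlMr// mulrC; exact: hF.
  have := (D2_cb B c1 b1 p q s'0).2 X => hb.
  apply: (@le_trans _ _ (tk m * (12 * tk k.+2 * (2 * Cg ^+ 2 / (3 * tk r) * (mu r / tk r))))).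
    apply: (ler_wpM2l (ltW tm)); apply: ler_wpM2l; first by rewrite mulr_ge0 ?(ltW t2).
    apply: le_trans hb _.
    rewrite ler_wpM2r ?divr_ge0 ?(ltW tr)// ler_wpM2l ?mulr_ge0 ?sqr_ge0//.
    by rewrite lef_pV2 ?posrE//; lra.
  by rewrite le_eqVlt; apply/orP; left; apply/eqP; field; rewrite gt_eqF.
have C0 : 0 <= Cg ^+ 2 by exact: sqr_ge0.
rewrite /interaction; case: leqP => mk.
  have E : tk k.+2 = tk m.+1 * (4^-1 * (4^-1) ^+ (k - m)).
    by rewrite -{1}(subnKC mk) -addn2 !tkD (tkS m); lra.
  have hq : (4^-1 : R) ^+ (k - m) <= 1 by rewrite exprn_ile1 ?invr_ge0//; lra.
  have q0 := @q_ge0 R (k - m); have tm := tk_gt0 m.+1.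
  apply: le_trans (main m.+1 _ _) _.
  - by rewrite E eq_sym lt_eqF// gtr_pMr//; lra.
  - by rewrite -tkS lerDl ltW// tk_gt0.
  rewrite E (tkS m) (_ : _ / _ = (4^-1) ^+ (k - m)); last by field; rewrite gt_eqF.
  rewrite -mulrA ler_wpM2r ?mulr_ge0//; lra.
have E : tk m = 64 * tk (k + 3) * (4^-1) ^+ (m - k).
  by rewrite -{1}(subnKC (ltnW mk)) !tkD; lra.
have E2 : tk k.+2 = 4 * tk (k + 3) by rewrite addn3 -tkS.
have q0 := @q_ge0 R (m - k); have tm := tk_gt0 (k + 3).
(* Here the time ratio is [256 4^-(m - k)], and [8 * 256 = 2048] fixes the constant of the
   statement. *)
apply: le_trans (main (k + 3)%N _ _) _.
- by rewrite E2 lt_eqF//; lra.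
- by rewrite -E2 lerDr ltW// tk_gt0.
rewrite E E2 (_ : _ / _ = 256 * (4^-1) ^+ (m - k)); last by field; rewrite gt_eqF.
by rewrite !mulrA ler_wpM2r// -!mulrA; lra.
Qed.

Section step.
Variables (F : 'I_n -> 'rV[R]_n -> R) (MF : R) (mu : nat -> R) (S : R).
Hypotheses (cF : forall j, continuous (F j)) (FM : forall j Y, `|F j Y| <= MF).
Hypotheses (MF0 : 0 <= MF) (mu0 : forall k, 0 <= mu k) (hF : forall j, mb (F j) mu).
Hypothesis (muS : forall N, \sum_(k < N) mu k <= S).

(** Block [k] of the integral over heat times up to [T] of [P_s div F], which solves
    [- Delta u = div F - P_T div F] in the coordinates of [B]. [step_grad] is its gradient and
    [step_flux t] is [div P_t F]. *)
Definition step_pot k X := \sum_(j < n) tavg (ta k) (tb k) (dheat j (tk k.+2) (F j)) X.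
Definition step_grad k i X := \sum_(j < n) tavg (ta k) (tb k) (D2 i j (tk k.+2) (F j)) X.
Definition step_flux t X := \sum_(j < n) dheat j t (F j) X.

Lemma D2tk_cb i j k : continuous (D2 i j (tk k) (F j)) /\
  forall Y, `|D2 i j (tk k) (F j) Y| <= mu k / tk k.
Proof.
split=> [|Y]; first exact: (D2_cb B (@cF j) (@FM j) i j (tk_gt0 k)).1.
by rewrite ler_pdivlMr ?tk_gt0// mulrC; exact: hF.
Qed.

Lemma step_pot_cb k : continuous (step_pot k) /\
  forall Y, `|step_pot k Y| <= n%:R * (3 * Cg * Num.sqrt T * MF * (2^-1) ^+ k).
Proof.
have h j := dheat_cb B (@cF j) (@FM j) j (tk_gt0 k.+2).
split.
  by apply: (@cts_sum _ _ _ _ xpredT) => j _; exact: tavgk_cts (h j).1 (h j).2.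
move=> Y; apply: le_trans (ler_norm_sum _ _ _) _.
rewrite -[X in _ <= X%:R * _]card_ord -sum1_card natr_sum mulr_suml.
apply: ler_sum => j _; rewrite mul1r.
apply: le_trans (tavgk_bound k Y (h j).1 (h j).2) _.
have st : 0 < Num.sqrt (tk k.+2) by rewrite sqrtr_gt0 tk_gt0.
rewrite -{1}(sqr_sqrtr (ltW (tk_gt0 k.+2))).
rewrite (_ : 12 * _ * _ = 12 * Cg * MF * Num.sqrt (tk k.+2)); last by field; rewrite gt_eqF.
rewrite sqrt_tk !exprS le_eqVlt; apply/orP; left; apply/eqP; lra.
Qed.

Lemma step_grad_cb k i : continuous (step_grad k i) /\
  forall Y, `|step_grad k i Y| <= 12 * n%:R * mu (k + 2)%N.
Proof.
split.
  by apply: (@cts_sum _ _ _ _ xpredT) => j _; exact: tavgk_cts (D2tk_cb i j _).1 (D2tk_cb i j _).2.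
move=> Y; apply: le_trans (ler_norm_sum _ _ _) _.
rewrite mulrAC mulrC -[X in _ <= X%:R * _]card_ord -sum1_card natr_sum mulr_suml.
apply: ler_sum => j _; rewrite mul1r addn2.
apply: le_trans (tavgk_bound k Y (D2tk_cb i j _).1 (D2tk_cb i j _).2) _.
by rewrite (_ : 12 * tk k.+2 * _ = 12 * mu k.+2)//; field; rewrite gt_eqF ?tk_gt0.
Qed.

Lemma step_pot_dird k i X : dird (step_pot k) X (row i B) (step_grad k i X).
Proof.
apply: dird_sum => j; have [c1 b1] := dheat_cb B (@cF j) (@FM j) j (tk_gt0 k.+2).
have dd Y := dheat_D2 B (@cF j) (@FM j) i j Y (tk_gt0 k.+2).
exact: (tavg_dird B (ta_gt0 k) (ltW (ta_ltb k)) c1 b1 (D2tk_cb i j k.+2).1 (D2tk_cb i j k.+2).2 dd).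
Qed.

Lemma step_flux_cb t : 0 < t -> continuous (step_flux t) /\
  forall Y, `|step_flux t Y| <= n%:R * (Cg / Num.sqrt t * MF).
Proof.
move=> t0; have h j := dheat_cb B (@cF j) (@FM j) j t0; split.
  by apply: (@cts_sum _ _ _ _ xpredT) => j _; exact: (h j).1.
move=> Y; apply: le_trans (ler_norm_sum _ _ _) _.
rewrite -[X in _ <= X%:R * _]card_ord -sum1_card natr_sum mulr_suml.
by apply: ler_sum => j _; rewrite mul1r; exact: (h j).2.
Qed.

(** The right-hand side is a difference of consecutive fluxes, so the sum over the blocks
    telescopes. *)
Lemma step_weak_k rho psi dpsi k : test_dirs B rho psi dpsi ->
  \sum_(i < n) Rintegral mu_ setT (fun X => step_grad k i X * dpsi i X) =
  Rintegral mu_ setT (fun X => step_flux (tk k.+1) X * psi X) -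
  Rintegral mu_ setT (fun X => step_flux (tk k) X * psi X).
Proof.
move=> tst; have [r0 cp cd dp sp] := tst.
have sp1 X h := (sp X h).1; have sp2 i X h := (sp X h).2 i.
have t2 := tk_gt0 k.+2; have h0 := half_gt0 t2.
have cf j t (t0 : 0 < t) := (dheat_cb B (@cF j) (@FM j) j t0).1.
have If j t (t0 : 0 < t) := supp_cts_integrable r0 cp sp1 (cf j t t0).
have Ig i j := supp_cts_integrable r0 (cd i) (sp2 i)
  (@tavgk_cts k _ _ (D2tk_cb i j k.+2).1 (D2tk_cb i j k.+2).2).
have -> : \sum_(i < n) Rintegral mu_ setT (fun X => step_grad k i X * dpsi i X) =
   \sum_(j < n) \sum_(i < n) Rintegral mu_ setT
     (fun X => tavg (ta k) (tb k) (D2 i j (tk k.+2) (F j)) X * dpsi i X).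
  rewrite exchange_big/=; apply: eq_bigr => i _.
  rewrite -(Rintegral_sum _ (Ig i)).2; apply: eq_Rintegral => X _.
  by rewrite mulr_suml.
have flux t (t0 : 0 < t) : Rintegral mu_ setT (fun X => step_flux t X * psi X) =
   \sum_(j < n) Rintegral mu_ setT (fun X => dheat j t (F j) X * psi X).
  rewrite -(Rintegral_sum _ (fun j => If j t t0)).2; apply: eq_Rintegral => X _.
  by rewrite mulr_suml.
rewrite (flux (tk k.+1) (tk_gt0 _)) (flux (tk k) (tk_gt0 _)) -sumrB; apply: eq_bigr => j _.
have [c1 b1] := dheat_cb B (@cF j) (@FM j) j h0.
have := tavg_weak tst (ta_gt0 k) (ta_ltb k) h0 c1 b1; rewrite /D2 => ->.
have a0 : 0 < ta k + tk k.+2 / 2 by rewrite addr_gt0 ?ta_gt0.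
have b0 : 0 < tb k + tk k.+2 / 2 by rewrite addr_gt0// (lt_trans (ta_gt0 k))// ta_ltb.
rewrite -(RintegralB measurableT (If j _ (tk_gt0 _)) (If j _ (tk_gt0 _))).
apply: eq_Rintegral => X _; rewrite (heat_dheat B j X a0 h0 (@cF j) (@FM j)).
rewrite (heat_dheat B j X b0 h0 (@cF j) (@FM j)) -mulrBl.
rewrite (_ : ta k + _ + _ = tk k.+1); last by rewrite /ta (tkS k.+1); lra.
by rewrite (_ : tb k + _ + _ = tk k)//; rewrite /tb (tkS k) (tkS k.+1); lra.
Qed.

Lemma tk_cvg0 : tk k @[k --> \oo] --> (0 : R).
Proof.
rewrite -[X in _ --> X](mulr0 T); apply: cvgM; first exact: cvg_cst.
by apply: cvg_expr; rewrite ger0_norm ?invr_ge0//; lra.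
Qed.

Variables (KB : R).
Hypotheses (KB0 : 0 <= KB) (hKB : forall y : 'rV[R]_n, `|y *m B| <= KB * `|y|).

(** The flux itself need not converge, but after an integration by parts [P_t F] tends to [F]
    pointwise and boundedly, and dominated convergence applies. *)
Lemma step_flux_cvg rho psi dpsi : test_dirs B rho psi dpsi ->
  Rintegral mu_ setT (fun X => step_flux (tk k) X * psi X) @[k --> \oo] -->
  - \sum_(j < n) Rintegral mu_ setT (fun X => F j X * dpsi j X).
Proof.
move=> tst; have [r0 cp cd dp sp] := tst.
have sp1 X h := (sp X h).1; have sp2 i X h := (sp X h).2 i.
have cf j t (t0 : 0 < t) := (dheat_cb B (@cF j) (@FM j) j t0).1.
have If j t (t0 : 0 < t) := supp_cts_integrable r0 cp sp1 (cf j t t0).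
have ch j t (t0 : 0 < t) := (heat_cb B (@cF j) (@FM j) t0).
have E : (fun k => Rintegral mu_ setT (fun X => step_flux (tk k) X * psi X)) =
  (fun k => - \sum_(j < n) Rintegral mu_ setT (fun X => heat (tk k) (F j) X * dpsi j X)).
  apply/funext => k; rewrite -sumrN.
  rewrite (@eq_Rintegral _ _ _ mu_ setT (fun X => \sum_(j < n) dheat j (tk k) (F j) X * psi X)); last first.
    by move=> X _; rewrite mulr_suml.
  rewrite (Rintegral_sum _ (fun j => If j _ (tk_gt0 k))).2; apply: eq_bigr => j _.
  rewrite (int_by_parts tst (ch j _ (tk_gt0 k)).1 (cf j _ (tk_gt0 k))) ?opprK// => X.
  exact: (heat_dird B j (tk_gt0 k) (@cF j) (@FM j)).
rewrite E; apply: cvgN; apply: seq_cvg_sum => j.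
have [Mp Mp0 hMp] := cts_supp_bounded (cd j) (sp2 j).
have Ip : mu_.-integrable setT (EFin \o (fun X => MF * `|dpsi j X|)).
  apply: (cts_supp_integrable _ r0); first by apply: cts_mul; [exact: cts_cst|exact: cts_norm].
  by move=> X /(sp2 j) ->; rewrite normr0 mulr0.
apply: (Rdominated_cvg _ _ Ip).
- move=> k; apply: continuous_measurable_row; apply: cts_mul; last exact: cd.
  exact: (ch j _ (tk_gt0 k)).1.
- move=> X; apply: cvgM; last exact: cvg_cst.
  exact: (heat_cvg KB0 hKB tk_gt0 tk_cvg0 (@cF j) (@FM j)).
- by move=> k X; rewrite normrM ler_wpM2r//; exact: (ch j _ (tk_gt0 k)).2.
Qed.

Lemma step_grad_mb N m p q i X :
  tk m * `|D2 p q (tk m) (fun Y => \sum_(k < N) step_grad k i Y) X| <=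
  n%:R * (2048 * Cg ^+ 2 * interaction_sum mu m).
Proof.
have tm := tk_gt0 m; rewrite mulrC -ler_pdivlMr//.
have b1 k j Y := @tavgk_bound k _ _ Y (D2tk_cb i j k.+2).1 (D2tk_cb i j k.+2).2.
have c1 k j := @tavgk_cts k _ _ (D2tk_cb i j k.+2).1 (D2tk_cb i j k.+2).2.
have h2 k : `|D2 p q (tk m) (step_grad k i) X| <=
    \sum_(j < n) 2048 * Cg ^+ 2 * interaction mu k m / tk m.
  apply: (@D2_sum_bound _ _ _ _ (index_enum 'I_n) p q _ _ _ (fun j => _) _ tm (c1 k) (fun j Y => b1 k j Y)) => j.
  rewrite (tavgk_D2 k p q tm (D2tk_cb i j k.+2).1 (D2tk_cb i j k.+2).2).
  have [cd bd] := D2_cb B (D2tk_cb i j k.+2).1 (D2tk_cb i j k.+2).2 p q tm.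
  rewrite ler_pdivlMr// mulrC.
  have b' : forall Y, `|D2 p q (tk m) (D2 i j (tk k.+2) (F j)) Y| <=
      2048 * Cg ^+ 2 * interaction mu k m / (tk m * (12 * tk k.+2)).
    move=> Y; rewrite ler_pdivlMr; last exact: (mulr_gt0 tm (mulr_gt0 (ltr0Sn R 11) (tk_gt0 _))).
    rewrite [leLHS]mulrC -[leLHS]mulrA.
    exact: (interaction_bound p q i j k m Y (@cF j) (@FM j) (@hF j) mu0).
  apply: le_trans (ler_wpM2l (ltW tm) (tavgk_bound k X cd b')) _.
  have t2 := tk_gt0 k.+2.
  by rewrite le_eqVlt; apply/orP; left; apply/eqP; field; rewrite (gt_eqF tm) (gt_eqF t2).
have h := @D2_sum_bound _ _ _ _ (index_enum 'I_N) p q _ (fun k : 'I_N => step_grad k i)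
  (fun k => _) _ X tm (fun k => (step_grad_cb k i).1) (fun k Y => (step_grad_cb k i).2 Y) (fun k : 'I_N => h2 k).
apply: le_trans h _.
rewrite (eq_bigr (fun k : 'I_N => n%:R * (2048 * Cg ^+ 2) / tk m * interaction mu k m)) => [|k _].
  rewrite -mulr_sumr; apply: le_trans (ler_wpM2l _ (sum_interaction m N mu0)) _.
    exact: (divr_ge0 (mulr_ge0 (ler0n R n) (mulr_ge0 (ler0n R 2048) (sqr_ge0 Cg))) (ltW tm)).
  by rewrite le_eqVlt; apply/orP; left; apply/eqP; field; rewrite (gt_eqF tm).
by rewrite sumr_const card_ord -mulr_natl; ring.
Qed.

(** The gradient satisfies bounds of the same kind as the data: its sup is controlled by the sum of
    [mu], and it has its own sequence [nu] of comparable sum. This closure is what allows iteration.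
    The sup of [u] uses only the sup of [F], through the sum of [sqrt t_k]. *)
Lemma step_solver : exists u (d : 'I_n -> 'rV[R]_n -> R) (nu : nat -> R),
  [/\ continuous u /\ (forall i, continuous (d i)),
      (forall X, `|u X| <= 6 * n%:R * Cg * Num.sqrt T * MF) /\
      (forall i X, `|d i X| <= 12 * n%:R * S),
      (forall i X, dird u X (row i B) (d i X)),
      [/\ forall i, mb (d i) nu, forall k, 0 <= nu k &
          forall N, \sum_(k < N) nu k <= 4096 * n%:R * Cg ^+ 2 * S] &
      forall rho psi dpsi, test_dirs B rho psi dpsi ->
        \sum_(i < n) Rintegral mu_ setT (fun X => d i X * dpsi i X) =
        - \sum_(j < n) Rintegral mu_ setT (fun X => F j X * dpsi j X) -
        Rintegral mu_ setT (fun X => step_flux T X * psi X)].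
Proof.
have S0 : 0 <= S by apply: le_trans (muS 0); rewrite big_ord0.
have Cg0 := Cg_ge0 R n; have sT := sqrtr_ge0 T.
have h1 N : \sum_(k < N) n%:R * (3 * Cg * Num.sqrt T * MF * (2^-1) ^+ k) <=
    6 * n%:R * Cg * Num.sqrt T * MF.
  rewrite -mulr_sumr -mulr_sumr.
  rewrite (_ : 6 * _ * _ * _ * _ = n%:R * (3 * Cg * Num.sqrt T * MF * 2)); last by ring.
  rewrite ler_wpM2l// ler_wpM2l ?mulr_ge0//; apply: le_trans (sum_geom _ _ _) _; try lra.
  by rewrite (_ : (1 - 2^-1)^-1 = 2)//; field.
have h2 N : \sum_(k < N) 12 * n%:R * mu (k + 2)%N <= 12 * n%:R * S.
  by rewrite -mulr_sumr ler_wpM2l ?mulr_ge0//; exact: psum_shift.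
have [||u [d [[cu cd] [ub db] dd uu [uc dc]]]] := gradient_series (fun k => (step_pot_cb k).1)
  (fun k i => (step_grad_cb k i).1) _ _ (fun k => (step_pot_cb k).2)
  (fun k i => (step_grad_cb k i).2) h1 h2 step_pot_dird.
- by move=> k; rewrite !mulr_ge0// exprn_ge0// invr_ge0.
- by move=> k; rewrite !mulr_ge0.
exists u, d, (fun m => n%:R * (2048 * Cg ^+ 2 * interaction_sum mu m)); split; [by []|by []|exact: dd| |].
- split=> [i m p q X|k|N].
  + have tm := tk_gt0 m; rewrite mulrC -ler_pdivlMr//.
    pose fN N Y := \sum_(k < N) step_grad k i Y.
    have cN N : continuous (fN N).
      apply: (@cts_sum _ _ _ _ xpredT (fun (k : 'I_N) Y => step_grad k i Y)) => k _.
      exact: (step_grad_cb k i).1.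
    have bN N Y : `|fN N Y| <= 12 * n%:R * S.
      apply: le_trans (ler_norm_sum _ _ _) _; apply: le_trans (h2 N).
      by apply: ler_sum => k _; exact: (step_grad_cb k i).2.
    have lN e : 0 < e -> exists k, forall Y, `|fN k Y - d i Y| <= e.
      by move=> /uu[N0 hN0]; exists N0 => Y; exact: hN0.
    have dN N : `|D2 p q (tk m) (fN N) X| <= n%:R * (2048 * Cg ^+ 2 * interaction_sum mu m) / tk m.
      by rewrite ler_pdivlMr// mulrC; exact: step_grad_mb.
    exact: (D2_limit tm cN bN (cd i) (db i) lN dN).
  + exact: (mulr_ge0 (ler0n R n) (mulr_ge0 (mulr_ge0 (ler0n R 2048) (sqr_ge0 Cg)) (interaction_sum_ge0 _ mu0))).
  + rewrite -mulr_sumr -mulr_sumr.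
    apply: (@le_trans _ _ (n%:R * (2048 * Cg ^+ 2 * (2 * S)))); last by lra.
    apply: (ler_wpM2l (ler0n R n)); apply: (ler_wpM2l (mulr_ge0 (ler0n R 2048) (sqr_ge0 Cg))).
    exact: sum_interaction_sum.
- move=> rho psi dpsi tst.
  have c1 := weak_series tst (fun k i => (step_grad_cb k i).1) cd uu.
  have := cvg_telescope (fun k => step_weak_k k tst) c1 (step_flux_cvg tst).
  by rewrite /tk expr0 mulr1.
Qed.

End step.
End step_solver.

(** * Truncated heat potential of a bounded source *)

Section scalar_potential.
Variables (R : realType) (n : nat) (B : 'M[R]_n) (T : R).
Hypothesis T0 : 0 < T.
Variables (KB : R).
Hypotheses (KB0 : 0 <= KB) (hKB : forall y : 'rV[R]_n, `|y *m B| <= KB * `|y|).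
Implicit Types (X Y : 'rV[R]_n) (i j p q : 'I_n).
Local Notation Cg := (Cg R n).
Local Notation heat := (heat B).
Local Notation dheat := (dheat B).
Local Notation tavg := (tavg B).
Local Notation D2 := (D2 B).
Local Notation mu_ := (lebesgue_row R n).
Local Notation tk := (tk T).
Local Notation ta := (ta T).
Local Notation tb := (tb T).
Local Notation tk_gt0 := (tk_gt0 T0).
Local Notation ta_gt0 := (ta_gt0 T0).
Local Notation ta_ltb := (ta_ltb T0).

Lemma sum_dist_half m N :
  \sum_(k < N) (2^-1 : R) ^+ (if (m <= k)%N then (k - m)%N else (m - k)%N) <= 3.
Proof.
have p0 k : 0 <= (2^-1 : R) ^+ k by rewrite exprn_ge0// invr_ge0.
pose f k := (2^-1 : R) ^+ (if (m <= k)%N then (k - m)%N else (m - k)%N).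
apply: (@le_trans _ _ (\sum_(k < m + N) f k)).
  by apply: (@psum_mono R f); [move=> k; exact: p0|exact: leq_addl].
rewrite big_split_ord/=; rewrite (_ : 3 = 1 + 2); last by lra.
apply: lerD; last first.
  rewrite (eq_bigr (fun k : 'I_N => (2^-1) ^+ k)) => [|k _]; last by rewrite /f leq_addr addKn.
  apply: le_trans (sum_geom _ _ _) _; rewrite ?invr_ge0//; try lra.
  by rewrite (_ : (1 - 2^-1)^-1 = 2)//; field.
rewrite (eq_bigr (fun k : 'I_m => (2^-1) ^+ (m - k))) => [|k _]; last by rewrite /f leqNgt ltn_ord.
elim: m {f} => [|m IH]; first by rewrite big_ord0.
rewrite big_ord_recr/= subSnn expr1 (eq_bigr (fun k : 'I_m => 2^-1 * (2^-1) ^+ (m - k))) => [|k _].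
  by rewrite -mulr_sumr; lra.
by rewrite subSn 1?ltnW// exprS.
Qed.

(** The cruder [E'] is charged only to indices from [k0] on, where the geometric weight is at most
    [r ^+ k0]. *)
Lemma sum_geom_tail (r E E' : R) k0 N : 0 <= r -> r < 1 -> 0 <= E -> 0 <= E' ->
  \sum_(k < N) r ^+ k * (E + (k0 <= k)%:R * E') <= (1 - r)^-1 * (E + r ^+ k0 * E').
Proof.
move=> r0 r1 E0 E'0; have p0 k : 0 <= r ^+ k by rewrite exprn_ge0.
rewrite (eq_bigr (fun k : 'I_N => E * r ^+ k + E' * ((k0 <= k)%:R * r ^+ k))) => [|k _]; last by ring.
rewrite big_split/= -!mulr_sumr.
have h : \sum_(k < N) (k0 <= k)%:R * r ^+ k <= r ^+ k0 * (1 - r)^-1.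
  pose f k := (k0 <= k)%:R * r ^+ k.
  apply: (@le_trans _ _ (\sum_(k < k0 + N) f k)).
    by apply: (@psum_mono R f); [move=> k; rewrite mulr_ge0|exact: leq_addl].
  rewrite big_split_ord/= big1 ?add0r => [|k _]; last by rewrite /f leqNgt ltn_ord mul0r.
  rewrite (eq_bigr (fun k : 'I_N => r ^+ k0 * r ^+ k)) => [|k _].
    by rewrite -mulr_sumr ler_wpM2l// sum_geom.
  by rewrite /f leq_addr mul1r exprD.
apply: le_trans (lerD (ler_wpM2l E0 (sum_geom N r0 r1)) (ler_wpM2l E'0 h)) _.
by rewrite le_eqVlt; apply/orP; left; apply/eqP; ring.
Qed.

Lemma sum_tavg_len N : \sum_(k < N) 12 * tk k.+2 = T - tk N.
Proof.
elim: N => [|N IH]; first by rewrite big_ord0 /tk expr0 mulr1 subrr.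
by rewrite big_ord_recr/= IH (tkS T N) (tkS T N.+1); lra.
Qed.

Section potential.
Variable s : 'rV[R]_n -> R.
Hypotheses (cs : continuous s) (s1 : forall Y, `|s Y| <= 1).

Definition pot k X := tavg (ta k) (tb k) (heat (tk k.+2) s) X.
Definition pot_grad k i X := tavg (ta k) (tb k) (dheat i (tk k.+2) s) X.

Lemma pot_cb k : continuous (pot k) /\ forall Y, `|pot k Y| <= 12 * tk k.+2.
Proof.
have [c1 b1] := heat_cb B cs s1 (tk_gt0 k.+2).
split=> [|Y]; first exact: tavgk_cts c1 b1.
by have := tavgk_bound B T0 k Y c1 b1; rewrite mulr1.
Qed.

Lemma pot_grad_cb k i : continuous (pot_grad k i) /\
  forall Y, `|pot_grad k i Y| <= 3 * Cg * Num.sqrt T * (2^-1) ^+ k.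
Proof.
have [c1 b1] := dheat_cb B cs s1 i (tk_gt0 k.+2).
split=> [|Y]; first exact: tavgk_cts c1 b1.
apply: le_trans (tavgk_bound B T0 k Y c1 b1) _.
have st : 0 < Num.sqrt (tk k.+2) by rewrite sqrtr_gt0 tk_gt0.
rewrite -{1}(sqr_sqrtr (ltW (tk_gt0 k.+2))).
rewrite (_ : 12 * _ * _ = 12 * Cg * Num.sqrt (tk k.+2)); last by field; rewrite gt_eqF.
rewrite (sqrt_tk T0) !exprS le_eqVlt; apply/orP; left; apply/eqP; lra.
Qed.

Lemma pot_dird k i X : dird (pot k) X (row i B) (pot_grad k i X).
Proof.
have [c0 b0] := heat_cb B cs s1 (tk_gt0 k.+2).
have [c1 b1] := dheat_cb B cs s1 i (tk_gt0 k.+2).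
have dd Y := heat_dird B i (tk_gt0 k.+2) cs s1 Y.
exact: (tavg_dird B (ta_gt0 k) (ltW (ta_ltb k)) c0 b0 c1 b1 dd).
Qed.

(** A bounded source gives a gradient one order smoother than a bounded field, whence the decay
    [2^-m]. *)
Lemma pot_grad_mb N m p q i X :
  tk m * `|D2 p q (tk m) (fun Y => \sum_(k < N) pot_grad k i Y) X| <=
  1152 * Cg ^+ 3 * Num.sqrt T * (2^-1) ^+ m.
Proof.
have tm := tk_gt0 m; have Cg0 := Cg_ge0 R n; have sT := sqrtr_ge0 T.
have C3 : 0 <= Cg ^+ 3 * Num.sqrt T by rewrite mulr_ge0// exprn_ge0.
pose d k := if (m <= k)%N then (k - m)%N else (m - k)%N.
have h2 k : `|D2 p q (tk m) (pot_grad k i) X| <=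
    384 * (Cg ^+ 3 * Num.sqrt T) * (2^-1) ^+ m / tk m * (2^-1) ^+ d k.
  have t2 := tk_gt0 k.+2; have h0 := half_gt0 t2.
  have [c1 b1] := dheat_cb B cs s1 i t2; have [c2 b2] := dheat_cb B cs s1 i h0.
  rewrite (tavgk_D2 B T0 k p q tm c1 b1).
  have s0 : 0 < tk m + tk k.+2 / 2 by rewrite addr_gt0.
  have [cd bd] := D2_cb B c1 b1 p q tm.
  have b' Y : `|D2 p q (tk m) (dheat i (tk k.+2) s) Y| <=
      2 * Cg ^+ 2 / (tk m + tk k.+2 / 2) * (Cg / Num.sqrt (tk k.+2 / 2)).
    rewrite (D2_dheat B p q i Y tm t2 cs s1).
    by have := (D2_cb B c2 b2 p q s0).2 Y; rewrite mulr1.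
  apply: le_trans (tavgk_bound B T0 k X cd b') _.
  have sth : 0 < Num.sqrt (tk k.+2 / 2) by rewrite sqrtr_gt0.
  have sq : Num.sqrt (tk k.+2 / 2) ^+ 2 = tk k.+2 / 2 by rewrite sqr_sqrtr// ltW.
  have st2 : 0 < Num.sqrt (tk k.+2) by rewrite sqrtr_gt0.
  have sle : Num.sqrt (tk k.+2 / 2) <= Num.sqrt (tk k.+2) by rewrite ler_sqrt ?(ltW t2)//; lra.
  have sE : Num.sqrt (tk k.+2) = Num.sqrt T * (2^-1) ^+ k / 4 by rewrite (sqrt_tk T0) !exprS; lra.
  set x := Num.sqrt (tk k.+2 / 2) in sth sq sle *; set y := Num.sqrt (tk k.+2) in st2 sle sE *.
  have xy : y <= 2 * x.
    rewrite -(ler_pXn2r (n := 2)) ?nnegrE ?(ltW st2) ?mulr_ge0 ?(ltW sth)//.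
    by rewrite exprMn sq /y sqr_sqrtr ?(ltW t2)//; lra.
  have x20 : 0 < x ^+ 2 by rewrite exprn_gt0.
  rewrite (_ : 12 * _ * _ = 48 * Cg ^+ 3 * (x / (tk m + x ^+ 2))); last first.
    have tE2 : tk k.+2 = 2 * x ^+ 2 by rewrite sq; lra.
    have xn : tk m + x ^+ 2 != 0 by rewrite gt_eqF ?addr_gt0.
    by rewrite tE2 (_ : 2 * x ^+ 2 / 2 = x ^+ 2); field; rewrite ?(gt_eqF sth) ?xn.
  (* For [m <= k] the outer time dominates the denominator, for [k < m] the time of the block does;
     the second case fixes [384 = 48 * 2 * 4]. *)
  rewrite /d; case: leqP => mk.
    have hx : x / (tk m + x ^+ 2) <= y / tk m.
      apply: ler_pM => //; rewrite ?(ltW sth) ?invr_ge0 ?addr_ge0 ?(ltW tm) ?(ltW x20)//.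
      by rewrite lef_pV2 ?posrE ?addr_gt0// lerDl ltW.
    apply: le_trans (ler_wpM2l _ hx) _; first by rewrite mulr_ge0// exprn_ge0.
    rewrite sE -{1}(subnKC mk) exprD.
    have := @q_ge0 R 0; have p1 : 0 <= Cg ^+ 3 * Num.sqrt T / tk m * ((2^-1) ^+ m * (2^-1) ^+ (k - m)).
      by rewrite mulr_ge0 ?(divr_ge0 C3 (ltW tm))// mulr_ge0// exprn_ge0// invr_ge0.
    by lra.
  have hx : x / (tk m + x ^+ 2) <= 2 / y.
    rewrite ler_pdivrMr ?addr_gt0// mulrAC ler_pdivlMr//.
    apply: (@le_trans _ _ (x * (2 * x))); first by rewrite ler_wpM2l// ltW.
    by rewrite expr2; lra.
  apply: le_trans (ler_wpM2l _ hx) _; first by rewrite mulr_ge0// exprn_ge0.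
  have wE : T = Num.sqrt T ^+ 2 by rewrite sqr_sqrtr// ltW.
  have w0 : 0 < Num.sqrt T by rewrite sqrtr_gt0.
  have a0 : 0 < (2^-1 : R) ^+ k by rewrite exprn_gt0// invr_gt0.
  have b0 : 0 < (2^-1 : R) ^+ (m - k) by rewrite exprn_gt0// invr_gt0.
  have mE : (2^-1 : R) ^+ m = (2^-1) ^+ k * (2^-1) ^+ (m - k) by rewrite -exprD subnKC// ltnW.
  have tE : tk m = (Num.sqrt T * ((2^-1) ^+ k * (2^-1) ^+ (m - k))) ^+ 2.
    by rewrite -mE -(sqrt_tk T0) sqr_sqrtr// ltW.
  rewrite tE mE sE; set w := Num.sqrt T in w0 *.
  set a := (2^-1) ^+ k in a0 *; set b := (2^-1) ^+ (m - k) in b0 *.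
  rewrite le_eqVlt; apply/orP; left; apply/eqP; field.
  by rewrite (gt_eqF a0) (gt_eqF b0) (gt_eqF w0).
pose M k := 3 * Cg * Num.sqrt T * (2^-1) ^+ k.
have h := @D2_sum_bound _ _ _ _ (index_enum 'I_N) p q _ (fun k : 'I_N => pot_grad k i)
  (fun k => M k) _ X tm (fun k => (pot_grad_cb k i).1) (fun k Y => (pot_grad_cb k i).2 Y) (fun k : 'I_N => h2 k).
rewrite mulrC -ler_pdivlMr//; apply: le_trans h _; rewrite -mulr_sumr.
have h3 := sum_dist_half m N.
apply: le_trans (ler_wpM2l _ h3) _.
  have h0 : 0 <= (2^-1 : R) ^+ m by rewrite exprn_ge0// invr_ge0.
  exact: (divr_ge0 (mulr_ge0 (mulr_ge0 (ler0n R 384) C3) h0) (ltW tm)).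
by rewrite le_eqVlt; apply/orP; left; apply/eqP; ring.
Qed.

(** Subtracting the constant before averaging in time keeps the estimate local at [X]. *)
Lemma pot_loc_k k X c (e : R) :
  (forall t, tk k.+1 <= t <= tk k -> `|heat t s X - c| <= e) ->
  `|pot k X - 12 * tk k.+2 * c| <= 12 * tk k.+2 * e.
Proof.
move=> he; have t2 := tk_gt0 k.+2.
have [c1 b1] := heat_cb B cs s1 t2.
have cc : continuous (fun _ : 'rV[R]_n => - c) by exact: cts_cst.
have bc (Y : 'rV[R]_n) : `|- c| <= `|c| by rewrite normrN.
have cF : continuous (fun Y => heat (tk k.+2) s Y - c) by exact: cts_add.
have bF Y : `|heat (tk k.+2) s Y - c| <= 1 + `|c| by apply: le_trans (ler_normB _ _) _; exact: lerD.
have E : tavg (ta k) (tb k) (fun Y => heat (tk k.+2) s Y - c) X = pot k X - 12 * tk k.+2 * c.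
  rewrite (tavgD B X (ta_gt0 k) (ltW (ta_ltb k)) c1 b1 cc bc).
  by rewrite (tavg_cst B (- c) X (ta_gt0 k) (ltW (ta_ltb k))) /ta /tb /pot; ring.
rewrite -E (_ : 12 * tk k.+2 = tb k - ta k); last by rewrite /ta /tb; ring.
apply: (tavg_bound_loc (ta_gt0 k) (ltW (ta_ltb k)) cF bF) => r /andP[r1 r2].
have r0 : 0 < r := lt_le_trans (ta_gt0 k) r1.
rewrite (heatD B X r0 c1 b1 cc bc) (heat_cst B (- c) X r0) (heat_heat B X r0 t2 cs s1).
apply: he; move: r1 r2; rewrite /ta /tb => r1 r2.
by clear bc; rewrite (tkS T k) (tkS T k.+1); apply/andP; split; lra.
Qed.

Lemma pot_grad_loc_k k i X (e : R) :
  (forall t, tk k.+1 <= t <= tk k -> `|dheat i t s X| <= e) ->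
  `|pot_grad k i X| <= 12 * tk k.+2 * e.
Proof.
move=> he; have t2 := tk_gt0 k.+2; have [c1 b1] := dheat_cb B cs s1 i t2.
rewrite (_ : 12 * tk k.+2 = tb k - ta k); last by rewrite /ta /tb; lra.
apply: (tavg_bound_loc (ta_gt0 k) (ltW (ta_ltb k)) c1 b1) => r /andP[r1 r2].
have r0 : 0 < r := lt_le_trans (ta_gt0 k) r1.
rewrite (heat_dheat B i X r0 t2 cs s1); apply: he; move: r1 r2; rewrite /ta /tb => r1 r2.
by rewrite (tkS T k) (tkS T k.+1); apply/andP; split; lra.
Qed.

Lemma pot_weak_k rho psi dpsi k : test_dirs B rho psi dpsi ->
  \sum_(i < n) Rintegral mu_ setT (fun X => pot_grad k i X * dpsi i X) =
  Rintegral mu_ setT (fun X => heat (tk k.+1) s X * psi X) -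
  Rintegral mu_ setT (fun X => heat (tk k) s X * psi X).
Proof.
move=> tst; have [r0 cp cd dp sp] := tst; have sp1 X h := (sp X h).1.
have t2 := tk_gt0 k.+2.
have If t (t0 : 0 < t) := supp_cts_integrable r0 cp sp1 (heat_cb B cs s1 t0).1.
rewrite (tavg_weak tst (ta_gt0 k) (ta_ltb k) t2 cs s1).
rewrite -(RintegralB measurableT (If (tk k.+1) (tk_gt0 _)) (If (tk k) (tk_gt0 _))).
apply: eq_Rintegral => X _; rewrite -mulrBl.
rewrite (_ : ta k + _ = tk k.+1); last by rewrite /ta (tkS T k.+1); lra.
by rewrite (_ : tb k + _ = tk k)//; rewrite /tb (tkS T k) (tkS T k.+1); lra.
Qed.

Lemma pot_flux_cvg rho psi dpsi : test_dirs B rho psi dpsi ->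
  Rintegral mu_ setT (fun X => heat (tk k) s X * psi X) @[k --> \oo] -->
  Rintegral mu_ setT (fun X => s X * psi X).
Proof.
move=> [r0 cp cd dp sp]; have sp1 X h := (sp X h).1.
have Ip : mu_.-integrable setT (EFin \o (fun X => `|psi X|)).
  by apply: (cts_supp_integrable (cts_norm cp) r0) => X /sp1 ->; rewrite normr0.
apply: (Rdominated_cvg _ _ Ip).
- move=> k; apply: continuous_measurable_row; apply: cts_mul cp.
  exact: (heat_cb B cs s1 (tk_gt0 k)).1.
- move=> X; apply: cvgM; last exact: cvg_cst.
  exact: (heat_cvg KB0 hKB tk_gt0 (tk_cvg0 T) cs s1).
- move=> k X; rewrite normrM -[leRHS]mul1r ler_wpM2r//.
  exact: (heat_cb B cs s1 (tk_gt0 k)).2.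
Qed.

(** The last clause localizes at one point with two levels of precision: [E] at heat times above
    [tk k0], and a crude [E'] at all times. Short times weigh [4^-k0] in [h] but [2^-k0] in the
    gradient, because the latter integrates [t^-1/2]. *)
Lemma scalar_potential : exists h (g : 'I_n -> 'rV[R]_n -> R) (nu : nat -> R),
  [/\ continuous h /\ (forall i, continuous (g i)),
      (forall X, `|h X| <= T) /\ (forall i X, `|g i X| <= 6 * Cg * Num.sqrt T),
      (forall i X, dird h X (row i B) (g i X)),
      [/\ forall i, mb B T (g i) nu, forall k, 0 <= nu k &
          forall N, \sum_(k < N) nu k <= 2304 * Cg ^+ 3 * Num.sqrt T] &
      (forall rho psi dpsi, test_dirs B rho psi dpsi ->
        \sum_(i < n) Rintegral mu_ setT (fun X => g i X * dpsi i X) =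
        Rintegral mu_ setT (fun X => s X * psi X) -
        Rintegral mu_ setT (fun X => heat T s X * psi X)) /\
      (forall X c E E' k0, 0 <= E -> 0 <= E' ->
        (forall t, 0 < t <= T -> `|heat t s X - c| <= E' /\
           forall i, `|dheat i t s X| <= E' / Num.sqrt t) ->
        (forall t, tk k0 <= t <= T -> `|heat t s X - c| <= E /\
           forall i, `|dheat i t s X| <= E / Num.sqrt t) ->
        `|h X - T * c| <= T * (E + (4^-1) ^+ k0 * E') /\
        forall i, `|g i X| <= 3 * Num.sqrt T * (E + (2^-1) ^+ k0 * E'))].
Proof.
have Cg0 := Cg_ge0 R n; have sT := sqrtr_ge0 T.
have h1 N : \sum_(k < N) 12 * tk k.+2 <= T.
  by rewrite sum_tavg_len lerBlDr lerDl ltW// tk_gt0.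
have C1 : 0 <= Cg * Num.sqrt T by rewrite mulr_ge0.
have half N : \sum_(k < N) (2^-1 : R) ^+ k <= 2.
  apply: le_trans (sum_geom _ _ _) _; try lra.
  by rewrite (_ : (1 - 2^-1)^-1 = 2)//; field.
have h2 N : \sum_(k < N) 3 * Cg * Num.sqrt T * (2^-1) ^+ k <= 6 * Cg * Num.sqrt T.
  rewrite -mulr_sumr; have := ler_wpM2l C1 (half N); lra.
have p0 k : 0 <= (2^-1 : R) ^+ k by rewrite exprn_ge0// invr_ge0.
have C3 : 0 <= Cg ^+ 3 * Num.sqrt T by rewrite mulr_ge0// exprn_ge0.
have c10 k : 0 <= 12 * tk k.+2 by rewrite mulr_ge0// ltW// tk_gt0.
have c20 k : 0 <= 3 * Cg * Num.sqrt T * (2^-1) ^+ k.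
  exact: (mulr_ge0 (mulr_ge0 (mulr_ge0 (ler0n R 3) Cg0) sT) (p0 k)).
have [h [g [[ch cg] [hb gb] dd uu [hc gc]]]] := gradient_series (fun k => (pot_cb k).1)
  (fun k i => (pot_grad_cb k i).1) c10 c20 (fun k => (pot_cb k).2)
  (fun k i => (pot_grad_cb k i).2) h1 h2 pot_dird.
exists h, g, (fun m => 1152 * Cg ^+ 3 * Num.sqrt T * (2^-1) ^+ m).
split; [by []|by []|exact: dd| |split].
- split=> [i m p q X|k|N].
  + have tm := tk_gt0 m; rewrite mulrC -ler_pdivlMr//.
    pose fN N Y := \sum_(k < N) pot_grad k i Y.
    have cN N : continuous (fN N).
      apply: (@cts_sum _ _ _ _ xpredT (fun (k : 'I_N) Y => pot_grad k i Y)) => k _.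
      exact: (pot_grad_cb k i).1.
    have bN N Y : `|fN N Y| <= 6 * Cg * Num.sqrt T.
      apply: le_trans (ler_norm_sum _ _ _) _; apply: le_trans (h2 N).
      by apply: ler_sum => k _; exact: (pot_grad_cb k i).2.
    have lN e : 0 < e -> exists k, forall Y, `|fN k Y - g i Y| <= e.
      by move=> /uu[N0 hN0]; exists N0 => Y; exact: hN0.
    have dN N : `|D2 p q (tk m) (fN N) X| <= 1152 * Cg ^+ 3 * Num.sqrt T * (2^-1) ^+ m / tk m.
      by rewrite ler_pdivlMr// mulrC; exact: pot_grad_mb.
    exact: (D2_limit tm cN bN (cg i) (gb i) lN dN).
  + have := mulr_ge0 C3 (p0 k); lra.
  + rewrite -mulr_sumr; have := ler_wpM2l C3 (half N); lra.
- move=> rho psi dpsi tst.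
  have c1 := weak_series tst (fun k i => (pot_grad_cb k i).1) cg uu.
  have := cvg_telescope (fun k => pot_weak_k k tst) c1 (pot_flux_cvg tst).
  by rewrite /tk expr0 mulr1.
- move=> X c E E' k0 E0 E'0 hE' hE.
  (* Block [k] uses heat times between [tk k.+1] and [tk k], which all lie above [tk k0] when
     [k < k0]. *)
  pose e k := E + (k0 <= k)%:R * E'.
  have tkT k t : tk k.+1 <= t <= tk k -> 0 < t <= T.
    move=> /andP[l1 l2]; rewrite (lt_le_trans (tk_gt0 _) l1)/=.
    exact: le_trans l2 (tk_le T0 k).
  have he k t : tk k.+1 <= t <= tk k -> `|heat t s X - c| <= e k /\
           forall i, `|dheat i t s X| <= e k / Num.sqrt t.
    move=> tt; have [b1 b2] := hE' t (tkT k t tt); have /andP[t0 tT] := tkT k t tt.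
    have si : 0 <= (Num.sqrt t)^-1 by rewrite invr_ge0 sqrtr_ge0.
    rewrite /e; case: leqP => k0k.
      rewrite mul1r; split=> [|i]; first by apply: le_trans b1 _; lra.
      by apply: le_trans (b2 i) _; rewrite ler_wpM2r//; lra.
    rewrite mul0r addr0; apply: hE; rewrite tT andbT.
    have /andP[l1 _] := tt; apply: le_trans l1.
    rewrite -(subnKC k0k) tkD; apply: ler_piMr; first exact: ltW (tk_gt0 _).
    by rewrite exprn_ile1 ?invr_ge0//; lra.
  split.
    have cv : `|\sum_(k < N) pot k X - (T - tk N) * c| @[N --> \oo] --> `|h X - T * c|.
      apply: cvg_norm; apply: cvgB => //; apply: cvgM; last exact: cvg_cst.
      by rewrite -[X in _ --> X]subr0; apply: cvgB; [exact: cvg_cst|exact: tk_cvg0].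
    apply: (seq_cvg_le cv); exists 0%N => N _.
    rewrite -sum_tavg_len mulr_suml -sumrB; apply: le_trans (ler_norm_sum _ _ _) _.
    apply: (@le_trans _ _ (\sum_(k < N) 3 / 4 * T * ((4^-1) ^+ k * e k))).
      apply: ler_sum => k _; apply: le_trans (pot_loc_k (fun t tt => (he k t tt).1)) _.
      by rewrite /tk !exprS le_eqVlt; apply/orP; left; apply/eqP; lra.
    have q0 : 0 <= 4^-1 :> R by rewrite invr_ge0.
    have q1 : 4^-1 < 1 :> R by lra.
    have cc : 0 <= (3 / 4 * T) := mulr_ge0 (divr_ge0 (ler0n R 3) (ler0n R 4)) (ltW T0).
    rewrite -mulr_sumr; apply: le_trans (ler_wpM2l cc (sum_geom_tail k0 N q0 q1 E0 E'0)) _.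
    rewrite (_ : (1 - 4^-1)^-1 = 4 / 3); last by field.
    by rewrite le_eqVlt; apply/orP; left; apply/eqP; field.
  move=> i; apply: (seq_cvg_le (cvg_norm (gc i X))); exists 0%N => N _.
  apply: le_trans (ler_norm_sum _ _ _) _.
  apply: (@le_trans _ _ (\sum_(k < N) 3 / 2 * Num.sqrt T * ((2^-1) ^+ k * e k))).
    apply: ler_sum => k _.
    have e0 : 0 <= e k by rewrite addr_ge0// mulr_ge0.
    have st : 0 < Num.sqrt (tk k.+1) by rewrite sqrtr_gt0 tk_gt0.
    have hd t : tk k.+1 <= t <= tk k -> `|dheat i t s X| <= e k / Num.sqrt (tk k.+1).
      move=> tt; apply: le_trans ((he k t tt).2 i) _; have /andP[l1 _] := tt.
      have t0 : 0 < t := lt_le_trans (tk_gt0 k.+1) l1.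
      apply: ler_wpM2l => //; rewrite lef_pV2 ?posrE//; last by rewrite sqrtr_gt0.
      by rewrite ler_sqrt// ltW.
    apply: le_trans (pot_grad_loc_k hd) _.
    rewrite (_ : 12 * tk k.+2 = 3 * tk k.+1); last by rewrite (tkS T k.+1); ring.
    rewrite -{1}(sqr_sqrtr (ltW (tk_gt0 k.+1))).
    rewrite (_ : 3 * _ * _ = 3 * Num.sqrt (tk k.+1) * e k); last by field; rewrite gt_eqF.
    by rewrite (sqrt_tk T0) !exprS le_eqVlt; apply/orP; left; apply/eqP; lra.
  have q0 : 0 <= 2^-1 :> R by rewrite invr_ge0.
  have q1 : 2^-1 < 1 :> R by lra.
  have cc : 0 <= (3 / 2 * Num.sqrt T) := mulr_ge0 (divr_ge0 (ler0n R 3) (ler0n R 2)) sT.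
  rewrite -mulr_sumr; apply: le_trans (ler_wpM2l cc (sum_geom_tail k0 N q0 q1 E0 E'0)) _.
  rewrite (_ : (1 - 2^-1)^-1 = 2); last by field.
  by rewrite le_eqVlt; apply/orP; left; apply/eqP; field.
Qed.

End potential.
End scalar_potential.

Lemma uniform_pairing (R : realType) (n : nat) (rho : R) (psi : 'rV[R]_n -> R)
    (f : nat -> 'rV[R]_n -> R) (g : 'rV[R]_n -> R) :
  0 <= rho -> continuous psi -> (forall X, rho < `|X| -> psi X = 0) ->
  (forall k, continuous (f k)) -> continuous g ->
  (forall r : R, 0 < r -> exists N0, forall N, (N0 <= N)%N ->
     forall X, `|\sum_(k < N) f k X - g X| <= r) ->
  \sum_(k < N) Rintegral (lebesgue_row R n) setT (fun X => f k X * psi X) @[N --> \oo]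
   --> Rintegral (lebesgue_row R n) setT (fun X => g X * psi X).
Proof.
move=> r0 cp p0 cf cg fu.
have If k := supp_cts_integrable r0 cp p0 (cf k).
have Ig := supp_cts_integrable r0 cp p0 cg.
have [M M0 hM] := cts_supp_bounded cp p0.
pose C := M * boxvol n rho.
have C0 : 0 <= C by rewrite mulr_ge0 ?boxvol_ge0.
apply/seq_cvgP => r rp; have rC : 0 < r / (C + 1) by rewrite divr_gt0// ltr_wpDl.
have [N0 hN0] := fu _ rC; exists N0 => N NN0.
have [IS ES] := Rintegral_sum (index_enum 'I_N) (fun k : 'I_N => If k).
rewrite -ES -(RintegralB measurableT IS Ig).
apply: (@le_lt_trans _ _ ((r / (C + 1)) * M * boxvol n rho)).
  apply: supp_Rintegral_le => //.
  - by rewrite mulr_ge0// ltW.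
  - apply: measurable_funB; [exact: (integ_measurable IS)|exact: (integ_measurable Ig)].
  - by move=> X h; rewrite big1 => [|k _]; rewrite (p0 X h) mulr0 ?subr0.
  - move=> X _; rewrite -mulr_suml -mulrBl normrM ler_pM//; exact: hN0.
rewrite -mulrA -/C mulrAC ltr_pdivrMr ?ltr_wpDl// mulrDr mulr1 ltrDl//.
Qed.

(** * Perturbation series for variable coefficients *)

Section patch.
Variables (R : realType) (n : nat) (B : 'M[R]_n) (T : R).
Hypothesis T0 : 0 < T.
Variables (KB : R).
Hypotheses (KB0 : 0 <= KB) (hKB : forall y : 'rV[R]_n, `|y *m B| <= KB * `|y|).
Implicit Types (X Y : 'rV[R]_n) (i j l p q : 'I_n).
Local Notation Cg := (Cg R n).
Local Notation Cw := (Cw n KB).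
Local Notation mu_ := (lebesgue_row R n).
Local Notation tk := (tk T).
Variables (b : 'I_n -> 'I_n -> 'rV[R]_n -> R) (eps : R) (beta : nat -> R).
Hypotheses (cb : forall j l, continuous (b j l)) (be : forall j l Y, `|b j l Y| <= eps).
Hypotheses (beta0 : forall k, 0 <= beta k) (betaS : forall N, \sum_(k < N) beta k <= eps).
Hypothesis (bb : forall k j l Y Z,
  `|b j l Y - b j l Z| <= beta k * expR (`|Y - Z| / Num.sqrt (tk k))).

(** One number bounds both the sup of the field and the total of its [mb] sequence; this is the norm
    in which the perturbation step contracts. *)
Definition good (P : R) (d : 'I_n -> 'rV[R]_n -> R) := 0 <= P /\
  [/\ forall i, continuous (d i), forall i X, `|d i X| <= P &
      exists nu, [/\ forall i, mb B T (d i) nu, forall k, 0 <= nu k &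
        forall N, \sum_(k < N) nu k <= P]].

Definition perturb (d : 'I_n -> 'rV[R]_n -> R) j X := \sum_(l < n) b j l X * d l X.

(** First term: [12 n] of [step_solver] times the factor [3 n Cw^2] of [perturb_mb]. Second term:
    [4096 n Cg^2] times the same factor. *)
Definition Cstep : R := 36 * n%:R ^+ 2 * Cw ^+ 2 + 12288 * n%:R ^+ 2 * Cw ^+ 2 * Cg ^+ 2.

Let eps0 : 0 <= eps.
Proof. by apply: le_trans (betaS 0); rewrite big_ord0. Qed.

Let Cw0 : 0 <= Cw ^+ 2. Proof. exact: sqr_ge0. Qed.

Lemma perturb_cb P d : good P d -> forall j, continuous (perturb d j) /\
  forall Y, `|perturb d j Y| <= n%:R * (eps * P).
Proof.
move=> [P0 [cd dP _]] j; split.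
  by apply: (@cts_sum _ _ _ _ xpredT) => l _; apply: cts_mul.
move=> Y; apply: le_trans (ler_norm_sum _ _ _) _.
rewrite -[X in _ <= X%:R * _]card_ord -sum1_card natr_sum mulr_suml.
by apply: ler_sum => l _; rewrite mul1r normrM ler_pM.
Qed.

(** Freezing [b] at the point costs its oscillation [beta k] against the sup of [d] and leaves [eps]
    times the sequence of [d]; both have a total of order [eps P]. *)
Lemma perturb_mb P d : good P d -> exists mu, [/\ forall j, mb B T (perturb d j) mu,
  forall k, 0 <= mu k & forall N, \sum_(k < N) mu k <= 3 * n%:R * Cw ^+ 2 * (eps * P)].
Proof.
move=> [P0 [cd dP [nu [dm nu0 nuS]]]].
have bP k : 0 <= beta k * P by rewrite mulr_ge0.
have en k : 0 <= eps * nu k by rewrite mulr_ge0.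
exists (fun k => n%:R * (2 * Cw ^+ 2 * (beta k * P) + eps * nu k)); split.
- move=> j k p q X; have tm := tk_gt0 T0 k; rewrite mulrC -ler_pdivlMr//.
  have h l : `|D2 B p q (tk k) (fun Y => b j l Y * d l Y) X| <=
      (2 * Cw ^+ 2 * (beta k * P) + eps * nu k) / tk k.
    have dm' : `|D2 B p q (tk k) (d l) X| <= nu k / tk k.
      by rewrite ler_pdivlMr// mulrC; exact: dm.
    apply: le_trans (D2_mul_bound KB0 hKB tm (@cb j l) (cd l) (dP l) (@be j l) (beta0 k) (@bb k j l) dm') _.
    by rewrite le_eqVlt; apply/orP; left; apply/eqP; field; rewrite (gt_eqF tm).
  have cm l : continuous (fun Y => b j l Y * d l Y) by apply: cts_mul.
  have bm l Y : `|b j l Y * d l Y| <= eps * P by rewrite normrM ler_pM.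
  apply: le_trans (@D2_sum_bound _ _ B _ (index_enum 'I_n) p q _ (fun l => _) (fun l => eps * P) _ X tm cm bm h) _.
  by rewrite sumr_const card_ord -[leLHS]mulr_natl [leLHS]mulrA.
- by move=> k; apply: (mulr_ge0 (ler0n R n)); apply: addr_ge0 (en k); exact: (mulr_ge0 (mulr_ge0 (ler0n R 2) Cw0) (bP k)).
- move=> N; rewrite -mulr_sumr big_split/= -!mulr_sumr -mulr_suml.
  have Cw1 : 1 <= Cw ^+ 2 by rewrite exprn_ege1// Cw_ge1.
  have h1 := ler_wpM2r P0 (betaS N).
  have h2 := ler_wpM2l eps0 (nuS N).
  have eP : 0 <= eps * P by rewrite mulr_ge0.
  rewrite (_ : 3 * _ * _ * _ = n%:R * (2 * Cw ^+ 2 * (eps * P) + Cw ^+ 2 * (eps * P))); last by ring.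
  apply: (ler_wpM2l (ler0n R n)); apply: lerD.
    exact: (ler_wpM2l (mulr_ge0 (ler0n R 2) Cw0) h1).
  by apply: le_trans h2 _; rewrite ler_peMl.
Qed.

Lemma perturb_step P d : good P d -> exists q : ('rV[R]_n -> R) * ('I_n -> 'rV[R]_n -> R) * ('rV[R]_n -> R),
  [/\ good (Cstep * eps * P) q.1.2,
      continuous q.1.1 /\ (forall X, `|q.1.1 X| <= 6 * n%:R ^+ 2 * Cg * Num.sqrt T * (eps * P)),
      (forall i X, dird q.1.1 X (row i B) (q.1.2 i X)),
      continuous q.2 /\ (forall X, `|q.2 X| <= n%:R ^+ 2 * Cg / Num.sqrt T * (eps * P)) &
      forall rho psi dpsi, test_dirs B rho psi dpsi ->
        \sum_(i < n) Rintegral mu_ setT (fun X => q.1.2 i X * dpsi i X) =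
        - \sum_(j < n) Rintegral mu_ setT (fun X => perturb d j X * dpsi j X) -
        Rintegral mu_ setT (fun X => q.2 X * psi X)].
Proof.
move=> gd; have [P0 _] := gd; have eP : 0 <= eps * P by rewrite mulr_ge0.
have [mu [hm mu0 muS]] := perturb_mb gd.
have cF j := (perturb_cb gd j).1; have bF j := (perturb_cb gd j).2.
have MF0 : 0 <= n%:R * (eps * P) by rewrite mulr_ge0.
have [u [d' [nu [[cu cd] [ub db] dd [m1 m2 m3] wk]]]] :=
  step_solver T0 cF bF MF0 mu0 hm muS KB0 hKB.
have fb := step_flux_cb B cF bF T0.
have Cg2 : 0 <= Cg ^+ 2 by exact: sqr_ge0.
have n2 : 0 <= n%:R ^+ 2 :> R by exact: sqr_ge0.
have c1 := mulr_ge0 (mulr_ge0 n2 Cw0) eP.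
have c2 := mulr_ge0 (mulr_ge0 (mulr_ge0 n2 Cw0) Cg2) eP.
have cs : 0 <= Cstep * eps * P.
  by rewrite /Cstep; lra.
exists (u, d', step_flux B (perturb d) T); split => //=.
- split=> //; split=> [//|i X|].
    by apply: le_trans (db i X) _; rewrite /Cstep; lra.
  exists nu; split=> // N; apply: le_trans (m3 N) _; rewrite /Cstep; lra.
- by split=> // X; apply: le_trans (ub X) _; lra.
- split; first exact: fb.1.
  by move=> X; apply: le_trans (fb.2 X) _; lra.
Qed.

Definition Cpatch : R := (12 * n%:R ^+ 2 * Cg + 2 * Cstep) * (6 * Cg + 2304 * Cg ^+ 3).

(** Neumann series: [d k.+1] is the gradient of the solution [u k] with data [b (d k)], and [z k] is
    the part of the data left at time [T]. *)
Lemma perturb_iterate g P : Cstep * eps <= 2^-1 -> good P g ->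
  exists (u : nat -> 'rV[R]_n -> R) (d : nat -> 'I_n -> 'rV[R]_n -> R) (z : nat -> 'rV[R]_n -> R),
  [/\ d 0%N = g,
      (forall k, good ((Cstep * eps) ^+ k * P) (d k)),
      (forall k, continuous (u k) /\
        forall X, `|u k X| <= 6 * n%:R ^+ 2 * Cg * Num.sqrt T * (eps * ((Cstep * eps) ^+ k * P))),
      (forall k i X, dird (u k) X (row i B) (d k.+1 i X)) &
      (forall k, continuous (z k) /\
        forall X, `|z k X| <= n%:R ^+ 2 * Cg / Num.sqrt T * (eps * ((Cstep * eps) ^+ k * P))) /\
      forall k rho psi dpsi, test_dirs B rho psi dpsi ->
        \sum_(i < n) Rintegral mu_ setT (fun X => d k.+1 i X * dpsi i X) =
        - \sum_(j < n) Rintegral mu_ setT (fun X => perturb (d k) j X * dpsi j X) -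
        Rintegral mu_ setT (fun X => z k X * psi X)].
Proof.
move=> small gg.
have h (p : ('I_n -> 'rV[R]_n -> R) * R) : exists q : ('rV[R]_n -> R) * ('I_n -> 'rV[R]_n -> R) * ('rV[R]_n -> R),
    good p.2 p.1 -> [/\ good (Cstep * eps * p.2) q.1.2,
      continuous q.1.1 /\ (forall X, `|q.1.1 X| <= 6 * n%:R ^+ 2 * Cg * Num.sqrt T * (eps * p.2)),
      (forall i X, dird q.1.1 X (row i B) (q.1.2 i X)),
      continuous q.2 /\ (forall X, `|q.2 X| <= n%:R ^+ 2 * Cg / Num.sqrt T * (eps * p.2)) &
      forall rho psi dpsi, test_dirs B rho psi dpsi ->
        \sum_(i < n) Rintegral mu_ setT (fun X => q.1.2 i X * dpsi i X) =
        - \sum_(j < n) Rintegral mu_ setT (fun X => perturb p.1 j X * dpsi j X) -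
        Rintegral mu_ setT (fun X => q.2 X * psi X)].
  have [gp|ngp] := pselect (good p.2 p.1).
    by have [q hq] := perturb_step gp; exists q.
  (* Arbitrary values where the hypothesis fails make the step a total function, to which [choice]
     applies. *)
  by exists (fun=> 0, fun _ _ => 0, fun=> 0).
have [F hF] := choice h.
pose S := fix S k := if k is k'.+1 then ((F (S k')).1.2, Cstep * eps * (S k').2) else (g, P).
have S2 k : (S k).2 = (Cstep * eps) ^+ k * P.
  by elim: k => [|k IH]/=; [rewrite expr0 mul1r|rewrite IH exprS mulrA].
have Sg k : good (S k).2 (S k).1.
  by elim: k => [//|k IH]; have [] := hF (S k) IH.
exists (fun k => (F (S k)).1.1), (fun k => (S k).1), (fun k => (F (S k)).2); split.
- by [].
- by move=> k; rewrite -S2.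
- by move=> k; have [_ + _ _ _] := hF (S k) (Sg k); rewrite S2.
- by move=> k; have [_ _ + _ _] := hF (S k) (Sg k).
- split=> k; first by have [_ _ _ + _] := hF (S k) (Sg k); rewrite S2.
  by have [_ _ _ _ +] := hF (S k) (Sg k).
Qed.

Lemma sum_small_geom (c : R) N : 0 <= c -> 0 <= Cstep * eps -> Cstep * eps <= 2^-1 ->
  \sum_(k < N) c * (Cstep * eps) ^+ k <= 2 * c.
Proof.
move=> c0 t0 t1; rewrite -mulr_sumr mulrC; apply: ler_wpM2r => //.
apply: le_trans (sum_geom _ t0 _) _; first by lra.
rewrite -[leRHS]invrK lef_pV2 ?posrE; lra.
Qed.

(** [G] is the gradient [g] of the potential plus all the corrections [d k.+1]. Each correction
    cancels the perturbation caused by the previous field, so the sum solves the perturbed equation,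
    and [z] collects the remainders at time [T]. *)
Lemma l_patch s : Cstep * eps <= 2^-1 -> continuous s -> (forall Y, `|s Y| <= 1) ->
  exists h (g : 'I_n -> 'rV[R]_n -> R) w (G : 'I_n -> 'rV[R]_n -> R) z,
  [/\ [/\ continuous w, forall i, continuous (G i), continuous z,
        forall i X, dird w X (row i B) (G i X) &
        forall X, `|z X| <= Cpatch * eps],
      (forall X, `|h X| <= T) /\ (forall i X, `|g i X| <= 6 * Cg * Num.sqrt T),
      (forall X, `|w X - h X| <= Cpatch * eps * T) /\
      (forall i X, `|G i X - g i X| <= Cpatch * eps * Num.sqrt T),
      (forall rho psi dpsi, test_dirs B rho psi dpsi ->
        \sum_(i < n) Rintegral mu_ setT (fun X => (G i X + perturb G i X) * dpsi i X) =
        Rintegral mu_ setT (fun X => (s X - heat B T s X - z X) * psi X)) &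
      (forall X c E E' k0, 0 <= E -> 0 <= E' ->
        (forall t, 0 < t <= T -> `|heat B t s X - c| <= E' /\
           forall i, `|dheat B i t s X| <= E' / Num.sqrt t) ->
        (forall t, tk k0 <= t <= T -> `|heat B t s X - c| <= E /\
           forall i, `|dheat B i t s X| <= E / Num.sqrt t) ->
        `|h X - T * c| <= T * (E + (4^-1) ^+ k0 * E') /\
        forall i, `|g i X| <= 3 * Num.sqrt T * (E + (2^-1) ^+ k0 * E'))].
Proof.
move=> small cs s1; have Cg0 := Cg_ge0 R n; have sT := sqrtr_ge0 T.
have sT0 : 0 < Num.sqrt T by rewrite sqrtr_gt0.
have TE : Num.sqrt T ^+ 2 = T by rewrite sqr_sqrtr// ltW.
have [h [g [nu [[ch cg] [hb gb] dh [gm nu0 nuS] [hw loc]]]]] := scalar_potential T0 KB0 hKB cs s1.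
pose K := 6 * Cg + 2304 * Cg ^+ 3; pose P := K * Num.sqrt T.
have C30 : 0 <= Cg ^+ 3 by exact: exprn_ge0.
have C1 := mulr_ge0 Cg0 sT; have C3 := mulr_ge0 C30 sT.
have K0 : 0 <= K by rewrite /K; lra.
have P0 : 0 <= P by rewrite /P mulr_ge0.
have gg : good P g.
  split=> //; split=> // [i X|]; first by apply: le_trans (gb i X) _; rewrite /P /K; lra.
  by exists nu; split=> // N; apply: le_trans (nuS N) _; rewrite /P /K; lra.
have [u [d [z [d0 dg hu ddu [hz wk]]]]] := perturb_iterate small gg.
pose th := Cstep * eps.
have Cst0 : 0 <= Cstep.
  have n2 : 0 <= n%:R ^+ 2 :> R by exact: sqr_ge0.
  have c1 := mulr_ge0 n2 Cw0; have c2 := mulr_ge0 c1 (sqr_ge0 Cg).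
  by rewrite /Cstep; lra.
have th0 : 0 <= th by exact: mulr_ge0.
have thk k : 0 <= th ^+ k by exact: exprn_ge0.
have cd k i : continuous (d k i) by have [_ []] := dg k.
have dP k i X : `|d k i X| <= th ^+ k * P by have [_ []] := dg k.
have a0 : 0 <= 6 * n%:R ^+ 2 * Cg * Num.sqrt T * (eps * P).
  have := mulr_ge0 (mulr_ge0 (sqr_ge0 (n%:R : R)) C1) (mulr_ge0 eps0 P0); lra.
have z0 : 0 <= n%:R ^+ 2 * Cg / Num.sqrt T * (eps * P).
  apply: mulr_ge0 (mulr_ge0 eps0 P0); apply: divr_ge0 sT; exact: (mulr_ge0 (sqr_ge0 _) Cg0).
have tP0 : 0 <= th * P by rewrite mulr_ge0.
have hu' k X : `|u k X| <= 6 * n%:R ^+ 2 * Cg * Num.sqrt T * (eps * P) * th ^+ k.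
  by apply: le_trans ((hu k).2 X) _; rewrite -/th; lra.
have hz' k X : `|z k X| <= n%:R ^+ 2 * Cg / Num.sqrt T * (eps * P) * th ^+ k.
  by apply: le_trans ((hz k).2 X) _; rewrite -/th; lra.
have hd' k i X : `|d k.+1 i X| <= th * P * th ^+ k.
  by apply: le_trans (dP k.+1 i X) _; rewrite exprS; lra.
have [U [D [[cU cD] [Ub Db] dU uu _]]] := gradient_series (fun k => (hu k).1)
  (fun k i => cd k.+1 i) (fun k => mulr_ge0 a0 (thk k)) (fun k => mulr_ge0 tP0 (thk k)) hu' hd'
  (fun N => sum_small_geom N a0 th0 small) (fun N => sum_small_geom N tP0 th0 small) ddu.
have [Z [cZ Zb _ uZ]] := uniform_series (fun k => (hz k).1) (fun k => mulr_ge0 z0 (thk k)) hz'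
  (fun N => sum_small_geom N z0 th0 small).
exists h, g, (fun X => h X + U X), (fun i X => g i X + D i X), Z.
have k1 : 2 * (6 * n%:R ^+ 2 * Cg * Num.sqrt T * (eps * P)) = 12 * n%:R ^+ 2 * Cg * K * eps * T.
  by rewrite /P -[in RHS]TE; ring.
have k2 : 2 * (n%:R ^+ 2 * Cg / Num.sqrt T * (eps * P)) = 2 * n%:R ^+ 2 * Cg * K * eps.
  by rewrite /P; field; rewrite (gt_eqF sT0).
have q1 : 0 <= n%:R ^+ 2 * Cg * K * eps := mulr_ge0 (mulr_ge0 (mulr_ge0 (sqr_ge0 _) Cg0) K0) eps0.
have q2 : 0 <= Cstep * K * eps := mulr_ge0 (mulr_ge0 Cst0 K0) eps0.
have CE : Cpatch * eps = 12 * (n%:R ^+ 2 * Cg * K * eps) + 2 * (Cstep * K * eps).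
  by rewrite /Cpatch /K; ring.
split; [split| by [] |split| |exact: loc].
- exact: cts_add.
- by move=> i; apply: cts_add.
- exact: cZ.
- by move=> i X; apply: dirdD.
- by move=> X; apply: le_trans (Zb X) _; rewrite k2 CE; lra.
- move=> X; rewrite addrAC subrr add0r; apply: le_trans (Ub X) _; rewrite k1 CE.
  by have := mulr_ge0 q2 (ltW T0); lra.
- move=> i X; rewrite addrAC subrr add0r; apply: le_trans (Db i X) _; rewrite CE /th /P.
  by have := mulr_ge0 q1 sT; lra.
- move=> rho psi dpsi tst; have [r0 cp cdp dp sp] := tst.
  have sp1 X hX := (sp X hX).1; have sp2 i X hX := (sp X hX).2 i.
  set G := fun i X => g i X + D i X.
  have cG i : continuous (G i) by exact: cts_add.
  have cp' (e : 'I_n -> 'rV[R]_n -> R) j : (forall l, continuous (e l)) -> continuous (perturb e j).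
    by move=> ce; apply: (@cts_sum _ _ _ _ xpredT) => l _; apply: cts_mul.
  have uP r : 0 < r -> exists N0, forall N, (N0 <= N)%N ->
      forall j X, `|\sum_(k < N) perturb (d k) j X - perturb G j X| <= r.
    move=> rp; have ne : 0 <= n%:R * eps by rewrite mulr_ge0.
    have r' : 0 < r / (n%:R * eps + 1) by rewrite divr_gt0// ltr_wpDl.
    (* The series for [D] starts at [d 1], while the perturbation also acts on [d 0 = g]: the
       partial sums are compared after one shift of the index. *)
    have [N0 hN0] := uu _ r'; exists N0.+1 => -[//|N] NN0 j X.
    rewrite big_ord_recl/= d0 (eq_bigr (fun k : 'I_N => perturb (d k.+1) j X)) //.
    have -> : perturb g j X + \sum_(k < N) perturb (d k.+1) j X - perturb G j X =
        \sum_(l < n) b j l X * (\sum_(k < N) d k.+1 l X - D l X).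
      rewrite /perturb exchange_big/= -big_split/= -sumrB; apply: eq_bigr => l _.
      by rewrite -mulr_sumr /G; ring.
    apply: le_trans (ler_norm_sum _ _ _) _.
    apply: (@le_trans _ _ (\sum_(l < n) eps * (r / (n%:R * eps + 1)))).
      by apply: ler_sum => l _; rewrite normrM ler_pM//; exact: hN0.
    rewrite sumr_const card_ord -[leLHS]mulr_natl [leLHS]mulrA [leLHS]mulrCA ler_piMr ?(ltW rp)//.
    by rewrite ler_pdivrMr ?ltr_wpDl// mul1r lerDl.
  have lA := weak_series tst (fun k i => cd k.+1 i) cD uu.
  have lB := weak_series tst (fun k j => cp' (d k) j (cd k)) (fun j => cp' G j cG) uP.
  have lZ := uniform_pairing r0 cp sp1 (fun k => (hz k).1) cZ uZ.
  have key : \sum_(i < n) Rintegral mu_ setT (fun X => D i X * dpsi i X) =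
     - \sum_(i < n) Rintegral mu_ setT (fun X => perturb G i X * dpsi i X)
     - Rintegral mu_ setT (fun X => Z X * psi X).
    have E : (fun N => \sum_(k < N) \sum_(i < n) Rintegral mu_ setT (fun X => d k.+1 i X * dpsi i X)) =
      (fun N => - \sum_(k < N) \sum_(j < n) Rintegral mu_ setT (fun X => perturb (d k) j X * dpsi j X)
        - \sum_(k < N) Rintegral mu_ setT (fun X => z k X * psi X)).
      by apply/funext => N; rewrite -sumrN -sumrB; apply: eq_bigr => k _; exact: (wk k _ _ _ tst).
    rewrite E in lA; apply: (cvg_unique _ lA); first exact: norm_hausdorff.
    by apply: cvgB => //; apply: cvgN.
  have hh := heat_cb B cs s1 T0.
  have Ig i := supp_cts_integrable r0 (cdp i) (sp2 i) (cg i).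
  have ID i := supp_cts_integrable r0 (cdp i) (sp2 i) (cD i).
  have IG i := supp_cts_integrable r0 (cdp i) (sp2 i) (cts_add (cg i) (cD i)).
  have IP i := supp_cts_integrable r0 (cdp i) (sp2 i) (cp' G i cG).
  have Is := supp_cts_integrable r0 cp sp1 cs.
  have Ih := supp_cts_integrable r0 cp sp1 hh.1.
  have Ish := supp_cts_integrable r0 cp sp1 (cts_sub cs hh.1).
  have IZ := supp_cts_integrable r0 cp sp1 cZ.
  have -> : Rintegral mu_ setT (fun X => (s X - heat B T s X - Z X) * psi X) =
      Rintegral mu_ setT (fun X => s X * psi X) - Rintegral mu_ setT (fun X => heat B T s X * psi X)
      - Rintegral mu_ setT (fun X => Z X * psi X).
    rewrite -(RintegralB measurableT Is Ih).
    rewrite (@eq_Rintegral _ _ _ mu_ setT (fun X => (s X - heat B T s X) * psi X - Z X * psi X)).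
      rewrite (RintegralB measurableT Ish IZ); congr (_ - _).
      by apply: eq_Rintegral => X _; rewrite mulrBl.
    by move=> X _; rewrite [LHS]mulrBl.
  rewrite -(hw _ _ _ tst).
  have -> : \sum_(i < n) Rintegral mu_ setT (fun X => (G i X + perturb G i X) * dpsi i X) =
     \sum_(i < n) (Rintegral mu_ setT (fun X => g i X * dpsi i X)
     + Rintegral mu_ setT (fun X => D i X * dpsi i X)
     + Rintegral mu_ setT (fun X => perturb G i X * dpsi i X)).
    apply: eq_bigr => i _; rewrite -(RintegralD measurableT (Ig i) (ID i)).
    rewrite (@eq_Rintegral _ _ _ mu_ setT (fun X => (g i X + D i X) * dpsi i X + perturb G i X * dpsi i X)).
      rewrite (RintegralD measurableT (IG i) (IP i)); congr (_ + _).
      by apply: eq_Rintegral => X _; rewrite mulrDl.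
    by move=> X _; rewrite [LHS]mulrDl.
  by rewrite !big_split/= key; lra.
Qed.

End patch.

(** * Solving on one patch *)

Section factorization.
Variable R : realType.

Definition quad n (A : 'M[R]_n) (x : 'rV[R]_n) : R := (x *m A *m x^T) ord0 ord0.

Lemma quad_block n (a : R) (v : 'rV[R]_n) (A : 'M[R]_n) (c : R) (x : 'rV[R]_n) :
  quad (block_mx a%:M v v^T A : 'M[R]_(1 + n)) (row_mx c%:M x) =
  a * c ^+ 2 + 2 * c * (x *m v^T) ord0 ord0 + quad A x.
Proof.
have E : v *m x^T = (x *m v^T)^T by rewrite trmx_mul trmxK.
rewrite /quad mul_row_block tr_row_mx mul_row_col !mulmxDl tr_scalar_mx.
rewrite !mul_scalar_mx !mul_mx_scalar -scalemxAl E.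
rewrite !(mxE _ (fun _ _ => _)) /= !mulr1n; ring.
Qed.

(** Elimination of the first coordinate: the Schur complement [S] is positive because [quad S x] is
    the value of [quad A] at the extension of [x] by the minimizing first coordinate [c]. *)
Lemma cholesky_step n (A : 'M[R]_(1 + n)) :
  (forall S : 'M[R]_n, S^T = S -> (forall x, x != 0 -> 0 < quad S x) ->
    exists B : 'M[R]_n, B^T *m B = S) ->
  A^T = A -> (forall x, x != 0 -> 0 < quad A x) -> exists B : 'M[R]_(1 + n), B^T *m B = A.
Proof.
move=> IH sA pA.
rewrite -[A]submxK in sA pA *.
move: (ulsubmx _) (ursubmx _) (dlsubmx _) (drsubmx _) sA pA => a v w A'.
rewrite tr_block_mx => /eq_block_mx[_ _ vw sA'] pA.
rewrite (mx11_scalar a) in pA *; rewrite -vw in pA *; set al := a ord0 ord0 in pA *.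
have al0 : 0 < al.
  have := pA (row_mx 1%:M 0); rewrite quad_block /quad !mul0mx !mxE mulr0 !addr0 expr1n mulr1.
  apply; apply/eqP => /(congr1 lsubmx); rewrite row_mxKl linear0 => /matrixP/(_ ord0 ord0).
  by rewrite !mxE/= => /eqP; rewrite oner_eq0.
have sa0 : 0 < Num.sqrt al by rewrite sqrtr_gt0.
have sE : Num.sqrt al * Num.sqrt al = al by rewrite -expr2 sqr_sqrtr// ltW.
pose S := A' - al^-1 *: (v^T *m v).
have sS : S^T = S by rewrite /S linearB/= linearZ/= trmx_mul trmxK sA'.
have pS x : x != 0 -> 0 < quad S x.
  move=> x0; pose c := - al^-1 * (x *m v^T) ord0 ord0.
  have := pA (row_mx c%:M x); rewrite quad_block.
  have -> : quad S x = al * c ^+ 2 + 2 * c * (x *m v^T) ord0 ord0 + quad A' x.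
    have -> : quad S x = quad A' x - al^-1 * (x *m v^T) ord0 ord0 ^+ 2.
      rewrite /quad /S mulmxBr mulmxBl.
      have -> : x *m (al^-1 *: (v^T *m v)) *m x^T = al^-1 *: ((x *m v^T) *m (x *m v^T)^T).
        by rewrite -scalemxAr -scalemxAl trmx_mul trmxK !mulmxA.
      move: (x *m v^T) (x *m A' *m x^T) => y z.
      by rewrite !mxE big_ord1 !mxE expr2.
    by rewrite /c; field; rewrite gt_eqF.
  apply; apply/eqP => /(congr1 rsubmx); rewrite row_mxKr linear0 => xe.
  by rewrite xe eqxx in x0.
have [B' hB] := IH S sS pS.
exists (block_mx (Num.sqrt al)%:M ((Num.sqrt al)^-1 *: v) 0 B' : 'M[R]_(1 + n)).
have ss : Num.sqrt al * (Num.sqrt al)^-1 = 1 by rewrite divff// gt_eqF.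
have E1 : (Num.sqrt al)%:M *m ((Num.sqrt al)^-1 *: v) = v.
  by rewrite mul_scalar_mx scalerA ss scale1r.
have tZ x : (x *: v)^T = x *: v^T by rewrite linearZ.
have E2 : ((Num.sqrt al)^-1 *: v)^T *m (Num.sqrt al)%:M = v^T.
  by rewrite tZ mul_mx_scalar scalerA ss scale1r.
have E3 : ((Num.sqrt al)^-1 *: v)^T *m ((Num.sqrt al)^-1 *: v) = al^-1 *: (v^T *m v).
  by rewrite tZ -scalemxAl -scalemxAr scalerA -invfM sE.
rewrite tr_block_mx mulmx_block !trmx0 !mul0mx !mulmx0 !addr0 tr_scalar_mx -scalar_mxM sE.
by rewrite E1 E2 E3 hB /S addrC subrK.
Qed.

Lemma cholesky n (A : 'M[R]_n) : A^T = A -> (forall x, x != 0 -> 0 < quad A x) ->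
  exists B : 'M[R]_n, B^T *m B = A.
Proof.
elim: n A => [|n IH] A sA pA; first by exists 0; apply/matrixP => -[].
exact: (@cholesky_step n A IH sA pA).
Qed.

Section bounds.
Variables (n : nat) (A B : 'M[R]_n) (kappa M : R).
Hypotheses (BA : B^T *m B = A) (k0 : 0 < kappa) (AM : forall j, A j j <= M).
Hypothesis (ell : forall x : 'rV[R]_n, kappa * \sum_i x ord0 i ^+ 2 <= quad A x).

Lemma quadE (x : 'rV[R]_n) : quad A x = \sum_j (x *m B^T) ord0 j ^+ 2.
Proof.
rewrite /quad -BA mulmxA -mulmxA -[B *m x^T]trmxK trmx_mul trmxK mxE.
by apply: eq_bigr => j _; rewrite [X in _ * X]mxE expr2.
Qed.

Lemma sqr_le_norm (x c : R) : 0 <= c -> x ^+ 2 <= c -> `|x| <= 1 + c.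
Proof.
move=> c0 xc; rewrite -(ler_pXn2r (n := 2)) ?nnegrE ?addr_ge0//.
by rewrite real_normK ?num_real//; nra.
Qed.

Lemma factor_entry i j : `|B i j| <= 1 + M.
Proof.
have h : B i j ^+ 2 <= A j j.
  rewrite -BA mxE (bigD1 i)//= [X in X * _]mxE -expr2 lerDl.
  by apply: sumr_ge0 => k _; rewrite mxE -expr2 sqr_ge0.
by apply: sqr_le_norm; [exact: le_trans (le_trans (sqr_ge0 _) h) (AM j)|exact: le_trans h (AM j)].
Qed.

Lemma factor_unit : B \in unitmx.
Proof.
rewrite -unitmx_tr -row_free_unit -kermx_eq0; apply/rowV0P => x /sub_kermxP xB.
apply/eqP; apply/negPn/negP => x0.
have : quad A x = 0.
  by rewrite quadE xB big1// => j _; rewrite mxE expr0n.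
move=> q0; have := ell x; rewrite q0 pmulr_rle0// => s0.
case/eqP: x0; apply/rowP => i; rewrite mxE; apply/eqP; rewrite -sqrf_eq0 eq_le sqr_ge0 andbT.
apply: le_trans s0; rewrite (bigD1 i)//= lerDl; apply: sumr_ge0 => k _; exact: sqr_ge0.
Qed.

(** The row [x] with [x B^T = e_j] has [quad A x = 1], so ellipticity bounds each of its entries,
    and these form column [j] of [invmx B]. *)
Lemma factor_inv_entry i j : `|invmx B i j| <= 1 + kappa^-1.
Proof.
apply: sqr_le_norm; first by rewrite invr_ge0 ltW.
pose x := (row j (invmx B)^T).
have xB : x *m B^T = delta_mx ord0 j.
  by rewrite /x -row_mul -trmx_mul mulmxV ?factor_unit// trmx1 row1.
have q1 : quad A x = 1.
  rewrite quadE xB (bigD1 j)//= !mxE !eqxx expr1n big1 ?addr0// => k /negPf kj.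
  by rewrite !mxE kj andbF expr0n.
have := ell x; rewrite q1 -ler_pdivlMl// mulr1; apply: le_trans.
rewrite (bigD1 i)//= !mxE lerDl; apply: sumr_ge0 => k _; exact: sqr_ge0.
Qed.

End bounds.

Lemma mulmx_row_bound n (B : 'M[R]_n) (c : R) : (forall i j, `|B i j| <= c) ->
  forall y : 'rV[R]_n, `|y *m B| <= n%:R * c * `|y|.
Proof.
move=> h y; apply: row_norm_le.
  apply: le_trans (_ : 0 <= n%:R * c * `|y|); first by [].
  case: n B h y => [|n] B h y; first by rewrite mul0r mul0r.
  by rewrite !mulr_ge0//; apply: le_trans (h ord0 ord0).
move=> j; rewrite mxE; apply: le_trans (ler_norm_sum _ _ _) _.
rewrite -mulrA -[X in _ <= X%:R * _]card_ord -sum1_card natr_sum mulr_suml.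
apply: ler_sum => i _; rewrite mul1r normrM mulrC ler_pM//; exact: ler_row_norm.
Qed.

End factorization.

(** * Sources concentrated near finitely many points *)

Section thin_sources.
Variables (R : realType) (n : nat).
Local Notation mu := (lebesgue_row R n).
Implicit Types (X Y : 'rV[R]_n).

Lemma boxvolE rho : 0 <= rho -> boxvol n rho = (2 * rho) ^+ n :> R.
Proof.
move=> r0; have E : mu (cbox rho) = ((2 * rho) ^+ n)%:E.
  rewrite (@lebesgue_row_box R n (fun=> `[- rho, rho]%classic))//.
  rewrite (eq_bigr (fun=> (2 * rho)%:E)) => [|i _].
    by rewrite prodEFin/= prodr_const card_ord.
  rewrite lebesgue_measure_itv/= lte_fin; case: ltP => h.
    by rewrite -EFinB; congr EFin; lra.
  by rewrite (_ : 2 * rho = 0)//; lra.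
rewrite /boxvol /Rintegral /bump integral_indic//; last exact: measurable_cbox.
by rewrite setIT; transitivity (fine (mu (cbox rho))) => //; rewrite E.
Qed.

(** In the variable [y] each ball of radius [delta] pulls back into a box of side [2 KI delta], so
    the source is carried by a set no larger than [N] such boxes. *)
Lemma thin_avg (k : 'rV[R]_n -> R) (phi : 'rV[R]_n -> 'rV[R]_n) (psi : 'rV[R]_n -> 'rV[R]_n)
    (S KI delta : R) (s : 'rV[R]_n -> R) N (Z : 'I_N -> 'rV[R]_n) X :
  (forall y, `|k y| <= S) -> mu.-integrable setT (EFin \o k) -> measurable_fun setT phi ->
  continuous s -> 0 <= delta -> 0 <= KI ->
  (forall Y y, `|X + phi y - Y| <= delta -> `|y - psi Y| <= KI * delta) ->
  (forall Y, `|s Y| <= \sum_(i < N) (`|Y - Z i| <= delta)%R%:R) ->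
  `|avg mu k phi s X| <= S * (N%:R * (2 * (KI * delta)) ^+ n).
Proof.
move=> kS Ik mphi cs d0 K0 hphi sN.
have S0 : 0 <= S by exact: le_trans (kS 0).
have Kd : 0 <= KI * delta by rewrite mulr_ge0.
have Ib i : mu.-integrable setT (EFin \o (fun y => bump (KI * delta) (y + - psi (Z i)))).
  exact: (integ_row_translate (- psi (Z i)) (bump_integrable n (KI * delta))).
have [IS ES] := Rintegral_sum (index_enum 'I_N) Ib.
have IG := integrableZl measurableT S IS.
have -> : S * (N%:R * (2 * (KI * delta)) ^+ n) =
    Rintegral mu setT (fun y => S * \sum_(i < N) bump (KI * delta) (y + - psi (Z i))).
  rewrite (RintegralZl S measurableT IS) ES; congr (_ * _).
  rewrite (eq_bigr (fun=> boxvol n (KI * delta))) => [|i _].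
    by rewrite sumr_const card_ord -[RHS]mulr_natl boxvolE.
  by rewrite (Rintegral_row_translate (- psi (Z i)) (integ_measurable (bump_integrable n (KI * delta)))).
apply: (avg_le Ik mphi cs IG) => y; apply: ler_pM => //.
apply: le_trans (sN _) _; apply: ler_sum => i _; rewrite bumpE.
case: (boolP (`|X + phi y - Z i| <= delta)%R) => [h|_]; last by [].
by rewrite mem_set//; apply/(cboxP _ Kd); exact: hphi.
Qed.

End thin_sources.

Lemma exprn_mono (R : realDomainType) n (x y : R) : 0 <= x -> x <= y -> x ^+ n <= y ^+ n.
Proof.
by move=> x0 xy; apply: lerXn2r; rewrite // ?nnegrE//; exact: le_trans x0 xy.
Qed.

(** * Linear change of coordinates in the weak equation *)

Section coordinates.
Variables (R : realType) (n : nat).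
Implicit Types (X Y : 'rV[R]_n) (B : 'M[R]_n).
Local Notation mu := (lebesgue_row R n).

Definition C1grad (w : 'rV[R]_n -> R) (G : 'I_n -> 'rV[R]_n -> R) :=
  [/\ continuous w, forall i, continuous (G i) &
      forall i X, dird w X (row i 1%:M) (G i X)].

(* [- div (A G) = f], tested against compactly supported C^1 functions. *)
Definition weakL (A : 'rV[R]_n -> 'M[R]_n) (G : 'I_n -> 'rV[R]_n -> R) (f : 'rV[R]_n -> R) :=
  forall rho psi dpsi, test_dirs 1%:M rho psi dpsi ->
    \sum_(i < n) Rintegral mu setT (fun X => (\sum_(j < n) A X i j * G j X) * dpsi i X) =
    Rintegral mu setT (fun X => f X * psi X).

Lemma row_dird_change B B' (C : 'M[R]_n) w (G : 'I_n -> 'rV[R]_n -> R) : B' = C *m B ->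
  (forall i, continuous (G i)) -> (forall i X, dird w X (row i B) (G i X)) ->
  forall k X, dird w X (row k B') (\sum_(i < n) C k i * G i X).
Proof.
move=> -> cG dG k X; rewrite row_mul mulmx_sum_row.
rewrite (eq_bigr (fun i => C k i *: row i B)) => [|i _]; last by rewrite mxE.
by apply: (@dird_dir_sum _ _ w _ _ (fun i => row i B) G (fun i => C k i)).
Qed.

Lemma test_dirs_change B rho psi dpsi : test_dirs 1%:M rho psi dpsi ->
  test_dirs B rho psi (fun i X => \sum_(j < n) B i j * dpsi j X).
Proof.
move=> [r0 cp cd dp sp]; split=> //.
- by move=> i; apply: (@cts_sum _ _ _ _ xpredT) => j _; apply: cts_mul => //; exact: cts_cst.
- by move=> i X; apply: (row_dird_change (B := 1%:M) (esym (mulmx1 B)) cd dp).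
- by move=> X /sp[-> h]; split=> // i; rewrite big1// => j _; rewrite h mulr0.
Qed.

(** Gradients and test gradients both transform by [B], so the form of [B^T B + b] becomes that of
    the identity plus [B^-T b B^-1]. *)
Lemma flux_change B (b : 'M[R]_n) (g p : 'I_n -> R) : B \in unitmx ->
  \sum_(i < n) (g i + \sum_(l < n) ((invmx B)^T *m b *m invmx B) i l * g l) *
     (\sum_(j < n) B i j * p j) =
  \sum_(i < n) (\sum_(j < n) (B^T *m B + b) i j * (\sum_(k < n) invmx B j k * g k)) * p i.
Proof.
move=> uB; pose gv := \col_i g i; pose pv := \col_i p i.
have mv (C : 'M[R]_n) (f : 'I_n -> R) i : \sum_(j < n) C i j * f j = (C *m (\col_i f i)) i ord0.
  by rewrite mxE; apply: eq_bigr => j _; rewrite mxE.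
have dt (u v : 'cV[R]_n) : \sum_(i < n) u i ord0 * v i ord0 = (u^T *m v) ord0 ord0.
  by rewrite mxE; apply: eq_bigr => i _; rewrite mxE.
set bt := _ *m invmx B.
have -> : \sum_(i < n) (g i + \sum_(l < n) bt i l * g l) * (\sum_(j < n) B i j * p j) =
    \sum_i (gv + bt *m gv) i ord0 * (B *m pv) i ord0.
  by apply: eq_bigr => i _; rewrite !mv [in RHS]mxE [X in _ = (X + _) * _]mxE.
have -> : \sum_(i < n) (\sum_(j < n) (B^T *m B + b) i j * (\sum_(k < n) invmx B j k * g k)) * p i =
    \sum_i ((B^T *m B + b) *m (invmx B *m gv)) i ord0 * pv i ord0.
  apply: eq_bigr => i _; rewrite [pv _ _]mxE; congr (_ * _); rewrite mxE.
  by apply: eq_bigr => j _; rewrite mv.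
rewrite !dt mulmxA -[X in (X *m pv) _ _ = _]trmxK trmx_mul trmxK; congr ((_^T *m _) _ _).
have kb : B^T *m bt = b *m invmx B.
  by rewrite /bt !mulmxA -trmx_mul mulVmx// trmx1 mul1mx.
have kB : B^T *m B *m invmx B = B^T by rewrite -mulmxA mulmxV// mulmx1.
by rewrite mulmxDr (mulmxA B^T) kb (mulmxA (_ + _)) mulmxDl kB mulmxDl.
Qed.

End coordinates.

Section patch_solver_tools.
Variables (R : realType) (n : nat) (kappa M : R).
Hypotheses (kappa0 : 0 < kappa) (M0 : 0 <= M).
Implicit Types (X Y : 'rV[R]_n) (B : 'M[R]_n).
Local Notation mu := (lebesgue_row R n).
Local Notation Cg := (Cg R n).

Lemma dheat_cst B i t (c : R) X : 0 < t -> dheat B i t (fun=> c) X = 0.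
Proof.
move=> t0; have cc (d : R) : continuous (fun _ : 'rV[R]_n => d) by exact: cts_cst.
have bc (d : R) (Y : 'rV[R]_n) : `|d| <= `|d| by [].
rewrite (heat_derive_comm X t0 (cc c) (bc c) (cc 0) (bc 0)); first exact: heat_cst.
by move=> Y; exact: dird_cst.
Qed.

(** Outside the ball where [s = c] the weight [2 exp (- La) exp (|Y - X| / sqrt T)] is at least [2],
    so it bounds [s - c] everywhere and [heat_weight] applies. *)
Lemma local_constant B KB t T s X c La : 0 <= KB -> (forall y : 'rV[R]_n, `|y *m B| <= KB * `|y|) ->
  0 < t -> t <= T -> continuous s -> (forall Y, `|s Y| <= 1) -> `|c| <= 1 ->
  (forall Y, `|Y - X| < La * Num.sqrt T -> s Y = c) ->
  `|heat B t s X - c| <= 2 * Cw n KB * expR (- La) /\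
  forall i, `|dheat B i t s X| <= 2 * Cw n KB * expR (- La) / Num.sqrt t.
Proof.
move=> KB0 hKB t0 tT cs s1 c1 sc.
have T0 := lt_le_trans t0 tT; have sT : 0 < Num.sqrt T by rewrite sqrtr_gt0.
have cc (d : R) : continuous (fun _ : 'rV[R]_n => d) by exact: cts_cst.
have bc (d : R) (Y : 'rV[R]_n) : `|d| <= `|d| by [].
have cF : continuous (fun Y => s Y + - c) by exact: cts_add.
have E0 : 0 <= 2 * expR (- La) by rewrite mulr_ge0 ?expR_ge0.
have hF Y : `|s Y + - c| <= 2 * expR (- La) * expR (`|Y - X| / Num.sqrt T).
  have [h|h] := ltP `|Y - X| (La * Num.sqrt T).
    by rewrite sc// subrr normr0 mulr_ge0 ?expR_ge0.
  apply: (@le_trans _ _ 2).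
    by apply: le_trans (ler_normB _ _) _; have := s1 Y; lra.
  rewrite -mulrA -expRD ler_peMr// -expR0 ler_expR addrC subr_ge0 ler_pdivlMr//.
have rt : Num.sqrt t <= Num.sqrt T by rewrite ler_sqrt// ltW.
split.
  rewrite -(heat_cst B c X t0) -[- heat _ _ _ _]mulN1r.
  rewrite (_ : -1 * heat B t (fun=> c) X = heat B t (fun=> - c) X); last by rewrite !heat_cst// mulN1r.
  rewrite -(heatD B X t0 cs s1 (cc (- c)) (bc (- c))).
  by apply: le_trans (heat_weight KB0 hKB t0 rt cF E0 hF) _; lra.
move=> i; rewrite -[dheat _ _ _ _ _]addr0 -(dheat_cst B i (- c) X t0).
rewrite -(dheatD B i X t0 cs s1 (cc (- c)) (bc (- c))).
apply: le_trans (dheat_weight KB0 hKB i t0 rt cF E0 hF) _.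
by rewrite le_eqVlt; apply/orP; left; apply/eqP; ring.
Qed.

Lemma thin_heat B KI t s N (Z : 'I_N -> 'rV[R]_n) delta X : 0 <= KI -> B \in unitmx ->
  (forall y : 'rV[R]_n, `|y *m invmx B| <= KI * `|y|) ->
  0 < t -> continuous s -> 0 <= delta ->
  (forall Y, `|s Y| <= \sum_(i < N) (`|Y - Z i| <= delta)%R%:R) ->
  `|heat B t s X| <= (Num.sqrt t)^-1 ^+ n * (N%:R * (2 * (KI * delta)) ^+ n) /\
  forall i, `|dheat B i t s X| <= Cg / Num.sqrt t *
    ((Num.sqrt t)^-1 ^+ n * (N%:R * (2 * (KI * delta)) ^+ n)).
Proof.
move=> KI0 uB hKI t0 cs d0 sN.
have hphi Y y : `|X + phiB B y - Y| <= delta -> `|y - (Y - X) *m invmx B| <= KI * delta.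
  move=> h; have -> : y - (Y - X) *m invmx B = (X + phiB B y - Y) *m invmx B.
    rewrite /phiB !mulmxBl mulmxDl -mulmxA (mulmxV uB) mulmx1 opprB.
    by rewrite [X *m _ + y]addrC -addrA.
  by apply: le_trans (hKI _) _; rewrite ler_wpM2l.
have gs r (y : 'rV[R]_n) : 0 < r -> t <= r -> gk r y <= (Num.sqrt t)^-1 ^+ n.
  move=> r0 tr; apply: le_trans (gk_sup y r0) _.
  have p4 : 1 <= 4 * pi :> R by have := @pi_ge2 R; lra.
  have tpr : t <= 4 * pi * r by apply: le_trans tr _; rewrite ler_peMl// ltW.
  have h : (Num.sqrt (4 * pi * r))^-1 <= (Num.sqrt t)^-1.
    have t1 := lt_le_trans t0 tpr.
    by rewrite lef_pV2 ?posrE ?sqrtr_gt0// ler_sqrt// ltW.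
  by apply: (exprn_mono _ _ h); rewrite invr_ge0 sqrtr_ge0.
split.
  have kS (y : 'rV[R]_n) : `|gk t y| <= (Num.sqrt t)^-1 ^+ n by rewrite ger0_norm ?gk_ge0//; exact: gs.
  exact: (thin_avg (psi := fun Y => (Y - X) *m invmx B) kS (gk_integrable n t0) (measurable_phiB B) cs d0 KI0 hphi sN).
move=> i; rewrite [leRHS]mulrA.
have kS (y : 'rV[R]_n) : `|dgk i t y| <= Cg / Num.sqrt t * (Num.sqrt t)^-1 ^+ n.
  apply: le_trans (dgk_le i y t0) _; rewrite mulrA; apply: ler_pM.
  - by rewrite mulr_ge0 ?invr_ge0 ?sqrtr_ge0// Cg_ge0.
  - exact: gk_ge0.
  - by rewrite mulrC.
  - by apply: gs; [rewrite mulr_gt0|lra].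
exact: (thin_avg (psi := fun Y => (Y - X) *m invmx B) kS (dgk_integrable i t0) (measurable_phiB B) cs d0 KI0 hphi sN).
Qed.

End patch_solver_tools.

(** [l_patch] transported by a Cholesky factor of [A0], with constants depending on [n], [kappa] and
    [M] only. The first local estimate serves to build cutoffs, as [w] is close to [c T] where the
    source is constantly [c]. In the second, the three terms of [e] come from a thin source at times
    above [tk T k0], from shorter times, and from the coefficients. *)
Lemma patch_solver (R : realType) (n : nat) (kappa M : R) : 0 < kappa -> 0 <= M ->
  exists C1 e0 : R, [/\ 1 <= C1, 0 < e0 &
  forall (A0 : 'M[R]_n) (T eps : R) (b : 'rV[R]_n -> 'M[R]_n) (beta : nat -> R) (s : 'rV[R]_n -> R),
  A0^T = A0 -> (forall x : 'rV[R]_n, kappa * \sum_i x ord0 i ^+ 2 <= quad A0 x) ->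
  (forall i, A0 i i <= M) ->
  0 < T -> eps <= e0 ->
  (forall i j, continuous (fun X => b X i j)) -> (forall i j X, `|b X i j| <= eps) ->
  (forall k, 0 <= beta k) -> (forall N, \sum_(k < N) beta k <= eps) ->
  (forall k i j Y Z, `|b Y i j - b Z i j| <= beta k * expR (`|Y - Z| / Num.sqrt (tk T k))) ->
  continuous s -> (forall Y, `|s Y| <= 1) ->
  exists w G f, [/\ C1grad w G, continuous f, weakL (fun X => A0 + b X) G f,
    [/\ forall X, `|w X| <= C1 * T, forall i X, `|G i X| <= C1 * Num.sqrt T &
        forall X, `|f X| <= 3] &
    (forall X c La, `|c| <= 1 -> (forall Y, `|Y - X| < La * Num.sqrt T -> s Y = c) ->
       `|w X - c * T| <= C1 * (expR (- La) + eps) * T) /\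
    (forall N (Z : 'I_N -> 'rV[R]_n) delta k0 X, 0 <= delta ->
       (forall Y, `|s Y| <= \sum_(i < N) (`|Y - Z i| <= delta)%R%:R) ->
       let e := (2 ^+ k0) ^+ n * (N%:R * (delta / Num.sqrt T) ^+ n) + (2^-1) ^+ k0 + eps in
       [/\ `|w X| <= C1 * e * T, forall i, `|G i X| <= C1 * e * Num.sqrt T &
           `|f X - s X| <= C1 * e])]].
Proof.
move=> kappa0 M0; pose mu := lebesgue_row R n.
(* Constants enter as opaque variables with a defining equation, so that [lra] sees them as
   atoms. *)
have def (x : R) : exists y, y = x by exists x.
have [KB KBE] := def (n%:R * (1 + M)); have [K1 K1E] := def (1 + kappa^-1).
have [KI KIE] := def (n%:R * K1).
have K10 : 0 <= K1 by rewrite K1E addr_ge0// invr_ge0 ltW.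
have KB0 : 0 <= KB by rewrite KBE mulr_ge0// addr_ge0.
have KI0 : 0 <= KI by rewrite KIE mulr_ge0.
(* [nb] is the loss in passing from [b] to [B^-T b B^-1]: [n^2] products of two entries of the
   inverse. *)
have [nb nbE] := def (KI ^+ 2); have nb0 : 0 <= nb by rewrite nbE; exact: sqr_ge0.
have [Cs CsE] := def (Cstep n KB); have [Cp CpE'] := def (Cpatch n KB * nb).
have [cw cwE] := def (Cw n KB).
have [Cg CgE] := def (Cg R n); have Cg0 : 0 <= Cg by rewrite CgE; exact: Cg_ge0.
 have cw1 : 1 <= cw by rewrite cwE; exact: Cw_ge1.
have Cs0 : 0 <= Cs.
  have c1 := mulr_ge0 (sqr_ge0 (n%:R : R)) (sqr_ge0 cw); have c2 := mulr_ge0 c1 (sqr_ge0 Cg).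
  by rewrite CsE /Cstep -cwE -CgE; lra.
have Cp0 : 0 <= Cp.
  rewrite CpE'; apply: mulr_ge0 nb0; rewrite /Cpatch -CsE -CgE; apply: mulr_ge0.
    by have := mulr_ge0 (sqr_ge0 (n%:R : R)) Cg0; lra.
  by have := exprn_ge0 3 Cg0; lra.
have [E1 E1E] := def ((1 + Cg) * (2 * KI) ^+ n); have [Ep EpE] := def (1 + Cg).
have E10 : 0 <= E1 by rewrite E1E mulr_ge0 ?exprn_ge0 ?addr_ge0 ?mulr_ge0.
have [S SE] := def (4 * cw + E1 + Ep + Cp + 6 * Cg).
have S0 : 1 <= S by lra.
(* This denominator of [e0] yields at once the smallness required by the perturbation series and the
   bounds [Cp eps <= 1] and [eps <= 1]. *)
have D0 : 0 < 2 * (1 + Cs * nb + Cp) by have := mulr_ge0 Cs0 nb0; lra.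
exists ((1 + 3 * KI) * S), (2 * (1 + Cs * nb + Cp))^-1; split.
- by have := mulr_ge0 KI0 (le_trans ler01 S0); lra.
- by rewrite invr_gt0.
move=> A0 T eps b beta s sA ell AM T0 he cb be beta0 betaS bb cs s1.
have eps0 : 0 <= eps by apply: le_trans (betaS 0%N); rewrite big_ord0.
have [hE1 hE2 hE3] : [/\ Cs * (nb * eps) <= 2^-1, Cp * eps <= 1 & eps <= 1].
  have := ler_wpM2r (ltW D0) he; rewrite mulVf ?gt_eqF// => h.
  have a1 := mulr_ge0 eps0 (mulr_ge0 Cs0 nb0); have a2 := mulr_ge0 eps0 Cp0.
  by split; lra.
have pA x : x != 0 -> 0 < quad A0 x.
  move=> x0; apply: lt_le_trans (ell x); apply: mulr_gt0 => //.
  have [i xi] : exists i, x ord0 i != 0.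
    apply/existsP; apply: contraNT x0; rewrite negb_exists => /forallP h.
    by apply/eqP/rowP => i; rewrite mxE; apply/eqP; have := h i; rewrite negbK.
  rewrite (bigD1 i)//=; apply: ltr_pwDl; first by rewrite exprn_even_gt0.
  by apply: sumr_ge0 => j _; exact: sqr_ge0.
have [B BA] := cholesky sA pA.
have uB := factor_unit BA kappa0 ell.
have hKB := mulmx_row_bound (factor_entry BA AM); rewrite -KBE in hKB.
have hKI := mulmx_row_bound (factor_inv_entry BA kappa0 ell); rewrite -K1E -KIE in hKI.
have eI := factor_inv_entry BA kappa0 ell; rewrite -K1E in eI.
have sT : 0 < Num.sqrt T by rewrite sqrtr_gt0.
pose bt i l X := ((invmx B)^T *m b X *m invmx B) i l.
have btE i l X : bt i l X = \sum_k (\sum_j invmx B j i * b X j k) * invmx B k l.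
  rewrite /bt mxE; apply: eq_bigr => k _; rewrite mxE; congr (_ * _).
  by apply: eq_bigr => j _; rewrite mxE.
have cst_sum (c : R) : \sum_(j < n) c = n%:R * c by rewrite sumr_const card_ord mulr_natl.
have hsum (D : 'M[R]_n) (d : R) i l : (forall j k, `|D j k| <= d) ->
    `|\sum_k (\sum_j invmx B j i * D j k) * invmx B k l| <= nb * d.
  move=> hD; apply: le_trans (ler_norm_sum _ _ _) _.
  apply: (@le_trans _ _ (\sum_(k < n) (n%:R * (K1 * d)) * K1)); last first.
    by rewrite cst_sum nbE KIE le_eqVlt; apply/orP; left; apply/eqP; ring.
  apply: ler_sum => k _; rewrite normrM; apply: ler_pM => //.
  apply: le_trans (ler_norm_sum _ _ _) _; rewrite -cst_sum.
  by apply: ler_sum => j _; rewrite normrM; apply: ler_pM.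
have cbt i l : continuous (bt i l).
  rewrite (_ : bt i l = fun X => \sum_k (\sum_j invmx B j i * b X j k) * invmx B k l).
    apply: (@cts_sum _ _ _ _ xpredT) => k _; apply: cts_mul; last exact: cts_cst.
    by apply: (@cts_sum _ _ _ _ xpredT) => j _; apply: cts_mul; [exact: cts_cst|exact: cb].
  by apply/funext => X; exact: btE.
have bte i l Y : `|bt i l Y| <= nb * eps by rewrite btE; exact: hsum.
have btb k i l Y Z : `|bt i l Y - bt i l Z| <=
    nb * beta k * expR (`|Y - Z| / Num.sqrt (tk T k)).
  rewrite !btE -sumrB.
  rewrite (eq_bigr (fun k => (\sum_j invmx B j i * (b Y - b Z) j k) * invmx B k l)) => [|q _].
    rewrite -mulrA; apply: hsum => p q; rewrite !mxE; exact: bb.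
  rewrite -mulrBl -sumrB; congr (_ * _); apply: eq_bigr => j _.
  by rewrite !mxE; ring.
have nbS N : \sum_(k < N) nb * beta k <= nb * eps by rewrite -mulr_sumr ler_wpM2l.
have nbe : 0 <= nb * eps by rewrite mulr_ge0.
have hE1' : Cstep n KB * (nb * eps) <= 2^-1 by rewrite -CsE.
have [h [g [w [G [z [[cw' cG cz dw zb] [hb gb] [wh Gg] wk loc]]]]]] :=
  l_patch T0 KB0 hKB cbt bte (fun k => mulr_ge0 nb0 (beta0 k)) nbS btb hE1' cs s1.
have hh := heat_cb B cs s1 T0.
have CpE : Cpatch n KB * (nb * eps) = Cp * eps by rewrite CpE' mulrA.
rewrite CpE in zb wh Gg; rewrite -CgE in gb.
have Cpe0 : 0 <= Cp * eps by rewrite mulr_ge0.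
pose Ge k X := \sum_(i < n) invmx B k i * G i X.
have Geb (d : R) X : (forall i, `|G i X| <= d) -> forall k, `|Ge k X| <= KI * d.
  move=> hd k; apply: le_trans (ler_norm_sum _ _ _) _; rewrite KIE -mulrA -cst_sum.
  by apply: ler_sum => i _; rewrite normrM; apply: ler_pM.
exists w, Ge, (fun X => s X - heat B T s X - z X); split.
- split=> //.
    by move=> i; apply: (@cts_sum _ _ _ _ xpredT) => j _; apply: cts_mul => //; exact: cts_cst.
  by move=> i X; apply: (row_dird_change (B := B)) => //; rewrite mulVmx.
- by apply: cts_sub => //; apply: cts_sub => //; exact: hh.1.
- move=> rho psi dpsi tst; have tB := test_dirs_change B tst.
  rewrite -(wk _ _ _ tB).
  have [r0 _ cdB _ spB] := tB; have [_ _ cd _ sp] := tst.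
  have IL i : mu.-integrable setT (EFin \o (fun X => (G i X + perturb bt G i X) *
      \sum_(j < n) B i j * dpsi j X)).
    apply: (supp_cts_integrable r0 (cdB i) (fun X h => (spB X h).2 i)).
    apply: cts_add => //; apply: (@cts_sum _ _ _ _ xpredT) => l _; exact: cts_mul.
  have IR i : mu.-integrable setT (EFin \o (fun X => (\sum_j (A0 + b X) i j * Ge j X) * dpsi i X)).
    apply: (supp_cts_integrable r0 (cd i) (fun X h => (sp X h).2 i)).
    apply: (@cts_sum _ _ _ _ xpredT) => j _; apply: cts_mul.
      rewrite (_ : (fun X => _) = fun X => A0 i j + b X i j); last by apply/funext => X; rewrite mxE.
      by apply: cts_add; [exact: cts_cst|exact: cb].
    by apply: (@cts_sum _ _ _ _ xpredT) => l _; apply: cts_mul => //; exact: cts_cst.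
  rewrite -(Rintegral_sum _ IL).2 -(Rintegral_sum _ IR).2.
  by apply: eq_Rintegral => X _; rewrite -BA -(flux_change (b X) (G ^~ X) (dpsi ^~ X) uB).
- have KS : 0 <= KI * S by rewrite mulr_ge0// (le_trans ler01).
  split=> [X|i X|X].
  + have -> : w X = h X + (w X - h X) by ring.
    apply: le_trans (ler_normD _ _) _; have := hb X; have := wh X => h1 h2.
    have h3 := ler_wpM2r (ltW T0) hE2; have h4 := mulr_ge0 KS (ltW T0).
    have h5 : 2 * T <= S * T by rewrite ler_pM2r//; clear - SE cw1 E10 EpE Cp0 Cg0; lra.
    by clear - h1 h2 h3 h4 h5; lra.
  + apply: le_trans (Geb ((6 * Cg + 1) * Num.sqrt T) X _ i) _.
      move=> l; have -> : G l X = g l X + (G l X - g l X) by ring.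
      apply: le_trans (ler_normD _ _) _; have := gb l X; have := Gg l X => h1 h2.
      by have h3 := ler_wpM2r (ltW sT) hE2; clear - h1 h2 h3; lra.
    rewrite mulrA; apply: ler_wpM2r; first exact: ltW.
    have h5 : KI * (6 * Cg + 1) <= KI * S by rewrite ler_wpM2l//; clear - SE cw1 E10 EpE Cp0 Cg0; lra.
    by clear - h5 KS KI0 S0; lra.
  + apply: le_trans (ler_normB _ _) _; apply: le_trans (lerD (ler_normB _ _) (lexx _)) _.
    have := s1 X; have := hh.2 X; have := zb X; clear - hE2; lra.
split=> [X c La c1 sc|N Z delta k0 X d0 sN e].
- have ls t (tt : 0 < t <= T) := local_constant KB0 hKB (andP tt).1 (andP tt).2 cs s1 c1 sc.
  rewrite -cwE in ls.
  have E0 : 0 <= 2 * cw * expR (- La) by rewrite mulr_ge0 ?expR_ge0// mulr_ge0// (le_trans ler01).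
  have [|hc _] := loc X c _ _ 0%N E0 E0 ls.
    by move=> t; rewrite /tk expr0 mulr1 => /andP[t1 t2]; apply: ls; rewrite (lt_le_trans T0 t1).
  have -> : w X - c * T = (w X - h X) + (h X - T * c) by ring.
  have hwX := wh X; rewrite expr0 mul1r in hc.
  apply: le_trans (ler_normD _ _) _.
  set x := expR _ in E0 hc *; have x0 : 0 <= x by exact: expR_ge0.
  have a1 := mulr_ge0 x0 (ltW T0); have a2 := mulr_ge0 eps0 (ltW T0).
  have S4 : 4 * cw <= S by clear - SE cw1 E10 EpE Cp0 Cg0; lra.
  have SC : Cp <= S by clear - SE cw1 E10 EpE Cp0 Cg0; lra.
  have b1 := ler_wpM2r a1 S4; have b2 := ler_wpM2r a2 SC.
  have S00 : 0 <= S by clear - S0; lra.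
  have b3 := mulr_ge0 (mulr_ge0 KI0 S00) a1; have b4 := mulr_ge0 (mulr_ge0 KI0 S00) a2.
  by clear - hc hwX b1 b2 b3 b4; lra.
have [ze zeE] := def ((2 ^+ k0) ^+ n * (N%:R * (delta / Num.sqrt T) ^+ n)).
have ze0 : 0 <= ze by rewrite zeE !mulr_ge0 ?exprn_ge0 ?divr_ge0 ?(ltW sT).
have [q qE] := def ((2^-1 : R) ^+ k0); have q0 : 0 <= q by rewrite qE exprn_ge0// invr_ge0.
have thin t : tk T k0 <= t -> `|heat B t s X| <= E1 * ze /\
    forall i, `|dheat B i t s X| <= E1 * ze / Num.sqrt t.
  move=> kt; have t0 := lt_le_trans (tk_gt0 T0 k0) kt.
  have [th1 th2] := thin_heat X KI0 uB hKI t0 cs d0 sN.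
  have st0 : 0 < Num.sqrt t by rewrite sqrtr_gt0.
  have [y yE0] := def ((Num.sqrt t)^-1 ^+ n * (N%:R * (2 * (KI * delta)) ^+ n)).
  rewrite -yE0 in th1 th2; rewrite -CgE in th2.
  have y0 : 0 <= y by rewrite yE0 !mulr_ge0 ?exprn_ge0 ?invr_ge0 ?(ltW st0) ?mulr_ge0.
  have yE : y <= (2 * KI) ^+ n * ze.
    have -> : (2 * KI) ^+ n * ze = (2 ^+ k0 / Num.sqrt T) ^+ n * (N%:R * (2 * (KI * delta)) ^+ n).
      by rewrite zeE !expr_div_n !exprMn; ring.
    rewrite yE0; apply: ler_wpM2r; first by rewrite mulr_ge0 ?exprn_ge0 ?mulr_ge0.
    have hs : (Num.sqrt t)^-1 <= 2 ^+ k0 / Num.sqrt T.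
      have := sqrt_tk T0 k0; have : Num.sqrt (tk T k0) <= Num.sqrt t by rewrite ler_sqrt// ltW.
      move=> h1 h2; rewrite h2 in h1.
      have sk : 0 < Num.sqrt T * (2^-1) ^+ k0 by rewrite mulr_gt0// exprn_gt0// invr_gt0.
      have -> : 2 ^+ k0 / Num.sqrt T = (Num.sqrt T * (2^-1) ^+ k0)^-1.
        by rewrite invfM -exprVn invrK mulrC.
      by rewrite lef_pV2 ?posrE.
    by apply: (exprn_mono _ _ hs); rewrite invr_ge0 ltW.
  have z1 : (1 + Cg) * y <= E1 * ze by rewrite E1E -mulrA ler_wpM2l ?addr_ge0.
  have Cy := mulr_ge0 Cg0 y0.
  split; first by apply: le_trans th1 _; clear - z1 Cy; lra.
  move=> i; apply: le_trans (th2 i) _; rewrite mulrAC; apply: ler_wpM2r.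
    by rewrite invr_ge0 ltW.
  by clear - z1 y0; lra.
have E0 : 0 <= E1 * ze by rewrite mulr_ge0.
have Ep0 : 0 <= Ep by rewrite EpE addr_ge0.
have crude t : 0 < t <= T -> `|heat B t s X - 0| <= Ep /\ forall i, `|dheat B i t s X| <= Ep / Num.sqrt t.
  move=> /andP[t0 _]; rewrite subr0; split=> [|i].
    by apply: le_trans ((heat_cb B cs s1 t0).2 X) _; rewrite EpE lerDl.
  apply: le_trans ((dheat_cb B cs s1 i t0).2 X) _; rewrite mulr1 -CgE.
  by apply: ler_wpM2r; [rewrite invr_ge0 sqrtr_ge0|rewrite EpE lerDr].
have [|hc gc] := loc X 0 _ _ k0 E0 Ep0 crude.
  by move=> t /andP[t1 _]; rewrite subr0; exact: thin.
rewrite mulr0 subr0 in hc.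
have q4 : (4^-1 : R) ^+ k0 <= q.
  rewrite qE; by apply: exprn_mono; rewrite ?invr_ge0//; clear; lra.
have eE : e = ze + q + eps by rewrite /e -zeE -qE.
clearbody e; rewrite -qE in gc.
have c1 := mulr_ge0 E10 ze0; have c2 := mulr_ge0 Ep0 q0.
have e0 : 0 <= e by clear - eE ze0 q0 eps0; lra.
have es : E1 * ze + Ep * q + Cp * eps <= S * e.
  have a1 := mulr_ge0 E10 q0; have a2 := mulr_ge0 E10 eps0.
  have a3 := mulr_ge0 Ep0 ze0; have a4 := mulr_ge0 Ep0 eps0.
  have a5 := mulr_ge0 Cp0 ze0; have a6 := mulr_ge0 Cp0 q0.
  have : 0 <= (4 * cw + 6 * Cg) * e by rewrite mulr_ge0//; clear - cw1 Cg0; lra.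
  by rewrite SE eE; clear - a1 a2 a3 a4 a5 a6; lra.
have S00 : 0 <= S by clear - S0; lra.
have KSe : 0 <= KI * (S * e) by rewrite !mulr_ge0.
split.
- have -> : w X = h X + (w X - h X) by ring.
  apply: le_trans (ler_normD _ _) _; have hw := wh X.
  have := ler_wpM2r (ltW T0) es; have := mulr_ge0 KSe (ltW T0).
  have := ler_wpM2l (ltW T0) (ler_wpM2r Ep0 q4).
  by clear - hw hc; lra.
- move=> i; apply: le_trans (Geb (3 * (S * e) * Num.sqrt T) X _ i) _.
    move=> l; have -> : G l X = g l X + (G l X - g l X) by ring.
    apply: le_trans (ler_normD _ _) _; have := gc l; have := Gg l X => h1 h2.
    have := ler_wpM2r (ltW sT) es; have := mulr_ge0 Cpe0 (ltW sT); clear - h1 h2; lra.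
  have := mulr_ge0 (mulr_ge0 S00 e0) (ltW sT); clear; lra.
- have -> : s X - heat B T s X - z X - s X = - (heat B T s X + z X) by ring.
  rewrite normrN; apply: le_trans (ler_normD _ _) _.
  have [hT _] := thin T (tk_le T0 k0); have := zb X.
  have := mulr_ge0 Ep0 q0; clear - hT es KSe; lra.
Qed.

(** * Dini moduli and extension of the coefficients *)

Section dini.
Variable R : realType.
Implicit Types (w : R -> R).
Local Notation lam := (@lebesgue_measure R).

(* The growth clause is iterated doubling; it is what the exponential weights absorb. *)
Definition dini_control w := [/\ w 0 = 0,
  forall s t, 0 <= s -> s <= t -> w s <= w t,
  exists2 C, 0 <= C & forall r l, 0 < r -> 0 <= l -> w (l * r) <= C * expR l * w r &
  forall e, 0 < e -> exists2 r0, 0 < r0 & forall r, 0 < r -> r <= r0 ->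
    w r <= e /\ forall N, \sum_(k < N) w (r * (2^-1) ^+ k) <= e].

Lemma dini_control_ge0 w : dini_control w -> forall t, 0 <= t -> 0 <= w t.
Proof. by move=> [w0 wm _ _] t t0; rewrite -w0; exact: wm. Qed.

Lemma le_pow2 (x : R) : exists j, x <= 2 ^+ j.
Proof.
have [x0|x0] := leP x 0; first by exists 0%N; rewrite expr0 (le_trans x0).
exists (Num.bound x); apply: le_trans (ltW (archi_boundP (ltW x0))) _.
by rewrite -natrX ler_nat ltnW// ltn_expl.
Qed.

Lemma doubling_growth w A : (forall s t, 0 <= s -> s <= t -> w s <= w t) ->
  (forall t, 0 <= t -> 0 <= w t) -> (forall t, 0 <= t -> w (2 * t) <= A * w t) ->
  exists2 C, 0 <= C & forall r l, 0 < r -> 0 <= l -> w (l * r) <= C * expR l * w r.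
Proof.
move=> wm w0 wd; pose A1 := Num.max A 1.
have A11 : 1 <= A1 by rewrite le_max lexx orbT.
have A10 : 0 <= A1 by exact: le_trans A11.
have wd1 t : 0 <= t -> w (2 * t) <= A1 * w t.
  by move=> t0; apply: le_trans (wd t t0) _; rewrite ler_wpM2r ?w0// le_max lexx.
have wj j t : 0 <= t -> w (2 ^+ j * t) <= A1 ^+ j * w t.
  elim: j => [|j IH] t0; first by rewrite !expr0 !mul1r.
  rewrite !exprS -!mulrA; apply: le_trans (wd1 _ _) _; first by rewrite mulr_ge0 ?exprn_ge0.
  by rewrite ler_wpM2l// IH.
have [p hp] := le_pow2 A1; have F0 : 0 < p.+1`!%:R :> R by rewrite ltr0n fact_gt0.
have C0 : 0 <= A1 * p.+1`!%:R by rewrite mulr_ge0.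
have C1 : 1 <= A1 * p.+1`!%:R by rewrite mulr_ege1// ler1n fact_gt0.
exists (A1 * p.+1`!%:R) => // r l r0 l0; have wr := w0 r (ltW r0).
have [l1|l1] := leP l 1.
  apply: (@le_trans _ _ (w r)).
    by apply: wm; [rewrite mulr_ge0// ltW|rewrite ler_piMl// ltW].
  by rewrite ler_peMl// mulr_ege1// -expR0 ler_expR.
have [j hj hmin] := ex_minnP (le_pow2 l).
case: j hj hmin => [|j] hj hmin; first by rewrite expr0 in hj; move: l1; rewrite ltNge hj.
have jl : 2 ^+ j < l.
  by rewrite ltNge; apply/negP => /hmin; rewrite ltnn.
apply: (@le_trans _ _ (w (2 ^+ j.+1 * r))).
  by apply: wm; [rewrite mulr_ge0// ltW|rewrite ler_wpM2r// ltW].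
apply: le_trans (wj _ _ (ltW r0)) _; rewrite ler_wpM2r// exprS -mulrA ler_wpM2l//.
apply: (@le_trans _ _ (l ^+ p.+1)); last first.
  have := @expR_ge1Dxn R l p l0; rewrite -ler_pdivrMl// mulrC; lra.
apply: (@le_trans _ _ ((2 ^+ j) ^+ p.+1)); last by apply: exprn_mono (ltW jl); exact: exprn_ge0.
rewrite -exprM mulnC exprM; apply: exprn_mono => //; apply: le_trans hp _.
by rewrite ler_eXn2l// ?ltr1n.
Qed.

(** On []2^-(k+1), 2^-k]] monotonicity gives [w t / t >= w (2^-(k+1)) 2^k], and the interval has
    length [2^-(k+1)], so each term is at most twice its share of the integral. *)
Lemma dini_partial_sums w : {within `[0, +oo[, continuous w} ->
  (forall s t, 0 <= s -> s <= t -> w s <= w t) -> (forall t, 0 <= t -> 0 <= w t) ->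
  (\int[lam]_(t in `]0%R, 1%R]) (w t / t)%:E < +oo)%E ->
  exists S : R, forall N, \sum_(k < N) w ((2^-1) ^+ k.+1) <= S.
Proof.
move=> cw wm w0 fin.
pose f t := (w t / t)%:E; pose h k : R := (2^-1) ^+ k.
have h0 k : 0 < h k by rewrite exprn_gt0// invr_gt0.
have hS k : h k = 2 * h k.+1 by rewrite /h exprS; lra.
have h1 k : h k <= 1 by rewrite exprn_ile1 ?invr_ge0//; lra.
have f0 t : 0 < t -> (0 <= f t)%E by move=> t0; rewrite lee_fin divr_ge0 ?w0 ?ltW.
have mw : @measurable_fun _ _ (measurableTypeR R) (measurableTypeR R) `[0%R, +oo[%classic w.
  by apply: subspace_continuous_measurable_fun.
have mi : @measurable_fun _ _ (measurableTypeR R) (measurableTypeR R) `]0%R, +oo[%classic (fun t => t^-1).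
  apply: open_continuous_measurable_fun; first exact: interval_open.
  move=> t; rewrite inE/= in_itv/= andbT => t0; apply: inv_continuous; rewrite gt_eqF//.
have mf (D : set (measurableTypeR R)) : measurable D -> D `<=` `]0%R, 1%R] -> measurable_fun D f.
  move=> mD D01; apply/measurable_EFinP; apply: measurable_funM.
    apply: measurable_funS mw => // t /D01/=; rewrite !in_itv/= => /andP[t0 _].
    by rewrite andbT ltW.
  apply: measurable_funS mi => // t /D01/=; rewrite !in_itv/= => /andP[t0 _].
  by rewrite t0.
have key N : ((\sum_(k < N) w (h k.+1) / 2)%:E <= \int[lam]_(t in `]h N, 1%R]) f t)%E.
  elim: N => [|N IH].
    by rewrite big_ord0; apply: integral_ge0 => t /=; rewrite in_itv/= => /andP[t0 _]; apply: f0; apply: lt_trans t0.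
  rewrite big_ord_recr/=.
  have E : `]h N.+1, 1%R]%classic = `]h N.+1, h N]%classic `|` `]h N, 1%R]%classic :> set R.
    apply/seteqP; split=> t /=; rewrite !in_itv/=.
      by move=> /andP[a b]; case: (leP t (h N)) => c; [left; rewrite a|right].
    case=> /andP[a b]; apply/andP; split=> //; first exact: le_trans b (h1 N).
    by apply: lt_trans a; rewrite (hS N) ltr_pMl// ltr1n.
  have sub1 : `]h N.+1, h N]%classic `<=` (`]0%R, 1%R]%classic : set R).
    move=> t /=; rewrite !in_itv/= => /andP[a b].
    by rewrite (lt_trans _ a)//= (le_trans b).
  have sub2 : `]h N, 1%R]%classic `<=` (`]0%R, 1%R]%classic : set R).
    by move=> t /=; rewrite !in_itv/= => /andP[a b]; rewrite (lt_trans _ a).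
  rewrite E ge0_integral_setU//=; last 3 first.
  - by apply: mf; [exact: measurableU|rewrite subUset].
  - by move=> t [/sub1|/sub2] /=; rewrite in_itv/= => /andP[t0 _]; exact: f0.
  - apply/disj_setPS => t /= []; rewrite !in_itv/= => /andP[_ a] /andP[b _].
    by move: b; rewrite ltNge a.
  rewrite EFinD addeC; apply: leeD => //.
  apply: (@le_trans _ _ (\int[lam]_(t in `]h N.+1, h N]) (cst (w (h N.+1) / h N)%:E t))%E).
    rewrite integral_cst//= lebesgue_measure_itv/= lte_fin ifT; last by rewrite (hS N) ltr_pMl// ltr1n.
    rewrite -EFinB -EFinM lee_fin (hS N) le_eqVlt; apply/orP; left; apply/eqP; field.
    by rewrite gt_eqF.
  apply: ge0_le_integral => //.
  - by move=> t _; rewrite lee_fin divr_ge0 ?w0 ?ltW.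
  - exact: mf.
  - move=> t /=; rewrite in_itv/= => /andP[a b]; rewrite lee_fin.
    have t0 : 0 < t by exact: lt_trans a.
    apply: ler_pM; [exact: w0 (ltW (h0 _))|by rewrite invr_ge0 ltW| |by rewrite lef_pV2 ?posrE].
    by apply: wm; exact: ltW.
exists (2 * fine (\int[lam]_(t in `]0%R, 1%R]) f t)%E) => N.
have fi : (\int[lam]_(t in `]0%R, 1%R]) f t)%E \is a fin_num.
  rewrite ge0_fin_numE//; apply: integral_ge0 => t /=; rewrite in_itv/= => /andP[t0 _]; exact: f0.
have : ((\sum_(k < N) w (h k.+1) / 2)%:E <= \int[lam]_(t in `]0%R, 1%R]) f t)%E.
  apply: le_trans (key N) _; apply: ge0_subset_integral => //.
  - exact: mf.
  - by move=> t /=; rewrite in_itv/= => /andP[t0 _]; exact: f0.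
  - by move=> t /=; rewrite !in_itv/= => /andP[a ->]; rewrite (lt_trans _ a).
rewrite -(fineK fi) lee_fin -mulr_suml; lra.
Qed.

(** Sums started at a radius below [2^-(N0+1)] are dominated termwise by a tail of the convergent
    series, and [w r] is itself the first term of such a sum. *)
Lemma dini_modulus_control w : dini_modulus w -> dini_control w.
Proof.
move=> [[cw wh w00 _] [A wA] fin].
have wm s t : 0 <= s -> s <= t -> w s <= w t.
  by move=> s0 st; apply: wh => //; rewrite in_itv/= ?s0// (le_trans s0 st).
have w0 t : 0 <= t -> 0 <= w t by move=> t0; rewrite -w00; exact: wm.
split=> //; first exact: doubling_growth wA.
move=> e e0; have [S hS] := dini_partial_sums cw wm w0 fin.
have h0 k : 0 <= (2^-1 : R) ^+ k by rewrite exprn_ge0// invr_ge0.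
have [N0 hN] := psum_cauchy (fun k => w0 _ (h0 k.+1)) hS e0.
exists ((2^-1) ^+ N0.+1) => [|r r0 rN]; first by rewrite exprn_gt0// invr_gt0.
have sum N : \sum_(k < N) w (r * (2^-1) ^+ k) <= e.
  apply: le_trans (hN N0 (N0 + N)%N (leqnn _) (leq_addr _ _)).
  rewrite -{1}(add0n N0) big_addn addKn big_mkord; apply: ler_sum => k _.
  apply: wm; first by rewrite mulr_ge0// ltW.
  by rewrite addnC -addSn exprD ler_wpM2r.
split=> //; apply: le_trans (sum 1%N).
by rewrite big_ord_recl big_ord0 expr0 mulr1 addr0.
Qed.

Lemma dini_controlZ c w : 0 <= c -> dini_control w -> dini_control (fun t => c * w t).
Proof.
move=> c0 [w0 wm [C C0 wC] wS]; split.
- by rewrite w0 mulr0.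
- by move=> s t s0 st; rewrite ler_wpM2l// wm.
- exists C => // r l r0 l0; rewrite mulrCA ler_wpM2l//; exact: wC.
- move=> e e0; have c1 : 0 < c + 1 by rewrite ltr_wpDl.
  have [r0 r00 hr] := wS (e / (c + 1)) (divr_gt0 e0 c1); exists r0 => // r rp rr.
  have [h1 h2] := hr r rp rr.
  have ce x : x <= e / (c + 1) -> c * x <= e.
    move=> xe; apply: le_trans (ler_wpM2l c0 xe) _.
    by rewrite mulrCA ler_piMr ?(ltW e0)// ler_pdivrMr// mul1r lerDl.
  by split=> [|N]; [exact: ce|rewrite -mulr_sumr; exact: ce].
Qed.

End dini.

(** * The Euclidean norm and the radial retraction *)

Section euclidean_norm.
Variables (R : realType) (n : nat).
Implicit Types (X Y Z : 'rV[R]_n).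

Lemma enorm_ge0 X : 0 <= enorm X.
Proof. exact: sqrtr_ge0. Qed.

Lemma sqr_enorm X : enorm X ^+ 2 = \sum_(i < n) X ord0 i ^+ 2.
Proof. by rewrite sqr_sqrtr//; apply: sumr_ge0 => i _; exact: sqr_ge0. Qed.

Lemma norm_le_enorm X : `|X| <= enorm X.
Proof.
apply: row_norm_le (enorm_ge0 X) _ => i.
rewrite -(ler_pXn2r (n := 2)) ?nnegrE ?enorm_ge0// sqr_enorm real_normK ?num_real//.
by rewrite (bigD1 i)//= lerDl; apply: sumr_ge0 => j _; exact: sqr_ge0.
Qed.

Lemma enorm_le_norm X : enorm X <= n%:R * `|X|.
Proof.
have nX : 0 <= n%:R * `|X| by rewrite mulr_ge0.
rewrite -(ler_pXn2r (n := 2)) ?nnegrE ?enorm_ge0// sqr_enorm exprMn.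
apply: (@le_trans _ _ (\sum_(i < n) `|X| ^+ 2)).
  by apply: ler_sum => i _; rewrite -(real_normK (num_real _)); apply: exprn_mono => //; exact: ler_row_norm.
rewrite sumr_const card_ord -[leLHS]mulr_natl ler_wpM2r ?sqr_ge0// -natrX ler_nat.
by case: n => // k; rewrite leq_pmull.
Qed.

Lemma enormZ c X : enorm (c *: X) = `|c| * enorm X.
Proof.
rewrite /enorm (eq_bigr (fun i => c ^+ 2 * X ord0 i ^+ 2)) => [|i _]; last by rewrite mxE exprMn.
by rewrite -mulr_sumr sqrtrM ?sqr_ge0// sqrtr_sqr.
Qed.

Lemma enormN X : enorm (- X) = enorm X.
Proof. by rewrite -scaleN1r enormZ normrN1 mul1r. Qed.

Lemma enormB X Y : enorm (X - Y) = enorm (Y - X).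
Proof. by rewrite -enormN opprB. Qed.

Lemma dot_le_enorm X Y : \sum_(i < n) X ord0 i * Y ord0 i <= enorm X * enorm Y.
Proof.
set p := \sum_(i < n) _; have x0 := enorm_ge0 X; have y0 := enorm_ge0 Y.
have expand (s t : R) : 0 <= s ^+ 2 * enorm X ^+ 2 - 2 * s * t * p + t ^+ 2 * enorm Y ^+ 2.
  rewrite !sqr_enorm /p !mulr_sumr -sumrB -big_split/=; apply: sumr_ge0 => i _.
  by rewrite (_ : _ + _ = (s * X ord0 i - t * Y ord0 i) ^+ 2) ?sqr_ge0//; ring.
have [xp|xp] := ltP 0 (enorm X); last first.
  have x00 : enorm X = 0 by apply/eqP; rewrite eq_le xp x0.
  have := norm_le_enorm X; rewrite x00 normr_le0 => /eqP X0.
  by rewrite mul0r /p big1// => i _; rewrite X0 mxE mul0r.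
have [yp|yp] := ltP 0 (enorm Y); last first.
  have y00 : enorm Y = 0 by apply/eqP; rewrite eq_le yp y0.
  have := norm_le_enorm Y; rewrite y00 normr_le0 => /eqP Y0.
  by rewrite mulr0 /p big1// => i _; rewrite Y0 mxE mulr0.
have := expand (enorm Y) (enorm X).
rewrite (_ : _ + _ = 2 * (enorm X * enorm Y) * (enorm X * enorm Y - p)); last by ring.
by rewrite pmulr_rge0 ?subr_ge0// !mulr_gt0.
Qed.

Lemma enormD X Y : enorm (X + Y) <= enorm X + enorm Y.
Proof.
have s0 : 0 <= enorm X + enorm Y by rewrite addr_ge0 ?enorm_ge0.
rewrite -(ler_pXn2r (n := 2)) ?nnegrE ?enorm_ge0// sqr_enorm.
rewrite (eq_bigr (fun i => X ord0 i ^+ 2 + 2 * (X ord0 i * Y ord0 i) + Y ord0 i ^+ 2)) => [|i _]; last first.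
  by rewrite mxE; ring.
rewrite !big_split/= -mulr_sumr -!sqr_enorm.
have := dot_le_enorm X Y; lra.
Qed.

Lemma enorm_distD Z X Y : enorm (X - Y) <= enorm (X - Z) + enorm (Z - Y).
Proof. by apply: le_trans (enormD _ _); rewrite addrA subrK. Qed.

Lemma enorm_dist X Y : `|enorm X - enorm Y| <= enorm (X - Y).
Proof.
have h1 := enormD (X - Y) Y; have h2 := enormD (Y - X) X.
by rewrite subrK in h1; rewrite subrK (enormB Y) in h2; rewrite ler_norml; apply/andP; split; lra.
Qed.

Lemma enorm_continuous c : continuous (fun X => enorm (X - c)).
Proof.
move=> X; apply/continuous_epsP => e e0; exists (e / (n%:R + 1)).
  by rewrite divr_gt0// ltr_wpDl.
move=> Y h; apply: le_lt_trans (enorm_dist _ _) _.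
rewrite opprB addrA subrK; apply: le_lt_trans (enorm_le_norm _) _.
apply: (@le_lt_trans _ _ ((n%:R + 1 / 2) * `|Y - X|)); first by rewrite ler_wpM2r//; lra.
by move: h; rewrite ltr_pdivlMr ?ltr_wpDl// mulrC; have := normr_ge0 (Y - X); lra.
Qed.

(** Radial projection onto the closed ball of radius [r]; the maximum avoids a case distinction and
    a division by zero at the origin. *)
Definition retract (r : R) X := (r / Num.max r (enorm X)) *: X.

Lemma retract_id r X : 0 < r -> enorm X <= r -> retract r X = X.
Proof. by move=> r0 h; rewrite /retract max_l// divff ?scale1r// gt_eqF. Qed.

Lemma retract_le r X : 0 < r -> enorm (retract r X) <= r.
Proof.
move=> r0; rewrite /retract enormZ ger0_norm; last first.
  by rewrite divr_ge0 ?(ltW r0)// le_max (ltW r0).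
have m0 : 0 < Num.max r (enorm X) by rewrite lt_max r0.
by rewrite mulrAC ler_pdivrMr// ler_pM2l// le_max lexx orbT.
Qed.

Lemma retract_lip r X Y : 0 < r -> enorm (retract r X - retract r Y) <= 2 * enorm (X - Y).
Proof.
move=> r0; rewrite /retract.
set p := Num.max r (enorm X); set q := Num.max r (enorm Y).
have p0 : 0 < p by rewrite lt_max r0.
have q0 : 0 < q by rewrite lt_max r0.
have rp : r <= p by rewrite le_max lexx.
have Yq : enorm Y <= q by rewrite le_max lexx orbT.
have pq : `|q - p| <= enorm (X - Y).
  have := enorm_dist X Y; rewrite !ler_norml => /andP[h1 h2].
  have e0 := enorm_ge0 (X - Y).
  by rewrite /p /q !maxEle; case: ifP => a; case: ifP => b; apply/andP; split; lra.
have -> : (r / p) *: X - (r / q) *: Y = (r / p) *: (X - Y) + ((r / p) * ((q - p) / q)) *: Y.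
  by apply/rowP => i; rewrite !mxE; field; rewrite (gt_eqF p0) (gt_eqF q0).
apply: le_trans (enormD _ _) _; rewrite !enormZ.
have rp0 : 0 <= r / p by rewrite divr_ge0// ltW.
have rp1 : r / p <= 1 by rewrite ler_pdivrMr// mul1r.
have qi : 0 <= q^-1 by rewrite invr_ge0 ltW.
rewrite (normrM (r / p)) (normrM (q - p)) (ger0_norm rp0) (ger0_norm qi).
have e0 := enorm_ge0 (X - Y).
have h1 : r / p * enorm (X - Y) <= enorm (X - Y) by rewrite ler_piMl.
have h2 : r / p * (`|q - p| / q) * enorm Y <= enorm (X - Y).
  rewrite -mulrA; apply: (@le_trans _ _ (`|q - p| / q * enorm Y)).
    by rewrite ler_piMl// mulr_ge0 ?enorm_ge0// divr_ge0// ltW.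
  rewrite mulrAC ler_pdivrMr//; apply: ler_pM => //; exact: enorm_ge0.
by lra.
Qed.

End euclidean_norm.

(** * Extension and localization of the coefficients *)

Section coefficients.
Variables (R : realType) (n : nat).
Implicit Types (X Y Z : 'rV[R]_n).

(** Precomposition with the radial retraction onto a smaller concentric ball keeps symmetry,
    ellipticity and the modulus up to a constant, and gives a bounded field on the whole space. *)
Lemma extend_coefficients (c : 'rV[R]_n) (radius r1 : R) (a : 'rV[R]_n -> 'M[R]_n) :
  0 < r1 -> r1 < radius -> elliptic_coefficients (eball c radius) a ->
  exists (a' : 'rV[R]_n -> 'M[R]_n) (kappa M : R) (w : R -> R), [/\ 0 < kappa /\ 0 <= M,
    (forall X, (a' X)^T = a' X) /\
      (forall X (x : 'rV[R]_n), kappa * \sum_i x ord0 i ^+ 2 <= quad (a' X) x),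
    (forall X i j, `|a' X i j| <= M),
    dini_control w /\ (forall X Y i j, `|a' X i j - a' Y i j| <= w `|X - Y|) &
    forall X, eball c r1 X -> a' X = a X].
Proof.
move=> r10 r1r [sa [kappa k0 ell] [w0 dm hw]].
have [_ [A hA] _] := dm; have dc := dini_modulus_control dm; have [w00 wm _ _] := dc.
pose P X := c + retract r1 (X - c).
have PU X : eball c radius (P X).
  by rewrite /eball/= /P addrC addKr; apply: le_lt_trans (retract_le _ r10) r1r.
have A0 : 0 <= A.
  have w1 : 0 < w0 1 by have [[_ _ _ h] _ _] := dm; exact: h.
  have : 0 <= A * w0 1 by apply: le_trans (hA 1 _) => //; apply: dini_control_ge0 => //; rewrite mulr1.
  by rewrite pmulr_lge0.
have pw j t : 0 <= t -> w0 (2 ^+ j * t) <= A ^+ j * w0 t.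
  move=> t0; elim: j => [|j IH]; first by rewrite !expr0 !mul1r.
  rewrite !exprS -!mulrA; apply: le_trans (hA _ _) _; first by rewrite mulr_ge0 ?exprn_ge0.
  by rewrite ler_wpM2l.
(* [A ^+ n.+1] is the price of [n + 1] doublings: one for the Lipschitz constant [2] of the
   retraction, [n] for passing to the sup norm, as [n <= 2^n]. *)
have Pb X Y i j : `|a (P X) i j - a (P Y) i j| <= A ^+ n.+1 * w0 `|X - Y|.
  apply: le_trans (hw _ _ i j (PU X) (PU Y)) _; apply: le_trans (pw n.+1 _ (normr_ge0 _)).
  apply: wm; first exact: enorm_ge0.
  rewrite /P opprD addrACA subrr add0r; apply: le_trans (retract_lip _ _ r10) _.
  rewrite opprB addrA subrK exprS -mulrA ler_wpM2l//; apply: le_trans (enorm_le_norm _) _.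
  by rewrite ler_wpM2r// -natrX ler_nat ltnW// ltn_expl.
exists (a \o P), kappa, (\sum_(i < n) \sum_(j < n) `|a c i j| + w0 r1), (fun t => A ^+ n.+1 * w0 t).
have w1 : 0 <= w0 r1 by apply: dini_control_ge0 => //; exact: ltW.
split.
- by split=> //; rewrite addr_ge0// sumr_ge0// => i _; exact: sumr_ge0.
- split=> [X|X x]; first exact: sa.
  by rewrite -sqr_enorm; exact: ell.
- move=> X i j /=; have cU : eball c radius c.
    by rewrite /eball/= subrr -[0](scale0r c) enormZ normr0 mul0r; exact: lt_trans r1r.
  have h := hw _ _ i j (PU X) cU.
  have h2 : w0 (enorm (P X - c)) <= w0 r1.
    by apply: wm; [exact: enorm_ge0|rewrite /P addrC addKr; exact: retract_le].
  have h3 : `|a c i j| <= \sum_(i < n) \sum_(j < n) `|a c i j|.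
    rewrite (bigD1 i)//= (bigD1 j)//= -addrA lerDl addr_ge0//; first by rewrite sumr_ge0.
    by apply: sumr_ge0 => k _; exact: sumr_ge0.
  have -> : a (P X) i j = a c i j + (a (P X) i j - a c i j) by ring.
  by apply: le_trans (ler_normD _ _) _; lra.
- by split=> //; apply: dini_controlZ => //; exact: exprn_ge0.
- by move=> X hX; rewrite /= /P retract_id ?(ltW hX)// addrC subrK.
Qed.

Definition cut (t : R) : R := Num.min 1 (Num.max 0 (2 - t)).

Lemma cut_ge0 t : 0 <= cut t.
Proof. by rewrite /cut le_min ler01 le_max lexx. Qed.

Lemma cut_le1 t : cut t <= 1.
Proof. by rewrite /cut ge_min lexx. Qed.

Lemma cutE t : cut t = if t <= 1 then 1 else if t <= 2 then 2 - t else 0.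
Proof.
rewrite /cut; case: leP => a; first by rewrite max_r ?min_l//; lra.
case: leP => b; first by rewrite max_r ?min_r//; lra.
by rewrite max_l ?min_r//; lra.
Qed.

Lemma cut_eq1 t : t <= 1 -> cut t = 1.
Proof. by move=> h; rewrite cutE h. Qed.

Lemma cut_eq0 t : 2 <= t -> cut t = 0.
Proof. by move=> h; rewrite cutE; case: leP => a; [lra|case: leP => b; lra]. Qed.

Lemma cut_lip s t : `|cut s - cut t| <= `|s - t|.
Proof.
have := ler_norm (s - t); have := ler_norm (- (s - t)); rewrite normrN => h1 h2.
rewrite !cutE ler_norml; case: (leP s 1) => a; case: (leP t 1) => b; try (apply/andP; split; lra).
- by case: (leP t 2) => c; apply/andP; split; lra.
- by case: (leP s 2) => c; apply/andP; split; lra.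
- by case: (leP s 2) => c; case: (leP t 2) => d; apply/andP; split; lra.
Qed.

Lemma cut_continuous (f : 'rV[R]_n -> R) : continuous f -> continuous (cut \o f).
Proof.
move=> cf; rewrite (_ : _ \o _ = fun X => Num.min 1 (Num.max 0 (2 - f X))); last by apply/funext.
apply: cts_min; first exact: cts_cst.
by apply: cts_max; [exact: cts_cst|apply: cts_sub => //; exact: cts_cst].
Qed.

Lemma norm_shift_continuous Q : continuous (fun X => `|X - Q|).
Proof.
move=> X; apply/continuous_epsP => e e0; exists e => // Y h.
apply: le_lt_trans (ler_dist_dist _ _) _; rewrite opprB addrA subrK//.
Qed.

Lemma control_continuous (f : 'rV[R]_n -> R) w : dini_control w ->
  (forall X Y, `|f X - f Y| <= w `|X - Y|) -> continuous f.
Proof.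
move=> [_ wm _ ws] hf X; apply/continuous_epsP => e e0.
have [r0 r00 hr] := ws (e / 2) (divr_gt0 e0 (ltr0Sn R 1)); exists r0 => // Y h.
apply: le_lt_trans (hf Y X) _; apply: (@le_lt_trans _ _ (e / 2)); last by lra.
by apply: le_trans (wm _ _ (normr_ge0 _) (ltW h)) _; have [] := hr r0 r00 (lexx _).
Qed.

(** [beta k] adds the oscillation of [a] over the length [rho 2^-k = sqrt t_k] and that of the
    cutoff, of order [2^-k]. Larger distances cost an exponential in these units. Both sums are
    small once [rho] is small, the first by the Dini condition, the second because [a - a(Q)] is
    small on the support. *)
Lemma local_perturbation (a : 'rV[R]_n -> 'M[R]_n) w : dini_control w ->
  (forall X Y i j, `|a X i j - a Y i j| <= w `|X - Y|) ->
  forall L e : R, 1 <= L -> 0 < e -> exists2 r0, 0 < r0 & forall rho Q, 0 < rho -> rho <= r0 ->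
    let b X := cut (`|X - Q| / (L * rho)) *: (a X - a Q) in
    [/\ forall i j, continuous (fun X => b X i j), forall i j X, `|b X i j| <= e &
      exists beta : nat -> R, [/\ forall k, 0 <= beta k, forall N, \sum_(k < N) beta k <= e &
        forall k i j Y Z, `|b Y i j - b Z i j| <= beta k * expR (`|Y - Z| / Num.sqrt (tk (rho ^+ 2) k))]].
Proof.
move=> dc ha L e L1 e0; have [w00 wm [C C0 hC] ws] := dc.
have L0 : 0 < L by exact: lt_le_trans L1.
pose e1 := e / (2 * (C + 1)); have D0 : 0 < 2 * (C + 1) by lra.
have e10 : 0 < e1 by rewrite divr_gt0.
have [r0 r00 hr] := ws e1 e10.
exists (r0 / (2 * L)) => [|rho Q rho0 rhor b]; first by rewrite divr_gt0// mulr_gt0.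
have Lr : 2 * L * rho <= r0 by move: rhor; rewrite ler_pdivlMr ?mulr_gt0// mulrC.
have Lr0 : 0 < L * rho by rewrite mulr_gt0.
have big0 : 0 < 2 * L * rho by rewrite !mulr_gt0.
have [wb _] := hr _ big0 Lr.
have rr : rho <= r0 by apply: le_trans Lr; rewrite ler_peMl ?(ltW rho0)//; lra.
have [_ wsum] := hr rho rho0 rr.
pose th X := cut (`|X - Q| / (L * rho)).
have bE X i j : b X i j = th X * (a X i j - a Q i j) by rewrite /b !mxE.
have th0 X : 2 * L * rho < `|X - Q| -> th X = 0.
  move=> h; apply: cut_eq0; rewrite ler_pdivlMr//; lra.
have aQ X i j : `|X - Q| <= 2 * L * rho -> `|a X i j - a Q i j| <= e1.
  by move=> h; apply: le_trans (ha X Q i j) _; apply: le_trans (wm _ _ _ h) wb.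
have e1e : 2 * (C + 1) * e1 = e by rewrite /e1; field; rewrite gt_eqF//; lra.
have Ce1 := mulr_ge0 C0 (ltW e10).
have thn X : `|th X| <= 1 by rewrite ger0_norm ?cut_ge0 ?cut_le1.
split.
- move=> i j; rewrite (_ : (fun X => _) = fun X => th X * (a X i j - a Q i j)); last first.
    by apply/funext => X; rewrite bE.
  apply: cts_mul.
    apply: (@cut_continuous (fun X => `|X - Q| / (L * rho))); apply: cts_mul (@cts_cst _ _ _).
    exact: norm_shift_continuous.
  apply: cts_sub (@cts_cst _ _ _); apply: (control_continuous dc) => X Y; exact: ha.
- move=> i j X; rewrite bE normrM; have [h|h] := leP `|X - Q| (2 * L * rho); last first.
    by rewrite th0// normr0 mul0r ltW.
  apply: (@le_trans _ _ (1 * e1)); first by apply: ler_pM => //; exact: aQ.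
  by lra.
exists (fun k => C * w (rho * (2^-1) ^+ k) + (2^-1) ^+ k * e1).
have p0 k : 0 < (2^-1 : R) ^+ k by rewrite exprn_gt0// invr_gt0.
have wk0 k : 0 <= w (rho * (2^-1) ^+ k) by apply: dini_control_ge0 => //; rewrite mulr_ge0// ltW.
split.
- by move=> k; exact: (addr_ge0 (mulr_ge0 C0 (wk0 k)) (mulr_ge0 (ltW (p0 k)) (ltW e10))).
- move=> N; rewrite big_split/= -mulr_sumr -mulr_suml.
  have h1 := ler_wpM2l C0 (wsum N).
  have h2 : \sum_(k < N) (2^-1 : R) ^+ k <= 2.
    apply: le_trans (sum_geom _ _ _) _; try lra.
    by rewrite (_ : (1 - 2^-1)^-1 = 2)//; field.
  by have h3 := ler_wpM2r (ltW e10) h2; lra.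
move=> k i j Y Z; set r := rho * (2^-1) ^+ k; have r0' : 0 < r by rewrite mulr_gt0.
rewrite (sqrt_tk (exprn_gt0 2 rho0)) sqrtr_sqr (gtr0_norm rho0) -/r.
pose l := `|Y - Z| / r; have l0 : 0 <= l by rewrite divr_ge0// ltW.
have wYZ : w `|Y - Z| <= C * expR l * w r.
  by have := hC r l r0' l0; rewrite /l mulfVK// gt_eqF.
have thYZ : `|th Y - th Z| <= (2^-1) ^+ k * expR l.
  apply: le_trans (cut_lip _ _) _; rewrite -mulrBl normrM (gtr0_norm (_ : 0 < (L * rho)^-1)) ?invr_gt0//.
  apply: (@le_trans _ _ (`|Y - Z| / rho)).
    apply: ler_pM => //; first by rewrite invr_ge0 ltW.
      apply: le_trans (ler_dist_dist _ _) _; rewrite opprB addrA subrK//.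
    by rewrite lef_pV2 ?posrE// ler_peMl// ltW.
  have -> : `|Y - Z| / rho = (2^-1) ^+ k * l.
    by rewrite /l /r; field; rewrite (gt_eqF rho0) (gt_eqF (p0 k)).
  rewrite ler_pM2l//; have := expR_ge1Dx l; lra.
(* By symmetry the first point may be taken within [2 L rho] of [Q]; if both points lie outside,
   both values of [b] vanish. *)
have main X W : `|X - Q| <= 2 * L * rho -> `|th X - th W| <= (2^-1) ^+ k * expR l ->
   w `|X - W| <= C * expR l * w r ->
   `|b X i j - b W i j| <= (C * w r + (2^-1) ^+ k * e1) * expR l.
  move=> hX ht hw; rewrite !bE.
  have -> : th X * (a X i j - a Q i j) - th W * (a W i j - a Q i j) =
    th W * (a X i j - a W i j) + (th X - th W) * (a X i j - a Q i j) by ring.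
  apply: le_trans (ler_normD _ _) _; rewrite !normrM mulrDl; apply: lerD.
    apply: (@le_trans _ _ (1 * w `|X - W|)); first by apply: ler_pM.
    by rewrite mul1r mulrAC.
  by rewrite mulrAC; apply: ler_pM => //; exact: aQ.
have [hY|hY] := leP `|Y - Q| (2 * L * rho); first exact: main.
have [hZ|hZ] := leP `|Z - Q| (2 * L * rho).
  by rewrite distrC; apply: main => //; rewrite distrC.
rewrite !bE (th0 _ hY) (th0 _ hZ) !mul0r subrr normr0.
exact: (mulr_ge0 (addr_ge0 (mulr_ge0 C0 (wk0 k)) (mulr_ge0 (ltW (p0 k)) (ltW e10))) (expR_ge0 _)).
Qed.

End coefficients.

(** * Calculus of weak solutions *)

Section weak_calculus.
Variables (R : realType) (n : nat) (A : 'rV[R]_n -> 'M[R]_n).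
Hypotheses (cA : forall i j, continuous (fun X => A X i j)) (sA : forall X, (A X)^T = A X).
Implicit Types (X Y : 'rV[R]_n) (w v f : 'rV[R]_n -> R) (G H : 'I_n -> 'rV[R]_n -> R).
Local Notation mu := (lebesgue_row R n).

(** [f] stands for [L w], which is defined only weakly but recorded as an explicit continuous
    function, so that the product and chain rules act on triples. *)
Definition wsol w G f := [/\ C1grad w G, continuous f & weakL A G f].

Definition ip G H X := \sum_(i < n) (\sum_(j < n) A X i j * G j X) * H i X.

Lemma ip_sym G H X : ip G H X = ip H G X.
Proof.
rewrite /ip; under eq_bigr do rewrite mulr_suml.
rewrite exchange_big/=; apply: eq_bigr => j _; rewrite mulr_suml; apply: eq_bigr => i _.
by rewrite -{1}(sA X) mxE; ring.
Qed.

Lemma flux_continuous G i : (forall j, continuous (G j)) ->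
  continuous (fun X => \sum_(j < n) A X i j * G j X).
Proof. by move=> cG; apply: (@cts_sum _ _ _ _ xpredT) => j _; apply: cts_mul. Qed.

Lemma ip_continuous G H : (forall j, continuous (G j)) -> (forall j, continuous (H j)) ->
  continuous (ip G H).
Proof.
move=> cG cH; apply: (@cts_sum _ _ _ _ xpredT) => i _; apply: cts_mul => //.
exact: flux_continuous.
Qed.

Lemma ip_bound G H X (M g h : R) : (forall i j, `|A X i j| <= M) ->
  (forall i, `|G i X| <= g) -> (forall i, `|H i X| <= h) ->
  `|ip G H X| <= n%:R ^+ 2 * M * g * h.
Proof.
move=> hM hg hh; apply: le_trans (ler_norm_sum _ _ _) _.
have cst_sum (c : R) : \sum_(j < n) c = n%:R * c by rewrite sumr_const card_ord mulr_natl.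
rewrite (_ : _ * h = \sum_(i < n) (n%:R * (M * g)) * h); last by rewrite cst_sum; ring.
apply: ler_sum => i _; rewrite normrM; apply: ler_pM => //.
apply: le_trans (ler_norm_sum _ _ _) _; rewrite -cst_sum.
by apply: ler_sum => j _; rewrite normrM; apply: ler_pM.
Qed.

Lemma weakL_ip G f : (forall j, continuous (G j)) -> weakL A G f <->
  forall rho psi dpsi, test_dirs 1%:M rho psi dpsi ->
    Rintegral mu setT (ip G dpsi) = Rintegral mu setT (fun X => f X * psi X).
Proof.
move=> cG; have E rho psi dpsi (tst : test_dirs 1%:M rho psi dpsi) :
    \sum_(i < n) Rintegral mu setT (fun X => (\sum_(j < n) A X i j * G j X) * dpsi i X) =
    Rintegral mu setT (ip G dpsi).
  have [r0 _ cd _ sp] := tst.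
  rewrite -(Rintegral_sum _ (fun i => supp_cts_integrable r0 (cd i) (fun X h => (sp X h).2 i)
    (@flux_continuous G i cG))).2.
  by apply: eq_Rintegral.
by split=> h rho psi dpsi tst; [rewrite -(E _ _ _ tst)|rewrite (E _ _ _ tst)]; exact: (h _ _ _ tst).
Qed.

Lemma C1grad_cst (c : R) : C1grad (fun=> c) (fun _ (_ : 'rV[R]_n) => 0).
Proof. by split=> [|i|i X]; [exact: cts_cst|exact: cts_cst|exact: dird_cst]. Qed.

Lemma C1grad_mul w G v H : C1grad w G -> C1grad v H ->
  C1grad (fun X => w X * v X) (fun i X => w X * H i X + v X * G i X).
Proof.
move=> [cw cG dw] [cv cH dv]; split=> [|i|i X]; first exact: cts_mul.
  by apply: cts_add; apply: cts_mul.
exact: dirdM.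
Qed.

Lemma C1grad_comp (phi phi1 : R -> R) w G : C1grad w G ->
  (forall X, is_derive (w X) 1 phi (phi1 (w X))) ->
  continuous (phi1 \o w) -> C1grad (phi \o w) (fun i X => phi1 (w X) * G i X).
Proof.
move=> [cw cG dw] dphi c1; split=> [X|i|i X].
- apply: continuous_comp; first exact: cw.
  by have [d _] := dphi X; apply: differentiable_continuous; apply/derivable1_diffP.
- exact: cts_mul.
- exact: dird_comp (dphi X) (dw i X).
Qed.

Lemma test_dirs_mul w G rho psi dpsi : C1grad w G -> test_dirs 1%:M rho psi dpsi ->
  test_dirs 1%:M rho (fun X => w X * psi X) (fun i X => w X * dpsi i X + psi X * G i X).
Proof.
move=> [cw cG dw] [r0 cp cd dp sp]; split=> //.
- exact: cts_mul.
- by move=> i; apply: cts_add; apply: cts_mul.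
- by move=> i X; exact: dirdM.
- by move=> X /sp[-> h]; rewrite mulr0; split=> // i; rewrite h mulr0 mul0r addr0.
Qed.

Lemma ip_lin G (c d : R) H H' X : ip G (fun i Y => c * H i Y + d * H' i Y) X = c * ip G H X + d * ip G H' X.
Proof.
rewrite /ip !mulr_sumr -big_split/=; apply: eq_bigr => i _; ring.
Qed.

(* [<A (phi G), D psi> = <A G, D (phi psi)> - psi <A G, D phi>]. *)
Lemma weakL_scale w G f phi P : wsol w G f -> C1grad phi P ->
  weakL A (fun i X => phi X * G i X) (fun X => phi X * f X - ip G P X).
Proof.
move=> [[cw cG dw] cf wk] C; have [cphi cP dP] := C.
have cpG j : continuous (fun X => phi X * G j X) by exact: cts_mul.
apply/(weakL_ip _ cpG) => rho psi dpsi tst.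
have t2 := test_dirs_mul C tst; have [r0 cp cd _ sp] := tst; have [_ cp2 cd2 _ sp2] := t2.
have sp1 X h := (sp X h).1.
have I1 := supp_cts_integrable r0 cp sp1 (cts_mul cphi cf).
have I2 := supp_cts_integrable r0 cp sp1 (ip_continuous cG cP).
have -> : Rintegral mu setT (fun X => (phi X * f X - ip G P X) * psi X) =
    Rintegral mu setT (fun X => phi X * f X * psi X) - Rintegral mu setT (fun X => ip G P X * psi X).
  by rewrite -(RintegralB measurableT I1 I2); apply: eq_Rintegral => X _; rewrite mulrBl.
have := (weakL_ip f cG).1 wk _ _ _ t2.
have I3 : mu.-integrable setT (EFin \o ip G (fun i X => phi X * dpsi i X + psi X * P i X)).
  apply: cts_supp_integrable r0 _; first exact: ip_continuous.
  by move=> X /sp2[_ h]; rewrite /ip big1// => i _; rewrite h mulr0.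
have E : Rintegral mu setT (ip (fun i X => phi X * G i X) dpsi) =
    Rintegral mu setT (fun X => ip G (fun i X => phi X * dpsi i X + psi X * P i X) X - ip G P X * psi X).
  apply: eq_Rintegral => X _; rewrite (_ : ip G _ X = ip G (fun i Y => phi X * dpsi i Y + psi X * P i Y) X)//.
  rewrite ip_lin (mulrC (psi X)) addrK /ip mulr_sumr; apply: eq_bigr => i _.
  by rewrite mulrA; congr (_ * _); rewrite mulr_sumr; apply: eq_bigr => j _; ring.
rewrite E (RintegralB measurableT I3 I2) => ->; congr (_ - _).
by apply: eq_Rintegral => X _; rewrite mulrA (mulrC (f X)).
Qed.

Lemma weakLD G f H g : (forall j, continuous (G j)) -> (forall j, continuous (H j)) ->
  continuous f -> continuous g -> weakL A G f -> weakL A H g ->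
  weakL A (fun i X => G i X + H i X) (fun X => f X + g X).
Proof.
move=> cG cH cf cg /(weakL_ip _ cG) wG /(weakL_ip _ cH) wH.
have cGH j : continuous (fun X => G j X + H j X) by exact: cts_add.
apply/(weakL_ip _ cGH) => rho psi dpsi tst; have [r0 cp cd _ sp] := tst.
have sp1 X h := (sp X h).1.
have Ip F : (forall j, continuous (F j)) -> mu.-integrable setT (EFin \o ip F dpsi).
  move=> cF; apply: cts_supp_integrable r0 _; first exact: ip_continuous.
  by move=> X /sp[_ h]; rewrite /ip big1// => i _; rewrite h mulr0.
rewrite (@eq_Rintegral _ _ _ mu setT (fun X => ip G dpsi X + ip H dpsi X)); last first.
  move=> X _; rewrite /ip -big_split/=; apply: eq_bigr => i _; rewrite -mulrDl -big_split/=.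
  by congr (_ * _); apply: eq_bigr => j _; rewrite mulrDr.
rewrite (RintegralD measurableT (Ip G cG) (Ip H cH)) (wG _ _ _ tst) (wH _ _ _ tst).
have If := supp_cts_integrable r0 cp sp1 cf; have Ig := supp_cts_integrable r0 cp sp1 cg.
rewrite -(RintegralD measurableT If Ig); apply: eq_Rintegral => X _; by rewrite mulrDl.
Qed.

Lemma weakL_eq G f G' f' : (forall i X, G i X = G' i X) -> (forall X, f X = f' X) ->
  weakL A G f -> weakL A G' f'.
Proof.
move=> hG hf; rewrite (_ : G = G'); last by apply/funext => i; apply/funext => X.
by rewrite (_ : f = f')//; apply/funext.
Qed.

Lemma wsol_eq w G f w' G' f' : (forall X, w X = w' X) -> (forall i X, G i X = G' i X) ->
  (forall X, f X = f' X) -> wsol w G f -> wsol w' G' f'.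
Proof.
move=> hw hG hf; rewrite (_ : w = w'); last by apply/funext.
rewrite (_ : G = G'); last by apply/funext => i; apply/funext => X.
by rewrite (_ : f = f')//; apply/funext.
Qed.

Lemma wsol_cst (c : R) : wsol (fun=> c) (fun _ _ => 0) (fun=> 0).
Proof.
split; [exact: C1grad_cst|exact: cts_cst|].
apply/weakL_ip => [j|rho psi dpsi tst]; first exact: cts_cst.
apply: eq_Rintegral => X _; rewrite mul0r /ip big1// => i _.
by rewrite big1 ?mul0r// => j _; rewrite mulr0.
Qed.

Lemma wsolD w G f v H g : wsol w G f -> wsol v H g ->
  wsol (fun X => w X + v X) (fun i X => G i X + H i X) (fun X => f X + g X).
Proof.
move=> [[cw cG dw] cf wk] [[cv cH dv] cg wk']; split; [split| |exact: weakLD].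
- exact: cts_add.
- by move=> i; exact: cts_add.
- by move=> i X; exact: dirdD.
- exact: cts_add.
Qed.

(** Leibniz rule [L (w v) = w L v + v L w - 2 <A grad w, grad v>]. Each factor in turn serves as the
    multiplier in [weakL_scale], and symmetry of [A] merges the two cross terms. *)
Lemma wsolM w G f v H g : wsol w G f -> wsol v H g ->
  wsol (fun X => w X * v X) (fun i X => w X * H i X + v X * G i X)
    (fun X => w X * g X + v X * f X - 2 * ip G H X).
Proof.
move=> sw sv; have [C1 cf wk] := sw; have [C2 cg wk'] := sv.
have [cw cG dw] := C1; have [cv cH dv] := C2.
have ci := ip_continuous cG cH.
split; first exact: C1grad_mul.
  by apply: cts_sub; [apply: cts_add; exact: cts_mul|apply: cts_mul => //; exact: cts_cst].
have k1 := weakL_scale sv C1; have k2 := weakL_scale sw C2.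
have cgw : continuous (fun X => w X * g X - ip H G X) by apply: cts_sub; [exact: cts_mul|exact: ip_continuous].
have cfv : continuous (fun X => v X * f X - ip G H X) by apply: cts_sub; [exact: cts_mul|exact: ip_continuous].
have cwH i : continuous (fun X => w X * H i X) by exact: cts_mul.
have cvG i : continuous (fun X => v X * G i X) by exact: cts_mul.
apply: (weakL_eq _ _ (weakLD cwH cvG cgw cfv k1 k2)) => // X.
by rewrite (ip_sym H G); ring.
Qed.

Lemma wsolZ (c : R) w G f : wsol w G f -> wsol (fun X => c * w X) (fun i X => c * G i X) (fun X => c * f X).
Proof.
move=> sw; have [[cw cG dw] cf wk] := sw.
split; [split| |].
- by apply: cts_mul => //; exact: cts_cst.
- by move=> i; apply: cts_mul => //; exact: cts_cst.
- by move=> i X; exact: dirdZ.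
- by apply: cts_mul => //; exact: cts_cst.
apply: (weakL_eq _ _ (weakL_scale sw (C1grad_cst c))) => // X.
rewrite /ip big1 ?subr0// => i _; by rewrite mulr0.
Qed.

Lemma wsol_sum (I : Type) (r : seq I) (w f : I -> 'rV[R]_n -> R) (G : I -> 'I_n -> 'rV[R]_n -> R) :
  (forall k, wsol (w k) (G k) (f k)) ->
  wsol (fun X => \sum_(k <- r) w k X) (fun i X => \sum_(k <- r) G k i X) (fun X => \sum_(k <- r) f k X).
Proof.
move=> h; elim: r => [|k r IH].
  by apply: (wsol_eq _ _ _ (wsol_cst 0)) => *; rewrite big_nil.
by apply: (wsol_eq _ _ _ (wsolD (h k) IH)) => *; rewrite big_cons.
Qed.

(** The flux of the composition is the flux of [w] scaled by [phi1 (w X)], so [weakL_scale] applies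
    with that multiplier, whose gradient brings in [phi2]. *)
Lemma wsol_comp (phi phi1 phi2 : R -> R) w G f : wsol w G f ->
  (forall X, is_derive (w X) 1 phi (phi1 (w X))) ->
  (forall X, is_derive (w X) 1 phi1 (phi2 (w X))) -> continuous (phi2 \o w) ->
  wsol (phi \o w) (fun i X => phi1 (w X) * G i X)
    (fun X => phi1 (w X) * f X - phi2 (w X) * ip G G X).
Proof.
move=> sw d1 d2 c2; have [C cf wk] := sw; have [cw cG dw] := C.
have C1 := C1grad_comp C d2 c2; have [c1 _ _] := C1.
split; first exact: C1grad_comp.
  apply: cts_sub; first exact: cts_mul.
  by apply: cts_mul => //; exact: ip_continuous.
apply: (weakL_eq _ _ (weakL_scale sw C1)) => // X; congr (_ - _).
by rewrite /ip mulr_sumr; apply: eq_bigr => i _; ring.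
Qed.

End weak_calculus.

(** Only the flux enters the equation, so the matrix may be exchanged wherever the gradient
    vanishes. *)
Lemma wsol_ext (R : realType) (n : nat) (A A' : 'rV[R]_n -> 'M[R]_n) w G f :
  (forall X i, \sum_(j < n) A X i j * G j X = \sum_(j < n) A' X i j * G j X) ->
  wsol A w G f -> wsol A' w G f.
Proof.
move=> h [C cf wk]; split=> // rho psi dpsi tst; rewrite -(wk _ _ _ tst).
by apply: eq_bigr => i _; apply: eq_Rintegral => X _; rewrite h.
Qed.

(** * Local bumps and solutions *)

Section cubic_step.
Variable R : realType.
Implicit Types (x y h : R).

Lemma isd_remainder (f : R -> R) x d C r : 0 < r -> 0 <= C ->
  (forall h, `|h| < r -> `|f (x + h) - f x - h * d| <= C * h ^+ 2) -> is_derive x 1 f d.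
Proof.
move=> r0 C0 hf; have D : is_derive (0 : R) 1 (fun s => f (x + s)) d.
  apply/is_derive_epsP => e e0; have C1 : 0 < C + 1 by lra.
  exists (Num.min r (e / (C + 1))); first by rewrite lt_min r0 divr_gt0.
  move=> h h0; rewrite lt_min ltr_pdivlMr// addr0 => /andP[hr he].
  have -> : h^-1 * (f (x + h) - f x) - d = h^-1 * (f (x + h) - f x - h * d) by field.
  have hp : 0 < `|h| by rewrite normr_gt0.
  rewrite normrM normfV; apply: le_lt_trans (ler_wpM2l _ (hf h hr)) _; first by rewrite invr_ge0 ltW.
  rewrite -(real_normK (num_real h)) (_ : `|h|^-1 * (C * `|h| ^+ 2) = C * `|h|); [|by field; rewrite gt_eqF].
  by apply: le_lt_trans he; rewrite mulrC ler_pM2l//; clear; lra.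
have S : is_derive x 1 (fun s : R => s - x) 1.
  by apply: (isd_eq _ _ (isdD (isd_id x) (isd_cst (- x) x))) => //; rewrite addr0.
have D' : is_derive (x - x) 1 (fun s => f (x + s)) d by rewrite subrr.
by apply: (isd_eq _ _ (@isd_comp R (fun s => f (x + s)) (fun s => s - x) x d 1 D' S)) => [s|]; [rewrite addrC subrK|rewrite mulr1].
Qed.

(* Truncations are cubed so as to be of class C^2, which keeps [L chi] bounded. *)
Definition pos x := Num.max 0 x.

Lemma pos_ge0 x : 0 <= pos x. Proof. by rewrite le_max lexx. Qed.

Lemma pos_id x : 0 <= x -> pos x = x. Proof. by move=> h; rewrite /pos max_r. Qed.

Lemma pos_0 x : x <= 0 -> pos x = 0. Proof. by move=> h; rewrite /pos max_l. Qed.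

(** Dispenses with one-sided derivatives at the kink: either [pos] moves rigidly, or both values are
    at most [|h|] and their powers are themselves of the order of the remainder. *)
Lemma pos_cases x h : pos (x + h) = pos x + h \/ (pos x <= `|h| /\ pos (x + h) <= `|h|).
Proof.
have := ler_norm h; have := ler_norm (- h); rewrite normrN => h1 h2.
have [a|a] := leP 0 x; have [b|b] := leP 0 (x + h).
- by left; rewrite !pos_id.
- by right; rewrite (pos_id a) (pos_0 (ltW b)); split; lra.
- by right; rewrite (pos_0 (ltW a)) (pos_id b); split; lra.
- by right; rewrite (pos_0 (ltW a)) (pos_0 (ltW b)).
Qed.

Lemma is_derive_pos3 x : is_derive x 1 (fun y => pos y ^+ 3) (3 * pos x ^+ 2).
Proof.
have p0 := pos_ge0 x.
apply: (@isd_remainder _ _ _ (3 * pos x + 6) 1) => // [|h h1]; first by lra.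
rewrite -(real_normK (num_real h)); have q0 := pos_ge0 (x + h); have n0 := normr_ge0 h.
have := ler_norm h; have := ler_norm (- h); rewrite normrN => l1 l2.
rewrite ler_norml; have [E|[h2 h3]] := pos_cases x h.
  have hE : h ^+ 2 = `|h| ^+ 2 by rewrite real_normK ?num_real.
  rewrite E (_ : _ - _ - _ = (3 * pos x + h) * h ^+ 2); last by ring.
  have s0 : 0 <= `|h| ^+ 2 by exact: sqr_ge0.
  by rewrite hE; apply/andP; split; nra.
have a1 : pos (x + h) ^+ 3 <= `|h| ^+ 3 by exact: exprn_mono.
have a2 : pos x ^+ 3 <= `|h| ^+ 3 by exact: exprn_mono.
have a3 : pos x ^+ 2 <= `|h| ^+ 2 by exact: exprn_mono.
have a4 : 0 <= pos x ^+ 3 by exact: exprn_ge0.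
have a5 : 0 <= pos (x + h) ^+ 3 by exact: exprn_ge0.
have a6 : 0 <= pos x ^+ 2 by exact: exprn_ge0.
have a7 : `|h| ^+ 3 <= `|h| ^+ 2 by rewrite exprS ler_piMl ?sqr_ge0// ltW.
have s0 : 0 <= `|h| ^+ 2 by exact: sqr_ge0.
have a8 : - (`|h| ^+ 2) <= h * pos x ^+ 2 <= `|h| ^+ 2.
  by apply/andP; split; nra.
have a9 : 0 <= pos x * `|h| ^+ 2 by rewrite mulr_ge0.
by move/andP: a8 => [b1 b2]; apply/andP; split; lra.
Qed.

Lemma is_derive_pos2 x : is_derive x 1 (fun y => 3 * pos y ^+ 2) (6 * pos x).
Proof.
have p0 := pos_ge0 x.
apply: (@isd_remainder _ _ _ 12 1) => // h h1.
rewrite -(real_normK (num_real h)); have q0 := pos_ge0 (x + h); have n0 := normr_ge0 h.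
have := ler_norm h; have := ler_norm (- h); rewrite normrN => l1 l2.
have s0 : 0 <= `|h| ^+ 2 by exact: sqr_ge0.
rewrite ler_norml; have [E|[h2 h3]] := pos_cases x h.
  have hE : h ^+ 2 = `|h| ^+ 2 by rewrite real_normK ?num_real.
  rewrite E (_ : _ - _ - _ = 3 * h ^+ 2); last by ring.
  by rewrite hE; apply/andP; split; lra.
have a1 : pos (x + h) ^+ 2 <= `|h| ^+ 2 by exact: exprn_mono.
have a3 : pos x ^+ 2 <= `|h| ^+ 2 by exact: exprn_mono.
have a5 : 0 <= pos (x + h) ^+ 2 by exact: exprn_ge0.
have a6 : 0 <= pos x ^+ 2 by exact: exprn_ge0.
have a8 : - (`|h| ^+ 2) <= h * pos x <= `|h| ^+ 2 by apply/andP; split; nra.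
by move/andP: a8 => [b1 b2]; apply/andP; split; lra.
Qed.

Lemma is_derive_recip x : x != 0 -> is_derive x 1 (fun y => y^-1) (- x ^- 2).
Proof.
move=> x0; have xp : 0 < `|x| by rewrite normr_gt0.
have C0 : 0 <= 2 * `|x| ^- 3 by rewrite mulr_ge0// invr_ge0 exprn_ge0.
apply: (@isd_remainder _ _ _ (2 * `|x| ^- 3) (`|x| / 2)) => // [|h hr]; first by rewrite divr_gt0.
have xh : `|x| / 2 <= `|x + h|.
  have := ler_normB (x + h) h; rewrite addrK; lra.
have xh0 : x + h != 0 by rewrite -normr_gt0; lra.
rewrite (_ : _ - _ - _ = h ^+ 2 / (x ^+ 2 * (x + h))); last by field; rewrite x0 xh0.
rewrite normrM (ger0_norm (sqr_ge0 h)) mulrC ler_wpM2r ?sqr_ge0// normfV normrM normrX.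
have -> : 2 * `|x| ^- 3 = (`|x| ^+ 2 * (`|x| / 2))^-1 by field; rewrite gt_eqF.
by rewrite lef_pV2 ?posrE ?mulr_gt0 ?exprn_gt0 ?divr_gt0 ?normr_gt0// ler_wpM2l ?sqr_ge0.
Qed.

End cubic_step.

(** The coefficients after extension: the conditions hold on the whole space, in sup norm, with
    entries bounded by [M]. *)
Definition elliptic_field (R : realType) n (a : 'rV[R]_n -> 'M[R]_n) (kappa M : R) (w : R -> R) :=
  [/\ 0 < kappa /\ 0 <= M,
    (forall X, (a X)^T = a X) /\
      (forall X (x : 'rV[R]_n), kappa * \sum_i x ord0 i ^+ 2 <= quad (a X) x),
    (forall X i j, `|a X i j| <= M), dini_control w &
    (forall X Y i j, `|a X i j - a Y i j| <= w `|X - Y|)].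

Lemma wsol_pos3 (R : realType) n (A : 'rV[R]_n -> 'M[R]_n) w G f :
  (forall i j, continuous (fun X => A X i j)) -> wsol A w G f ->
  wsol A (fun X => pos (w X) ^+ 3) (fun i X => 3 * pos (w X) ^+ 2 * G i X)
    (fun X => 3 * pos (w X) ^+ 2 * f X - 6 * pos (w X) * ip A G G X).
Proof.
move=> cA sw; have [[cw _ _] _ _] := sw.
apply: (wsol_comp (phi := fun y => pos y ^+ 3) (phi1 := fun y => 3 * pos y ^+ 2)
  (phi2 := fun y => 6 * pos y) cA sw) => [X|X|]; [exact: is_derive_pos3|exact: is_derive_pos2|].
by apply: (@cts_mul _ _ (fun=> 6)); [exact: cts_cst|apply: cts_max => //; exact: cts_cst].
Qed.

(** [chi] is made from a solution whose source is the tent [sB]. Divided by [rho^2] it is close to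
    [1] on the inner ball and close to [0] outside, and the cube of the positive part of its excess
    over [1/4] vanishes exactly there. The local solver is [chi] times the patch solution, whose
    cross terms are small where the patch solution and its gradient are. *)
Lemma local_structure (R : realType) n (a : 'rV[R]_n -> 'M[R]_n) kappa M w c0 :
  elliptic_field a kappa M w -> 1 <= c0 ->
  exists L C2 : R, [/\ c0 <= L, 1 <= C2 & forall eps0, 0 < eps0 ->
  exists2 r0, 0 < r0 & forall rho Q, 0 < rho -> rho <= r0 ->
  exists chi Xg l, [/\ wsol a chi Xg l,
    [/\ forall X, 0 <= chi X <= C2, forall i X, `|Xg i X| <= C2 / rho &
        forall X, `|l X| <= C2 / rho ^+ 2],
    (forall X, `|X - Q| <= c0 * rho -> 8^-1 <= chi X),
    (forall X, L * rho <= `|X - Q| -> [/\ chi X = 0, forall i, Xg i X = 0 & l X = 0]) &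
    forall s : 'rV[R]_n -> R, continuous s -> (forall Y, `|s Y| <= 1) -> exists u Ug h,
      [/\ wsol a u Ug h,
        [/\ forall X, `|u X| <= C2 * rho ^+ 2, forall i X, `|Ug i X| <= C2 * rho &
            forall X, `|h X| <= C2],
        (forall X, L * rho <= `|X - Q| -> [/\ u X = 0, forall i, Ug i X = 0 & h X = 0]) &
        forall N (Z : 'I_N -> 'rV[R]_n) delta k0 X, 0 <= delta ->
          (forall Y, `|s Y| <= \sum_(i < N) (`|Y - Z i| <= delta)%R%:R) ->
          `|h X - chi X * s X| <=
            C2 * ((2 ^+ k0) ^+ n * (N%:R * (delta / rho) ^+ n) + (2^-1) ^+ k0 + eps0)]]].
Proof.
move=> [[kp0 M0] [sa ell] aM dc aw] c01.
have [C1 [e0 [C11 e00 PS]]] := patch_solver n kp0 M0.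
have C10 : 0 < C1 by exact: lt_le_trans C11.
(* [exp (- La) <= 1 / (1 + La)] makes the influence of far values at most [1/16]; the tolerance [e]
   adds another [1/16]. *)
have [La LaE] : exists x, x = 16 * C1 by eexists.
have La0 : 0 < La by rewrite LaE mulr_gt0.
have hLa : C1 * expR (- La) <= 16^-1.
  rewrite expRN ler_pdivrMr ?expR_gt0//; have := expR_ge1Dx La; rewrite LaE; lra.
have [K KE] : exists x, x = n%:R ^+ 2 * (M + 1) by eexists.
have K0 : 0 <= K by rewrite KE mulr_ge0 ?sqr_ge0// addr_ge0.
have [cl clE] : exists x, x = 9 * C1 ^+ 2 + 6 * K * C1 ^+ 3 by eexists.
have C12 : 1 <= C1 ^+ 2 by exact: exprn_ege1.
have C13 : 1 <= C1 ^+ 3 by exact: exprn_ege1.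
have C14 : 1 <= C1 ^+ 4 by exact: exprn_ege1.
have KC3 : 0 <= K * C1 ^+ 3 := mulr_ge0 K0 (exprn_ge0 3 (ltW C10)).
have KC4 : 0 <= K * C1 ^+ 4 := mulr_ge0 K0 (exprn_ge0 4 (ltW C10)).
have cl0 : 0 <= cl by clear - clE C12 KC3; lra.
have C1cl : 0 <= C1 * cl := mulr_ge0 (ltW C10) cl0.
have [Y0 YE] : exists x, x = 4 * C1 ^+ 3 + 4 * C1 ^+ 4 + cl + 3 * (C1 * cl) + 18 * (K * C1 ^+ 4) by eexists.
have Y00 : 0 <= Y0 by clear - YE C13 C14 cl0 C1cl KC4; lra.
have [C2 C2E] : exists x, x = Y0 * C1 by eexists.
have YC : Y0 <= C2 by rewrite C2E ler_peMr.
exists (2 * c0 + 3 * La), C2; split.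
- by clear - c01 La0; lra.
- by clear - YC YE C13 C14 cl0 C1cl KC4; lra.
move=> eps0 eps00.
have [e [ep ee0 eeps e1 eC1]] : exists e, [/\ 0 < e, e <= e0, e <= eps0, e <= 1 & C1 * e <= 16^-1].
  exists (Num.min (Num.min e0 eps0) (16 * C1)^-1); split.
  - by rewrite !lt_min e00 eps00 invr_gt0 mulr_gt0.
  - by rewrite !ge_min lexx.
  - by rewrite !ge_min lexx orbT.
  - by rewrite !ge_min invf_le1 ?mulr_gt0// (_ : 1 <= 16 * C1) ?orbT//; lra.
  - apply: (@le_trans _ _ (C1 * (16 * C1)^-1)); first by rewrite ler_pM2l// ge_min lexx orbT.
    by rewrite invfM mulrCA divff ?mulr1// gt_eqF.
(* The tent vanishes beyond [2 (c0 + La) rho]; a further margin [La rho] makes the source zero on a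
   full ball around each outer point. *)
set L := 2 * c0 + 3 * La; have L1 : 1 <= L by rewrite /L; clear - c01 La0; lra.
have [r0 r00 hr] := local_perturbation dc aw L1 ep.
exists r0 => // rho Q rho0 rhor; have [cb be [beta [beta0 betaS bb]]] := hr rho Q rho0 rhor.
set b := fun X => cut (`|X - Q| / (L * rho)) *: (a X - a Q) in cb be bb.
have T0 : 0 < rho ^+ 2 by rewrite exprn_gt0.
have sT : Num.sqrt (rho ^+ 2) = rho by rewrite sqrtr_sqr gtr0_norm.
have aQM i : a Q i i <= M by apply: le_trans (ler_norm _) (aM _ _ _).
pose A X := a Q + b X.
have sol s cs s1 := PS (a Q) (rho ^+ 2) e b beta s (sa Q) (ell Q) aQM T0 ee0 cb be beta0 betaS bb cs s1.
clear PS.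
have sA X : (A X)^T = A X by rewrite /A /b linearD/= linearZ/= linearB/= !sa.
have cA i j : continuous (fun X => A X i j).
  rewrite (_ : (fun X => _) = fun X => a Q i j + b X i j); last by apply/funext => X; rewrite mxE.
  by apply: cts_add => //; exact: cts_cst.
have AM X i j : `|A X i j| <= M + 1.
  by rewrite /A mxE; apply: le_trans (ler_normD _ _) _; apply: lerD => //; exact: le_trans (be i j X) e1.
have Aa X : `|X - Q| < L * rho -> A X = a X.
  move=> h; rewrite /A /b cut_eq1 ?scale1r ?[a Q + _]addrC ?subrK//.
  by rewrite ler_pdivrMr ?mul1r ?ltW// mulr_gt0// (lt_le_trans ltr01).
have cLr : 0 < (c0 + La) * rho by rewrite mulr_gt0// addr_gt0// (lt_le_trans ltr01).
pose sB Y := cut (`|Y - Q| / ((c0 + La) * rho)).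
have csB : continuous sB.
  apply: (@cut_continuous _ _ (fun X => `|X - Q| / ((c0 + La) * rho))); apply: cts_mul (@cts_cst _ _ _).
  exact: norm_shift_continuous.
have sB1 Y : `|sB Y| <= 1 by rewrite ger0_norm ?cut_ge0 ?cut_le1.
have [wB [GB [fB [CB cfB wkB [wBb GBb fBb] [locB _]]]]] := sol sB csB sB1.
rewrite sT in GBb locB.
have near X : `|X - Q| <= c0 * rho -> 7 / 8 * rho ^+ 2 <= wB X.
  move=> hX; have := locB X 1 La; rewrite normr1 => /(_ (lexx _)) h.
  have hs Y : `|Y - X| < La * rho -> sB Y = 1.
    move=> hY; apply: cut_eq1; rewrite ler_pdivrMr// mul1r.
    have := ler_distD X Y Q; clear - hY hX; lra.
  have := h hs; rewrite ler_norml => /andP[h1 _].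
  have : C1 * (expR (- La) + e) * rho ^+ 2 <= 8^-1 * rho ^+ 2.
    by rewrite ler_pM2r// mulrDr; clear - hLa eC1; lra.
  by clear - h1; lra.
have far X : L * rho <= `|X - Q| -> wB X <= 8^-1 * rho ^+ 2.
  move=> hX; have := locB X 0 La; rewrite normr0 => /(_ ler01) h.
  have hs Y : `|Y - X| < La * rho -> sB Y = 0.
    move=> hY; apply: cut_eq0; rewrite ler_pdivlMr//.
    have := ler_distD Y X Q; rewrite (distrC X Y) => h2; move: hX; rewrite /L => hX.
    by clear - hY hX h2; lra.
  have := h hs; rewrite ler_norml => /andP[_ h1].
  have : C1 * (expR (- La) + e) * rho ^+ 2 <= 8^-1 * rho ^+ 2.
    by rewrite ler_pM2r// mulrDr; clear - hLa eC1; lra.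
  by clear - h1; lra.
clear locB.
have iT : 0 < (rho ^+ 2)^-1 by rewrite invr_gt0.
have solB : wsol A wB GB fB by [].
have solY := wsolD cA (wsolZ cA (rho ^+ 2)^-1 solB) (wsol_cst cA (- 4^-1)).
set y := fun X => (rho ^+ 2)^-1 * wB X + _ in solY.
set Gy := fun i X => (rho ^+ 2)^-1 * GB i X + 0 in solY.
set fy := fun X => (rho ^+ 2)^-1 * fB X + 0 in solY.
have yC X : y X <= C1.
  have : (rho ^+ 2)^-1 * wB X <= C1.
    rewrite mulrC ler_pdivrMr//; apply: le_trans (ler_norm _) (wBb X).
  by rewrite /y; clear; lra.
have py X : 0 <= pos (y X) <= C1.
  by rewrite pos_ge0/= /pos ge_max (ltW C10) yC.
have Gyb i X : `|Gy i X| <= C1 / rho.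
  rewrite /Gy addr0 normrM (gtr0_norm iT).
  apply: le_trans (ler_wpM2l (ltW iT) (GBb i X)) _.
  by rewrite le_eqVlt; apply/orP; left; apply/eqP; field; rewrite gt_eqF.
have fyb X : `|fy X| <= 3 / rho ^+ 2.
  by rewrite /fy addr0 normrM (gtr0_norm iT) mulrC ler_wpM2r// ltW.
have solC := wsol_pos3 cA solY.
set chi := fun X => pos (y X) ^+ 3 in solC.
set Xg := fun i X => 3 * pos (y X) ^+ 2 * Gy i X in solC.
set l := fun X => 3 * pos (y X) ^+ 2 * fy X - 6 * pos (y X) * ip A Gy Gy X in solC.
have p2 X : 0 <= 3 * pos (y X) ^+ 2 <= 3 * C1 ^+ 2.
  have /andP[q0 q1] := py X; have := exprn_mono 2 q0 q1; have := sqr_ge0 (pos (y X)).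
  by clear; move=> ??; apply/andP; split; lra.
have chib X : 0 <= chi X <= C1 ^+ 3.
  by have /andP[q0 q1] := py X; rewrite exprn_ge0//= exprn_mono.
have Xgb i X : `|Xg i X| <= 3 * C1 ^+ 3 / rho.
  have /andP[q0 q1] := p2 X.
  rewrite /Xg normrM (ger0_norm q0) (_ : 3 * C1 ^+ 3 / rho = 3 * C1 ^+ 2 * (C1 / rho)); last by ring.
  exact: ler_pM.
have ipK G H X (g h : R) : (forall i, `|G i X| <= g) -> (forall i, `|H i X| <= h) -> `|ip A G H X| <= K * g * h.
  by move=> hg hh; rewrite KE; apply: ip_bound => // i j; exact: AM.
have lb X : `|l X| <= cl / rho ^+ 2.
  have /andP[q0 q1] := p2 X; have /andP[t0 t1] := py X.
  apply: le_trans (ler_normB _ _) _; rewrite (_ : cl / _ = 3 * C1 ^+ 2 * (3 / rho ^+ 2) +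
     6 * C1 * (K * (C1 / rho) * (C1 / rho))); last by rewrite clE; field; rewrite gt_eqF.
  apply: lerD; first by rewrite normrM (ger0_norm q0); apply: ler_pM.
  rewrite normrM; have h6 : `|6 * pos (y X)| <= 6 * C1.
    by rewrite ger0_norm; [rewrite ler_pM2l|rewrite mulr_ge0].
  by apply: ler_pM => //; exact: ipK.
have out X : L * rho <= `|X - Q| -> [/\ chi X = 0, forall i, Xg i X = 0 & l X = 0].
  move=> /far h; have py0 : pos (y X) = 0.
    apply: pos_0; rewrite /y; have : (rho ^+ 2)^-1 * wB X <= 8^-1 by rewrite mulrC ler_pdivrMr.
    by clear; lra.
  rewrite /chi /Xg /l py0; split=> [|i|]; first by rewrite expr0n.
    by rewrite expr0n/= mulr0 mul0r.
  by rewrite expr0n/= !mulr0 !mul0r subrr.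
have ext u Ug h : (forall X, L * rho <= `|X - Q| -> forall i, Ug i X = 0) -> wsol A u Ug h -> wsol a u Ug h.
  move=> hU; apply: wsol_ext => X i; have [h1|h1] := ltP `|X - Q| (L * rho).
    by apply: eq_bigr => j _; rewrite Aa.
  by rewrite !big1// => j _; rewrite (hU X h1) mulr0.
exists chi, Xg, l; split=> //.
- by apply: ext solC => X /out[].
- split=> [X|i X|X].
  + have /andP[-> h] := chib X; apply: le_trans h _; clear - YC YE C13 C14 cl0 C1cl KC4; lra.
  + apply: le_trans (Xgb i X) _; rewrite ler_pM2r ?invr_gt0//; clear - YC YE C13 C14 cl0 C1cl KC4; lra.
  + apply: le_trans (lb X) _; rewrite ler_pM2r//; clear - YC YE C13 C14 cl0 C1cl KC4; lra.
(* [7/8 - 1/4 = 5/8], and [(5/8)^3] exceeds [1/8]. *)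
- move=> X /near h; have h1 : 5 / 8 <= y X.
    have : 7 / 8 <= (rho ^+ 2)^-1 * wB X by rewrite [leRHS]mulrC ler_pdivlMr.
    by rewrite /y; clear; lra.
  rewrite /chi pos_id; last by clear - h1; lra.
  apply: (@le_trans _ _ ((5 / 8) ^+ 3)); first by rewrite !exprS expr0; clear; lra.
  by apply: exprn_mono h1; clear; lra.
move=> s cs s1; have [v [V [f [CV cf wkV [vb Vb fb] [_ thin]]]]] := sol s cs s1.
rewrite sT in Vb thin.
have solV : wsol A v V f by [].
have solU := wsolM cA sA solC solV.
set u := fun X => chi X * v X in solU.
set Ug := fun i X => chi X * V i X + v X * Xg i X in solU.
set h := fun X => chi X * f X + v X * l X - 2 * ip A Xg V X in solU.
have outU X : L * rho <= `|X - Q| -> [/\ u X = 0, forall i, Ug i X = 0 & h X = 0].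
  move=> /out[z1 z2 z3]; rewrite /u /Ug /h z1 z3; split=> [|i|]; rewrite ?mul0r ?mulr0 ?z2 ?mulr0 ?addr0//.
  rewrite /ip big1 ?mulr0 ?subr0// => i _; rewrite big1 ?mul0r// => j _; by rewrite z2 mulr0.
have nchi X : `|chi X| <= C1 ^+ 3 by have /andP[q0 q1] := chib X; rewrite ger0_norm.
(* One computation for two uses: with [d = 3] it bounds [h], with [d = C1 q] it bounds
   [h - chi s]. *)
have hb0 X (d : R) (g : R) : `|g| <= d -> `|v X| <= C1 * d * rho ^+ 2 -> (forall i, `|V i X| <= C1 * d * rho) ->
    `|chi X * g + v X * l X - 2 * ip A Xg V X| <= (C1 ^+ 3 + C1 * cl + 6 * (K * C1 ^+ 4)) * d.
  move=> hg hv hV; apply: le_trans (ler_normB _ _) _.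
  have a1 : `|chi X * g| <= C1 ^+ 3 * d by rewrite normrM; apply: ler_pM.
  have a2 : `|v X * l X| <= C1 * d * rho ^+ 2 * (cl / rho ^+ 2) by rewrite normrM; apply: ler_pM.
  have a3 : `|2 * ip A Xg V X| <= 2 * (K * (3 * C1 ^+ 3 / rho) * (C1 * d * rho)).
    by rewrite normrM (ger0_norm (ler0n R 2)) ler_pM2l//; apply: ipK.
  have E2 : C1 * d * rho ^+ 2 * (cl / rho ^+ 2) = C1 * cl * d by field; rewrite gt_eqF.
  have E3 : 2 * (K * (3 * C1 ^+ 3 / rho) * (C1 * d * rho)) = 6 * (K * C1 ^+ 4) * d by field; rewrite gt_eqF.
  rewrite E2 in a2; rewrite E3 in a3.
  apply: le_trans (lerD (ler_normD _ _) (lexx _)) _; clear - a1 a2 a3; lra.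
exists u, Ug, h; split=> //.
- by apply: ext solU => X /outU[].
- split=> [X|i X|X].
  + rewrite /u normrM; apply: le_trans (ler_pM _ _ (nchi X) (vb X)) _ => //.
    rewrite mulrA ler_pM2r// (_ : C1 ^+ 3 * C1 = C1 ^+ 4); last by ring.
    by clear - YC YE C13 C14 cl0 C1cl KC4; lra.
  + apply: le_trans (ler_normD _ _) _.
    have a1 : `|chi X| * `|V i X| <= C1 ^+ 3 * (C1 * rho) by apply: ler_pM.
    have a2 : `|v X| * `|Xg i X| <= C1 * rho ^+ 2 * (3 * C1 ^+ 3 / rho) by apply: ler_pM.
    have E2 : C1 * rho ^+ 2 * (3 * C1 ^+ 3 / rho) = 3 * C1 ^+ 4 * rho by field; rewrite gt_eqF.
    have E1 : C1 ^+ 3 * (C1 * rho) = C1 ^+ 4 * rho by ring.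
    rewrite E2 in a2; rewrite E1 in a1.
    apply: (@le_trans _ _ (C1 ^+ 4 * rho + 3 * C1 ^+ 4 * rho)).
      by apply: lerD; rewrite normrM.
    rewrite -mulrDl.
    by rewrite ler_pM2r//; clear - YC YE C13 C14 cl0 C1cl KC4; lra.
  + have v3 : `|v X| <= C1 * 3 * rho ^+ 2.
      apply: le_trans (vb X) _; rewrite ler_pM2r//; clear - C10; lra.
    have V3 i : `|V i X| <= C1 * 3 * rho.
      apply: le_trans (Vb i X) _; rewrite ler_pM2r//; clear - C10; lra.
    by apply: le_trans (hb0 X 3 (f X) (fb X) v3 V3) _; clear - YC YE C13 C14 cl0 C1cl KC4; lra.
- move=> N Z delta k0 X d0 sN; have [t1 t2 t3] := thin N Z delta k0 X d0 sN.
  set q := _ + _ + e in t1 t2 t3.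
  have q0 : 0 <= q.
    rewrite /q addr_ge0 ?(ltW ep)// addr_ge0 ?exprn_ge0 ?invr_ge0//.
    by rewrite mulr_ge0 ?exprn_ge0// mulr_ge0// exprn_ge0// divr_ge0// ltW.
  have C1q : 0 <= C1 * q by rewrite mulr_ge0// ltW.
  have -> : h X - chi X * s X = chi X * (f X - s X) + v X * l X - 2 * ip A Xg V X by rewrite /h; ring.
  have qC : q <= C1 * q by rewrite ler_peMl.
  have v3 : `|v X| <= C1 * (C1 * q) * rho ^+ 2.
    by apply: le_trans t1 _; rewrite ler_pM2r// ler_pM2l.
  have V3 i : `|V i X| <= C1 * (C1 * q) * rho.
    by apply: le_trans (t2 i) _; rewrite ler_pM2r// ler_pM2l.
  apply: le_trans (hb0 X (C1 * q) (f X - s X) t3 v3 V3) _.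
  apply: (@le_trans _ _ (Y0 * (C1 * q))).
    by apply: ler_wpM2r => //; clear - YE C13 C14 cl0 C1cl KC4; lra.
  rewrite mulrA -C2E; apply: ler_wpM2l; first exact: le_trans YC.
  by rewrite /q lerD2l.
Qed.

(** * Nets and the correction step *)

Section nets.
Variables (R : realType) (n : nat) (K : set 'rV[R]_n).
Implicit Types (X Y Z Q : 'rV[R]_n) (zs : seq 'rV[R]_n).

(* Condition A at scale [delta], in sup norm and with the net listed as a sequence. *)
Definition net (c0 c1 delta : R) zs := [/\ uniq zs, forall Z, Z \in zs -> K Z,
  forall X, thickening K delta X -> exists2 Z, Z \in zs & `|X - Z| <= c0 * delta &
  forall X r, delta <= r -> (count (fun Z => `|Z - X| <= r)%R zs)%:R <= c1 * (r / delta) ^+ (n - 2)].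

Lemma condition_A_net : (0 < n)%N -> condition_A K -> exists c0 c1 : R,
  [/\ 1 <= c0, 0 <= c1 & forall delta, 0 < delta -> exists zs, net c0 c1 delta zs].
Proof.
move=> n0 [c0 [c1 hA]]; have n1 : 1 <= n%:R :> R by rewrite ler1n.
exists (Num.max c0 1), (Num.max c1 0 * n%:R ^+ (n - 2)); split.
- by rewrite le_max lexx orbT.
- by rewrite mulr_ge0 ?exprn_ge0// le_max lexx orbT.
move=> delta d0; have [S [fS SK _ cov cnt]] := hA delta d0.
exists (enum_fset (fset_set S)).
have inS Z : Z \in enum_fset (fset_set S) -> S Z.
  by move=> h; apply/set_mem; rewrite -in_fset_set.
have inS' Z : S Z -> Z \in enum_fset (fset_set S).
  by move=> h; change (Z \in fset_set S); rewrite in_fset_set// mem_set.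
split.
- exact: fset_uniq.
- by move=> Z /inS /SK.
- move=> X /cov[Z SZ]; rewrite /eclosed_ball/= => h; exists Z; first exact: inS'.
  apply: le_trans (norm_le_enorm _) _; apply: le_trans h _.
  by rewrite ler_pM2r// le_max lexx.
move=> X r dr; have r0 : 0 < r := lt_le_trans d0 dr.
have nr : delta <= n%:R * r by apply: le_trans dr _; rewrite ler_peMl// ltW.
have fSB : finite_set (S `&` eclosed_ball X (n%:R * r)) by exact: finite_setIl.
apply: (@le_trans _ _ (#|` fset_set (S `&` eclosed_ball X (n%:R * r))|%:R)).
  rewrite ler_nat -size_filter; apply: uniq_leq_size; first by rewrite filter_uniq// fset_uniq.
  move=> Z; rewrite mem_filter => /andP[h /inS SZ]; rewrite in_fset_set// mem_set//; split=> //.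
  rewrite /eclosed_ball/=; apply: le_trans (enorm_le_norm _) _; rewrite ler_pM2l//.
  exact: lt_le_trans n1.
apply: le_trans (cnt _ X nr) _.
rewrite -(mulrA n%:R) exprMn -[leRHS]mulrA; apply: ler_wpM2r; last by rewrite le_max lexx.
by rewrite mulr_ge0 ?exprn_ge0// divr_ge0// ltW.
Qed.

Lemma sum_support zs (p : pred 'rV[R]_n) (g : 'rV[R]_n -> R) (B : R) :
  (forall Q, Q \in zs -> ~~ p Q -> g Q = 0) -> (forall Q, Q \in zs -> p Q -> `|g Q| <= B) ->
  `|\sum_(Q <- zs) g Q| <= (count p zs)%:R * B.
Proof.
move=> g0 gB; have E : \sum_(Q <- zs | ~~ p Q) g Q = 0.
  by rewrite big_seq_cond big1// => Q /andP[Qz np]; exact: g0.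
rewrite (bigID p)/= E addr0.
apply: le_trans (ler_norm_sum _ _ _) _; rewrite big_seq_cond.
apply: (@le_trans _ _ (\sum_(Q <- zs | (Q \in zs) && p Q) B)).
  by apply: ler_sum => Q /andP[Qz pQ]; exact: gB.
by rewrite -big_seq_cond big_const_seq iter_addr_0 mulr_natl.
Qed.

End nets.

Section correction.
Variables (R : realType) (n : nat).
Implicit Types (X Y Z Q : 'rV[R]_n).

Definition bumps a rho c0 L C2 (chi : 'rV[R]_n -> 'rV[R]_n -> R)
    (Xg : 'rV[R]_n -> 'I_n -> 'rV[R]_n -> R) (l : 'rV[R]_n -> 'rV[R]_n -> R) :=
  [/\ forall Q, wsol a (chi Q) (Xg Q) (l Q),
    forall Q, [/\ forall X, 0 <= chi Q X <= C2, forall i X, `|Xg Q i X| <= C2 / rho &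
        forall X, `|l Q X| <= C2 / rho ^+ 2],
    forall Q X, `|X - Q| <= c0 * rho -> 8^-1 <= chi Q X &
    forall Q X, L * rho <= `|X - Q| -> [/\ chi Q X = 0, forall i, Xg Q i X = 0 & l Q X = 0]].

(** The three errors, from thinness, short times and coefficients, are made at most [1/48] by [Rr],
    [k0] and [eps0] respectively; their sum times the normalizing factor [8] is [1/2]. *)
Lemma correction (a : 'rV[R]_n -> 'M[R]_n) kappa M w c0 c1 (K : set 'rV[R]_n) : (2 <= n)%N ->
  elliptic_field a kappa M w -> 1 <= c0 -> 0 <= c1 ->
  exists L C2 C3 Rr d0, [/\ c0 <= L /\ 1 <= C2, 1 <= C3, 1 <= Rr, 0 < d0 &
  forall delta, 0 < delta -> delta <= d0 -> let rho := Rr * delta in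
  forall zr zd, net K c0 c1 rho zr -> net K c0 c1 delta zd ->
  exists chi Xg l, bumps a rho c0 L C2 chi Xg l /\
  forall q, continuous q -> (forall X, `|q X| <= 1) -> exists u U h,
    [/\ wsol a u U h, forall X, `|u X| <= C3 * rho ^+ 2, forall i X, `|U i X| <= C3 * rho,
      forall X, `|h X| <= C3 & forall X, thickening K delta X -> `|h X - q X| <= 2^-1]].
Proof.
move=> n2 ef c01 c10; have [L [C2 [cL C21 loc]]] := local_structure ef c01.
have [[kp0 M0] [sa ell] aM dc aw] := ef.
have ca i j : continuous (fun X => a X i j) by apply: (control_continuous dc) => X Y; exact: aw.
have L1 : 1 <= L by exact: le_trans cL.
have L0 : 0 < L by exact: lt_le_trans L1.
have C20 : 0 < C2 by exact: lt_le_trans C21.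
have [N1 N1E] : exists x, x = c1 * L ^+ (n - 2) by eexists.
have N10 : 0 <= N1 by rewrite N1E mulr_ge0// exprn_ge0// ltW.
have NC0 : 0 <= N1 * C2 by rewrite mulr_ge0// ltW.
(* [k0] is chosen before [Rr]: the constant [B] of the thin part contains a power of [2 ^+ k0], and
   only then can [Rr] be taken large. *)
have [k0 hk0] := le_pow2 (48 * (N1 * C2)).
have [B BE] : exists x, x = (2 ^+ k0) ^+ n * (c1 * (4 * L) ^+ (n - 2) * (2 * c0) ^+ n) by eexists.
have B0 : 0 <= B.
  rewrite BE; apply: mulr_ge0; first by rewrite !exprn_ge0.
  apply: mulr_ge0; last by rewrite exprn_ge0// mulr_ge0// (le_trans ler01).
  by rewrite mulr_ge0// exprn_ge0// mulr_ge0// ltW.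
have [Rr RE] : exists x, x = 1 + 48 * (N1 * C2) * B by eexists.
have R1 : 1 <= Rr by rewrite RE lerDl mulr_ge0// mulr_ge0.
have R0 : 0 < Rr by exact: lt_le_trans R1.
have D0 : 0 < 48 * (N1 * C2) + 1 by clear - NC0; lra.
have [eps0 epsE] : exists x, x = (48 * (N1 * C2) + 1)^-1 by eexists.
have eps00 : 0 < eps0 by rewrite epsE invr_gt0.
have [r0 r00 hr] := loc eps0 eps00.
exists L, C2, (8 * (N1 * C2) + 1), Rr, (r0 / Rr); split=> //; first by clear - NC0; lra.
  by rewrite divr_gt0.
move=> delta d0 dd0 rho zr zd [uz zK zcov zcnt] [uzd _ zdcov zdcnt].
have rho0 : 0 < rho by rewrite mulr_gt0.
have rhor : rho <= r0 by move: dd0; rewrite ler_pdivlMr// mulrC.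
have drho : delta <= rho by rewrite ler_peMl// ltW.
have [chi hchi] := choice (fun Q => hr rho Q rho0 rhor).
have [Xg hXg] := choice hchi.
have [l hl] := choice hXg.
exists chi, Xg, l; split.
  by split=> [Q|Q|Q|Q]; have [] := hl Q.
clear hchi hXg loc hr.
move=> q cq q1.
have cd0 : 0 < c0 * delta by rewrite mulr_gt0// (lt_le_trans ltr01).
have Lr0 : 0 < L * rho by rewrite mulr_gt0.
(* At least [1] on the thickening of radius [delta] and supported within [2 c0 delta] of the fine
   net: multiplication by its truncation makes the source thin. *)
pose ze Y := \sum_(Z <- zd) cut (`|Y - Z| / (c0 * delta)).
have ctent Q c : continuous (fun Y : 'rV[R]_n => cut (`|Y - Q| / c)).
  apply: (@cut_continuous _ _ (fun X => `|X - Q| / c)); apply: cts_mul (@cts_cst _ _ _).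
  exact: norm_shift_continuous.
have cze : continuous ze by apply: (@cts_sum _ _ _ _ xpredT) => Z _; exact: ctent.
have ze0 Y : 0 <= ze Y by apply: sumr_ge0 => Z _; exact: cut_ge0.
pose S X := \sum_(Q <- zr) chi Q X.
have cchi Q : continuous (chi Q) by have [[[]]] := hl Q.
have chi0 Q X : 0 <= chi Q X by have [_ [h _ _] _ _ _] := hl Q; have /andP[] := h X.
have cS : continuous S by apply: (@cts_sum _ _ _ _ xpredT).
have S8 X : thickening K delta X -> 8^-1 <= S X.
  move=> [Z KZ hZ]; have [Q Qz hQ] : exists2 Q, Q \in zr & `|X - Q| <= c0 * rho.
    by apply: zcov; exists Z => //; rewrite /eball/= in hZ *; exact: lt_le_trans drho.
  rewrite /S (bigD1_seq Q)//=; apply: (@le_trans _ _ (chi Q X)).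
    by have [_ _ h _ _] := hl Q; exact: h.
  by rewrite lerDl sumr_ge0.
(* The sum of the bumps is at least [1/8] near [K]; truncating it from below keeps the quotient
   continuous everywhere, and the factor [8] keeps the pieces bounded by [1]. *)
pose den X := 8 * Num.max 8^-1 (S X).
have den1 X : 1 <= den X.
  have : 8^-1 <= Num.max 8^-1 (S X) by rewrite le_max lexx.
  by rewrite /den; clear; lra.
have den0 X : 0 < den X by exact: lt_le_trans (den1 X).
have cden : continuous (fun X => (den X)^-1).
  apply: cts_inv => [X|]; first by rewrite gt_eqF.
  by apply: (@cts_mul _ _ (fun=> 8)); [exact: cts_cst|apply: cts_max => //; exact: cts_cst].
pose s Q Y := q Y * Num.min 1 (ze Y) * cut (`|Y - Q| / (L * rho)) / den Y.
have cs Q : continuous (s Q).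
  apply: cts_mul => //; apply: cts_mul; last exact: ctent.
  by apply: cts_mul => //; apply: cts_min => //; exact: cts_cst.
have mz0 Y : 0 <= Num.min 1 (ze Y) by rewrite le_min ler01 ze0.
have sb Q Y : `|s Q Y| <= Num.min 1 (ze Y) * cut (`|Y - Q| / (L * rho)).
  rewrite /s !normrM (ger0_norm (mz0 Y)) (ger0_norm (cut_ge0 _)).
  have di : `|(den Y)^-1| <= 1 by rewrite normfV (gtr0_norm (den0 Y)) invf_le1.
  have mc : 0 <= Num.min 1 (ze Y) * cut (`|Y - Q| / (L * rho)) by rewrite mulr_ge0 ?cut_ge0.
  apply: (@le_trans _ _ (1 * (Num.min 1 (ze Y) * cut (`|Y - Q| / (L * rho))) * 1)).
    rewrite -(mulrA `|q Y|); apply: ler_pM => //; first by rewrite mulr_ge0.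
    by apply: ler_pM.
  by rewrite mulr1 mul1r.
have s1 Q Y : `|s Q Y| <= 1.
  apply: le_trans (sb Q Y) _; rewrite -[leRHS]mul1r; apply: ler_pM => //; rewrite ?cut_ge0 ?cut_le1//.
  by rewrite ge_min lexx.
have hu Q : exists p : ('rV[R]_n -> R) * ('I_n -> 'rV[R]_n -> R) * ('rV[R]_n -> R),
   [/\ wsol a p.1.1 p.1.2 p.2,
     [/\ forall X, `|p.1.1 X| <= C2 * rho ^+ 2, forall i X, `|p.1.2 i X| <= C2 * rho & forall X, `|p.2 X| <= C2],
     (forall X, L * rho <= `|X - Q| -> [/\ p.1.1 X = 0, forall i, p.1.2 i X = 0 & p.2 X = 0]) &
     forall N (Z : 'I_N -> 'rV[R]_n) delta k0 X, 0 <= delta ->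
          (forall Y, `|s Q Y| <= \sum_(i < N) (`|Y - Z i| <= delta)%R%:R) ->
          `|p.2 X - chi Q X * s Q X| <=
            C2 * ((2 ^+ k0) ^+ n * (N%:R * (delta / rho) ^+ n) + (2^-1) ^+ k0 + eps0)].
  have [_ _ _ _ h] := hl Q; have [u [Ug [hh [h1 h2 h3 h4]]]] := h (s Q) (cs Q) (s1 Q).
  by exists (u, Ug, hh).
have [P hP] := choice hu.
have cnt X : (count (fun Q => `|Q - X| <= L * rho)%R zr)%:R <= N1.
  apply: le_trans (zcnt X (L * rho) _) _; first by rewrite ler_peMl// ltW.
  by rewrite N1E mulfK// gt_eqF.
have far Q X : ~~ (`|Q - X| <= L * rho) -> L * rho <= `|X - Q|.
  by rewrite -ltNge => /ltW; rewrite distrC.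
have sumP (g : 'rV[R]_n -> R) (d : R) X : 0 <= d ->
    (forall Q, L * rho <= `|X - Q| -> g Q = 0) -> (forall Q, `|g Q| <= d) ->
    `|8 * \sum_(Q <- zr) g Q| <= 8 * (N1 * d).
  move=> dd g0 gd; rewrite normrM (ger0_norm (ler0n R 8)) ler_pM2l//.
  have h1 Q : Q \in zr -> ~~ (`|Q - X| <= L * rho) -> g Q = 0 by move=> _ /far; exact: g0.
  have h2 Q : Q \in zr -> `|Q - X| <= L * rho -> `|g Q| <= d by move=> _ _; exact: gd.
  apply: le_trans (@sum_support R n zr (fun Q => `|Q - X| <= L * rho) g d h1 h2) _.
  by rewrite ler_wpM2r.
exists (fun X => 8 * \sum_(Q <- zr) (P Q).1.1 X), (fun i X => 8 * \sum_(Q <- zr) (P Q).1.2 i X),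
  (fun X => 8 * \sum_(Q <- zr) (P Q).2 X); split.
- apply: (wsolZ ca 8); apply: (wsol_sum ca zr) => Q; by have [] := hP Q.
- move=> X; apply: le_trans (sumP _ (C2 * rho ^+ 2) X _ _ _) _.
  + by rewrite mulr_ge0 ?sqr_ge0// ltW.
  + by move=> Q h; have [_ _ h3 _] := hP Q; have [] := h3 X h.
  + by move=> Q; have [_ [h _ _] _ _] := hP Q.
  + by have := sqr_ge0 rho; clear; lra.
- move=> i X; apply: le_trans (sumP _ (C2 * rho) X _ _ _) _.
  + by rewrite mulr_ge0// ltW.
  + by move=> Q h; have [_ _ h3 _] := hP Q; have [] := h3 X h.
  + by move=> Q; have [_ [_ h _] _ _] := hP Q.
  + by clear - rho0; lra.
- move=> X; apply: le_trans (sumP _ C2 X _ _ _) _.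
  + exact: ltW.
  + by move=> Q h; have [_ _ h3 _] := hP Q; have [] := h3 X h.
  + by move=> Q; have [_ [_ _ h] _ _] := hP Q.
  + by clear; lra.
move=> X KX.
have SX := S8 X KX; have SX0 : 0 < S X by exact: lt_le_trans SX.
have zeX : Num.min 1 (ze X) = 1.
  apply: min_l; have [Z Zz hZ] := zdcov X KX.
  rewrite /ze (bigD1_seq Z)//= cut_eq1 ?lerDl ?sumr_ge0// => [Y _|]; first exact: cut_ge0.
  by rewrite ler_pdivrMr// mul1r.
have denX : den X = 8 * S X by rewrite /den max_r.
have qE : q X = 8 * \sum_(Q <- zr) chi Q X * s Q X.
  have E Q : chi Q X * s Q X = q X / den X * chi Q X.
    rewrite /s zeX mulr1; have [h|h] := leP (L * rho) `|X - Q|.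
      have [_ _ _ h4 _] := hl Q; have [-> _ _] := h4 X h; by rewrite mul0r mulr0.
    by rewrite cut_eq1; [ring|rewrite ler_pdivrMr// mul1r ltW].
  under eq_bigr do rewrite E.
  by rewrite -mulr_sumr -/(S X) denX; field; rewrite gt_eqF.
rewrite qE -mulrBr -sumrB.
have e'b Q : `|(P Q).2 X - chi Q X * s Q X| <= C2 * (B / Rr ^+ 2 + (2^-1) ^+ k0 + eps0).
  have [_ _ _ thin] := hP Q.
  (* The piece for [Q] lives within [2 L rho] of [Q], and [2 c0 delta <= 2 L rho], so only fine net
     points within [4 L rho] matter. *)
  pose zq := [seq Z <- zd | `|Z - Q| <= 4 * L * rho].
  have sN Y : `|s Q Y| <= \sum_(i < size zq) (`|Y - nth 0 zq i| <= 2 * c0 * delta)%R%:R.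
    rewrite -(big_mkord xpredT (fun i => (`|Y - nth 0 zq i| <= 2 * c0 * delta)%R%:R)).
    rewrite -(big_nth 0 xpredT (fun Z => (`|Y - Z| <= 2 * c0 * delta)%R%:R)).
    apply: le_trans (sb Q Y) _; have [h|h] := leP (2 * (L * rho)) `|Y - Q|.
      rewrite (cut_eq0 (t := `|Y - Q| / _)) ?mulr0 ?sumr_ge0//.
      by rewrite ler_pdivlMr.
    apply: (@le_trans _ _ (ze Y * 1)).
      by apply: ler_pM => //; rewrite ?cut_ge0 ?cut_le1// ge_min lexx orbT.
    rewrite mulr1 /zq big_filter /ze [leRHS]big_mkcond/=; apply: ler_sum => Z _.
    have [hZ|hZ] := leP `|Y - Z| (2 * c0 * delta); last first.
      by rewrite cut_eq0; [case: ifP|rewrite ler_pdivlMr//; clear - hZ; lra].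
    rewrite ifT ?cut_le1//; have := ler_distD Y Z Q; rewrite (distrC Z Y).
    have : c0 * delta <= L * rho by apply: ler_pM => //; [exact: le_trans c01|exact: ltW].
    by clear - hZ h; lra.
  have dd : 0 <= 2 * c0 * delta by clear - cd0; lra.
  apply: le_trans (thin _ _ (2 * c0 * delta) k0 X dd sN) _; rewrite ler_pM2l// !lerD2r.
  rewrite size_filter BE -[leRHS]mulrA ler_wpM2l ?exprn_ge0//.
  have -> : 2 * c0 * delta / rho = 2 * c0 / Rr by rewrite /rho; field; rewrite (gt_eqF R0) (gt_eqF d0).
  (* At most [c1 (4 L Rr)^(n-2)] balls, each of relative volume of order [(2 c0 / Rr)^n], leave the
     factor [Rr^-2]. *)
  have n2E : n = (n - 2 + 2)%N by rewrite subnK.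
  have h4 : delta <= 4 * L * rho.
    by apply: le_trans drho _; rewrite ler_peMl ?(ltW rho0)//; clear - L1; lra.
  have cn := zdcnt Q (4 * L * rho) h4.
  apply: le_trans (ler_wpM2r _ cn) _; first by rewrite exprn_ge0// divr_ge0 ?(ltW R0)// mulr_ge0// (le_trans ler01).
  have -> : 4 * L * rho / delta = 4 * L * Rr by rewrite /rho; field; rewrite gt_eqF.
  rewrite exprMn expr_div_n [in Rr ^+ n]n2E [in Rr ^+ (_ + _)]exprD.
  rewrite le_eqVlt; apply/orP; left; apply/eqP; field; by rewrite !expf_neq0 ?gt_eqF.
apply: le_trans (sumP _ (C2 * (B / Rr ^+ 2 + (2^-1) ^+ k0 + eps0)) X _ _ e'b) _.
- rewrite mulr_ge0 ?(ltW C20)// !addr_ge0 ?(ltW eps00) ?exprn_ge0 ?invr_ge0//.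
  by rewrite divr_ge0 ?exprn_ge0 ?(ltW R0).
- move=> Q h; have [_ _ h3 _] := hP Q; have [_ _ ->] := h3 X h.
  by have [_ _ _ h4 _] := hl Q; have [-> _ _] := h4 X h; rewrite mul0r subrr.
have p1 : N1 * C2 * (B / Rr ^+ 2) <= 48^-1.
  rewrite mulrA ler_pdivrMr ?exprn_gt0//.
  have : Rr <= Rr ^+ 2 by rewrite expr2 ler_peMl// ltW.
  by rewrite RE; clear; lra.
have p2 : N1 * C2 * (2^-1) ^+ k0 <= 48^-1.
  by rewrite exprVn ler_pdivrMr ?exprn_gt0//; clear - hk0; lra.
have p3 : N1 * C2 * eps0 <= 48^-1.
  by rewrite epsE ler_pdivrMr//; clear - NC0; lra.
by rewrite mulrA !mulrDr; clear - p1 p2 p3; lra.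
Qed.

End correction.

(** * Interpolation on the net *)

Section interpolation.
Variables (R : realType) (n : nat).
Implicit Types (X Y Z Q : 'rV[R]_n).

Lemma wsol_recip (a : 'rV[R]_n -> 'M[R]_n) v V g :
  (forall i j, continuous (fun X => a X i j)) -> (forall X, v X != 0) -> wsol a v V g ->
  wsol a (fun X => (v X)^-1) (fun i X => - (v X) ^- 2 * V i X)
    (fun X => - (v X) ^- 2 * g X - 2 * (v X) ^- 3 * ip a V V X).
Proof.
move=> ca v0 sv; have [[cv _ _] _ _] := sv.
have d1 X : is_derive (v X) 1 (fun y : R => y^-1) (- (v X) ^- 2) by exact: is_derive_recip.
have d2 X : is_derive (v X) 1 (fun y : R => - y ^- 2) (2 * (v X) ^- 3).
  have h := isdZ (-1) (isdM (d1 X) (d1 X)).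
  apply: (isd_eq _ _ h) => [y|]; first by rewrite expr2 invfM mulN1r.
  by field.
apply: (wsol_comp (phi := fun y => y^-1) (phi1 := fun y => - y ^- 2) (phi2 := fun y => 2 * y ^- 3) ca sv d1 d2).
apply: (@cts_mul _ _ (fun=> 2)); first exact: cts_cst.
apply: (@cts_inv _ _ (fun X => v X ^+ 3)) => [X|]; first by rewrite expf_neq0.
by rewrite (_ : (fun X => _) = fun X => v X * (v X * v X)); [do 2 apply: cts_mul => //|apply/funext => X; rewrite !exprS expr0 mulr1].
Qed.

(** [v] is the quotient of the blend of the values [F Q] by the sum of the bumps; the product and
    reciprocal rules give [L v] explicitly, and each order of differentiation costs [rho^-1]. *)
Lemma interpolation (a : 'rV[R]_n -> 'M[R]_n) kappa M w c0 c1 (K : set 'rV[R]_n) L C2 :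
  elliptic_field a kappa M w -> 1 <= c0 -> 0 <= c1 -> c0 <= L -> 1 <= C2 ->
  exists2 C4, 1 <= C4 & forall rho zr chi Xg l (F : 'rV[R]_n -> R), 0 < rho ->
    net K c0 c1 rho zr -> bumps a rho c0 L C2 chi Xg l ->
    exists v V g, wsol a v V g /\
    forall X Q0 F0 osc, Q0 \in zr -> `|X - Q0| <= c0 * rho -> 0 <= osc ->
      (forall Q, Q \in zr -> `|X - Q| < L * rho -> `|F Q - F0| <= osc) ->
      [/\ `|v X - F0| <= C4 * osc, forall i, `|V i X| <= C4 * osc / rho &
          `|g X| <= C4 * osc / rho ^+ 2].
Proof.
move=> [[kp0 M0] [sa ell] aM dc aw] c01 c10 cL C21.
have ca i j : continuous (fun X => a X i j) by apply: (control_continuous dc) => X Y; exact: aw.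
have L1 : 1 <= L by exact: le_trans cL.
have L0 : 0 < L by exact: lt_le_trans L1.
have C20 : 0 < C2 by exact: lt_le_trans C21.
have [P PE] : exists x, x = 8 * (c1 * L ^+ (n - 2) * C2) by eexists.
have P0 : 0 <= P.
  by rewrite PE !mulr_ge0 ?exprn_ge0// ltW.
have [H HE] : exists x, x = n%:R ^+ 2 * M by eexists.
have H0 : 0 <= H by rewrite HE mulr_ge0// sqr_ge0.
have HP2 : 0 <= H * P ^+ 2 by rewrite mulr_ge0 ?sqr_ge0.
have HP3 : 0 <= H * P ^+ 3 by rewrite mulr_ge0 ?exprn_ge0.
have P20 : 0 <= P ^+ 2 by exact: sqr_ge0.
exists (1 + P + P ^+ 2 + 2 * (H * P ^+ 3) + 2 * (H * P ^+ 2)); first by clear - P0 HP2 HP3 P20; lra.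
move=> rho zr chi Xg l F rho0 [uz zK zcov zcnt] [bs bb bl bo].
have solS := wsolZ ca 8 (wsol_sum ca zr bs).
have solN := wsolZ ca 8 (wsol_sum ca zr (fun Q => wsolZ ca (F Q) (bs Q))).
set sg := fun X => 8 * \sum_(Q <- zr) chi Q X in solS.
set Sg := fun i X => 8 * \sum_(Q <- zr) Xg Q i X in solS.
set ls := fun X => 8 * \sum_(Q <- zr) l Q X in solS.
set N := fun X => 8 * \sum_(Q <- zr) F Q * chi Q X in solN.
set Ng := fun i X => 8 * \sum_(Q <- zr) F Q * Xg Q i X in solN.
set ln := fun X => 8 * \sum_(Q <- zr) F Q * l Q X in solN.
have solP := wsol_pos3 ca (wsolD ca (wsol_cst ca 1) (wsolZ ca (-1) solS)).
have solD := wsolD ca solS solP.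
(* The cubed term keeps the denominator away from [0] and vanishes where [1 <= sg]. *)
set D := fun X => sg X + _ in solD.
have sg0 X : 0 <= sg X.
  by rewrite /sg mulr_ge0// sumr_ge0// => Q _; have [h _ _] := bb Q; have /andP[] := h X.
have D0 X : D X != 0.
  rewrite gt_eqF// /D; have [h|h] := leP (sg X) 2^-1.
    apply: ltr_wpDl => //; rewrite exprn_gt0// pos_id; clear - h; lra.
  by apply: ltr_pwDl; [clear - h; lra|rewrite exprn_ge0// pos_ge0].
have solI := wsol_recip ca D0 solD.
have solV := wsolM ca sa solN solI.
move: solV; set v := fun X => N X * _; set V := fun i X => N X * _ + _.
set g := fun X => N X * _ + _ - _ => solV.
exists v, V, g; split=> // X Q0 F0 osc Q0z hQ0 osc0 hosc.
have cnt : (count (fun Q => `|Q - X| <= L * rho)%R zr)%:R <= c1 * L ^+ (n - 2).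
  apply: le_trans (zcnt X (L * rho) _) _; first by rewrite ler_peMl// ltW.
  by rewrite mulfK// gt_eqF.
have sumP (z : 'rV[R]_n -> R) (d : R) : 0 <= d ->
    (forall Q, L * rho <= `|X - Q| -> z Q = 0) ->
    (forall Q, Q \in zr -> `|X - Q| < L * rho -> `|z Q| <= C2 * d) ->
    `|8 * \sum_(Q <- zr) z Q| <= P * d.
  move=> dd g0 gd; rewrite normrM (ger0_norm (ler0n R 8)) PE -[leRHS]mulrA ler_pM2l//.
  have h1 Q : Q \in zr -> ~~ (`|Q - X| <= L * rho) -> z Q = 0.
    by move=> _; rewrite -ltNge => /ltW; rewrite distrC; exact: g0.
  have h2 Q : Q \in zr -> `|Q - X| <= L * rho -> `|z Q| <= C2 * d.
    move=> Qz _; have [h|h] := ltP `|X - Q| (L * rho); first exact: gd.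
    by rewrite g0// normr0 mulr_ge0// ltW.
  apply: le_trans (@sum_support R n zr (fun Q => `|Q - X| <= L * rho) z (C2 * d) h1 h2) _.
  by rewrite -[leRHS]mulrA ler_wpM2r// mulr_ge0// ltW.
have r1 : 0 <= rho^-1 by rewrite invr_ge0 ltW.
have r2 : 0 <= rho ^- 2 by rewrite invr_ge0 sqr_ge0.
have sg1 : 1 <= sg X.
  have h : 8^-1 <= \sum_(Q <- zr) chi Q X.
    rewrite (bigD1_seq Q0)//=; apply: (@le_trans _ _ (chi Q0 X)); first exact: bl.
    rewrite lerDl sumr_ge0// => Q _; have [hh _ _] := bb Q; have /andP[] := hh X; by [].
  by rewrite /sg; clear - h; lra.
have sgp : 0 < sg X by exact: lt_le_trans sg1.
have ps : pos (1 + -1 * sg X) = 0 by apply: pos_0; clear - sg1; lra.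
have DX : D X = sg X by rewrite /D ps expr0n addr0.
(* The blend of a constant is that constant, so only differences against [F0] matter. *)
pose N' := 8 * \sum_(Q <- zr) (F Q - F0) * chi Q X.
pose Ng' i := 8 * \sum_(Q <- zr) (F Q - F0) * Xg Q i X.
pose ln' := 8 * \sum_(Q <- zr) (F Q - F0) * l Q X.
have shift (z : 'rV[R]_n -> R) : 8 * (\sum_(Q <- zr) F Q * z Q) =
    8 * (\sum_(Q <- zr) (F Q - F0) * z Q) + F0 * (8 * \sum_(Q <- zr) z Q).
  rewrite [F0 * _]mulrCA -mulrDr; congr (_ * _).
  by rewrite [F0 * _]mulr_sumr -big_split/=; apply: eq_bigr => Q _; rewrite -mulrDl subrK.
have NE : N X = N' + F0 * sg X by exact: shift.
have NgE i : Ng i X = Ng' i + F0 * Sg i X.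
  exact: shift.
have lnE : ln X = ln' + F0 * ls X.
  exact: shift.
have bN : `|N'| <= P * osc.
  apply: sumP => // [Q /bo[-> _ _]|Q Qz h]; first by rewrite mulr0.
  have [hc _ _] := bb Q; have /andP[q0 q1] := hc X.
  by rewrite normrM mulrC; apply: ler_pM => //; [rewrite ger0_norm|exact: hosc].
have bNg i : `|Ng' i| <= P * (osc / rho).
  apply: sumP; [by rewrite mulr_ge0|by move=> Q /bo[_ -> _]; rewrite mulr0|move=> Q Qz h].
  have [_ hc _] := bb Q; rewrite normrM.
  apply: le_trans (ler_pM (normr_ge0 _) (normr_ge0 _) (hosc Q Qz h) (hc i X)) _.
  by rewrite [leLHS]mulrCA.
have bln : `|ln'| <= P * (osc / rho ^+ 2).
  apply: sumP; [by rewrite mulr_ge0|by move=> Q /bo[_ _ ->]; rewrite mulr0|move=> Q Qz h].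
  have [_ _ hc] := bb Q; rewrite normrM.
  apply: le_trans (ler_pM (normr_ge0 _) (normr_ge0 _) (hosc Q Qz h) (hc X)) _.
  by rewrite [leLHS]mulrCA.
have bSg i : `|Sg i X| <= P * rho^-1.
  apply: sumP => // [Q /bo[_ -> _]|Q Qz h]//.
  by have [_ hc _] := bb Q; exact: hc.
have bls : `|ls X| <= P * rho ^- 2.
  apply: sumP => // [Q /bo[_ _ ->]|Q Qz h]//.
  by have [_ _ hc] := bb Q; exact: hc.
pose i1 := ip a Sg Sg X; pose i2 := \sum_(i < n) (\sum_(j < n) a X i j * Ng' j) * Sg i X.
have bi1 : `|i1| <= H * (P * rho^-1) * (P * rho^-1).
  by rewrite HE; apply: ip_bound => // *; exact: aM.
have bi2 : `|i2| <= H * (P * (osc / rho)) * (P * rho^-1).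
  by rewrite HE; apply: (@ip_bound _ _ _ (fun j _ => Ng' j) Sg X) => // *; exact: aM.
have ig0 : 0 < (sg X)^-1 by rewrite invr_gt0.
have ig1 : (sg X)^-1 <= 1 by rewrite invf_le1.
have [y yE] : exists y, y = (sg X)^-1 by eexists.
rewrite -yE in ig0 ig1.
have yz k (z : R) : `|y ^+ k * z| <= `|z|.
  rewrite normrM (ger0_norm (exprn_ge0 k (ltW ig0))).
  by rewrite -[leRHS]mul1r ler_wpM2r//; apply: exprn_ile1 => //; exact: ltW.
have yK : y * sg X = 1 by rewrite yE mulVf// gt_eqF.
have vE : v X - F0 = y ^+ 1 * N'.
  rewrite /v DX -yE NE expr1; have -> : N' = N' + F0 * (sg X - sg X) by ring.
  transitivity (y * N' + F0 * (y * sg X - 1)); first by ring.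
  by rewrite yK; ring.
have D2 : D X ^- 2 = y ^+ 2 by rewrite DX yE exprVn.
have D3 : D X ^- 3 = y ^+ 3 by rewrite DX yE exprVn.
have gs i : Sg i X + 3 * pos (1 + -1 * sg X) ^+ 2 * (0 + -1 * Sg i X) = Sg i X.
  by rewrite ps expr0n/= mulr0 mul0r addr0.
have VE i : V i X = - (y ^+ 2 * (N' * Sg i X)) + y ^+ 1 * Ng' i.
  rewrite /V D2 gs DX -yE NE NgE expr1.
  transitivity (- (y ^+ 2 * (N' * Sg i X)) + y * Ng' i + F0 * y * Sg i X * (1 - y * sg X)); first by ring.
  by rewrite yK; ring.
(* All terms carrying [F0] contain the factor [1 - y * sg X], which is zero. *)
have gE : g X = - (y ^+ 2 * (N' * ls X)) - 2 * (y ^+ 3 * (N' * i1)) + y ^+ 1 * ln' + 2 * (y ^+ 2 * i2).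
  have ipD (G H1 H2 G2 : 'I_n -> 'rV[R]_n -> R) :
      (forall i, G i X = H1 i X) -> (forall i, G2 i X = H2 i X) -> ip a G G2 X = ip a H1 H2 X.
    move=> e1 e2; apply: eq_bigr => i _; rewrite e2; congr (_ * _).
    by apply: eq_bigr => j _; rewrite e1.
  have ip1 : ip a Ng (fun i X => - D X ^- 2 * (Sg i X + 3 * pos (1 + -1 * sg X) ^+ 2 * (0 + -1 * Sg i X))) X
      = - y ^+ 2 * (i2 + F0 * i1).
    rewrite (@ipD _ (fun i _ => Ng' i + F0 * Sg i X) (fun i _ => - y ^+ 2 * Sg i X)); last 2 first.
    - exact: NgE.
    - by move=> i; rewrite D2 gs.
    rewrite /ip /i1 /i2 /ip mulrDr mulrCA !mulr_sumr -big_split/=; apply: eq_bigr => i _.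
    rewrite (_ : \sum_(j < n) _ = (\sum_(j < n) a X i j * Ng' j) + F0 * \sum_(j < n) a X i j * Sg j X); first by ring.
    by rewrite mulr_sumr -big_split/=; apply: eq_bigr => j _; ring.
  rewrite /g ip1 D2 D3 DX -yE NE lnE ps !mulr0 mul0r expr0n/= !mulr0 !mul0r subr0 addr0.
  rewrite (@ipD _ Sg Sg _ gs gs) -/i1.
  transitivity (- (y ^+ 2 * (N' * ls X)) - 2 * (y ^+ 3 * (N' * i1)) + y ^+ 1 * ln' + 2 * (y ^+ 2 * i2)
    + F0 * y * (1 - y * sg X) * (ls X + 2 * y * i1)); first by ring.
  by rewrite yK; ring.
have t0 : 0 <= osc / rho by rewrite mulr_ge0.
have t2 : 0 <= osc / rho ^+ 2 by rewrite mulr_ge0.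
have up (A B t : R) : 0 <= t -> A <= B -> A * t <= B * t by move=> *; rewrite ler_wpM2r.
split.
- rewrite vE; apply: le_trans (yz _ _) _; apply: le_trans bN _; apply: up => //.
  by clear - P0 HP2 HP3 P20; lra.
- move=> i; rewrite VE -[leRHS]mulrA; apply: le_trans (ler_normD _ _) _; rewrite normrN.
  apply: le_trans (lerD (yz _ _) (yz _ _)) _; rewrite normrM.
  apply: le_trans (lerD (ler_pM (normr_ge0 _) (normr_ge0 _) bN (bSg i)) (bNg i)) _.
  rewrite [leLHS](_ : _ = (P ^+ 2 + P) * (osc / rho)); last by ring.
  by apply: up => //; clear - P0 HP2 HP3 P20; lra.
- rewrite gE -[leRHS]mulrA.
  have e1 : `|N' * ls X| <= P * osc * (P * rho ^- 2).
    by rewrite normrM; exact: ler_pM.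
  have e2 : `|N' * i1| <= P * osc * (H * (P * rho^-1) * (P * rho^-1)).
    by rewrite normrM; exact: ler_pM.
  have f1 := le_trans (yz 2 (N' * ls X)) e1.
  have f2 := le_trans (yz 3 (N' * i1)) e2.
  have f3 := le_trans (yz 1 ln') bln.
  have f4 := le_trans (yz 2 i2) bi2.
  have tri (p q r s : R) : `|- p - 2 * q + r + 2 * s| <= `|p| + 2 * `|q| + `|r| + 2 * `|s|.
    have n2 (t : R) : `|2 * t| = 2 * `|t| by rewrite normrM (ger0_norm (ler0n R 2)).
    apply: le_trans (ler_normD _ _) _; rewrite n2 lerD2r.
    apply: le_trans (ler_normD _ _) _; rewrite lerD2r.
    by apply: le_trans (ler_normD _ _) _; rewrite !normrN n2.
  apply: le_trans (tri _ _ _ _) _.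
  apply: (@le_trans _ _ ((P ^+ 2 + 2 * (H * P ^+ 3) + P + 2 * (H * P ^+ 2)) * (osc / rho ^+ 2))).
    apply: le_trans (lerD (lerD (lerD f1 (ler_wpM2l (ler0n R 2) f2)) f3) (ler_wpM2l (ler0n R 2) f4)) _.
    rewrite -!exprVn le_eqVlt; apply/orP; left; apply/eqP; ring.
  by apply: up => //; clear - P0 HP2 HP3 P20; lra.
Qed.

End interpolation.

(** * The real-valued theorem *)

Section wsol_series.
Variables (R : realType) (n : nat) (a : 'rV[R]_n -> 'M[R]_n) (M : R).
Hypothesis ca : forall i j, continuous (fun X => a X i j).
Hypothesis aM : forall X i j, `|a X i j| <= M.

(** Uniform convergence of the gradients passes to the fluxes because [a] is bounded, so the weak
    equations can be summed. *)
Lemma wsol_series (u : nat -> 'rV[R]_n -> R) (U : nat -> 'I_n -> 'rV[R]_n -> R) (h : nat -> 'rV[R]_n -> R)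
    (c1 c2 c3 : nat -> R) (S1 S2 S3 : R) :
  (forall k, wsol a (u k) (U k) (h k)) ->
  (forall k, 0 <= c1 k) -> (forall k, 0 <= c2 k) -> (forall k, 0 <= c3 k) ->
  (forall k X, `|u k X| <= c1 k) -> (forall k i X, `|U k i X| <= c2 k) ->
  (forall k X, `|h k X| <= c3 k) ->
  (forall N, \sum_(k < N) c1 k <= S1) -> (forall N, \sum_(k < N) c2 k <= S2) ->
  (forall N, \sum_(k < N) c3 k <= S3) ->
  exists v V g, [/\ wsol a v V g, forall X, `|v X| <= S1, forall i X, `|V i X| <= S2 &
    forall X, \sum_(k < N) h k X @[N --> \oo] --> g X].
Proof.
move=> sol c10 c20 c30 ub Ub hb s1 s2 s3.
have cu k : continuous (u k) by have [[]] := sol k.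
have cU k i : continuous (U k i) by have [[]] := sol k.
have ch k : continuous (h k) by have [] := sol k.
have dU k i X : dird (u k) X (row i 1%:M) (U k i X) by have [[]] := sol k.
have [v [V [[cv cV] [vb Vb] dV VU _]]] := gradient_series cu cU c10 c20 ub Ub s1 s2 dU.
have [g [cg _ hg gU]] := uniform_series ch c30 hb s3.
exists v, V, g; split=> //; split=> // rho psi dpsi tst.
have [r0 cp cd _ sp] := tst.
pose e k i X := \sum_(j < n) a X i j * U k j X.
pose d i X := \sum_(j < n) a X i j * V j X.
have ce k i : continuous (e k i) by apply: (@cts_sum _ _ _ _ xpredT) => j _; apply: (@cts_mul _ _ (fun X => a X i j)); [exact: ca|exact: cU].
have cdd i : continuous (d i) by apply: (@cts_sum _ _ _ _ xpredT) => j _; apply: (@cts_mul _ _ (fun X => a X i j)); [exact: ca|exact: cV].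
have eU (r : R) : 0 < r -> exists N0, forall N, (N0 <= N)%N ->
    forall i X, `|\sum_(k < N) e k i X - d i X| <= r.
  move=> r0'; have M1 : 0 <= n%:R * `|M| by rewrite mulr_ge0.
  have q0 : 0 < r / (n%:R * `|M| + 1) by rewrite divr_gt0// ltr_wpDl.
  have [N0 hN0] := VU _ q0; exists N0 => N NN i X.
  rewrite /e exchange_big /d -sumrB/=.
  apply: le_trans (ler_norm_sum _ _ _) _.
  apply: (@le_trans _ _ (\sum_(j < n) `|M| * (r / (n%:R * `|M| + 1)))).
    apply: ler_sum => j _; rewrite -mulr_sumr -mulrBr normrM.
    apply: ler_pM => //; last exact: hN0.
    by apply: le_trans (aM X i j) _; exact: ler_norm.
  rewrite sumr_const card_ord -[leLHS]mulr_natl mulrA mulrCA -[leRHS]mulr1 ler_wpM2l//; first exact: ltW.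
  by rewrite ler_pdivrMr ?mul1r ?lerDl// ltr_wpDl.
have h1 := weak_series tst ce cdd eU.
have h2 := uniform_pairing r0 cp (fun X p => (sp X p).1) ch cg gU.
apply: (cvg_unique (@norm_hausdorff R _) h1).
apply: cvg_trans h2; rewrite (_ : (fun N => _) = (fun N => \sum_(k < N) Rintegral (lebesgue_row R n) setT (fun X => h k X * psi X))) //.
apply/funext => N; apply: eq_bigr => k _.
by have [_ _ wk] := sol k; exact: wk tst.
Qed.

(* Iterates the solver on twice the error of the previous step, truncated to [-1, 1]. *)
Lemma correction_series (D : set 'rV[R]_n) (A1 A2 A3 : R) : 0 <= A1 -> 0 <= A2 -> 0 <= A3 ->
  (forall q, continuous q -> (forall X, `|q X| <= 1) -> exists u U h,
    [/\ wsol a u U h, forall X, `|u X| <= A1, forall i X, `|U i X| <= A2,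
      forall X, `|h X| <= A3 & forall X, D X -> `|h X - q X| <= 2^-1]) ->
  forall q, continuous q -> (forall X, `|q X| <= 1) -> exists v V g,
    [/\ wsol a v V g, forall X, `|v X| <= 2 * A1, forall i X, `|V i X| <= 2 * A2 &
      forall X, D X -> g X = q X].
Proof.
move=> A10 A20 A30 step q0 cq0 q01.
have /choice[T hT] (q : 'rV[R]_n -> R) : exists t : ('rV[R]_n -> R) * ('I_n -> 'rV[R]_n -> R) * ('rV[R]_n -> R),
    continuous q -> (forall X, `|q X| <= 1) ->
    [/\ wsol a t.1.1 t.1.2 t.2, forall X, `|t.1.1 X| <= A1, forall i X, `|t.1.2 i X| <= A2,
      forall X, `|t.2 X| <= A3 & forall X, D X -> `|t.2 X - q X| <= 2^-1].
  have [[cq q1]|nq] := pselect (continuous q /\ forall X, `|q X| <= 1).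
    by have [u [U [h hh]]] := step q cq q1; exists (u, U, h).
  by exists (q, fun=> q, q) => cq q1; exfalso; apply: nq.
(* Truncation to [[-1, 1]], in a form whose continuity follows from that of the absolute value. *)
pose clip (y : R) := (`|y + 1| - `|y - 1|) / 2.
have clip1 y : `|clip y| <= 1.
  rewrite /clip normrM [ `|2^-1| ]ger0_norm// ler_pdivrMr// mul1r.
  by apply: le_trans (ler_dist_dist _ _) _; rewrite (_ : _ - _ = 2) ?ger0_norm//; ring.
have clipE y : `|y| <= 1 -> clip y = y.
  rewrite ler_norml => /andP[h1 h2]; rewrite /clip ger0_norm ?ler0_norm; first by field.
  - by rewrite subr_le0.
  - by rewrite -lerBlDr sub0r.
pose Q k := iter k (fun q X => clip (2 * (q X - (T q).2 X))) q0.
have hQ k : continuous (Q k) /\ forall X, `|Q k X| <= 1.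
  elim: k => [|k [ck k1]]; first by split.
  split=> [|X]; last by exact: clip1.
  have [[_ ch _] _ _ _ _] := hT _ ck k1.
  have cy : continuous (fun X => 2 * (Q k X - (T (Q k)).2 X)).
    by apply: cts_mul; [exact: cts_cst|apply: cts_sub].
  rewrite /Q iterS -/(Q k) /clip; apply: (@cts_mul _ _ _ (fun=> 2^-1)); last exact: cts_cst.
  apply: cts_sub; apply: cts_norm; [apply: (@cts_add _ _ _ (fun=> 1))|apply: (@cts_sub _ _ _ (fun=> 1))] => //; exact: cts_cst.
have sol k := hT _ (hQ k).1 (hQ k).2.
have g0 k : 0 <= 2^-1 ^+ k :> R by rewrite exprn_ge0.
have gs (A : R) N : 0 <= A -> \sum_(k < N) 2^-1 ^+ k * A <= 2 * A.
  move=> A0; rewrite -mulr_suml ler_wpM2r//.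
  apply: le_trans (sum_geom _ _ _) _; [by []|by rewrite invf_lt1 ?ltr1n|].
  by rewrite (_ : 1 - 2^-1 = 2^-1) ?invrK//; field.
have [||||||v [V [g [sv vb Vb hg]]]] := @wsol_series (fun k X => 2^-1 ^+ k * (T (Q k)).1.1 X)
   (fun k i X => 2^-1 ^+ k * (T (Q k)).1.2 i X) (fun k X => 2^-1 ^+ k * (T (Q k)).2 X)
   (fun k => 2^-1 ^+ k * A1) (fun k => 2^-1 ^+ k * A2) (fun k => 2^-1 ^+ k * A3)
   (2 * A1) (2 * A2) (2 * A3)
   (fun k => wsolZ ca _ (let: And5 h _ _ _ _ := sol k in h))
   (fun k => mulr_ge0 (g0 k) A10) (fun k => mulr_ge0 (g0 k) A20) (fun k => mulr_ge0 (g0 k) A30).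
- by move=> k X; have [_ h _ _ _] := sol k; rewrite normrM ger0_norm// ler_wpM2l.
- by move=> k i X; have [_ _ h _ _] := sol k; rewrite normrM ger0_norm// ler_wpM2l.
- by move=> k X; have [_ _ _ h _] := sol k; rewrite normrM ger0_norm// ler_wpM2l.
- by move=> N; exact: gs.
- by move=> N; exact: gs.
- by move=> N; exact: gs.
exists v, V, g; split=> // X DX.
apply: (cvg_unique (@norm_hausdorff R _) (hg X)).
apply/seq_cvgP => e e0.
(* On [D] the error is at most [1/2], so its double lies in [[-1, 1]] and the truncation acts as the
   identity. *)
have QS k : Q k.+1 X = 2 * (Q k X - (T (Q k)).2 X).
  have [_ _ _ _ h] := sol k; have := h X DX => hX.
  rewrite /Q iterS -/(Q k); apply: clipE.
  rewrite normrM ger0_norm// distrC; clear - hX; lra.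
have sumE N : \sum_(k < N) 2^-1 ^+ k * (T (Q k)).2 X = q0 X - 2^-1 ^+ N * Q N X.
  elim: N => [|N IH]; first by rewrite big_ord0 expr0 mul1r subrr.
  by rewrite QS exprS big_ord_recr/= IH; field.
have [N0 hN0] : exists N0, forall N, (N0 <= N)%N -> `|2^-1 ^+ N| < e.
  have := @cvg_expr R 2^-1; rewrite ger0_norm// => h.
  have /seq_cvgP/(_ e e0)[N0 hN0] := h (ltac:(lra)).
  by exists N0 => N NN; have := hN0 N NN; rewrite subr0.
exists N0 => N NN; rewrite sumE (_ : _ - q0 X = - (2^-1 ^+ N * Q N X)); last by ring.
rewrite normrN normrM; apply: le_lt_trans (hN0 N NN).
by rewrite -[leRHS]mulr1 ler_wpM2l//; exact: (hQ N).2.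
Qed.

End wsol_series.

(** * Approximation at small scales *)

Section small_scale.
Variables (R : realType) (n : nat).
Implicit Types (X Y Z Q : 'rV[R]_n) (K : set 'rV[R]_n) (omega : R -> R).

Definition scaling_modulus omega := [/\ forall t, 0 < t -> 0 < omega t,
  forall s t, 0 <= s -> s <= t -> omega s <= omega t &
  forall s t, 0 < s -> s <= t -> omega t / t <= omega s / s].

Lemma scaling_modulus_mul omega (l t s : R) : scaling_modulus omega -> 1 <= l -> 0 < t ->
  0 <= s -> s <= l * t -> omega s <= l * omega t.
Proof.
move=> [_ om od] l1 t0 s0 sl; have l0 : 0 < l by exact: lt_le_trans l1.
apply: le_trans (om _ _ s0 sl) _.
have tl : t <= l * t by rewrite ler_peMl// ltW.
have := od t (l * t) t0 tl.
rewrite ler_pdivrMr ?mulr_gt0// => h; apply: le_trans h _.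
by rewrite (_ : _ * (l * t) = l * omega t)//; field; rewrite gt_eqF.
Qed.

(** [v] is the interpolant [v0] minus [B0] times the solution with data [g0 / B0]. As [B0] is of
    order [omega(delta) / rho^2], the correction is of order [omega(delta)] and its gradient of
    order [omega(delta) / rho], like the interpolation error and the gradient of [v0]. *)
Lemma small_scale (a : 'rV[R]_n -> 'M[R]_n) kappa M w K omega (f : 'rV[R]_n -> R) (C : R) :
  (2 <= n)%N -> elliptic_field a kappa M w -> condition_A K -> scaling_modulus omega ->
  0 < C -> (forall X Y, K X -> K Y -> `|f X - f Y| <= C * omega (enorm (X - Y))) ->
  exists d0 c2 c3, [/\ 0 < d0, 0 <= c2, 0 <= c3 & forall delta, 0 < delta -> delta <= d0 ->
    exists v V g, [/\ wsol a v V g, forall X, thickening K delta X -> g X = 0,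
      forall X i, thickening K delta X -> `|V i X| <= c2 * (omega delta / delta) &
      forall X, K X -> `|f X - v X| <= c3 * omega delta]].
Proof.
move=> n2 ef KA om C0 fK.
have [c0 [c1 [c01 c10 nets]]] := condition_A_net (ltnW n2) KA.
have [L [C2 [C3 [Rr [d0 [[cL C21] C31 Rr1 d00 corr]]]]]] := correction K n2 ef c01 c10.
have [C4 C41 inter] := interpolation K ef c01 c10 cL C21.
have [[kp0 M0] [sa ell] aM dc aw] := ef.
have ca i j : continuous (fun X => a X i j) by apply: (control_continuous dc) => X Y; exact: aw.
have n1 : 1 <= n%:R :> R by rewrite ler1n ltnW.
have L1 : 1 <= L by exact: le_trans cL.
have C30 : 0 < C3 by exact: lt_le_trans C31.
have C40 : 0 < C4 by exact: lt_le_trans C41.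
have Rr0 : 0 < Rr by exact: lt_le_trans Rr1.
(* Net points that act at [X] lie within [(L + c0) rho] of the chosen [Q0] in sup norm; [n] converts
   to the Euclidean norm and [Rr] to units of [delta]. *)
have [lam lamE] : exists x, x = n%:R * (L + c0) * Rr by eexists.
have lam1 : 1 <= lam.
  rewrite lamE -[leLHS](mulr1 1); apply: ler_pM => //; rewrite -[leLHS](mulr1 1); apply: ler_pM => //.
  by clear - L1 c01; lra.
have lam0 : 0 < lam by exact: lt_le_trans lam1.
exists d0, (C4 * (C * lam) * (1 + 2 * C3 * Rr)), (C * lam * (1 + C4 + 2 * (C4 * C3 * Rr ^+ 2))).
have CL0 : 0 < C * lam by rewrite mulr_gt0.
split=> //.
- by rewrite mulr_ge0 ?addr_ge0 ?mulr_ge0// ltW.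
- by rewrite mulr_ge0 ?addr_ge0 ?mulr_ge0 ?sqr_ge0// ltW.
move=> delta dl0 dld; have [rho rhoE] : exists x, x = Rr * delta by eexists.
have rho0 : 0 < rho by rewrite rhoE mulr_gt0.
have drho : delta <= rho by rewrite rhoE ler_peMl// ltW.
have [zd nd] := nets _ dl0; have [zr nr] := nets _ rho0.
have := corr delta dl0 dld; rewrite /= -rhoE => /(_ zr zd nr nd)[chi [Xg [l [bmp solver]]]].
have [v0 [V0 [g0 [sol0 loc]]]] := inter rho zr chi Xg l f rho0 nr bmp.
have [osc oscE] : exists x, x = C * lam * omega delta by eexists.
have om0 : 0 < omega delta by have [h _ _] := om; exact: h.
have osc0 : 0 < osc by rewrite oscE mulr_gt0.
have near X Y : K X -> K Y -> `|X - Y| <= (L + c0) * rho -> `|f X - f Y| <= osc.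
  move=> KX KY h; apply: le_trans (fK _ _ KX KY) _; rewrite oscE -mulrA ler_pM2l//.
  apply: scaling_modulus_mul om lam1 dl0 (enorm_ge0 _) _.
  apply: le_trans (enorm_le_norm _) _; rewrite lamE -!mulrA ler_wpM2l//.
  by rewrite -rhoE.
have [_ zK zcov _] := nr.
have thick X : thickening K delta X -> thickening K rho X.
  by move=> [Z KZ hZ]; exists Z => //; rewrite /eball/= in hZ *; exact: lt_le_trans drho.
have Kthick X : K X -> thickening K delta X.
  by move=> KX; exists X => //; rewrite /eball/= subrr -(scale0r X) enormZ normr0 mul0r.
have est X : thickening K delta X -> exists2 Q0, Q0 \in zr /\ `|X - Q0| <= c0 * rho &
    [/\ `|v0 X - f Q0| <= C4 * osc, forall i, `|V0 i X| <= C4 * osc / rho &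
          `|g0 X| <= C4 * osc / rho ^+ 2].
  move=> /thick/zcov[Q0 Qz hQ]; exists Q0 => //; apply: (loc X Q0 (f Q0) osc Qz hQ (ltW osc0)).
  move=> Q Qz' hQ'; apply: near; [exact: zK|exact: zK|].
  apply: le_trans (ler_distD X _ _) _; rewrite mulrDl; apply: lerD => //.
  by rewrite distrC ltW.
have [B0 B0E] : exists x, x = C4 * osc / rho ^+ 2 by eexists.
have B00 : 0 < B0 by rewrite B0E divr_gt0 ?exprn_gt0 ?mulr_gt0.
(* The bound of [g0] by [B0] is known on the thickening, where the truncation changes nothing;
   elsewhere it makes the data admissible. *)
pose q X := Num.max (-1) (Num.min 1 (g0 X / B0)).
have cq : continuous q.
  have [_ cg _] := sol0.
  apply: (@cts_max _ _ (fun=> -1)); [exact: cts_cst|apply: (@cts_min _ _ (fun=> 1)); first exact: cts_cst].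
  by apply: (@cts_mul _ _ _ (fun=> B0^-1)) => //; exact: cts_cst.
have q1 X : `|q X| <= 1.
  by rewrite ler_norml /q le_max lexx ge_max ge_min lexx /= andbT; clear; lra.
have qE X : thickening K delta X -> q X = g0 X / B0.
  move=> /est[Q0 _ [_ _ h]]; have : `|g0 X / B0| <= 1.
    by rewrite normrM (ger0_norm (x := B0^-1)) ?invr_ge0 ?(ltW B00)// ler_pdivrMr// mul1r B0E.
  by rewrite ler_norml => /andP[h1 h2]; rewrite /q min_r// max_r.
have A10 : 0 <= C3 * rho ^+ 2 by rewrite mulr_ge0 ?sqr_ge0// ltW.
have A20 : 0 <= C3 * rho by rewrite mulr_ge0// ltW.
have [u [U [h [sol1 ub Ub hq]]]] :=
  correction_series ca aM A10 A20 (ltW C30) solver cq q1.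
exists (fun X => v0 X + - B0 * u X), (fun i X => V0 i X + - B0 * U i X), (fun X => g0 X + - B0 * h X).
have mB (x y : R) : `|x| <= y -> `|- B0 * x| <= B0 * y.
  by move=> hx; rewrite normrM normrN (ger0_norm (ltW B00)) ler_pM2l.
split.
- exact: wsolD (wsolZ ca _ sol1).
- by move=> X tX; rewrite hq// qE// mulNr mulrCA divff ?gt_eqF// mulr1 subrr.
- move=> X i /est[Q0 _ [_ hV _]]; apply: le_trans (ler_normD _ _) _.
  apply: le_trans (lerD (hV i) (mB _ _ (Ub i X))) _.
  rewrite [leLHS](_ : _ = C4 * osc / rho * (1 + 2 * C3)); last first.
    by rewrite B0E; field; rewrite gt_eqF.
  rewrite [leRHS](_ : _ = C4 * osc / delta * (1 + 2 * C3 * Rr)); last by rewrite oscE; ring.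
  have x0 : 0 <= C4 * osc by rewrite mulr_ge0// ltW.
  apply: ler_pM.
  + by rewrite divr_ge0// ltW.
  + by rewrite addr_ge0// mulr_ge0// ltW.
  + by rewrite ler_wpM2l// lef_pV2.
  + by rewrite lerD2l ler_peMr// mulr_ge0// ltW.
- move=> X KX; have [Q0 [Q0z hQ] [hv _ _]] := est X (Kthick X KX).
  have h1 : `|f X - f Q0| <= osc.
    apply: near => //; first exact: zK.
    by apply: le_trans hQ _; rewrite ler_pM2r// lerDr; exact: le_trans L1.
  rewrite (_ : _ - _ = (f X - f Q0) + (f Q0 - v0 X) + - (- B0 * u X)); last by ring.
  apply: le_trans (ler_normD _ _) _; rewrite normrN.
  apply: le_trans (lerD (ler_normD _ _) (mB _ _ (ub X))) _; rewrite [ `|f Q0 - _| ]distrC.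
  apply: le_trans (lerD (lerD h1 hv) (lexx _)) _.
  rewrite [leLHS](_ : _ = osc * (1 + C4 + 2 * (C4 * C3))); last first.
    by rewrite B0E; field; rewrite gt_eqF.
  rewrite [leRHS](_ : _ = osc * (1 + C4 + 2 * (C4 * C3 * Rr ^+ 2))); last by rewrite oscE; ring.
  rewrite ler_pM2l// lerD2l ler_pM2l// ler_peMr ?mulr_ge0 ?(ltW C40) ?(ltW C30)//.
  by rewrite expr_ge1// ltW.
Qed.

End small_scale.

(** * Real data at all scales *)

Section real_solution.
Variables (R : realType) (n : nat).
Implicit Types (X Y Z : 'rV[R]_n) (K : set 'rV[R]_n) (omega : R -> R).
Local Notation mu := (lebesgue_row R n).

Lemma regular_scaling omega : regular_modulus omega -> scaling_modulus omega.
Proof.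
move=> [[_ om _ o0] _ od _]; split=> // s t s0 st.
by apply: om; rewrite ?in_itv/= ?andbT//; exact: le_trans st.
Qed.

Lemma Rintegral_eq0 (D : set 'rV[R]_n) (f : 'rV[R]_n -> R) :
  (forall X, D X -> f X = 0) -> Rintegral mu D f = 0.
Proof.
move=> f0; transitivity (Rintegral mu D (fun=> 0)); first by apply: eq_Rintegral => X /set_mem; exact: f0.
by rewrite /Rintegral integral0.
Qed.

Lemma thickening_ball K delta center r X : (forall Z, K Z -> enorm (Z - center) <= r) ->
  thickening K delta X -> enorm (X - center) < delta + r.
Proof.
move=> Kr [Z KZ]; rewrite /eball/= => h; apply: le_lt_trans (enorm_distD Z _ _) _.
by apply: ltr_leD => //; exact: Kr.
Qed.

(** The flux is a continuous field on the whole space that agrees with [a G] on [U], since [a] is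
    controlled only inside the ball while the integrals run over the whole space. *)
Definition weakly_harmonic (a : 'rV[R]_n -> 'M[R]_n) (U : set 'rV[R]_n) (G : 'I_n -> 'rV[R]_n -> R) :=
  exists2 F : 'I_n -> 'rV[R]_n -> R,
    (forall i, continuous (F i)) /\ (forall i X, U X -> F i X = \sum_(j < n) a X i j * G j X) &
  forall rho psi dpsi, test_dirs 1%:M rho psi dpsi ->
    (forall X, ~ U X -> psi X = 0 /\ forall i, dpsi i X = 0) ->
    \sum_(i < n) Rintegral mu setT (fun X => F i X * dpsi i X) = 0.

Lemma weakly_harmonic0 a U : weakly_harmonic a U (fun _ _ => 0).
Proof.
exists (fun _ _ => 0); first split.
- by move=> i; exact: cts_cst.
- by move=> i X _; rewrite big1// => j _; rewrite mulr0.
- by move=> rho psi dpsi _ _; rewrite big1// => i _; apply: Rintegral_eq0 => X _; rewrite mul0r.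
Qed.

(** By compactness [K] lies in a strictly smaller ball, so for small [delta] the thickening stays
    where the extended coefficients agree with [a]. Above the threshold [e0] the constant [f X0] is
    enough, since the diameter of [K] is at most a fixed multiple of [delta]. *)
Lemma real_solution K (center : 'rV[R]_n) (radius : R) (a : 'rV[R]_n -> 'M[R]_n) omega
    (f : 'rV[R]_n -> R) (C : R) :
  (2 <= n)%N -> K !=set0 -> compact K -> condition_A K -> K `<=` eball center radius ->
  elliptic_coefficients (eball center radius) a -> regular_modulus omega ->
  (forall X Y, K X -> K Y -> `|f X - f Y| <= C * omega (enorm (X - Y))) ->
  exists c2 c3, [/\ 0 < c2, 0 < c3 & forall delta, 0 < delta ->
    exists v V, [/\ C1grad v V, weakly_harmonic a (thickening K delta) V,
      forall X i, thickening K delta X -> `|V i X| <= c2 * (omega delta / delta) &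
      forall X, K X -> `|f X - v X| <= c3 * omega delta]].
Proof.
move=> n2 K0 Kc KA KO ha om fK0.
have [[_ _ o0 _] _ _ _] := om.
have {}om := regular_scaling om; have [om0 omm _] := om.
have omg t : 0 <= t -> 0 <= omega t by move=> t0; rewrite -o0; exact: omm.
pose C1 := `|C| + 1.
have C10 : 0 < C1 by exact: ltr_wpDl.
have fK X Y : K X -> K Y -> `|f X - f Y| <= C1 * omega (enorm (X - Y)).
  move=> KX KY; apply: le_trans (fK0 _ _ KX KY) _; rewrite ler_wpM2r ?omg ?enorm_ge0//.
  by apply: le_trans (ler_norm C) _; rewrite lerDl.
have [Z0 Z0K hZ0] := compact_EVT_max K0 Kc (continuous_subspaceT (@enorm_continuous R n center)).
have KZ0 : K Z0 by exact: set_mem.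
pose r0 := enorm (Z0 - center); pose r1 := (r0 + radius) / 2.
have Kr0 Z : K Z -> enorm (Z - center) <= r0 by move=> KZ; apply: hZ0; exact: mem_set.
have r00 : 0 <= r0 by exact: enorm_ge0.
have r0r : r0 < radius by exact: KO.
have r0r1 : r0 < r1 by rewrite /r1; clear - r0r; lra.
have r1r : r1 < radius by rewrite /r1; clear - r0r; lra.
have [a' [kappa [M [w [kM sell aM dcw aE]]]]] := extend_coefficients (le_lt_trans r00 r0r1) r1r ha.
have [d0 [c2 [c3 [d00 c20 c30 small]]]] :=
  small_scale n2 (And5 kM sell aM dcw.1 dcw.2 : elliptic_field a' kappa M w) KA om C10 fK.
pose e0 := Num.min d0 (r1 - r0).
have e00 : 0 < e0 by rewrite /e0 lt_min d00 subr_gt0.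
(* [2 r0] bounds the diameter of [K], hence [l delta] does when [delta > e0]; the summand [1]
   ensures [1 <= l]. *)
pose l := 2 * r0 / e0 + 1.
have l1 : 1 <= l by rewrite /l lerDr divr_ge0 ?mulr_ge0// ltW.
exists (c2 + 1), (c3 + C1 * l); split.
- exact: ltr_wpDl.
- by apply: ltr_wpDl => //; rewrite mulr_gt0//; exact: lt_le_trans l1.
move=> delta dl0; have [ds|dl] := leP delta e0.
  have dsd : delta <= d0 by apply: le_trans ds _; rewrite /e0 ge_min lexx.
  have dsr : delta <= r1 - r0 by apply: le_trans ds _; rewrite /e0 ge_min lexx orbT.
  have od0 : 0 <= omega delta by exact: ltW (om0 _ dl0).
  have [v [V [g [[CV cg wk] g0 hV hv]]]] := small delta dl0 dsd.
  exists v, V; split=> //.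
  - exists (fun i X => \sum_(j < n) a' X i j * V j X); first split.
    + move=> i; apply: (@cts_sum _ _ _ _ xpredT) => j _; apply: cts_mul; last by have [_ h _] := CV.
      by apply: (control_continuous dcw.1) => X Y; exact: dcw.2.
    + move=> i X tX; apply: eq_bigr => j _; rewrite aE// /eball/=.
      by apply: lt_le_trans (thickening_ball Kr0 tX) _; rewrite -lerBrDr.
    move=> rho psi dpsi tst out.
    rewrite (wk _ _ _ tst); apply: Rintegral_eq0 => X _; have [tX|tX] := pselect (thickening K delta X).
      by rewrite g0// mul0r.
    by rewrite (out X tX).1 mulr0.
  - move=> X i /hV h; apply: le_trans (h i) _; rewrite ler_wpM2r ?divr_ge0// ?lerDl//.
    exact: ltW.
  - move=> X /hv h; apply: le_trans h _; rewrite ler_wpM2r// lerDl mulr_ge0 ?(ltW C10)//.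
    exact: le_trans l1.
have [X0 KX0] := K0.
have od0 : 0 <= omega delta by exact: ltW (om0 _ dl0).
exists (fun=> f X0), (fun _ _ => 0); split.
- exact: C1grad_cst.
- exact: weakly_harmonic0.
- by move=> X i _; rewrite normr0 mulr_ge0 ?divr_ge0 ?addr_ge0// ltW.
- move=> X KX; apply: le_trans (fK X X0 KX KX0) _.
  have h : omega (enorm (X - X0)) <= l * omega delta.
    apply: (scaling_modulus_mul om l1 dl0 (enorm_ge0 _)).
    apply: le_trans (enorm_distD center _ _) _; rewrite [enorm (center - _)]enormB.
    apply: le_trans (lerD (Kr0 _ KX) (Kr0 _ KX0)) _.
    rewrite -mulr2n -[leLHS]mulr_natl /l [leRHS](mulrDl (2 * r0 / e0) 1) mul1r -[leLHS]addr0; apply: (lerD _ (ltW dl0)).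
    by rewrite -[leRHS]mulrA ler_peMr ?mulr_ge0// mulrC ler_pdivlMr// mul1r ltW.
  apply: le_trans (ler_wpM2l (ltW C10) h) _.
  by rewrite mulrA ler_wpM2r// lerDr.
Qed.

End real_solution.

(** * Complex-valued functions *)

Local Open Scope complex_scope.

Section weak_calculus.
Variables (R : realType) (n : nat).
Implicit Types (U C D : set 'rV[R]_n) (f phi : 'rV[R]_n -> R) (X : 'rV[R]_n).
Local Notation mu := (lebesgue_row R n).
Local Notation normc := (@ComplexField.Normc.normc R).

Lemma measurable_compact_row C : compact C -> measurable C.
Proof.
move=> cC; rewrite -(setCK C); apply: measurableC; apply: measurable_row_open.
by apply: closed_openC; apply: compact_closed cC; exact: norm_hausdorff.
Qed.

Lemma compact_row_bound C : compact C -> exists2 r : R, 0 <= r & forall X, C X -> `|X| <= r.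
Proof.
move=> cC; have [C0|/set0P[X0 CX0]] := eqVneq C set0.
  by exists 0 => // X; rewrite C0.
have cn : continuous (fun X : 'rV[R]_n => `|X|) by move=> X; exact: norm_continuous.
have [Z _ hZ] := @compact_EVT_max _ R _ _ (ex_intro _ X0 CX0) cC (continuous_subspaceT cn).
by exists `|Z| => // X CX; apply: hZ; exact: mem_set.
Qed.

(** A continuous cutoff equal to [1] on [D] reduces the claim to compactly supported functions. *)
Lemma cts_integrable D r f : measurable D -> (forall X, D X -> `|X| <= r) -> continuous f ->
  mu.-integrable D (EFin \o f).
Proof.
move=> mD Dr cf; pose g X := f X * Num.max 0 (Num.min 1 (`|r| + 1 - `|X|)).
have cg : continuous g.
  apply: cts_mul => //; apply: (@cts_max _ _ (fun=> 0)); first exact: cts_cst.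
  apply: (@cts_min _ _ (fun=> 1)); first exact: cts_cst.
  by apply: (@cts_sub _ _ (fun=> `|r| + 1)); [exact: cts_cst|move=> X; exact: norm_continuous].
have I : mu.-integrable setT (EFin \o g).
  apply: (cts_supp_integrable (rho := `|r| + 1) cg) => [|X hX]; first exact: addr_ge0.
  by rewrite /g max_l ?mulr0// ge_min subr_le0 (ltW hX) orbT.
have := integrableS measurableT mD (@subsetT _ _) I; apply: eq_integrable => // X /set_mem/Dr h.
by rewrite /= /g min_l ?max_r ?mulr1// lerBrDr addrC lerD2r; apply: le_trans h (ler_norm r).
Qed.

Lemma Rintegral_supp U f : (forall X, ~ U X -> f X = 0) ->
  Rintegral mu U f = Rintegral mu setT f.
Proof.
move=> f0; rewrite Rintegral_mkcond; apply: eq_Rintegral => X _; rewrite patchE.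
by case: ifPn => // /negP UX; rewrite f0// => h; apply: UX; exact: mem_set.
Qed.

Lemma partial_eq0 (i : 'I_n) phi C : closed C -> (forall X, ~ C X -> phi X = 0) ->
  (forall X, derivable phi X (delta_mx ord0 i)) -> forall X, ~ C X -> partial i phi X = 0.
Proof.
move=> cC p0 dp X CX; have oC : open (~` C) by exact: closed_openC.
apply: (@dird_unique _ _ phi X (delta_mx ord0 i)).
  by apply/dird_is_derive; exact: derivableP.
have /nbhs_ballP[e e0 he] : nbhs X (~` C) by exact: open_nbhs_nbhs.
apply/dirdP => r r0; have d0 : 0 < e / (`|delta_mx ord0 i : 'rV[R]_n| + 1).
  by rewrite divr_gt0// ltr_wpDl.
exists (e / (`|delta_mx ord0 i : 'rV[R]_n| + 1)) => // h _ hd.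
rewrite !p0//; first by rewrite subrr mulr0 subr0 normr0.
apply: he; rewrite -ball_normE/= opprD addrA subrr sub0r normrN normrZ.
move: hd; rewrite ltr_pdivlMr ?ltr_wpDl// => hd; apply: le_lt_trans hd.
by rewrite ler_wpM2l// lerDl.
Qed.

(** Smooth test functions are special C^1 ones, and their derivatives vanish off the compact support
    because its complement is open. *)
Lemma test_dirs_smooth phi C U : smooth phi -> compact C -> C `<=` U ->
  (forall X, ~ C X -> phi X = 0) ->
  exists2 rho, test_dirs 1%:M rho phi (fun i => partial i phi) &
    forall X, ~ U X -> phi X = 0 /\ forall i, partial i phi X = 0.
Proof.
move=> sp cC CU p0; have [r r0 hr] := compact_row_bound cC.
have cC' : closed C by apply: compact_closed cC; exact: norm_hausdorff.
have [cp dp] := sp 1%N.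
have d0 i X : ~ C X -> partial i phi X = 0.
  by apply: partial_eq0 => //; exact: (dp i).1.
exists r; last by move=> X UX; split=> [|i]; [apply: p0|apply: d0] => /CU.
split=> //; first by move=> i; exact: (dp i).2.1.
- move=> i X; rewrite row1; apply/dird_is_derive; apply: derivableP; exact: (dp i).1.
- move=> X hX; have CX : ~ C X by move=> /hr; rewrite leNgt hX.
  by split=> [|i]; [exact: p0|exact: d0].
Qed.

Lemma ReIm_sum (I : Type) (s : seq I) (F : I -> R[i]) :
  \sum_(k <- s) F k = (\sum_(k <- s) complex.Re (F k)) +i* (\sum_(k <- s) complex.Im (F k)).
Proof.
elim: s => [|k s IH]; first by rewrite !big_nil.
by rewrite !big_cons IH; case: (F k).
Qed.

Section gradient.
Variables (v1 v2 : 'rV[R]_n -> R) (V1 V2 : 'I_n -> 'rV[R]_n -> R).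
Hypotheses (C1 : C1grad v1 V1) (C2 : C1grad v2 V2).
Let v X := v1 X +i* v2 X.
Let V X : 'rV[R[i]]_n := \row_j (V1 j X +i* V2 j X).

Lemma C1grad_weak_gradient U : weak_gradient U v V.
Proof.
have [cv1 cV1 dV1] := C1; have [cv2 cV2 dV2] := C2.
have loc f C : compact C -> continuous f -> mu.-integrable C (EFin \o f).
  move=> cC cf; have [r _ hr] := compact_row_bound cC.
  exact: cts_integrable (measurable_compact_row cC) hr cf.
split.
- by move=> C cC _; split; apply: loc.
- move=> j C cC _; split.
  + rewrite (_ : (fun X => _) = EFin \o V1 j); first exact: loc.
    by apply/funext => X; rewrite /= mxE.
  + rewrite (_ : (fun X => _) = EFin \o V2 j); first exact: loc.
    by apply/funext => X; rewrite /= mxE.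
move=> psi [s1 s2 [C [cC CU p0]]] j.
have [r1 t1 z1] := test_dirs_smooth s1 cC CU (fun X h => congr1 (@complex.Re R) (p0 X h)).
have [r2 t2 z2] := test_dirs_smooth s2 cC CU (fun X h => congr1 (@complex.Im R) (p0 X h)).
set p1 := (fun X => complex.Re (psi X)) in t1 z1; set p2 := (fun X => complex.Im (psi X)) in t2 z2.
have [r10 cp1 cd1 _ sp1] := t1; have [r20 cp2 cd2 _ sp2] := t2.
have I1 f : continuous f -> mu.-integrable setT (EFin \o (fun X => f X * p1 X)) by
  exact: supp_cts_integrable r10 cp1 (fun X h => (sp1 X h).1).
have I2 f : continuous f -> mu.-integrable setT (EFin \o (fun X => f X * p2 X)) by
  exact: supp_cts_integrable r20 cp2 (fun X h => (sp2 X h).1).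
have J1 f : continuous f -> mu.-integrable setT (EFin \o (fun X => f X * partial j p1 X)) by
  exact: supp_cts_integrable r10 (cd1 j) (fun X h => (sp1 X h).2 j).
have J2 f : continuous f -> mu.-integrable setT (EFin \o (fun X => f X * partial j p2 X)) by
  exact: supp_cts_integrable r20 (cd2 j) (fun X h => (sp2 X h).2 j).
have A11 := int_by_parts t1 cv1 (cV1 j) (dV1 j).
have A12 := int_by_parts t2 cv1 (cV1 j) (dV1 j).
have A21 := int_by_parts t1 cv2 (cV2 j) (dV2 j).
have A22 := int_by_parts t2 cv2 (cV2 j) (dV2 j).
rewrite /cintegral.
have -> : Rintegral mu U (fun X => complex.Re (v X * cpartial j psi X)) =
    - Rintegral mu U (fun X => complex.Re (V X ord0 j * psi X)).
  transitivity (Rintegral mu U (fun X => v1 X * partial j p1 X - v2 X * partial j p2 X)) => //.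
  rewrite Rintegral_supp => [|X UX]; last by rewrite (z1 X UX).2 (z2 X UX).2 !mulr0 subr0.
  rewrite (RintegralB measurableT (J1 _ cv1) (J2 _ cv2)) A11 A22 -opprD; congr (- _).
  rewrite -(RintegralB measurableT (I1 _ (cV1 j)) (I2 _ (cV2 j))) -[LHS](@Rintegral_supp U) => [|X UX].
    by apply: eq_Rintegral => X _; rewrite mxE /p1 /p2; case: (psi X).
  have e1 : p1 X = 0 by exact: (z1 X UX).1.
  have e2 : p2 X = 0 by exact: (z2 X UX).1.
  by rewrite e1 e2 !mulr0 subr0.
have -> // : Rintegral mu U (fun X => complex.Im (v X * cpartial j psi X)) =
    - Rintegral mu U (fun X => complex.Im (V X ord0 j * psi X)).
transitivity (Rintegral mu U (fun X => v1 X * partial j p2 X + v2 X * partial j p1 X)) => //.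
rewrite Rintegral_supp => [|X UX]; last by rewrite (z1 X UX).2 (z2 X UX).2 !mulr0 addr0.
rewrite (RintegralD measurableT (J2 _ cv1) (J1 _ cv2)) A12 A21 -opprD; congr (- _).
rewrite -(RintegralD measurableT (I2 _ (cV1 j)) (I1 _ (cV2 j))) -[LHS](@Rintegral_supp U) => [|X UX].
  by apply: eq_Rintegral => X _; rewrite mxE /p1 /p2; case: (psi X).
have e1 : p1 X = 0 by exact: (z1 X UX).1.
have e2 : p2 X = 0 by exact: (z2 X UX).1.
by rewrite e1 e2 !mulr0 addr0.
Qed.

(** As [a] is real, the real and imaginary parts of the solution and of the test function give four
    real pairings, each of which vanishes. *)
Lemma weakly_harmonic_solution a U : weakly_harmonic a U V1 -> weakly_harmonic a U V2 ->
  weak_solution a U v V.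
Proof.
move=> [F1 [cF1 F1E] H1] [F2 [cF2 F2E] H2]; split; first exact: C1grad_weak_gradient.
move=> psi [s1 s2 [C [cC CU p0]]].
have [r1 t1 z1] := test_dirs_smooth s1 cC CU (fun X h => congr1 (@complex.Re R) (p0 X h)).
have [r2 t2 z2] := test_dirs_smooth s2 cC CU (fun X h => congr1 (@complex.Im R) (p0 X h)).
set p1 := (fun X => complex.Re (psi X)) in t1 z1; set p2 := (fun X => complex.Im (psi X)) in t2 z2.
have [r10 cp1 cd1 _ sp1] := t1; have [r20 cp2 cd2 _ sp2] := t2.
have J1 f j : continuous f -> mu.-integrable setT (EFin \o (fun X => f X * partial j p1 X)) by
  exact: supp_cts_integrable r10 (cd1 j) (fun X h => (sp1 X h).2 j).
have J2 f j : continuous f -> mu.-integrable setT (EFin \o (fun X => f X * partial j p2 X)) by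
  exact: supp_cts_integrable r20 (cd2 j) (fun X h => (sp2 X h).2 j).
have E X : U X -> \sum_(j < n) (\sum_(k < n) (a X j k)%:C * V X ord0 k) * (cpartial j psi X)^* =
    (\sum_(j < n) (F1 j X * partial j p1 X + F2 j X * partial j p2 X)) +i*
    (\sum_(j < n) (F2 j X * partial j p1 X - F1 j X * partial j p2 X)).
  move=> UX; rewrite ReIm_sum.
  have S j : \sum_(k < n) (a X j k)%:C * V X ord0 k = F1 j X +i* F2 j X.
    rewrite ReIm_sum F1E// F2E//; congr (_ +i* _); apply: eq_bigr => k _; rewrite mxE /=.
      by rewrite mul0r subr0.
    by rewrite mul0r addr0.
  by congr (_ +i* _); apply: eq_bigr => j _; rewrite S /=; ring.
rewrite /cintegral.
have -> : Rintegral mu U (fun X => complex.Re (\sum_(j < n) (\sum_(k < n) (a X j k)%:C * V X ord0 k) * (cpartial j psi X)^*)) = 0.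
  transitivity (Rintegral mu U (fun X => \sum_(j < n) (F1 j X * partial j p1 X + F2 j X * partial j p2 X))).
    by apply: eq_Rintegral => X /set_mem UX; rewrite E.
  rewrite Rintegral_supp => [|X UX]; last first.
    by rewrite big1// => j _; rewrite (z1 X UX).2 (z2 X UX).2 !mulr0 addr0.
  rewrite (Rintegral_sum _ (fun j => integrableD measurableT (J1 _ j (cF1 j)) (J2 _ j (cF2 j)))).2.
  under eq_bigr do rewrite (RintegralD measurableT (J1 _ _ (cF1 _)) (J2 _ _ (cF2 _))).
  by rewrite big_split; exact: etrans (congr2 +%R (H1 _ _ _ t1 z1) (H2 _ _ _ t2 z2)) (addr0 _).
have -> // : Rintegral mu U (fun X => complex.Im (\sum_(j < n) (\sum_(k < n) (a X j k)%:C * V X ord0 k) * (cpartial j psi X)^*)) = 0.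
transitivity (Rintegral mu U (fun X => \sum_(j < n) (F2 j X * partial j p1 X - F1 j X * partial j p2 X))).
  by apply: eq_Rintegral => X /set_mem UX; rewrite E.
rewrite Rintegral_supp => [|X UX]; last first.
  by rewrite big1// => j _; rewrite (z1 X UX).2 (z2 X UX).2 !mulr0 subr0.
rewrite (Rintegral_sum _ (fun j => integrableB measurableT (J1 _ j (cF2 j)) (J2 _ j (cF1 j)))).2.
under eq_bigr do rewrite (RintegralB measurableT (J1 _ _ (cF2 _)) (J2 _ _ (cF1 _))).
by rewrite sumrB; exact: etrans (congr2 (fun x y => x - y) (H2 _ _ _ t1 z1) (H1 _ _ _ t2 z2)) (subr0 _).
Qed.

End gradient.

Lemma cts_L2 D r (f g : 'rV[R]_n -> R) : measurable D -> (forall X, D X -> `|X| <= r) ->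
  continuous f -> continuous g -> L2 D (fun X => f X +i* g X).
Proof.
move=> mD Dr cf cg; split.
- exact: measurable_funTS (continuous_measurable_row cf).
- exact: measurable_funTS (continuous_measurable_row cg).
have /integrableP[_] := cts_integrable mD Dr (cts_add (cts_mul cf cf) (cts_mul cg cg)).
apply: le_lt_trans; rewrite le_eqVlt; apply/orP; left; apply/eqP; apply: eq_integral => X _ /=.
have h : 0 <= f X * f X + g X * g X by rewrite addr_ge0// -expr2 sqr_ge0.
by rewrite sqr_sqrtr ?ger0_norm// !expr2.
Qed.

End weak_calculus.

(** * Assembly of the real and imaginary parts *)

Section assembly.
Variables (R : realType) (n : nat).
Implicit Types (X Y : 'rV[R]_n) (K : set 'rV[R]_n).
Local Notation normc := (@ComplexField.Normc.normc R).

(** Keeps the approximation of a real-valued [f] real: an imaginary part that vanishes on [K] is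
    approximated by zero itself. *)
Lemma real_solution_vanishing K (center : 'rV[R]_n) (radius : R) (a : 'rV[R]_n -> 'M[R]_n) omega
    (f : 'rV[R]_n -> R) (C : R) :
  (2 <= n)%N -> K !=set0 -> compact K -> condition_A K -> K `<=` eball center radius ->
  elliptic_coefficients (eball center radius) a -> regular_modulus omega ->
  (forall X Y, K X -> K Y -> `|f X - f Y| <= C * omega (enorm (X - Y))) ->
  exists c2 c3, [/\ 0 < c2, 0 < c3 & forall delta, 0 < delta ->
    exists v V, [/\ C1grad v V, weakly_harmonic a (thickening K delta) V,
      forall X i, thickening K delta X -> `|V i X| <= c2 * (omega delta / delta),
      forall X, K X -> `|f X - v X| <= c3 * omega delta &
      (forall X, K X -> f X = 0) -> forall X, v X = 0]].
Proof.
move=> n2 K0 Kc KA KO ha om fK.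
have [_ om0 _] : scaling_modulus omega by exact: regular_scaling.
have [[_ _ _ omp] _ _ _] := om.
have [f0|nf0] := pselect (forall X, K X -> f X = 0).
  exists 1, 1; split=> // delta dl0; have od := ltW (omp _ dl0).
  exists (fun=> 0), (fun _ _ => 0); split=> //.
  - exact: C1grad_cst.
  - exact: weakly_harmonic0.
  - by move=> X i _; rewrite normr0 mul1r divr_ge0// ltW.
  - by move=> X /f0 ->; rewrite subrr normr0 mul1r.
have [c2 [c3 [c20 c30 h]]] := real_solution n2 K0 Kc KA KO ha om fK.
exists c2, c3; split=> // delta /h[v [V [h1 h2 h3 h4]]].
by exists v, V; split.
Qed.

Lemma normc_le (x y : R) : normc (x +i* y) <= `|x| + `|y|.
Proof.
rewrite /= -[leRHS]ger0_norm ?addr_ge0// -sqrtr_sqr ler_wsqrtr// sqrrD !real_normK ?num_real//.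
by rewrite -addrA lerD2l lerDr mulrn_wge0// mulr_ge0.
Qed.

Lemma Re_le_normc (z : R[i]) : `|complex.Re z| <= normc z.
Proof. by case: z => x y /=; rewrite -sqrtr_sqr ler_wsqrtr// lerDl sqr_ge0. Qed.

Lemma Im_le_normc (z : R[i]) : `|complex.Im z| <= normc z.
Proof. by case: z => x y /=; rewrite -sqrtr_sqr ler_wsqrtr// lerDr sqr_ge0. Qed.

Lemma cvnorm_le (z : 'rV[R[i]]_n) (b : R) : 0 <= b ->
  (forall j, normc (z ord0 j) <= b) -> cvnorm z <= n%:R * b.
Proof.
move=> b0 zb; have nb : 0 <= n%:R * b by rewrite mulr_ge0.
rewrite /cvnorm -(ger0_norm nb) -sqrtr_sqr ler_wsqrtr//.
apply: (@le_trans _ _ (\sum_(j < n) b ^+ 2)).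
  apply: ler_sum => j _; have z0 := le_trans (normr_ge0 _) (Re_le_normc (z ord0 j)).
  by rewrite ler_sqr ?nnegrE.
rewrite sumr_const card_ord -[leLHS]mulr_natl exprMn ler_wpM2r ?sqr_ge0//.
by rewrite -natrX ler_nat; case: (n) => // k; rewrite expnS leq_pmulr// expn_gt0.
Qed.

Lemma eball_open (c : 'rV[R]_n) r : open (eball c r).
Proof.
by apply: (@open_comp _ _ (fun X => enorm (X - c)) [set y | y < r]) => [X _|]; [exact: enorm_continuous|exact: open_lt].
Qed.

Lemma eball_norm (c : 'rV[R]_n) r X : eball c r X -> `|X| <= r + `|c|.
Proof.
rewrite /eball/= => h; rewrite -[X in `|X|](subrK c); apply: le_trans (ler_normD _ _) _.
by rewrite lerD2r; apply: le_trans (norm_le_enorm _) (ltW h).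
Qed.

End assembly.

Unset Implicit Arguments.

Theorem theorem7p1 (R : realType) (m : nat) (hm : (3 <= m)%N)
  (K : set 'rV[R]_m) (K0 : K !=set0) (Kc : compact K) (KA : condition_A K)
  (center : 'rV[R]_m) (radius : R) (KOmega : K `<=` eball center radius)
  (a : 'rV[R]_m -> 'M[R]_m)
  (ha : elliptic_coefficients (eball center radius) a)
  (omega : R -> R) (homega : regular_modulus omega)
  (f : 'rV[R]_m -> R[i]) (hf : in_Comega K omega f) :
  exists c2 c3 : R, [/\ 0 < c2, 0 < c3 &
    forall delta : R, 0 < delta ->
      thickening K delta `<=` eball center radius ->
    exists (v : 'rV[R]_m -> R[i]) (grad_v : 'rV[R]_m -> 'rV[R[i]]_m),
      [/\ in_H1 (eball center radius) v grad_v,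
          weak_solution a (thickening K delta) v grad_v,
          ccontinuous_on (thickening K delta) v,
          {ae lebesgue_row R m, forall X, thickening K delta X ->
             cvnorm (grad_v X) <= c2 * (omega delta / delta)} &
          (forall X, K X ->
             ComplexField.Normc.normc (f X - v X) <= c3 * omega delta) /\
          ((forall X, K X -> complex.Im (f X) = 0) ->
             forall X, eball center radius X -> complex.Im (v X) = 0)]].
Proof.
have m2 : (2 <= m)%N by exact: ltnW.
have m0 : 0 < m%:R :> R by rewrite ltr0n ltnW.
have [[_ _ _ omp] _ _ _] := homega; have [C fC] := hf.
have f1C X Y : K X -> K Y -> `|complex.Re (f X) - complex.Re (f Y)| <= C * omega (enorm (X - Y)).
  move=> KX KY; apply: le_trans (fC X Y KX KY); apply: le_trans (Re_le_normc _).
  by case: (f X) => x y; case: (f Y).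
have f2C X Y : K X -> K Y -> `|complex.Im (f X) - complex.Im (f Y)| <= C * omega (enorm (X - Y)).
  move=> KX KY; apply: le_trans (fC X Y KX KY); apply: le_trans (Im_le_normc _).
  by case: (f X) => x y; case: (f Y).
have [p2 [p3 [p20 p30 h1]]] := real_solution_vanishing m2 K0 Kc KA KOmega ha homega f1C.
have [q2 [q3 [q20 q30 h2]]] := real_solution_vanishing m2 K0 Kc KA KOmega ha homega f2C.
(* The modulus of a complex number is at most the sum of those of its parts, and the length of a
   vector at most [m] times its largest entry. *)
exists (m%:R * (p2 + q2)), (p3 + q3); split.
- by rewrite mulr_gt0// addr_gt0.
- exact: addr_gt0.
move=> delta dl0 _; have od := omp _ dl0.
have [v1 [V1 [C1 w1 b1 e1 _]]] := h1 delta dl0.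
have [v2 [V2 [C2 w2 b2 e2 z2]]] := h2 delta dl0.
have [cv1 cV1 _] := C1; have [cv2 cV2 _] := C2.
have mO : measurable (eball center radius) by apply: measurable_row_open; exact: eball_open.
have Or X : eball center radius X -> `|X| <= radius + `|center| by exact: eball_norm.
exists (fun X => v1 X +i* v2 X), (fun X => \row_j (V1 j X +i* V2 j X)); split.
- split; first exact: cts_L2 mO Or cv1 cv2.
  + move=> j; rewrite (_ : (fun X => _) = fun X => V1 j X +i* V2 j X); last first.
      by apply/funext => X; rewrite mxE.
    exact: cts_L2 mO Or (cV1 j) (cV2 j).
  + exact: C1grad_weak_gradient.
- exact: weakly_harmonic_solution.
- by move=> X _; split; [exact: cv1|exact: cv2].
- apply: aeW => X tX; rewrite -[leRHS]mulrA; apply: cvnorm_le.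
    by rewrite mulr_ge0 ?divr_ge0 ?addr_ge0// ltW.
  move=> j; rewrite mxE; apply: le_trans (normc_le _ _) _; rewrite mulrDl.
  by apply: lerD; [exact: b1|exact: b2].
- split=> [X KX|f0 X _ /=]; last by apply: z2 => Y; exact: f0.
  rewrite mulrDl; apply: le_trans (lerD (e1 X KX) (e2 X KX)).
  apply: le_trans (normc_le _ _); by case: (f X).
Qed.
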